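(* Consider the $\mathbb{N}$-colored collection $O_\infty(n_1,\dots,n_k;n)=\coprod_{(t,\sigma)}P_t$ (disjoint union over all operadic trees $(t,\sigma)$ of type $(n_1,\dots,n_k;n)$) of standard weight Loday realizations of operahedra. (1) This collection, together with the partial composition maps $\circ_i=\Theta\circ(\mathrm{tr}\times\mathrm{id})$, the symmetric group actions, and the 0-dimensional unit elements $O_\infty(n;n)$, $n\in\mathbb{N}$ (given by the corollas), forms a symmetric colored operad in the category $\mathsf{Poly}$. (2) This colored operad structure extends the operad structure on the vertices of the operahedra, that is, on fully nested operadic trees with composition given by nested tree substitution. (3) The bot-top diagonal maps $\{\triangle_{(t,\vec v)}:P_t\to P_t\times P_t\}_{(t,\sigma)}$, where the $\vec v$ are principal orientation vectors, form a morphism of symmetric colored operads $O_\infty\to O_\infty\times O_\infty$ in the category $\mathsf{Poly}$.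
   Context: Trees. $\mathrm{PT}_k$ is the set of planar rooted trees with $k$ internal vertices, each having at least one input. $V(t)$, $E(t)$ denote internal vertices and internal edges. Walking around the tree clockwise from the root and numbering each vertex (resp. edge) when first met identifies $V(t)=\{1,\dots,k\}$, $E(t)=\{1,\dots,k-1\}$. A nest is a nonempty $N\subset E(t)$ whose edges with their adjacent vertices form a connected graph; $t(N)$ is the induced subtree. A nesting is a set $\mathcal{N}$ of nests containing $E(t)$, any two distinct ones being strictly nested or disjoint, and when disjoint having no edge of one adjacent to an edge of the other. Maximal nestings are those with $k-1$ nests; $\min\mathcal{N}(i)$ is the smallest nest of $\mathcal{N}$ containing edge $i$. A corolla ($k=1$) has only the empty nesting. A (fully) nested tree is a tree with a (maximal) nesting. Operahedra. For $\omega\in\mathbb{Z}_{>0}^k$ and a maximal nesting $\mathcal{N}$ of $t$, cutting $t(\min\mathcal{N}(i))$ at edge $i$ gives subtrees $t_1$ (root $i$) and $t_2$ (leaf $i$); let $M(t,\mathcal{N},\omega)\in\mathbb{R}^{k-1}$ have $i$-th coordinate $(\sum_{j\in V(t_1)}\omega_j)(\sum_{j\in V(t_2)}\omega_j)$. $P_{(t,\omega)}$ is the convex hull of all $M(t,\mathcal{N},\omega)$; its vertices are exactly these points and its nonempty faces are in inclusion-reversing bijection with nestings of $t$ (a nesting corresponds to the convex hull of the $M(t,\mathcal{N}'',\omega)$ for maximal $\mathcal{N}''$ containing it). $P_t=P_{(t,(1,\dots,1))}$. For a corolla it is a point. Diagonals. $\vec v\in\mathbb{R}^{m}$ is a principal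 orientation vector if $\sum_{i\in I}v_i>\sum_{j\in J}v_j$ for all $I,J\subset\{1,\dots,m\}$ nonempty, disjoint, with $|I|=|J|$ and $\min(I\cup J)\in I$. For $P=P_{(t,\omega)}$ and such $\vec v\in \mathbb{R}^{k-1}$, $\langle-,\vec v\rangle$ has a unique minimizer bot and maximizer top on $P\cap\rho_zP$, $\rho_zP=2z-P$, for each $z\in P$; the bot-top diagonal $\triangle_{(t,\vec v)}:P\to P\times P$ is $z\mapsto(\operatorname{bot}(P\cap\rho_zP),\operatorname{top}(P\cap\rho_zP))$. It does not depend on the choice of principal $\vec v$. Category $\mathsf{Poly}$. Objects: finite disjoint unions of polytopes. Morphisms: maps sending each component $P$ of the source to a component $Q$ of the target by a continuous map $f$ that is a homeomorphism from $P$ onto the underlying set $|\mathcal{D}|$ of a polytopal subcomplex $\mathcal{D}$ of the face complex of $Q$ and such that $f^{-1}(\mathcal{D})$ is a polytopal subdivision of $P$. It is symmetric monoidal for the cartesian product, with unit a point. Operadic trees. An operadic tree of type $(n_1,\dots,n_k;n)$ is $(t,\sigma)$ with $t\in\mathrm{PT}_k$ and a bijection $\sigma:\{1,\dots,k\}\to V(t)$ such that vertex $\sigma(i)$ has $n_i$ inputs; then $n=n_1+\dots+n_k-k+1$ is the number of leaves of $t$. If $t''\in\mathrm{PT}_l$ has as many leaves as vertex $\sigma'(i)$ of $t'$ has inputs, $(t',\sigma')\circ_i(t'',\sigma'')=(t'\circ_{\sigma'(i)}t'',\sigma'\circ_i\sigma'')$, where $t'\circ_{a}t''$ replaces vertex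 $a$ of $t'$ by $t''$ (so $E(t)=E(t')\sqcup E(t'')$, $V(t)=(V(t')\setminus\{a\})\sqcup V(t'')$), and $\sigma'\circ_i\sigma''(j)$ equals $\sigma'(j)$ if $j<i$, $\sigma''(j-i+1)$ if $i\le j\le i+l-1$, $\sigma'(j-l+1)$ if $j\ge i+l$. The symmetric group acts by precomposition on $\sigma$. On nested trees, substitution at vertex $a$ gives the nesting consisting of the nests of $\mathcal{N}''$, the nests $N'\cup E(t'')$ for $N'\in\mathcal{N}'$ having an edge adjacent to $a$, and the other nests $N'\in\mathcal{N}'$. Structure maps of $O_\infty$. Let $(t,\sigma)=(t',\sigma')\circ_i(t'',\sigma'')$ with $t'\in\mathrm{PT}_k$, $t''\in\mathrm{PT}_l$, and let $\omega$ be the weight of length $k$ equal to $l$ at vertex $\sigma'(i)$ and $1$ elsewhere. $\Theta:\mathbb{R}^{k-1}\times\mathbb{R}^{l-1}\to\mathbb{R}^{k+l-2}$ is the coordinate permutation induced by $E(t')\sqcup E(t'')=E(t)$; it maps $P_{(t',\omega)}\times P_{t''}$ onto a face of $P_t$. $\mathrm{tr}:P_{t'}\to P_{(t',\omega)}$ is the unique continuous map which sends $M(t',\mathcal{N},(1,\dots,1))$ to $M(t',\mathcal{N},\omega)$ for all maximal nestings $\mathcal{N}$ and commutes with the bot-top diagonals (for principal orientation vectors); it exists by a known result of Masuda–Thomas–Tonks–Vallette and is an isomorphism in $\mathsf{Poly}$. The partial composition on components is $\circ_i:P_{t'}\times P_{t''}\xrightarrow{\mathrm{tr}\times\mathrm{id}}P_{(t',\omega)}\times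 P_{t''}\xrightarrow{\Theta}P_t$. A permutation $\kappa$ acts by the identity map $P_t\to P_t$ from the component of $(t,\sigma)$ to that of $(t,\sigma\circ\kappa)$. $O_\infty\times O_\infty$ denotes the componentwise product operad, with component $P_t\times P_t$ for each $(t,\sigma)$. *)

(* Defs.v *)
From mathcomp Require Import all_boot all_order all_algebra.
From mathcomp Require Import all_classical all_reals topology normedtype.

Set Implicit Arguments.
Unset Strict Implicit.
Unset Printing Implicit Defensive.

Import Order.TTheory GRing.Theory Num.Theory.
Import numFieldNormedType.Exports.

Local Open Scope classical_set_scope.
Local Open Scope ring_scope.

(* Conventions.
   - All numberings (vertices, edges, inputs, partial compositions) start at 0.
   - A finite sequence, in particular a permutation of {0, ..., k-1} or a
     bijection from {0, ..., k-1} to a set of vertices, is the seq of its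
     values. *)

Definition is_perm (k : nat) (s : seq nat) : bool := perm_eq s (iota 0 k).

(* precompose s kappa is s \o kappa *)
Definition precompose (T : Type) (s : seq T) (kappa : seq nat) : seq T :=
  pmap (onth s) kappa.

(* entry i of s is replaced by the block u *)
Definition splice (T : Type) (i : nat) (s u : seq T) : seq T :=
  take i s ++ u ++ drop i.+1 s.

(* The permutation kappa o_i tau: entry i of kappa, of value a, is replaced by
   tau, after the identification of ({0..k-1} \ {a}) + {0..l-1} with
   {0..k+l-2} which inserts the second summand as a block at position a. *)
Definition block_perm (kappa : seq nat) (i : nat) (tau : seq nat) : seq nat :=
  let a := nth 0%N kappa i in
  let l := size tau in
  splice i [seq (if (v < a)%N then v else (v + l).-1)%N | v <- kappa]
           [seq (a + w)%N | w <- tau].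

(* The set of operations of profile (c; d) is ops c d, a subset of a carrier
   type.  The partial composition ocomp i x y is only meaningful when the
   output colour of y is the i-th input colour of x, and oact kappa x when kappa
   is a permutation of the inputs of x. *)
Record operad (C : Type) := Operad {
  elt : seq C -> C -> Type;
  ops : forall c d, set (elt c d);
  ocomp : forall c d c' d' (i : nat),
    elt c d -> elt c' d' -> elt (splice i c c') d;
  oact : forall c d (kappa : seq nat), elt c d -> elt (precompose c kappa) d;
  ounit : forall c : C, elt [:: c] c }.

Arguments ops {C} o c d.
Arguments ocomp {C} o {c d c' d'} i x y.
Arguments oact {C} o {c d} kappa x.
Arguments ounit {C} o c.

(* An operation together with its profile; the two sides of the axioms below
   have profiles that are equal but not convertible. *)
Definition tot (C : Type) (O : operad C) c d (x : elt O c d) :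
    {cd : seq C * C & elt O cd.1 cd.2} :=
  existT (fun cd : seq C * C => elt O cd.1 cd.2) (c, d) x.

Record is_operad (C : Type) (O : operad C) : Prop := IsOperad {
  op_comp : forall c d c' d' i (x : elt O c d) (y : elt O c' d'),
    ops O c d x -> ops O c' d' y -> onth c i = Some d' ->
    ops O _ _ (ocomp O i x y);
  op_act : forall c d kappa (x : elt O c d),
    ops O c d x -> is_perm (size c) kappa -> ops O _ _ (oact O kappa x);
  op_unit : forall c, ops O _ _ (ounit O c);
  op_seqA : forall c d c1 d1 c2 d2 i j
      (x : elt O c d) (y : elt O c1 d1) (z : elt O c2 d2),
    ops O c d x -> ops O c1 d1 y -> ops O c2 d2 z ->
    onth c i = Some d1 -> onth c1 j = Some d2 ->
    tot (ocomp O (i + j)%N (ocomp O i x y) z) = tot (ocomp O i x (ocomp O j y z));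
  op_parA : forall c d c1 d1 c2 d2 i j
      (x : elt O c d) (y : elt O c1 d1) (z : elt O c2 d2),
    ops O c d x -> ops O c1 d1 y -> ops O c2 d2 z ->
    onth c i = Some d1 -> onth c j = Some d2 -> (i < j)%N ->
    tot (ocomp O (j + size c1).-1 (ocomp O i x y) z) =
    tot (ocomp O i (ocomp O j x z) y);
  op_unitr : forall c d d' i (x : elt O c d),
    ops O c d x -> onth c i = Some d' -> tot (ocomp O i x (ounit O d')) = tot x;
  op_unitl : forall c d (x : elt O c d),
    ops O c d x -> tot (ocomp O 0 (ounit O d) x) = tot x;
  op_act1 : forall c d (x : elt O c d),
    ops O c d x -> tot (oact O (iota 0 (size c)) x) = tot x;
  op_actM : forall c d kappa tau (x : elt O c d),
    ops O c d x -> is_perm (size c) kappa -> is_perm (size c) tau ->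
    tot (oact O tau (oact O kappa x)) = tot (oact O (precompose kappa tau) x);
  op_equiv : forall c d c' d' i kappa tau (x : elt O c d) (y : elt O c' d'),
    ops O c d x -> ops O c' d' y ->
    is_perm (size c) kappa -> is_perm (size c') tau ->
    onth (precompose c kappa) i = Some d' ->
    tot (ocomp O i (oact O kappa x) (oact O tau y)) =
    tot (oact O (block_perm kappa i tau) (ocomp O (nth 0%N kappa i) x y)) }.

Record operad_morphism (C : Type) (O O' : operad C)
    (f : forall c d, elt O c d -> elt O' c d) : Prop := OperadMorphism {
  om_ops : forall c d x, ops O c d x -> ops O' c d (f c d x);
  om_comp : forall c d c' d' i (x : elt O c d) (y : elt O c' d'),
    ops O c d x -> ops O c' d' y -> onth c i = Some d' ->
    f _ _ (ocomp O i x y) = ocomp O' i (f _ _ x) (f _ _ y);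
  om_act : forall c d kappa (x : elt O c d),
    ops O c d x -> is_perm (size c) kappa ->
    f _ _ (oact O kappa x) = oact O' kappa (f _ _ x);
  om_unit : forall c, f _ _ (ounit O c) = ounit O' c }.

Section Polytopes.
Variable R : realType.
Implicit Types m n : nat.

Definition dotp n (u v : 'rV[R]_n) : R := \sum_i u 0 i * v 0 i.

Definition hull n (A : set 'rV[R]_n) : set 'rV[R]_n :=
  [set x | exists m (a : 'I_m -> R) (p : 'I_m -> 'rV[R]_n),
     [/\ forall i, 0 <= a i, \sum_i a i = 1, forall i, A (p i)
       & x = \sum_i a i *: p i]].

Definition polytope n (P : set 'rV[R]_n) : Prop :=
  exists2 A : set 'rV[R]_n, finite_set A & P = hull A.

(* P itself and the empty set are faces of P *)
Definition face n (P F : set 'rV[R]_n) : Prop :=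
  exists (u : 'rV[R]_n) (c : R),
    (forall x, P x -> dotp x u <= c) /\ F = P `&` [set x | dotp x u = c].

Definition vertex n (P : set 'rV[R]_n) (x : 'rV[R]_n) : Prop := face P [set x].

Record polytopal_complex n (D : set (set 'rV[R]_n)) : Prop := PolytopalComplex {
  pc_finite : finite_set D;
  pc_polytope : forall F, D F -> polytope F;
  pc_face : forall F G, D F -> face F G -> D G;
  pc_meet : forall F G, D F -> D G -> face F (F `&` G) /\ face G (F `&` G) }.

Definition complex_support n (D : set (set 'rV[R]_n)) : set 'rV[R]_n :=
  \bigcup_(F in D) F.

Definition polytopal_subdivision n (P : set 'rV[R]_n) (D : set (set 'rV[R]_n)) :=
  polytopal_complex D /\ complex_support D = P.

Definition homeomorphism m n (P : set 'rV[R]_m) (Q : set 'rV[R]_n)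
    (f : 'rV[R]_m -> 'rV[R]_n) : Prop :=
  exists g : 'rV[R]_n -> 'rV[R]_m,
    [/\ {within P, continuous f}, {within Q, continuous g},
        forall x, P x -> Q (f x) /\ g (f x) = x
      & forall y, Q y -> P (g y) /\ f (g y) = y].

Definition poly_arrow m n (P : set 'rV[R]_m) (Q : set 'rV[R]_n)
    (f : 'rV[R]_m -> 'rV[R]_n) : Prop :=
  exists D : set (set 'rV[R]_n),
    [/\ polytopal_complex D, D `<=` face Q, homeomorphism P (complex_support D) f
      & polytopal_subdivision P [set P `&` f @^-1` F | F in D]].

(* A disjoint union of polytopes, one for each index i in the set comps. *)
Record polysum := PolySum {
  idx : Type;
  comps : set idx;
  dim : idx -> nat;
  poly : forall i, set 'rV[R]_(dim i) }.

Arguments comps : clear implicits.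
Arguments poly {p} i _.

Definition poly_object (A : polysum) : Prop :=
  finite_set (comps A) /\
  forall i, comps A i -> polytope (poly i) /\ poly i !=set0.

Definition pt (A : polysum) : Type := {i : idx A & 'rV[R]_(dim i)}.

Definition mkpt (A : polysum) (i : idx A) (z : 'rV[R]_(dim i)) : pt A :=
  existT (fun i : idx A => 'rV[R]_(dim i)) i z.

Definition points (A : polysum) : set (pt A) :=
  [set p | comps A (tag p) /\ poly (tag p) (tagged p)].

Record polymap (A B : polysum) := PolyMap {
  imap : idx A -> idx B;
  vmap : forall i, 'rV[R]_(dim i) -> 'rV[R]_(dim (imap i)) }.

Arguments imap {A B} p i.
Arguments vmap {A B} p i z.

Definition poly_morphism (A B : polysum) (f : polymap A B) : Prop :=
  forall i, comps A i ->
    comps B (imap f i) /\ poly_arrow (poly i) (poly (imap f i)) (vmap f i).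

Definition ptmap (A B : polysum) (f : polymap A B) (p : pt A) : pt B :=
  mkpt (vmap f (tag p) (tagged p)).

Definition prod_set m n (P : set 'rV[R]_m) (Q : set 'rV[R]_n) :
    set 'rV[R]_(m + n) :=
  [set z | P (lsubmx z) /\ Q (rsubmx z)].

Definition prod_poly (A B : polysum) : polysum := {|
  idx := (idx A * idx B)%type;
  comps := [set p | comps A p.1 /\ comps B p.2];
  dim := fun p => (dim p.1 + dim p.2)%N;
  poly := fun p => prod_set (poly p.1) (poly p.2) |}.

Definition pair_pt (A B : polysum) (p : pt A) (q : pt B) : pt (prod_poly A B) :=
  @mkpt (prod_poly A B) (tag p, tag q) (row_mx (tagged p) (tagged q)).

Definition point_poly : polysum := {|
  idx := Datatypes.unit;
  comps := setT;
  dim := fun=> 0%N;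
  poly := fun=> setT |}.

Definition the_point : pt point_poly := @mkpt point_poly tt 0.

Record poly_operad (C : Type) := PolyOperad {
  obj : seq C -> C -> polysum;
  pcomp : forall c d c' d' (i : nat),
    polymap (prod_poly (obj c d) (obj c' d')) (obj (splice i c c') d);
  pact : forall c d (kappa : seq nat),
    polymap (obj c d) (obj (precompose c kappa) d);
  punit : forall c, polymap point_poly (obj [:: c] c) }.

Definition underlying (C : Type) (O : poly_operad C) : operad C := {|
  elt := fun c d => pt (obj O c d);
  ops := fun c d => @points (obj O c d);
  ocomp := fun c d c' d' i p q => ptmap (pcomp O c d c' d' i) (pair_pt p q);
  oact := fun c d kappa p => ptmap (pact O c d kappa) p;
  ounit := fun c => ptmap (punit O c) the_point |}.

(* Poly is concrete, and its monoidal product is the cartesian product of the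
   underlying sets: the diagrams of an operad commute iff they commute on
   points. *)
Record is_poly_operad (C : Type) (O : poly_operad C) : Prop := IsPolyOperad {
  po_obj : forall c d, poly_object (obj O c d);
  po_comp : forall c d c' d' i, onth c i = Some d' ->
    poly_morphism (pcomp O c d c' d' i);
  po_act : forall c d kappa, is_perm (size c) kappa ->
    poly_morphism (pact O c d kappa);
  po_unit : forall c, poly_morphism (punit O c);
  po_operad : is_operad (underlying O) }.

Definition poly_operad_morphism (C : Type) (O O' : poly_operad C)
    (f : forall c d, polymap (obj O c d) (obj O' c d)) : Prop :=
  (forall c d, poly_morphism (f c d)) /\
  operad_morphism (O := underlying O) (O' := underlying O')
    (fun c d => ptmap (f c d)).

(* The componentwise product of an operad with itself: component P x P for
   every component P. *)
Definition square_poly (A : polysum) : polysum := {|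
  idx := idx A;
  comps := comps A;
  dim := fun i => (dim i + dim i)%N;
  poly := fun i => prod_set (poly i) (poly i) |}.

Definition square_map (A B : polysum) (f : polymap A B) :
    polymap (square_poly A) (square_poly B) :=
  @PolyMap (square_poly A) (square_poly B) (imap f)
    (fun i z => row_mx (vmap f i (lsubmx z)) (vmap f i (rsubmx z))).

Definition square_map2 (A B D : polysum) (f : polymap (prod_poly A B) D) :
    polymap (prod_poly (square_poly A) (square_poly B)) (square_poly D) :=
  @PolyMap (prod_poly (square_poly A) (square_poly B)) (square_poly D) (imap f)
    (fun p z => row_mx
       (vmap f p (row_mx (lsubmx (lsubmx z)) (lsubmx (rsubmx z))))
       (vmap f p (row_mx (rsubmx (lsubmx z)) (rsubmx (rsubmx z))))).

Definition square_unit (A : polysum) (f : polymap point_poly A) :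
    polymap point_poly (square_poly A) :=
  @PolyMap point_poly (square_poly A) (imap f)
    (fun i z => row_mx (vmap f i z) (vmap f i z)).

Definition square_operad (C : Type) (O : poly_operad C) : poly_operad C := {|
  obj := fun c d => square_poly (obj O c d);
  pcomp := fun c d c' d' i => square_map2 (pcomp O c d c' d' i);
  pact := fun c d kappa => square_map (pact O c d kappa);
  punit := fun c => square_unit (punit O c) |}.

Definition principal m (v : 'rV[R]_m) : Prop :=
  forall I J : {set 'I_m}, I != finset.set0 -> J != finset.set0 ->
    (I :&: J)%SET = finset.set0 -> #|I| = #|J| ->
    (exists2 i, i \in I & forall j, (j \in I) || (j \in J) -> (i <= j)%N) ->
    \sum_(j in J) v 0 j < \sum_(i in I) v 0 i.

Definition bot_pt m (v : 'rV[R]_m) (A : set 'rV[R]_m) : 'rV[R]_m :=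
  xget 0 [set x | A x /\ forall y, A y -> dotp x v <= dotp y v].

Definition top_pt m (v : 'rV[R]_m) (A : set 'rV[R]_m) : 'rV[R]_m :=
  xget 0 [set x | A x /\ forall y, A y -> dotp y v <= dotp x v].

(* P `&` rho_z P, where rho_z P = 2z - P *)
Definition reflected m (P : set 'rV[R]_m) (z : 'rV[R]_m) : set 'rV[R]_m :=
  P `&` [set 2%:R *: z - y | y in P].

Definition diagonal m (v : 'rV[R]_m) (P : set 'rV[R]_m) (z : 'rV[R]_m) :
    'rV[R]_(m + m) :=
  row_mx (bot_pt v (reflected P z)) (top_pt v (reflected P z)).

End Polytopes.

Arguments pt {R} A.
Arguments points {R} A.
Arguments point_poly {R}.
Arguments comps {R} p _.
Arguments poly {R p} i _.

(* Planar rooted trees with labelled internal vertices; the inputs of a vertex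
   are listed from left to right. *)
Inductive tree (T : Type) : Type := Leaf | Node of T & seq (tree T).
Arguments Leaf {T}.

Fixpoint tmap (S T : Type) (f : S -> T) (t : tree S) : tree T :=
  match t with
  | Leaf => Leaf
  | Node x ts => Node (f x) [seq tmap f s | s <- ts]
  end.

(* The labels of the vertices, their numbers of inputs, and the internal edges
   (lower vertex, upper vertex), in the order in which they are first met when
   walking around the tree clockwise from the root. *)
Fixpoint labels (T : Type) (t : tree T) : seq T :=
  match t with
  | Leaf => [::]
  | Node x ts => x :: flatten [seq labels s | s <- ts]
  end.

Fixpoint arities (T : Type) (t : tree T) : seq nat :=
  match t with
  | Leaf => [::]
  | Node _ ts => size ts :: flatten [seq arities s | s <- ts]
  end.

Fixpoint edges (T : Type) (t : tree T) : seq (T * T) :=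
  match t with
  | Leaf => [::]
  | Node x ts =>
      flatten [seq (if s is Node y _ then [:: (x, y)] else [::]) ++ edges s
              | s <- ts]
  end.

Fixpoint leaves (T : Type) (t : tree T) : nat :=
  match t with
  | Leaf => 1%N
  | Node _ ts => sumn [seq leaves s | s <- ts]
  end.

(* The trees in ts are grafted on the successive leaves of t. *)
Fixpoint graft (T : Type) (t : tree T) (ts : seq (tree T)) {struct t} : tree T :=
  match t with
  | Leaf => head Leaf ts
  | Node x us =>
      Node x
        ((fix graft_forest us ts := match us with
          | [::] => [::]
          | u :: us' =>
              graft u (take (leaves u) ts) ::
              graft_forest us' (drop (leaves u) ts)
          end) us ts)
  end.

(* The vertices of t whose label satisfies a are replaced by s. *)
Fixpoint subst (T : Type) (a : pred T) (s t : tree T) : tree T :=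
  match t with
  | Leaf => Leaf
  | Node x ts =>
      let ts' := [seq subst a s u | u <- ts] in
      if a x then graft s ts' else Node x ts'
  end.

(* The elements of PT_k, k > 0: the internal vertices are labelled by their
   numbers 0, ..., k-1.  As all vertices have an input, the numbering makes the
   label redundant. *)
Definition nv (t : tree nat) : nat := size (labels t).

Definition planar_tree (t : tree nat) : bool :=
  [&& (0 < nv t)%N, labels t == iota 0 (nv t) & all (leq 1) (arities t)].

Definition corolla (n : nat) : tree nat := Node 0%N (nseq n Leaf).

(* |E(t)|, which is nv t - 1 *)
Definition ne (t : tree nat) : nat := size (edges t).

Section Nestings.
Variable t : tree nat.
Implicit Types (e f : 'I_(ne t)) (N : {set 'I_(ne t)}).

Definition edge e : nat * nat := nth (0%N, 0%N) (edges t) e.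
Definition incident (v : nat) e : bool := (v == (edge e).1) || (v == (edge e).2).

Definition touches N (v : nat) : bool := [exists e in N, incident v e].

Definition joined N : rel 'I_(nv t) :=
  fun u v => [exists e in N, (edge e == (val u, val v)) || (edge e == (val v, val u))].

Definition adjacent e f : bool := incident (edge e).1 f || incident (edge e).2 f.

Definition nest N : bool :=
  (N != finset.set0) &&
  [forall u : 'I_(nv t), forall v : 'I_(nv t),
     touches N u ==> touches N v ==> connect (joined N) u v].

Definition compatible (N1 N2 : {set 'I_(ne t)}) : bool :=
  [|| N1 \proper N2, N2 \proper N1
    | ((N1 :&: N2)%SET == finset.set0) && [forall e in N1, forall f in N2, ~~ adjacent e f]].

(* If t is a corolla, E(t) is empty, hence not a nest, and the only nesting
   is the empty one. *)
Definition nesting (NN : {set {set 'I_(ne t)}}) : bool :=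
  [&& [forall N in NN, nest N],
      (0 < ne t)%N ==> (finset.setT \in NN)
    & [forall N1 in NN, forall N2 in NN, (N1 != N2) ==> compatible N1 N2]].

Definition maximal_nesting (NN : {set {set 'I_(ne t)}}) : bool :=
  nesting NN && (#|NN| == ne t).

(* The nests of NN which contain e form a chain. *)
Definition min_nest (NN : {set {set 'I_(ne t)}}) e : {set 'I_(ne t)} :=
  [arg min_(N < finset.setT | (N \in NN) && (e \in N)) #|N|].

(* Cutting t(N) at its edge e: side N e v, for v the upper (resp. lower) end of
   e, is the set of vertices of the subtree with root (resp. leaf) e. *)
Definition side N e (v : nat) : {set 'I_(nv t)} :=
  [set u | [exists w : 'I_(nv t),
     (val w == v) && connect (joined (N :\ e)) w u]]%SET.

End Nestings.

Definition std (t : tree nat) : 'I_(nv t) -> nat := fun=> 1%N.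
Arguments std t _ : clear implicits.

Definition weight (t : tree nat) (a l : nat) : 'I_(nv t) -> nat :=
  fun v => if val v == a then l else 1%N.

Section Operahedra.
Variable R : realType.

Definition vertexM (t : tree nat) (NN : {set {set 'I_(ne t)}})
    (w : 'I_(nv t) -> nat) : 'rV[R]_(ne t) :=
  \row_e ((\sum_(u in side (min_nest NN e) e (edge e).2) w u) *
          (\sum_(u in side (min_nest NN e) e (edge e).1) w u))%N%:R.

Definition operahedron (t : tree nat) (w : 'I_(nv t) -> nat) :
    set 'rV[R]_(ne t) :=
  hull [set vertexM NN w | NN in [set NN | maximal_nesting NN]].

Definition loday (t : tree nat) : set 'rV[R]_(ne t) := operahedron (std t).
Arguments loday t _ : clear implicits.

Record is_transition (t : tree nat) (w : 'I_(nv t) -> nat)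
    (f : 'rV[R]_(ne t) -> 'rV[R]_(ne t)) : Prop := IsTransition {
  tr_cont : {within loday t, continuous f};
  tr_fun : forall z, loday t z -> operahedron w (f z);
  tr_vertex : forall NN, maximal_nesting NN ->
    f (vertexM NN (std t)) = vertexM NN w;
  tr_diag : forall v, principal v -> forall z, loday t z ->
    diagonal v (operahedron w) (f z) =
    row_mx (f (bot_pt v (reflected (loday t) z))) (f (top_pt v (reflected (loday t) z))) }.

(* Only the restriction to loday t is characterized by is_transition. *)
Definition tr (t : tree nat) (w : 'I_(nv t) -> nat) :
    'rV[R]_(ne t) -> 'rV[R]_(ne t) :=
  xget (idfun : 'rV[R]_(ne t) -> 'rV[R]_(ne t)) [set f | is_transition w f].

End Operahedra.

Arguments loday {R} t _.
Arguments vertexM R {t} NN w.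

(* pairs (t, sigma) *)
Definition optree : Type := (tree nat * seq nat)%type.

Definition is_optree (x : optree) : bool :=
  planar_tree x.1 && is_perm (nv x.1) x.2.

Definition posn : Type := {n : nat | (0 < n)%N}.

Definition of_type (c : seq posn) (d : posn) (x : optree) : Prop :=
  [seq nth 0%N (arities x.1) v | v <- x.2] = [seq val n | n <- c] /\
  leaves x.1 = val d.

(* Substitution of s at the vertex a of t.  In subst_lab the vertices keep
   their names, inl v for v in V(t) \ {a} and inr v for v in V(s); this gives
   the identification new_vertex of V(t) \ {a} + V(s) with the vertices of
   subst_tree. *)
Definition subst_lab (t : tree nat) (a : nat) (s : tree nat) :
    tree (nat + nat) :=
  subst (pred1 (inl a)) (tmap inr s) (tmap inl t).

Definition new_vertex (t : tree nat) (a : nat) (s : tree nat) (v : nat + nat) :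
    nat :=
  index v (labels (subst_lab t a s)).

Definition subst_tree (t : tree nat) (a : nat) (s : tree nat) : tree nat :=
  tmap (new_vertex t a s) (subst_lab t a s).

(* The identification of E(subst_tree t a s) with E(t) + E(s): an edge with
   both ends in s comes from s; any other edge comes from the edge of t obtained
   by contracting s to the vertex a. *)
Definition origin (t : tree nat) (a : nat) (s : tree nat)
    (e : 'I_(ne (subst_tree t a s))) : nat + nat :=
  let contract v := if v is inl u then u else a in
  match nth (inl 0%N, inl 0%N) (edges (subst_lab t a s)) e with
  | (inr u, inr v) => inr (index (u, v) (edges s))
  | (u, v) => inl (index (contract u, contract v) (edges t))
  end.

Definition optree_comp (i : nat) (x y : optree) : optree :=
  let a := nth 0%N x.2 i in
  (subst_tree x.1 a y.1,
   splice i [seq new_vertex x.1 a y.1 (inl v) | v <- x.2]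
            [seq new_vertex x.1 a y.1 (inr v) | v <- y.2]).

Definition optree_act (kappa : seq nat) (x : optree) : optree :=
  (x.1, precompose x.2 kappa).

Definition optree_unit (n : posn) : optree := (corolla (val n), [:: 0%N]).

Definition nested_tree : Type := {x : optree & {set {set 'I_(ne x.1)}}}.

Definition mknested (x : optree) (NN : {set {set 'I_(ne x.1)}}) : nested_tree :=
  existT (fun x : optree => {set {set 'I_(ne x.1)}}) x NN.

Section NestedSubstitution.
Variables (t : tree nat) (a : nat) (s : tree nat).

(* the images of subsets of E(t) and E(s) in E(subst_tree t a s) *)
Definition edges_inl (N : {set 'I_(ne t)}) : {set 'I_(ne (subst_tree t a s))} :=
  [set e | [exists f in N, origin e == inl (val f)]]%SET.

Definition edges_inr (N : {set 'I_(ne s)}) : {set 'I_(ne (subst_tree t a s))} :=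
  [set e | [exists f in N, origin e == inr (val f)]]%SET.

Definition subst_nesting (NN' : {set {set 'I_(ne t)}})
    (NN'' : {set {set 'I_(ne s)}}) : {set {set 'I_(ne (subst_tree t a s))}} :=
  ([set edges_inr N | N in NN''] :|:
   [set (if touches N a then edges_inl N :|: edges_inr finset.setT
         else edges_inl N) | N in NN'])%SET.

End NestedSubstitution.

Definition nested_operad : operad posn := {|
  elt := fun _ _ => nested_tree;
  ops := fun c d => [set p | [/\ is_optree (tag p), of_type c d (tag p)
                               & maximal_nesting (tagged p)]];
  ocomp := fun _ _ _ _ i p q =>
    @mknested (optree_comp i (tag p) (tag q))
      (subst_nesting (nth 0%N (tag p).2 i) (tagged p) (tagged q));
  oact := fun _ _ kappa p => @mknested (optree_act kappa (tag p)) (tagged p);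
  ounit := fun n => @mknested (optree_unit n) finset.set0 |}.

Section OInfinity.
Variable R : realType.

Definition coord n (z : 'rV[R]_n) (i : nat) : R :=
  if insub i is Some j then z 0 j else 0.

(* the coordinate permutation induced by E(t) + E(s) = E(subst_tree t a s) *)
Definition theta (t : tree nat) (a : nat) (s : tree nat)
    (z : 'rV[R]_(ne t)) (z' : 'rV[R]_(ne s)) : 'rV[R]_(ne (subst_tree t a s)) :=
  \row_e match origin e with inl i => coord z i | inr i => coord z' i end.

Definition Oinf_obj (c : seq posn) (d : posn) : polysum R := {|
  idx := optree;
  comps := [set x | is_optree x /\ of_type c d x];
  dim := fun x => ne x.1;
  poly := fun x => loday x.1 |}.

Definition Oinf_comp c d c' d' (i : nat) :
    polymap (prod_poly (Oinf_obj c d) (Oinf_obj c' d'))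
            (Oinf_obj (splice i c c') d) :=
  @PolyMap R (prod_poly (Oinf_obj c d) (Oinf_obj c' d'))
             (Oinf_obj (splice i c c') d)
    (fun xy => optree_comp i xy.1 xy.2)
    (fun xy z =>
       let: t' := xy.1.1 in let: t'' := xy.2.1 in
       let: a := nth 0%N xy.1.2 i in
       theta a (tr (@weight t' a (nv t'')) (lsubmx z)) (rsubmx z)).

Definition Oinf_act c d (kappa : seq nat) :
    polymap (Oinf_obj c d) (Oinf_obj (precompose c kappa) d) :=
  @PolyMap R (Oinf_obj c d) (Oinf_obj (precompose c kappa) d)
    (optree_act kappa) (fun x z => z).

Definition Oinf_unit (n : posn) :
    polymap (@point_poly R) (Oinf_obj [:: n] n) :=
  @PolyMap R point_poly (Oinf_obj [:: n] n)
    (fun=> optree_unit n) (fun _ _ => 0).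

Definition Oinf : poly_operad R posn := {|
  obj := Oinf_obj;
  pcomp := Oinf_comp;
  pact := Oinf_act;
  punit := Oinf_unit |}.

Definition vertex_point c d (p : elt nested_operad c d) :
    elt (underlying Oinf) c d :=
  @mkpt R (Oinf_obj c d) (tag p) (vertexM R (tagged p) (std (tag p).1)).

Definition vertices (A : polysum R) : set (pt A) :=
  [set p | comps A (tag p) /\ vertex (poly (tag p)) (tagged p)].

Definition Oinf_diagonal (v : forall x : optree, 'rV[R]_(ne x.1))
    (c : seq posn) (d : posn) :
    polymap (obj Oinf c d) (obj (square_operad Oinf) c d) :=
  @PolyMap R (Oinf_obj c d) (square_poly (Oinf_obj c d))
    (fun x => x) (fun x z => diagonal (v x) (loday x.1) z).

End OInfinity.

Arguments vertices {R} A.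

(* Main.v *)
Require Import Defs.
From mathcomp Require Import all_boot all_order all_algebra.
From mathcomp Require Import all_classical all_reals topology normedtype derive.
From mathcomp Require Import ring lra zify.

Set Implicit Arguments.
Unset Strict Implicit.
Unset Printing Implicit Defensive.

Import Order.TTheory GRing.Theory Num.Theory.
Import numFieldNormedType.Exports.

Local Open Scope classical_set_scope.
Local Open Scope ring_scope.

(* A Loday polytope is cut out by the equation x(E) = c(E) and the inequalities
   x(N) >= c(N) over the nests N, where x(N) is the sum of the coordinates in N
   and c(N) the sum of the products of the weights of the pairs of distinct
   vertices of t(N).  Tight nests form nestings, hence laminar families, and a
   vector of total sum zero contains, conformally to two laminar families, a
   vector 1_I - 1_J with |I| = |J|.  So the pairs (bot z, top z) are the pairs
   (x, y) of points whose tight families satisfy a combinatorial condition, in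
   which neither v nor the weights occur.  This gives the independence of the
   orientation vector, the image of the diagonal as a union of faces of P x P on
   which the midpoint is a homeomorphism, and the compatibility of the diagonal
   with Theta.

   A transition map between two weights is a limit: start from any map with the
   right values on the vertices and average repeatedly over bot and top, which
   have smaller ranks.  The same contraction gives uniqueness, so both sides of
   every equation between composites of transitions and coordinate permutations
   are equal once they agree on vertices and commute with the diagonals.  In this
   way the operad axioms reduce to identities of planar trees, proved by tracking
   the labels of the vertices of an iterated substitution.  The axioms for nested
   trees and for the square are pulled back along jointly injective families of
   maps commuting with the structure. *)

(** * Laminar families *)

(** The map [tr] has no formula: [xget] picks some map with the required properties. Away from the
    vertices nothing about it can be computed, so its existence, its uniqueness and every identity
    have to come from one contraction argument. The rank used there is the dimension of the smallest
    face containing a point. For a good pair (x, y) no nonzero direction has sum zero over the tight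
    nests of both points, since that direction and its opposite would both have a positive product
    with v; hence the ranks of bot z and top z add up to at most the rank of z. A bound proportional
    to the rank is therefore halved by each averaging, although neither rank need drop. Tight nests
    are laminar because c is strictly supermodular: the union of two overlapping subtrees gains the
    pairs of vertices contained in neither of them. General weights are unavoidable, since
    contracting a subtree to a vertex gives this vertex the weight of the whole subtree. [Theta]
    permutes the coordinates, which might spoil a condition on least indices; it is harmless because
    it is increasing on each of the two blocks of edges. *)

Lemma halving_principle (R : realType) (X : Type) (S : X -> Prop)
    (rk : X -> nat) (b t : X -> X) (h : X -> R) (K : R) :
  (forall x, S x -> S (b x) /\ S (t x)) ->
  (forall x, S x -> (rk (b x) + rk (t x) <= rk x)%N) ->
  (forall x, S x -> h x <= K) ->
  (forall x, S x -> rk x = 0%N -> h x <= 0) ->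
  (forall x, S x -> h x <= (h (b x) + h (t x)) / 2) ->
  forall x, S x -> h x <= 0.
Proof.
move=> Sbt rkbt hK h0 hbt.
(* For k = 0, a positive rank is at least 1, so K is a bound, and at rank 0 the hypothesis gives 0.
   The average halves the bound because the two ranks add up to at most [rk x]. *)
have bound k x : S x -> h x <= `|K| * (rk x)%:R / 2 ^+ k.
  elim: k x => [|k IH] x Sx.
    rewrite expr0 divr1; case: (posnP (rk x)) => [r0|r_gt0].
      by rewrite r0 mulr0 h0.
    rewrite (le_trans (hK _ Sx))// (le_trans (ler_norm _))//.
    by rewrite ler_peMr// ler1n.
  have [Sb St] := Sbt x Sx.
  apply: le_trans (hbt _ Sx) _.
  rewrite ler_pdivrMr//; apply: le_trans (lerD (IH _ Sb) (IH _ St)) _.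
  have -> : `|K| * (rk x)%:R / 2 ^+ k.+1 * 2 = `|K| * (rk x)%:R / 2 ^+ k.
    by rewrite exprS invfM; set y := (2 ^+ k)^-1; lra.
  rewrite -mulrDl -mulrDr -natrD ler_pM2r ?invr_gt0 ?exprn_gt0//.
  by rewrite ler_wpM2l// ler_nat rkbt.
move=> x Sx; rewrite leNgt; apply/negP => hx.
set M := `|K| * (rk x)%:R in bound.
have M0 : 0 <= M / h x by rewrite divr_ge0 ?mulr_ge0// ltW.
have := archi_boundP M0; set k := Num.bound _ => Mk.
have := bound k x Sx; apply/negP; rewrite -ltNge.
rewrite ltr_pdivrMr ?exprn_gt0// [ltRHS]mulrC -ltr_pdivrMr//.
apply: lt_trans Mk _; rewrite -natrX ltr_nat ltn_expl//.
Qed.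

Local Notation disj N M := (fintype.disjoint (mem N) (mem M)).

Section SetSums.
Import mathcomp.boot.fintype mathcomp.boot.finset.
Variables (R : realType) (n : nat).
Implicit Types (N M I J : {set 'I_n}) (x d : 'rV[R]_n).

Definition setsum N x : R := \sum_(e in N) x 0 e.

Lemma setsumD N x y : setsum N (x + y) = setsum N x + setsum N y.
Proof. by rewrite -big_split; apply: eq_bigr => e _; rewrite mxE. Qed.

Lemma setsumZ N a x : setsum N (a *: x) = a * setsum N x.
Proof. by rewrite mulr_sumr; apply: eq_bigr => e _; rewrite mxE. Qed.

Lemma setsumN N x : setsum N (- x) = - setsum N x.
Proof. by rewrite -scaleN1r setsumZ mulN1r. Qed.

Lemma setsumB N x y : setsum N (x - y) = setsum N x - setsum N y.
Proof. by rewrite setsumD setsumN. Qed.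

Lemma setsum1 e x : setsum [set e]%SET x = x 0 e.
Proof. by rewrite /setsum big_set1. Qed.

Lemma setsum_setU N M x :
  disj N M -> setsum (N :|: M)%SET x = setsum N x + setsum M x.
Proof.
by move=> dNM; rewrite /setsum -bigU//=; apply: eq_bigl => e; rewrite !inE.
Qed.

Definition signvec I J : 'rV[R]_n := \row_e ((e \in I)%:R - (e \in J)%:R).

Lemma setsum_signvec N I J :
  setsum N (signvec I J) = #|I :&: N|%SET%:R - #|J :&: N|%SET%:R.
Proof.
have count (K : {set 'I_n}) :
    \sum_(e in N) (e \in K)%:R = #|K :&: N|%SET%:R :> R.
  rewrite -sum1_card natr_sum (eq_bigl (fun e => (e \in N) && (e \in K))).
    by rewrite big_mkcondr; apply: eq_bigr => e _; case: ifP.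
  by move=> e; rewrite inE andbC.
by rewrite -!count -sumrB; apply: eq_bigr => e _; rewrite mxE.
Qed.

Lemma dotp_signvec I J (v : 'rV[R]_n) :
  dotp (signvec I J) v = \sum_(e in I) v 0 e - \sum_(e in J) v 0 e.
Proof.
rewrite /dotp (eq_bigr (fun e => (e \in I)%:R * v 0 e - (e \in J)%:R * v 0 e)).
  rewrite sumrB; congr (_ - _); rewrite [RHS]big_mkcond; apply: eq_bigr => e _;
  by case: ifP; rewrite ?mul1r ?mul0r.
by move=> e _; rewrite mxE mulrBl.
Qed.

End SetSums.

Section Laminar.
Import mathcomp.boot.fintype mathcomp.boot.finset.
Variables (R : realType) (n : nat).
Implicit Types (N M I J : {set 'I_n}) (F A B : {set {set 'I_n}}) (x d : 'rV[R]_n).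

Definition laminar F : Prop := forall N M, N \in F -> M \in F ->
  [\/ N \subset M, M \subset N | disj N M].

Lemma laminar_sub F F' : F' \subset F -> laminar F -> laminar F'.
Proof. by move=> /subsetP sF lF N M /sF FN /sF; apply: lF. Qed.

(** The union of a laminar family is the disjoint union of its maximal members. A member of largest
    cardinality contains or avoids every other one, so it can be split off. *)
Lemma setsum_cover_ge0 F d : laminar F ->
  (forall N, N \in F -> 0 <= setsum N d) -> 0 <= setsum (cover F) d.
Proof.
move: {2}(#|F|) (leqnn #|F|) => k; elim: k F => [|k IH] F.
  rewrite leqn0 cards_eq0 => /eqP -> _ _.
  by rewrite /cover big_set0 /setsum big_set0.
move=> Fk lF F0; case: (set_0Vmem F) => [->|[N0 FN0]].
  by rewrite /cover big_set0 /setsum big_set0.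
case: (arg_maxnP (fun N => #|N|) FN0) => N FN Nmax.
(* The condition [M != N] matters for an empty [N], which is disjoint from itself: the family has to
   shrink. *)
pose F' := [set M in F | disj M N && (M != N)]%SET.
have sF' : F' \subset F by apply/subsetP => M; rewrite inE => /andP[].
have covE : (cover F = N :|: cover F')%SET.
  apply/eqP; rewrite eqEsubset; apply/andP; split; apply/subsetP => e.
    case/bigcupP => M FM eM; rewrite inE; case: (lF M N FM FN) => [sMN|sNM|dMN].
    - by rewrite (subsetP sMN).
    - suff -> : N = M by rewrite eM.
      by apply/eqP; rewrite eqEcard sNM; apply: Nmax.
    - have [<-|neqMN] := eqVneq M N; first by rewrite eM.
      by apply/orP; right; apply/bigcupP; exists M; rewrite ?inE ?FM ?dMN.
  rewrite inE => /orP[eN|]; first by apply/bigcupP; exists N.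
  case/bigcupP => M /(subsetP sF') FM eM; by apply/bigcupP; exists M.
have dis : disj N (cover F').
  rewrite disjoint_sym disjoints_subset; apply/bigcupsP => M; rewrite -disjoints_subset.
  by rewrite inE => /and3P[].
rewrite covE setsum_setU//; apply: addr_ge0; first exact: F0.
apply: IH.
- rewrite -ltnS; apply: leq_trans Fk; apply: proper_card.
  rewrite properE sF'; apply/subsetPn; exists N; rewrite // inE [N \in F]FN /=.
  by rewrite eqxx andbF.
- exact: laminar_sub lF.
- by move=> M /(subsetP sF'); apply: F0.
Qed.

(* N0 is the least member of F containing e whose sum is nonpositive.  If every
   negative coordinate in N0 lay in a member of F inside N0, away from e and of
   nonnegative sum, the sum over N0 would be positive. *)
Lemma laminar_partner F d e : laminar F -> [set: 'I_n]%SET \in F ->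
  setsum [set: 'I_n]%SET d <= 0 -> 0 < d 0 e ->
  exists f, d 0 f < 0 /\ forall N, N \in F ->
    (e \in N -> f \notin N -> 0 < setsum N d) /\
    (e \notin N -> f \in N -> setsum N d < 0).
Proof.
move=> lF FT dT de.
pose P N := [&& N \in F, e \in N & setsum N d <= 0].
have PT : P [set: 'I_n]%SET by rewrite /P FT inE dT.
case: (arg_minnP (fun N => #|N|) PT) => N0 /and3P[FN0 eN0 dN0] N0min.
pose U := [set N in F | [&& N \subset N0, e \notin N & 0 <= setsum N d]]%SET.
have UP N : N \in U -> [/\ N \in F, N \subset N0, e \notin N & 0 <= setsum N d].
  by rewrite inE => /and4P[].
have sUN0 : cover U \subset N0 by apply/bigcupsP => N /UP[].
have [f /and3P[fN0 df fU]|nof] :=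
    pickP (fun f => [&& f \in N0, d 0 f < 0 & f \notin cover U]).
  exists f; split => // N FN; split => [eN fN|eN fN]; last first.
    rewrite ltNge; apply/negP => dN; case: (lF N N0 FN FN0) => [sN|sN|dis].
    - by move/negP: fU; apply; apply/bigcupP; exists N; rewrite // inE FN sN eN.
    - by rewrite (subsetP sN) in eN.
    - by have := disjointFr dis fN; rewrite fN0.
  rewrite ltNge; apply/negP => dN; case: (lF N N0 FN FN0) => [sN|sN|dis].
  - have /eqP NN0 : N == N0 by rewrite eqEcard sN; apply: N0min; apply/and3P.
    by rewrite NN0 fN0 in fN.
  - by rewrite (subsetP sN) in fN.
  - by have := disjointFr dis eN; rewrite eN0.
suff : 0 < setsum N0 d by rewrite ltNge dN0.
have -> : N0 = (cover U :|: (N0 :\: cover U))%SET by rewrite setDE setUIr setUCr setIT; apply/esym/setUidPr.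
rewrite setsum_setU; last by rewrite disjoints_subset setCD subsetUr.
have eU : e \notin cover U by apply/negP => /bigcupP[N /UP[_ _ /negP]].
rewrite ltr_wpDl//.
  apply: setsum_cover_ge0 => [|N /UP[]//].
  by apply: laminar_sub lF; apply/subsetP => N /UP[].
rewrite /setsum (bigD1 e) ?inE ?eN0 ?eU//= ltr_wpDr// sumr_ge0// => f.
rewrite inE => /andP[/andP[fU fN0] _]; rewrite leNgt; apply/negP => df.
by have := nof f; rewrite fN0 df fU.
Qed.

Definition balanced I J : Prop :=
  [/\ I != set0, J != set0, (I :&: J)%SET = set0
    & #|I| = #|J|].

Definition conformal N I J d : Prop :=
  (0 < setsum N (signvec R I J) -> 0 < setsum N d) /\
  (setsum N (signvec R I J) < 0 -> setsum N d < 0).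

(* An alternating cycle of the partners for A and the partners for B. *)
Lemma conformal_signvec A B d : laminar A -> laminar B ->
  [set: 'I_n]%SET \in A -> [set: 'I_n]%SET \in B ->
  setsum [set: 'I_n]%SET d = 0 -> d != 0 ->
  exists I J, [/\ balanced I J, forall e, e \in I -> 0 < d 0 e,
    forall e, e \in J -> d 0 e < 0
    & forall N, (N \in A) || (N \in B) -> conformal N I J d].
Proof.
move=> lA lB AT BT dT d0.
have [e0 de0] : exists e, 0 < d 0 e.
  apply/existsP; apply: contraT; rewrite negb_exists => /forallP npos.
  have : d == 0; last by rewrite (negbTE d0).
  have all0 : forall e, true -> - d 0 e = 0.
    apply: psumr_eq0P => [e _|]; first by rewrite oppr_ge0 leNgt npos.
    rewrite sumrN; move: dT; rewrite /setsum.
    under eq_bigl do rewrite inE. by move=> ->; rewrite oppr0.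
  apply/eqP/rowP => e; rewrite mxE.
  by apply/eqP; rewrite -oppr_eq0 all0.
(* f is a partner of e for the family: wherever 1_e - 1_f has a nonzero sum over a member, the sum
   of x has the same sign. *)
pose pa F x e f := (x 0 f < 0) && [forall N in F,
  ((e \in N) && (f \notin N) ==> (0 < setsum N x)) &&
  ((e \notin N) && (f \in N) ==> (setsum N x < 0))].
have paE F x e : laminar F -> [set: 'I_n]%SET \in F ->
    setsum [set: 'I_n]%SET x = 0 -> 0 < x 0 e -> exists f, pa F x e f.
  move=> lF FT xT xe; have [|f [xf fN]] := laminar_partner lF FT _ xe.
    by rewrite xT.
  exists f; rewrite /pa xf /=; apply/forallP => N; apply/implyP => FN.
  have [h1 h2] := fN N FN; apply/andP.
  by split; apply/implyP => /andP[]; [apply: h1|apply: h2].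
pose alpha e := odflt e [pick f | pa A d e f].
(* For [B] the signs are exchanged, so [beta] leads from a negative coordinate back to a positive
   one. *)
pose beta e := odflt e [pick f | pa B (- d) e f].
have alphaP e : 0 < d 0 e -> pa A d e (alpha e).
  move=> de; rewrite /alpha; case: pickP => //= no.
  by have [f] := paE A d e lA AT dT de; rewrite no.
have betaP e : d 0 e < 0 -> pa B (- d) e (beta e).
  move=> de; rewrite /beta; case: pickP => //= no.
  have [||f] := paE B (- d) e lB BT; rewrite ?no//.
    by rewrite setsumN dT oppr0.
  by rewrite mxE oppr_gt0.
pose phi e := beta (alpha e).
have alpha_neg e : 0 < d 0 e -> d 0 (alpha e) < 0 by move=> /alphaP/andP[].
have phi_pos e : 0 < d 0 e -> 0 < d 0 (phi e).
  by move=> /alpha_neg/betaP/andP[]; rewrite mxE oppr_lt0.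
(* On a smallest nonempty set of positive coordinates stable under [phi], the map [phi] is a
   permutation; this set and its image under [alpha] form the alternating cycle. *)
pose closed I := [&& I != set0, I \subset [set e | 0 < d 0 e]%SET
                   & phi @: I \subset I].
have closed0 : closed [set e | 0 < d 0 e]%SET.
  apply/and3P; split=> //; first by apply/set0Pn; exists e0; rewrite inE.
  by apply/subsetP => y /imsetP[e]; rewrite !inE => /phi_pos de ->.
case: (arg_minnP (fun I => #|I|) closed0) => I /and3P[I0 Ipos phiI] Imin.
have dI e : e \in I -> 0 < d 0 e by move=> /(subsetP Ipos); rewrite inE.
have phiIE : phi @: I = I.
  apply/eqP; rewrite eqEcard phiI /=; apply: Imin; apply/and3P; split.
  - by have /set0Pn[e eI] := I0; apply/set0Pn; exists (phi e); apply: imset_f.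
  - exact: fintype.subset_trans phiI Ipos.
  - exact: imsetS.
have phi_inj : {in I &, injective phi}.
  by apply/imset_injP; rewrite phiIE.
have alpha_inj : {in I &, injective alpha}.
  by move=> e f eI fI ef; apply: phi_inj; rewrite // /phi ef.
have dJ e : e \in alpha @: I -> d 0 e < 0.
  by case/imsetP => f fI ->; apply/alpha_neg/dI.
have sumE N : setsum N (signvec R I (alpha @: I)) =
    \sum_(e in I) ((e \in N)%:R - (alpha e \in N)%:R).
  rewrite setsum_signvec sumrB; congr (_ - _).
    rewrite -sum1_card natr_sum (eq_bigl (fun e => (e \in I) && (e \in N))).
      by rewrite big_mkcondr; apply: eq_bigr => e _; case: ifP.
    by move=> e; rewrite inE.
  rewrite -(big_imset (fun e => (e \in N)%:R)) //=.
  rewrite -sum1_card natr_sum (eq_bigl (fun e => (e \in alpha @: I) && (e \in N))).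
    by rewrite big_mkcondr; apply: eq_bigr => e _; case: ifP.
  by move=> e; rewrite inE.
(* As [phi] permutes [I], each [alpha e] can be matched with [phi e], its partner for [B], instead
   of with e. *)
have sumE' N : setsum N (signvec R I (alpha @: I)) =
    \sum_(e in I) ((phi e \in N)%:R - (alpha e \in N)%:R).
  rewrite sumE !sumrB; congr (_ - _).
  by rewrite -{1}phiIE big_imset.
exists I, (alpha @: I); split => //.
- split => //.
  + by have /set0Pn[e eI] := I0; apply/set0Pn; exists (alpha e); apply: imset_f.
  + apply/setP => e; rewrite !inE; apply/negbTE/negP => /andP[/dI eI /dJ eJ].
    by have := lt_trans eI eJ; rewrite ltxx.
  + by rewrite card_in_imset.
move=> N /orP[NA|NB].
  rewrite /conformal sumE; split => cN.
    rewrite ltNge; apply/negP => dN.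
    suff : \sum_(e in I) ((e \in N)%:R - (alpha e \in N)%:R) <= 0 :> R.
      by rewrite leNgt cN.
    apply: sumr_le0 => e /dI/alphaP/andP[_ /forall_inP/(_ N NA)/andP[/implyP h _]].
    case: (boolP (e \in N)) => eN; case: (boolP (alpha e \in N)) => aN;
      rewrite ?subrr ?sub0r ?oppr_le0 ?subr0//.
    by have := h; rewrite eN aN => /(_ isT); rewrite ltNge dN.
  rewrite ltNge; apply/negP => dN.
  suff : 0 <= \sum_(e in I) ((e \in N)%:R - (alpha e \in N)%:R) :> R.
    by rewrite leNgt cN.
  apply: sumr_ge0 => e /dI/alphaP/andP[_ /forall_inP/(_ N NA)/andP[_ /implyP h]].
  case: (boolP (e \in N)) => eN; case: (boolP (alpha e \in N)) => aN;
    rewrite ?subrr ?sub0r ?subr0//.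
  by have := h; rewrite eN aN => /(_ isT); rewrite ltNge dN.
rewrite /conformal sumE'; split => cN.
  rewrite ltNge; apply/negP => dN.
  suff : \sum_(e in I) ((phi e \in N)%:R - (alpha e \in N)%:R) <= 0 :> R.
    by rewrite leNgt cN.
  apply: sumr_le0 => e /dI/alpha_neg/betaP/andP[_ /forall_inP/(_ N NB)/andP[_ /implyP]].
  rewrite -/(phi e) setsumN oppr_lt0 => h.
  case: (boolP (phi e \in N)) => eN; case: (boolP (alpha e \in N)) => aN;
    rewrite ?subrr ?sub0r ?oppr_le0 ?subr0//.
  by have := h; rewrite eN aN => /(_ isT); rewrite ltNge dN.
rewrite ltNge; apply/negP => dN.
suff : 0 <= \sum_(e in I) ((phi e \in N)%:R - (alpha e \in N)%:R) :> R.
  by rewrite leNgt cN.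
apply: sumr_ge0 => e /dI/alpha_neg/betaP/andP[_ /forall_inP/(_ N NB)/andP[/implyP]].
rewrite -/(phi e) setsumN oppr_gt0 => h _.
case: (boolP (phi e \in N)) => eN; case: (boolP (alpha e \in N)) => aN;
  rewrite ?subrr ?sub0r ?subr0//.
by have := h; rewrite eN aN => /(_ isT); rewrite ltNge dN.
Qed.

(** With the singletons added, every coordinate is the sum over a member: conformality then controls
    the signs of the coordinates, and a vector with all sums zero vanishes. *)
Lemma laminar_singletons F :
  laminar F -> laminar (F :|: [set [set e] | e : 'I_n])%SET.
Proof.
have single e M : [\/ [set e]%SET \subset M, M \subset [set e]%SET | disj [set e]%SET M].
  have [eM|eM] := boolP (e \in M); first by apply: Or31; rewrite sub1set.
  by apply: Or33; rewrite disjoints1.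
move=> lF N M; rewrite !inE => /orP[FN|/imsetP[e _ ->]]; last by move=> _; apply: single.
move=> /orP[FM|/imsetP[e _ ->]]; first exact: lF.
case: (single e N) => h; [by apply: Or32|by apply: Or31|].
by apply: Or33; rewrite disjoint_sym.
Qed.

Definition feasible A B d : Prop :=
  (forall N, N \in A -> 0 <= setsum N d) /\ (forall N, N \in B -> setsum N d <= 0).

Definition leads I J : Prop :=
  exists2 i, i \in I & forall j, (j \in I) || (j \in J) -> (i <= j)%N.

(* If A and B are the tight families of x and y, every d such that x + d and y - d
   stay in the polytope is feasible; such a d raises x in the direction of any
   principal vector. *)
Definition good A B : Prop := forall I J,
  balanced I J -> feasible A B (signvec R I J) -> leads I J.

Lemma feasible_sub A B A' B' d :
  A' \subset A -> B' \subset B -> feasible A B d -> feasible A' B' d.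
Proof.
by move=> /subsetP sA /subsetP sB [hA hB]; split=> N; [move/sA/hA|move/sB/hB].
Qed.

Lemma good_sub A B A' B' :
  A \subset A' -> B \subset B' -> good A B -> good A' B'.
Proof. by move=> sA sB g I J bIJ f; apply: g (feasible_sub sA sB f). Qed.

(** Induction on the number of members of [F] over which d has a nonzero sum. A conformal vector 1_I
    - 1_J is itself feasible, so its product with v is positive; subtracting the largest multiple
    that reverses no sign keeps d feasible and makes one more sum vanish. *)
Lemma good_dotp_gt0 A B v d : principal v -> laminar A -> laminar B ->
  [set: 'I_n]%SET \in A -> [set: 'I_n]%SET \in B -> good A B ->
  feasible A B d -> d != 0 -> 0 < dotp d v.
Proof.
move=> pv lA lB AT BT gAB.
pose S := [set [set e] | e : 'I_n]%SET : {set {set 'I_n}}.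
pose F := ((A :|: S) :|: (B :|: S))%SET.
pose m d := #|[set N in F | setsum N d != 0]%SET|.
rewrite ltNge => fd dn0; apply/negP => dv.
move: {2}(m d) (leqnn (m d)) => k.
elim: k d fd dn0 dv => [|k IH] d fd dn0 dv mk.
  move: mk; rewrite leqn0 cards_eq0 => /eqP F0.
  case/negP: dn0; apply/eqP/rowP => e; rewrite mxE -setsum1.
  have := in_set0 [set e]%SET; rewrite -F0 !inE.
  by rewrite (_ : [set e]%SET \in S) ?imset_f// orbT => /negbFE/eqP.
have dT : setsum [set: 'I_n]%SET d = 0.
  by apply/eqP; rewrite eq_le; case: fd => /(_ _ AT) -> /(_ _ BT) ->.
have [||I [J [bIJ dI dJ conf]]] := conformal_signvec
    (laminar_singletons lA) (laminar_singletons lB) _ _ dT dn0.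
- by rewrite inE AT.
- by rewrite inE BT.
set c := signvec R I J.
have {}conf N : N \in F -> conformal N I J d by rewrite inE => /conf.
have fc : feasible A B c.
  case: fd => fA fB; split => N NAB; rewrite leNgt; apply/negP => cN.
    have [|_ /(_ cN)] := conf N; first by rewrite !inE NAB.
    by rewrite ltNge fA.
  have [|/(_ cN)] := conf N; first by rewrite !inE NAB !orbT.
  by rewrite ltNge fB.
have cv : 0 < dotp c v.
  have [I0 J0 IJ0 cIJ] := bIJ.
  by rewrite dotp_signvec subr_gt0; apply: pv => //; apply: gAB.
have [i iI] : exists i, i \in I by apply/set0Pn; case: bIJ.
pose P N := (N \in F) && (setsum N c != 0).
have Pi : P [set i]%SET.
  rewrite /P !inE (_ : [set i]%SET \in S) ?imset_f// !orbT /=.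
  rewrite setsum1 mxE iI (_ : (i \in J) = false) ?subr0 ?oner_eq0//.
  by apply/negP => iJ; have := lt_trans (dI _ iI) (dJ _ iJ); rewrite ltxx.
have ratio N : P N -> 0 < setsum N d / setsum N c.
  case/andP => FN; rewrite neq_lt => /orP[cN|cN]; have [h1 h2] := conf N FN.
    by rewrite -divrNN divr_gt0 ?oppr_gt0// h2.
  by rewrite divr_gt0// h1.
(* The least ratio is the largest multiple of [c] that can be subtracted without reversing the sign
   of a sum. *)
case: (@Order.TotalTheory.arg_minP _ _ _ [set i]%SET P (fun N => setsum N d / setsum N c) Pi) => N0 PN0 N0min.
set l := setsum N0 d / setsum N0 c in N0min.
have l0 : 0 < l by apply: ratio.
have FN0 : N0 \in F by case/andP: PN0.
have dE N : setsum N (d - l *: c) = setsum N d - l * setsum N c.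
  by rewrite setsumB setsumZ.
have sgn N : N \in F -> (0 <= setsum N d -> 0 <= setsum N (d - l *: c)) /\
     (setsum N d <= 0 -> setsum N (d - l *: c) <= 0).
  move=> FN; have [h1 h2] := conf N FN; rewrite dE.
  have lN : setsum N c != 0 -> l <= setsum N d / setsum N c.
    by move=> cN; apply: N0min; rewrite /P FN.
  split => dN.
    have [cN|cN|->] := ltrgt0P (setsum N c); last by rewrite mulr0 subr0.
      by rewrite subr_ge0 -ler_pdivlMr// lN// gt_eqF.
    by move: dN; rewrite leNgt h2.
  have [cN|cN|->] := ltrgt0P (setsum N c); last by rewrite mulr0 subr0.
    by move: dN; rewrite leNgt h1.
  by rewrite subr_le0 -ler_ndivlMr// lN// lt_eqF.
have d'v : dotp (d - l *: c) v < 0.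
  have -> : dotp (d - l *: c) v = dotp d v - l * dotp c v.
    rewrite /dotp mulr_sumr -sumrB; apply: eq_bigr => e _.
    by rewrite !mxE mulrBl mulrA.
  by rewrite subr_lt0 (le_lt_trans dv)// mulr_gt0.
apply: (IH (d - l *: c)).
- case: fd => fA fB; split => N NAB.
    by have [|h _] := sgn N; [rewrite !inE NAB|apply/h/fA].
  by have [|_ h] := sgn N; [rewrite !inE NAB !orbT|apply/h/fB].
- by apply: contraTneq d'v => ->; rewrite /dotp big1 ?ltxx// => e _; rewrite mxE mul0r.
- exact: ltW.
rewrite -ltnS; apply: leq_trans mk; apply: proper_card; rewrite properE.
apply/andP; split.
  apply/subsetP => N; rewrite in_set => /andP[FN hN]; rewrite in_set FN /=.
  have [h1 h2] := sgn N FN; apply: contraNneq hN => dN.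
  by rewrite eq_le h1 ?dN// h2 ?dN.
apply/subsetPn; exists N0.
  rewrite in_set FN0 /=; apply: contraTneq (ratio N0 PN0) => ->.
  by rewrite mul0r ltxx.
rewrite in_set FN0 /= negbK dE divfK ?subrr//.
by case/andP: PN0.
Qed.

End Laminar.

(** * Polytopes *)

Section ConvexGeometry.
Variable R : realType.
Implicit Types (m n k : nat).

Lemma dotpE n (x u : 'rV[R]_n) : dotp x u = (x *m u^T) 0 0.
Proof. by rewrite mxE; apply: eq_bigr => i _; rewrite !mxE. Qed.

Lemma dotpDl n (x y u : 'rV[R]_n) : dotp (x + y) u = dotp x u + dotp y u.
Proof. by rewrite !dotpE mulmxDl mxE. Qed.

Lemma dotpZl n a (x u : 'rV[R]_n) : dotp (a *: x) u = a * dotp x u.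
Proof. by rewrite !dotpE -scalemxAl mxE. Qed.

Lemma dotpNl n (x u : 'rV[R]_n) : dotp (- x) u = - dotp x u.
Proof. by rewrite -scaleN1r dotpZl mulN1r. Qed.

Lemma dotpBl n (x y u : 'rV[R]_n) : dotp (x - y) u = dotp x u - dotp y u.
Proof. by rewrite dotpDl dotpNl. Qed.

Lemma dotp0l n (u : 'rV[R]_n) : dotp 0 u = 0.
Proof. by rewrite dotpE mul0mx mxE. Qed.

Lemma dotpC n (x u : 'rV[R]_n) : dotp x u = dotp u x.
Proof. by apply: eq_bigr => i _; rewrite mulrC. Qed.

Lemma dotp_suml n (I : finType) (F : I -> 'rV[R]_n) u :
  dotp (\sum_i F i) u = \sum_i dotp (F i) u.
Proof.
apply: (big_morph (fun x => dotp x u)) => [x y|]; first exact: dotpDl.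
exact: dotp0l.
Qed.

Lemma dotp_mulmx m n (x : 'rV[R]_m) (S : 'M[R]_(m, n)) u :
  dotp (x *m S) u = dotp x (u *m S^T).
Proof. by rewrite !dotpE trmx_mul trmxK mulmxA. Qed.

Lemma dotp_row_mx m n (x u : 'rV[R]_m) (y v : 'rV[R]_n) :
  dotp (row_mx x y) (row_mx u v) = dotp x u + dotp y v.
Proof. by rewrite !dotpE tr_row_mx mul_row_col mxE. Qed.

Definition convexset n (A : set 'rV[R]_n) : Prop := forall x y t,
  A x -> A y -> 0 <= t <= 1 -> A (t *: x + (1 - t) *: y).

Lemma sub_hull n (A : set 'rV[R]_n) : A `<=` hull A.
Proof.
move=> x Ax; exists 1%N, (fun=> 1), (fun=> x); split => //.
- by rewrite big_ord1.
- by rewrite big_ord1 scale1r.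
Qed.

Lemma hull_fin n (A : set 'rV[R]_n) (I : finType) (a : I -> R) (p : I -> 'rV[R]_n) :
  (forall i, 0 <= a i) -> \sum_i a i = 1 -> (forall i, A (p i)) ->
  hull A (\sum_i a i *: p i).
Proof.
move=> a0 a1 Ap.
exists #|I|, (fun i => a (enum_val i)), (fun i => p (enum_val i)).
have sumE (V : nmodType) (F : I -> V) :
    \sum_(i < #|I|) F (enum_val i) = \sum_i F i.
  rewrite (reindex (@enum_rank I)) /=.
    by apply: eq_bigr => i _; rewrite enum_rankK.
  by exists enum_val => x _; [exact: enum_rankK|exact: enum_valK].
by split => //; rewrite (sumE _ a, sumE _ (fun i => a i *: p i)).
Qed.

Lemma hull_convex n (A : set 'rV[R]_n) : convexset (hull A).
Proof.
move=> x y t [m [a [p [a0 a1 Ap ->]]]] [k [b [q [b0 b1 Bq ->]]]] /andP[t0 t1].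
have s0 : 0 <= 1 - t by rewrite subr_ge0.
pose c (i : 'I_m + 'I_k) := match i with inl j => t * a j | inr j => (1 - t) * b j end.
pose r (i : 'I_m + 'I_k) := match i with inl j => p j | inr j => q j end.
have -> : t *: \sum_i a i *: p i + (1 - t) *: \sum_i b i *: q i = \sum_i c i *: r i.
  rewrite big_sumType /= !scaler_sumr; congr (_ + _);
  by apply: eq_bigr => i _; rewrite scalerA.
apply: hull_fin => [[i|i]||[i|i]]; rewrite /c /r ?mulr_ge0//.
by rewrite big_sumType /= -!mulr_sumr a1 b1 !mulr1 addrC subrK.
Qed.

Lemma hull_set0 n : hull (set0 : set 'rV[R]_n) = set0.
Proof.
apply/seteqP; split => // x [[|m] [a [p [_ a1 Ap _]]]]; last by case: (Ap ord0).
by move: a1; rewrite big_ord0 => /eqP; rewrite eq_sym oner_eq0.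
Qed.

Lemma hull_mono n (A B : set 'rV[R]_n) : A `<=` B -> hull A `<=` hull B.
Proof.
by move=> AB x [m [a [p [a0 a1 Ap ->]]]]; exists m, a, p; split=> // i; apply/AB.
Qed.

Lemma hull_dotp_le n (A : set 'rV[R]_n) u c :
  (forall x, A x -> dotp x u <= c) -> forall x, hull A x -> dotp x u <= c.
Proof.
move=> Ac x [m [a [p [a0 a1 Ap ->]]]]; rewrite dotp_suml -[c]mul1r -a1 mulr_suml.
by apply: ler_sum => i _; rewrite dotpZl ler_wpM2l// Ac.
Qed.

Lemma hull_dotp_eq n (A : set 'rV[R]_n) u c :
  (forall x, A x -> dotp x u = c) -> forall x, hull A x -> dotp x u = c.
Proof.
move=> Ac x [m [a [p [a0 a1 Ap ->]]]]; rewrite dotp_suml -[c]mul1r -a1 mulr_suml.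
by apply: eq_bigr => i _; rewrite dotpZl Ac.
Qed.

Lemma hull_linear m n (M : 'M[R]_(m, n)) A :
  [set x *m M | x in hull A] = hull [set x *m M | x in A].
Proof.
apply/seteqP; split => [_ [x [k [a [p [a0 a1 Ap ->]]]] <-]|y].
  exists k, a, (fun i => p i *m M); split=> // [i|]; first by exists (p i).
  by rewrite mulmx_suml; apply: eq_bigr => i _; rewrite scalemxAl.
move=> [k [a [p [a0 a1 Ap ->]]]].
have /choice[q qP] : forall i, exists x, A x /\ x *m M = p i.
  by move=> i; have [x Ax <-] := Ap i; exists x.
exists (\sum_i a i *: q i).
  by exists k, a, q; split => // i; case: (qP i).
by rewrite mulmx_suml; apply: eq_bigr => i _; rewrite -scalemxAl (qP i).2.
Qed.

Lemma polytope_linear m n (M : 'M[R]_(m, n)) A :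
  polytope A -> polytope [set x *m M | x in A].
Proof.
move=> [B fB ->]; exists [set x *m M | x in B]; last exact: hull_linear.
exact: finite_image.
Qed.

Lemma face_sub n (P F : set 'rV[R]_n) : face P F -> F `<=` P.
Proof. by move=> [u [c [_ ->]]] x []. Qed.

Lemma face_refl n (P : set 'rV[R]_n) : face P P.
Proof.
exists 0, 0; split=> [x _|]; first by rewrite dotpC dotp0l.
by apply/seteqP; split => [x Px|x []//]; split => //=; rewrite dotpC dotp0l.
Qed.

Lemma face_set0 n (P : set 'rV[R]_n) : face P set0.
Proof.
exists 0, 1; split=> [x _|]; first by rewrite dotpC dotp0l.
apply/seteqP; split => // x [_ /=]; rewrite dotpC dotp0l => /eqP.
by rewrite eq_sym oner_eq0.
Qed.

Lemma faceI n (P F G : set 'rV[R]_n) : face P F -> face P G -> face P (F `&` G).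
Proof.
move=> [u [c [uc ->]]] [u' [c' [uc' ->]]]; exists (u + u'), (c + c').
have dE x : dotp x (u + u') = dotp x u + dotp x u' by rewrite !(dotpC x) dotpDl.
split=> [x Px|]; first by rewrite dE lerD ?uc ?uc'.
apply/seteqP; split=> [x [[Px /= xu] [_ xu']]|x [Px /=]].
  by split => //=; rewrite dE xu xu'.
rewrite dE => xcc; have := uc _ Px; have := uc' _ Px.
by move=> h1 h2; split; split => //=; lra.
Qed.

Lemma face_subface n (P F G : set 'rV[R]_n) :
  F `<=` P -> face P G -> G `<=` F -> face F G.
Proof.
move=> FP [u [c [uc GE]]] GF; exists u, c; split=> [x /FP/uc//|].
rewrite GE in GF *; apply/seteqP; split => x; last by move=> [/FP].
by move=> Gx; split; [apply: GF|case: Gx].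
Qed.

(** If a convex combination attains the maximum of a functional, so does every point that enters it
    with a nonzero coefficient. *)
Lemma face_hull n (A F : set 'rV[R]_n) : face (hull A) F -> F = hull (A `&` F).
Proof.
move=> [u [c [uc ->]]]; apply/seteqP; split => [x [[m [a [p [a0 a1 Ap ->]]]] /=]|]; last first.
  move=> x hx; split; first by apply: hull_mono hx => y [].
  by apply: hull_dotp_eq hx => y [_ []].
rewrite dotp_suml => sumc.
have pc i : a i != 0 -> dotp (p i) u = c.
  move=> ai0; have : forall i, true -> a i * (c - dotp (p i) u) = 0.
    apply: psumr_eq0P => [j _|].
      by rewrite mulr_ge0// subr_ge0 uc//; apply: sub_hull.
    under eq_bigr do rewrite mulrBr -dotpZl.
    by rewrite sumrB -mulr_suml a1 sumc mul1r subrr.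
  move=> /(_ i isT)/eqP; rewrite mulf_eq0 (negbTE ai0) /= subr_eq0.
  by move=> /eqP.
have [i0 ai0] : exists i, a i != 0.
  apply/existsP; apply: contraT; rewrite negb_exists => /forallP h.
  move: a1; rewrite big1; first by move=> /eqP; rewrite eq_sym oner_eq0.
  by move=> i _; apply/eqP; have := h i; rewrite negbK.
(* A point with coefficient 0 may lie off the face; [p i0], which lies on it, takes its place. *)
exists m, a, (fun i => if a i == 0 then p i0 else p i); split => //.
  move=> i; case: ifPn => [_|ai]; split => //; split; try exact: sub_hull.
    exact: pc.
  exact: pc.
by apply: eq_bigr => i _; case: eqP => // ->; rewrite !scale0r.
Qed.

Lemma polytope_face n (P F : set 'rV[R]_n) : polytope P -> face P F -> polytope F.
Proof.
move=> [A fA ->] fF; exists (A `&` F); last exact: face_hull.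
by apply: sub_finite_set fA => x [].
Qed.

(** A face is the hull of the generators it contains, hence determined by a bit mask on their
    list. *)
Lemma finite_faces n (P : set 'rV[R]_n) : polytope P -> finite_set (face P).
Proof.
move=> [A /finite_seqP[s ->] ->].
apply: (@sub_finite_set _ _ [set hull [set` mask (val b) s] | b in
  [set: (size s).-tuple bool]]).
  move=> F /face_hull FE; exists [tuple of [seq `[< F x >] | x <- in_tuple s]] => //=.
  rewrite -filter_mask {2}FE; congr hull; apply/seteqP; split => x /=.
    by rewrite mem_filter => /andP[/asboolP].
  by move=> [sx Fx]; rewrite mem_filter sx andbT; apply/asboolP.
exact/finite_image/finite_finset.
Qed.

(** If u defines [F] in [P] and u' defines [G] in [F], then [M *: u + u'] defines [G] in [P] once M
    is so large that a generator off [F] loses more in u than it can gain in u'. *)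
Lemma face_trans n (P F G : set 'rV[R]_n) :
  polytope P -> face P F -> face F G -> face P G.
Proof.
move=> [A /finite_seqP[s As] ->] fF fG.
have FE := face_hull fF.
have GE : G = hull (A `&` G).
  have := fG; rewrite {1}FE => /face_hull {1}->; congr hull.
  apply/seteqP; split => [x [[]]//|x [Ax Gx]]; split => //; split => //.
  by apply: face_sub Gx.
have [u [c [uc FE']]] := fF; have [u' [c' [uc' GE']]] := fG.
(* A sum of nonnegative terms stands in for a maximum. The [+ 1] makes the inequality [MP] strict;
   generators on [F] contribute 0, because a division by zero yields 0. *)
pose M := \sum_(a <- s) (`|dotp a u' - c'| + 1) / (c - dotp a u).
have Ac a : A a -> 0 <= c - dotp a u by move=> /sub_hull/uc; rewrite subr_ge0.
have term0 a : A a -> 0 <= (`|dotp a u' - c'| + 1) / (c - dotp a u).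
  by move=> /Ac h; rewrite divr_ge0// addr_ge0.
have MP a : A a -> dotp a u < c -> dotp a u' - c' < M * (c - dotp a u).
  move=> Aa ac; have ac' : 0 < c - dotp a u by rewrite subr_gt0.
  rewrite -ltr_pdivrMr//; apply: (@lt_le_trans _ _ ((`|dotp a u' - c'| + 1) / (c - dotp a u))).
    by rewrite ltr_pM2r ?invr_gt0// (le_lt_trans (ler_norm _))// ltrDl.
  have sa : a \in s by move: Aa; rewrite As.
  rewrite /M (big_rem a)//= lerDl big_seq sumr_ge0// => b bs; apply: term0.
  by rewrite As /=; exact: mem_rem bs.
have dE x : dotp x (M *: u + u') = M * dotp x u + dotp x u'.
  by rewrite !(dotpC x) dotpDl dotpZl.
have AP a : A a -> dotp a (M *: u + u') <= M * c + c' /\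
    (dotp a (M *: u + u') = M * c + c' -> G a).
  move=> Aa; have := uc _ (sub_hull Aa); rewrite le_eqVlt => /orP[/eqP ac|ac].
    have Fa : F a by rewrite FE'; split => //; apply: sub_hull.
    rewrite dE ac lerD2l uc'//; split => // /addrI ac'.
    by rewrite GE'.
  have := MP _ Aa ac; rewrite dE mulrBr => h; split; first by lra.
  by move=> h'; move: h; rewrite ltNge => /negP[]; lra.
have fH : face (hull A) (hull A `&` [set x | dotp x (M *: u + u') = M * c + c']).
  exists (M *: u + u'), (M * c + c'); split => // x.
  by apply: hull_dotp_le => a /AP[].
have := face_hull fH; set H := _ `&` [set x | _] => HE.
suff -> : G = H by [].
rewrite GE HE; congr hull; apply/seteqP; split => [a [Aa Ga]|a [Aa [_ /= Ha]]].
  split => //; split => /=; first exact: sub_hull.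
  have Fa := face_sub fG Ga.
  by move: Ga Fa; rewrite GE' FE' => -[_ /= ga] [_ /= fa]; rewrite dE ga fa.
by split => //; apply: (AP a Aa).2.
Qed.

Lemma face_complex n (P : set 'rV[R]_n) (D : set (set 'rV[R]_n)) :
  polytope P -> D `<=` face P -> (forall F G, D F -> face F G -> D G) ->
  polytopal_complex D.
Proof.
move=> pP DP Dface; split => //.
- by apply: sub_finite_set DP _; apply: finite_faces.
- by move=> F /DP; apply: polytope_face.
move=> F G DF DG; have fFG := faceI (DP _ DF) (DP _ DG).
by split; apply: face_subface fFG _; try exact: face_sub (DP _ _); move=> x [].
Qed.

Lemma prod_set_polytope m n (P : set 'rV[R]_m) (Q : set 'rV[R]_n) :
  polytope P -> polytope Q -> polytope (prod_set P Q).
Proof.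
move=> [A fA ->] [B fB ->].
exists [set row_mx p.1 p.2 | p in A `*` B]; first exact/finite_image/finite_setX.
apply/seteqP; split => z.
  move=> [[k [a [p [a0 a1 Ap zl]]]] [l [b [q [b0 b1 Bq zr]]]]].
  have -> : z = \sum_(i : 'I_k * 'I_l) (a i.1 * b i.2) *: row_mx (p i.1) (q i.2).
    rewrite -[z]hsubmxK zl zr.
    rewrite -(pair_bigA _ (fun i j => (a i * b j) *: row_mx (p i) (q j))) /=.
    rewrite -[RHS]hsubmxK; congr row_mx; rewrite [RHS]linear_sum /=; last first.
      under [RHS]eq_bigr do rewrite linear_sum.
      rewrite exchange_big; apply: eq_bigr => j _ /=.
      under eq_bigr do rewrite linearZ /= row_mxKr.
      by rewrite -scaler_suml -mulr_suml a1 mul1r.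
    apply: eq_bigr => i _; rewrite linear_sum /=.
    under eq_bigr do rewrite linearZ /= row_mxKl.
    by rewrite -scaler_suml -mulr_sumr b1 mulr1.
  apply: hull_fin => [[i j]||[i j]] /=; first by rewrite mulr_ge0.
    rewrite -(pair_bigA _ (fun i j => a i * b j)) /=.
    by under eq_bigr do rewrite -mulr_sumr b1 mulr1.
  by exists (p i, q j) => //; split; [exact: Ap|exact: Bq].
move=> [k [a [p [a0 a1 ABp ->]]]]; split; rewrite /= linear_sum /=.
  under eq_bigr do rewrite linearZ /=.
  exists k, a, (fun i => lsubmx (p i)); split => // i.
  by have [[x y] [/= Ax By] <-] := ABp i; rewrite row_mxKl.
under eq_bigr do rewrite linearZ /=.
exists k, a, (fun i => rsubmx (p i)); split => // i.
by have [[x y] [/= Ax By] <-] := ABp i; rewrite row_mxKr.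
Qed.

Lemma prod_set_face m n (P F : set 'rV[R]_m) (Q G : set 'rV[R]_n) :
  face P F -> face Q G -> face (prod_set P Q) (prod_set F G).
Proof.
move=> [u [c [uc ->]]] [u' [c' [uc' ->]]]; exists (row_mx u u'), (c + c').
have dE (z : 'rV[R]_(m + n)) : dotp z (row_mx u u') = dotp (lsubmx z) u + dotp (rsubmx z) u'.
  by rewrite -{1}[z]hsubmxK dotp_row_mx.
split => [z [zP zQ]|]; first by rewrite dE lerD ?uc ?uc'.
apply/seteqP; split => z; first by move=> [[? /= h1] [? /= h2]]; split => //=; rewrite dE h1 h2.
move=> [[zP zQ] /=]; rewrite dE => h.
by have := uc _ zP; have := uc' _ zQ; split; split => //=; lra.
Qed.

(* Every coordinate functional of the directions of F factors through the
   injective map M, by a partial inverse of M on their span. *)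
Lemma face_linear n0 n (M : 'M[R]_(n0, n)) (F G : set 'rV[R]_n0) :
  polytope F -> {in F &, injective (fun x => x *m M)} -> face F G ->
  face [set x *m M | x in F] [set x *m M | x in G].
Proof.
move=> [A /finite_seqP[s As] FE] Minj fG.
have [F0|Fn0] := pselect (F = set0).
  have -> : G = set0 by rewrite -subset0 -F0; apply: face_sub fG.
  by rewrite image_set0; apply: face_set0.
pose k := size s; pose s0 := head 0 s.
have k0 : (0 < k)%N.
  rewrite /k lt0n size_eq0; apply/eqP => s_nil; apply: Fn0.
  rewrite FE As s_nil -[RHS](hull_set0 n0); congr hull.
  by apply/seteqP; split.
pose i0 := Ordinal k0.
have s0E : s0 = s`_i0 by rewrite /s0 nth0.
pose W : 'M[R]_(k, n0) := \matrix_(i < k) (s`_i - s0).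
have inW x : F x -> (x - s0 <= W)%MS.
  rewrite FE => -[l [a [p [a0 a1 Ap ->]]]].
  have -> : \sum_i a i *: p i - s0 = \sum_i a i *: (p i - s0).
    under [RHS]eq_bigr do rewrite scalerBr.
    by rewrite sumrB -scaler_suml a1 scale1r.
  apply: summx_sub => i _; apply: scalemx_sub.
  have := Ap i; rewrite As /= => psi.
  have hk : (index (p i) s < k)%N by rewrite index_mem.
  have -> : p i - s0 = row (Ordinal hk) W by rewrite rowK /= nth_index.
  exact: row_sub.
have hs i : A s`_(i : 'I_k) by rewrite As /= mem_nth.
(* [M] is injective on the span of [W]: the barycentre b of the generators can be moved inside [F]
   by a small multiple of any w in the span, and if [M] kills w the two points have the same
   image. *)
have Winj (w : 'rV_n0) : (w <= W)%MS -> w *m M = 0 -> w = 0.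
  move=> /submxP[lam wE] wM0.
  pose L := \sum_i `|lam 0 i|.
  have L0 : 0 <= L by apply: sumr_ge0.
  have lamL i : `|lam 0 i| <= L.
    by rewrite /L (bigD1 i)//= lerDl sumr_ge0.
  pose S0 := \sum_i lam 0 i.
  have S0L : `|S0| <= L by apply: ler_norm_sum.
  have kR : 0 < k%:R :> R by rewrite ltr0n.
  (* The coefficients of b are all [1 / k] and those of the perturbation have absolute value at most
     [2 * L]; the generator [s0] absorbs [S0], so that the coefficients still sum to 1. *)
  pose e := (k%:R * (1 + 2 * L))^-1.
  have e0 : 0 < e by rewrite invr_gt0 mulr_gt0//; lra.
  pose b := \sum_(i < k) k%:R^-1 *: s`_i.
  have sum1 : \sum_(i < k) k%:R^-1 = 1 :> R.
    by rewrite sumr_const card_ord -[_ *+ _]mulr_natl divff// gt_eqF.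
  have Fb : F b.
    by rewrite FE; apply: hull_fin => // i; rewrite invr_ge0 ltW.
  have wS : w = \sum_(i < k) lam 0 i *: s`_i - S0 *: s0.
    rewrite wE mulmx_sum_row; under eq_bigr do rewrite rowK scalerBr.
    by rewrite sumrB -scaler_suml.
  have Fbw : F (b + e *: w).
    have -> : b + e *: w = \sum_(i < k)
        (k%:R^-1 + e * (lam 0 i - (i == i0)%:R * S0)) *: s`_i.
      under [RHS]eq_bigr do rewrite mulrBr addrA scalerBl scalerDl.
      rewrite sumrB big_split /= -/b wS scalerBr addrA; congr (_ + _ - _).
        by rewrite scaler_sumr; apply: eq_bigr => i _; rewrite scalerA.
      rewrite (bigD1 i0)//= big1 ?addr0 => [|i /negbTE ->].
        by rewrite mul1r s0E scalerA.
      by rewrite mul0r mulr0 scale0r.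
    rewrite FE; apply: hull_fin => // [i|].
      have eL : e * (2 * L) <= k%:R^-1.
        rewrite /e invfM -mulrA ger_pMr ?invr_gt0// mulrC ler_pdivrMr; lra.
      have : `|lam 0 i - (i == i0)%:R * S0| <= 2 * L.
        apply: le_trans (ler_normB _ _) _; rewrite mulrDl mul1r lerD//.
        by case: eqP; rewrite ?mul1r// mul0r normr0.
      move=> /(ler_wpM2l (ltW e0)) /le_trans/(_ eL).
      set y := _ - _ * S0 => ey; have := ler_wpM2l (ltW e0) (ler_norm (- y)).
      by rewrite normrN; lra.
    rewrite big_split /= sum1 -mulr_sumr sumrB -/S0 -mulr_suml.
    rewrite (bigD1 i0)//= big1 ?addr0 ?eqxx ?mul1r ?subrr ?mulr0 ?addr0//.
    by move=> i /negbTE ->.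
  have : b + e *: w = b.
    apply: Minj; rewrite ?inE//.
    by rewrite mulmxDl -scalemxAl wM0 scaler0 addr0.
  move=> /eqP; rewrite -subr_eq0 addrAC subrr add0r scaler_eq0 gt_eqF//=.
  by move=> /eqP.
(* The partial inverse: by [WS] it undoes [M] on the rows of [W], hence on all differences of points
   of [F]. *)
pose S := pinvmx (W *m M) *m W.
have WS : W *m M *m S = W.
  apply/eqP; rewrite -subr_eq0; apply/eqP/row_matrixP => i; rewrite row0.
  apply: Winj.
    apply: submx_trans (row_sub _ _) _.
    by rewrite addmx_sub// ?eqmx_opp// /S mulmxA submxMl.
  rewrite -row_mul mulmxBl /S mulmxA -[X in X - _]mulmxA mulmxKpV ?submx_refl//.
  by rewrite subrr row0.
have [u [c [uc GE]]] := fG.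
pose u' := u *m S^T.
have uE x : F x -> dotp (x *m M) u' = dotp x u - dotp s0 u + dotp (s0 *m M) u'.
  move=> /inW/submxP[lam xE]; rewrite -dotpBl xE.
  rewrite -{1}[x](subrK s0) xE mulmxDl dotpDl; congr (_ + _).
  by rewrite /u' -dotp_mulmx -2!(mulmxA lam) WS.
exists u', (c - dotp s0 u + dotp (s0 *m M) u'); split.
  by move=> _ [x Fx <-]; rewrite uE// !lerD2r uc.
apply/seteqP; split => [_ [x Gx <-]|_ [[x Fx <-] /=]].
  have Fx := face_sub fG Gx; split; first by exists x.
  by rewrite /= uE//; move: Gx; rewrite GE => -[_ /= ->].
by rewrite uE// => /addIr/addIr xc; exists x => //; rewrite GE.
Qed.

(** The cells are the linear images under [M] of the members of [D]. As [f] inverts [M] on the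
    support, [M] is injective on each member, and [face_linear] carries the incidences over. *)
Lemma subdivision_linear m n (M : 'M[R]_(m, n)) (f : 'rV[R]_n -> 'rV[R]_m)
    (D : set (set 'rV[R]_m)) (P : set 'rV[R]_n) :
  polytopal_complex D ->
  (forall y, P y -> complex_support D (f y) /\ f y *m M = y) ->
  (forall x, complex_support D x -> P (x *m M) /\ f (x *m M) = x) ->
  polytopal_subdivision P [set P `&` f @^-1` F | F in D].
Proof.
move=> cD fP fM.
have cell F : D F -> P `&` f @^-1` F = [set x *m M | x in F].
  move=> DF; apply/seteqP; split => [y [Py Fy]|_ [x Fx <-]].
    by exists (f y) => //; case: (fP y Py).
  by have [|h1 h2] := fM x; [exists F|split => //=; rewrite h2].
have Minj F : D F -> {in F &, injective (fun x => x *m M)}.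
  move=> DF x y /set_mem Fx /set_mem Fy xy.
  have [|_ <-] := fM x; first by exists F.
  by have [|_ yE] := fM y; [exists F|rewrite xy yE].
split; last first.
  apply/seteqP; split => [y [_ [F DF <-] []]//|y Py].
  have [[F DF Fy] _] := fP y Py; exists (P `&` f @^-1` F) => //.
  by exists F.
split.
- by apply: finite_image; apply: pc_finite cD.
- by move=> _ [F DF <-]; rewrite cell//; apply/polytope_linear/(pc_polytope cD).
- move=> _ G [F DF <-]; rewrite cell// => -[u [c [uc ->]]].
  pose H := F `&` [set x | dotp x (u *m M^T) = c].
  have fH : face F H.
    exists (u *m M^T), c; split => // x Fx.
    by rewrite -dotp_mulmx; apply: uc; exists x.
  have DH := pc_face cD DF fH; exists H => //; rewrite cell//.
  apply/seteqP; split => [_ [x [Fx /= xc] <-]|_ [[x Fx <-] /= xc]].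
    by split; [exists x|rewrite /= dotp_mulmx].
  by exists x => //; split => //=; rewrite -dotp_mulmx.
move=> _ _ [F DF <-] [G DG <-].
have [h1 h2] := pc_meet cD DF DG.
have DFG := pc_face cD DF h1.
have -> : (P `&` f @^-1` F) `&` (P `&` f @^-1` G) = P `&` f @^-1` (F `&` G).
  by apply/seteqP; split => [x [[Px Fx] [_ Gx]]|x [Px [Fx Gx]]].
by rewrite !cell//; split; apply: face_linear; rewrite //; first
  [exact: pc_polytope cD _ _|exact: Minj].
Qed.

(* A point of F with the fewest tight constraints is tight exactly for those
   constraints that are tight on all of F. *)
Lemma face_tight n (I : finType) (s : I -> 'rV[R]_n -> R)
    (E P F : set 'rV[R]_n) :
  (forall i x y t, s i (t *: x + (1 - t) *: y) = t * s i x + (1 - t) * s i y) ->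
  (forall x y t, E x -> E y -> E (t *: x + (1 - t) *: y)) ->
  P = E `&` [set x | forall i, 0 <= s i x] ->
  face P F -> F !=set0 ->
  exists S : {set I}, F = P `&` [set x | forall i, i \in S -> s i x = 0].
Proof.
move=> saff Eaff PE [u [c [uc FE]]] [y0 Fy0].
pose T x := [set i | s i x == 0]%SET.
have [x [Fx xmin]] : exists x, F x /\ forall y, F y -> (#|T x| <= #|T y|)%N.
  have ex : exists k, `[< exists2 x, F x & #|T x| = k >].
    by exists #|T y0|; apply/asboolP; exists y0.
  case: (ex_minnP ex) => k /asboolP[x Fx <-] kmin; exists x; split => // y Fy.
  by apply: kmin; apply/asboolP; exists y.
have Ps i z : P z -> 0 <= s i z by rewrite PE => -[_ /(_ i)].
have FP z : F z -> P z by rewrite FE => -[].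
have dE t y z : dotp (t *: y + (1 - t) *: z) u = t * dotp y u + (1 - t) * dotp z u.
  by rewrite dotpDl !dotpZl.
exists (T x); apply/seteqP; split => [y Fy|y [Py sy]].
  split; [exact: FP|move=> i iT /=].
  (* The midpoint is tight exactly where both ends are; by the minimality of x it has the tight
     constraints of x, so y has them too. *)
  pose z := 2^-1 *: x + (1 - 2^-1) *: y.
  have sz j : s j z = (s j x + s j y) / 2 by rewrite saff; lra.
  have Fz : F z.
    move: (Fx) (Fy); rewrite FE => -[Px /= xc] [Py /= yc]; split => /=.
      rewrite PE; split; first by apply: Eaff; move: Px Py; rewrite PE => -[? _] [].
      by move=> j /=; rewrite sz divr_ge0// addr_ge0 ?Ps.
    by rewrite dE xc yc; lra.
  have TE : T z = T x.
    apply/eqP; rewrite eqEcard xmin// andbT; apply/fintype.subsetP => j.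
    rewrite !inE sz => /eqP h; have := Ps j _ (FP _ Fx); have := Ps j _ (FP _ Fy).
    by move=> h1 h2; apply/eqP; lra.
  have : i \in T z by rewrite TE.
  rewrite inE sz => /eqP h; have := Ps i _ (FP _ Fx); have := Ps i _ (FP _ Fy).
  by move=> h1 h2; lra.
(* The segment from y to x can be prolonged beyond x inside [P], since y is tight wherever x is and
   e is small for the other constraints. The functional is maximal at the inner point x, hence also
   at y. *)
pose K := \sum_i s i y / s i x.
have Px := FP _ Fx.
have K0 : 0 <= K by apply: sumr_ge0 => i _; rewrite divr_ge0 ?Ps.
pose e := (1 + K)^-1.
have e0 : 0 < e by rewrite invr_gt0; lra.
pose z := (1 + e) *: x + (1 - (1 + e)) *: y.
have sz i : s i z = s i x + e * (s i x - s i y) by rewrite saff; lra.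
have Pz : P z.
  rewrite PE; split; first by apply: Eaff; move: Px Py; rewrite PE => -[? _] [].
  move=> i /=; rewrite sz; have [iT|iT] := boolP (i \in T x).
    rewrite sy//; move: iT; rewrite inE => /eqP ->; lra.
  have sx : 0 < s i x by rewrite lt_neqAle eq_sym Ps// andbT; move: iT; rewrite inE.
  suff : e * s i y <= s i x by have := mulr_ge0 (ltW e0) (ltW sx); lra.
  rewrite -ler_pdivlMl// invrK -ler_pdivrMr// ler_wpDl// /K (bigD1 i)//= lerDl.
  by apply: sumr_ge0 => j _; rewrite divr_ge0 ?Ps.
rewrite FE; split => //=; apply/eqP; rewrite eq_le uc//=.
have := uc _ Pz; rewrite dE; move: Fx; rewrite FE => -[_ /= ->] h.
rewrite -(ler_pM2l e0); lra.
Qed.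

End ConvexGeometry.

(** * Continuity and limits *)

Section Continuity.
Variable R : realType.

Lemma within_epsP (V W : normedModType R) (A : set V) (f : V -> W) :
  {within A, continuous f} <-> (forall x, A x -> forall e, 0 < e ->
    exists2 d, 0 < d & forall y, A y -> `|x - y| < d -> `|f x - f y| < e).
Proof.
rewrite subspace_continuousP; split => h x Ax.
  move=> e e0; have /cvgrPdist_lt/(_ e e0) := h x Ax.
  rewrite near_withinE => /nbhs_ballP[d /= d0 hd]; exists d => // y Ay xy.
  by apply: hd => //; rewrite -ball_normE.
apply/cvgrPdist_lt => e e0; have [d d0 hd] := h x Ax e e0.
rewrite near_withinE; apply/nbhs_ballP; exists d => //= y.
by rewrite -ball_normE /= => xy Ay; apply: hd.
Qed.

Lemma lipschitz_continuous (V W : normedModType R) (f : V -> W) (K : R) :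
  (forall x y, `|f x - f y| <= K * `|x - y|) -> continuous f.
Proof.
move=> fK x; apply/cvgrPdist_lt => e e0.
have K0 : 0 < `|K| + 1 by rewrite ltr_wpDl.
apply/nbhs_ballP; exists (e / (`|K| + 1)) => /=; first exact: divr_gt0.
move=> y; rewrite -ball_normE /= => xy; apply: le_lt_trans (fK _ _) _.
apply: (@le_lt_trans _ _ ((`|K| + 1) * `|x - y|)).
  by rewrite ler_wpM2r// (le_trans (ler_norm _))// lerDl.
by rewrite mulrC -ltr_pdivlMr.
Qed.

(** The points of [K] away from x0 form a compact set. Its image is closed and, as g recovers the
    points, avoids [f x0]; so images close to [f x0] come from points close to x0. *)
Lemma compact_inverse (V W : normedModType R) (K : set V) (f : V -> W) (g : W -> V) :
  compact K -> {within K, continuous f} -> (forall x, K x -> g (f x) = x) ->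
  {within f @` K, continuous g}.
Proof.
move=> cK cf gf; apply/within_epsP => _ [x0 Kx0 <-] e e0.
pose C := K `&` ~` ball x0 e.
have cC : compact C.
  by apply: compact_closedI => //; apply: open_closedC; apply: ball_open.
have cfC : compact (f @` C).
  by apply: continuous_compact => //; apply: continuous_subspaceW cf => x [].
have clC : closed (f @` C) by apply: compact_closed => //; exact: norm_hausdorff.
have : nbhs (f x0) (~` (f @` C)).
  apply: open_nbhs_nbhs; split; first exact: closed_openC.
  move=> [x [Kx nx] xx0]; apply: nx; rewrite -(gf x Kx) xx0 gf//.
  exact: ballxx.
move=> /nbhs_ballP[d /= d0 hd]; exists d => // _ [x Kx <-] xd.
rewrite !gf//; apply: contrapT => nxe; apply: (hd (f x)).
  by rewrite -ball_normE.
by exists x => //; split => //; rewrite -ball_normE.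
Qed.

Lemma uniform_limit (V W : normedModType R) (A : set V) (u : nat -> V -> W) (f : V -> W) (C : R) :
  (forall k, {within A, continuous (u k)}) ->
  (forall k x, A x -> `|u k x - f x| <= C / 2 ^+ k) -> {within A, continuous f}.
Proof.
move=> cu uf; apply/within_epsP => x Ax e e0.
have [k kC] : exists k, C / 2 ^+ k < e / 4.
  have C0 : 0 <= `|C| / (e / 4) by rewrite divr_ge0// divr_ge0// ltW.
  exists (Num.bound (`|C| / (e / 4))); rewrite ltr_pdivrMr ?exprn_gt0//.
  rewrite mulrC -ltr_pdivrMr ?divr_gt0//.
  apply: (@le_lt_trans _ _ (`|C| / (e / 4))).
    by rewrite ler_pM2r ?invr_gt0 ?divr_gt0// ler_norm.
  by apply: lt_trans (archi_boundP C0) _; rewrite -natrX ltr_nat ltn_expl.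
have [d d0 hd] := (within_epsP _ _).1 (cu k) x Ax (e / 4) (divr_gt0 e0 (ltr0Sn _ _)).
exists d => // y Ay xy; have h1 := uf k x Ax; have h2 := uf k y Ay.
have h3 := hd y Ay xy.
apply: le_lt_trans (ler_distD (u k x) _ _) _.
have := ler_distD (u k y) (u k x) (f y); rewrite (distrC (f x)); lra.
Qed.

(** The intervals of centre [a k] and radius [2 * C / 2 ^ k] are nested; the limit is the supremum
    of their left ends. *)
Lemma geometric_limit (a : nat -> R) (C : R) :
  (forall k, `|a k.+1 - a k| <= C / 2 ^+ k) ->
  exists l, forall k, `|a k - l| <= 2 * C / 2 ^+ k.
Proof.
move=> aC.
have half k : C / 2 ^+ k.+1 = C / 2 ^+ k / 2 by rewrite exprS invfM; lra.
pose lo k := a k - 2 * (C / 2 ^+ k); pose hi k := a k + 2 * (C / 2 ^+ k).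
have C0 k : 0 <= C / 2 ^+ k by apply: le_trans (aC k); exact: normr_ge0.
have loS k : lo k <= lo k.+1.
  by rewrite /lo half; have := aC k; rewrite ler_norml => /andP[]; lra.
have hiS k : hi k.+1 <= hi k.
  by rewrite /hi half; have := aC k; rewrite ler_norml => /andP[]; lra.
have lohi i j : lo i <= hi j.
  have mono m k : lo m <= lo (m + k)%N /\ hi (m + k)%N <= hi m.
    elim: k => [|k [h1 h2]]; first by rewrite addn0.
    by rewrite addnS; split; [apply: le_trans h1 _|apply: le_trans _ h2].
  have [h1 _] := mono i j; have [_ h2] := mono j i.
  apply: le_trans h1 _; apply: le_trans _ h2; rewrite addnC /lo /hi.
  by have := C0 (j + i)%N; lra.
have sne : range lo !=set0 by exists (lo 0); exists 0%N.
have sup_lo : has_sup (range lo) by split => //; exists (hi 0) => _ [k _ <-].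
exists (sup (range lo)) => k.
have h1 : lo k <= sup (range lo) by apply: sup_upper_bound => //; exists k.
have h2 : sup (range lo) <= hi k by apply: ge_sup => // _ [i _ <-].
move: h1 h2; rewrite /lo /hi -mulrA => h1 h2; rewrite ler_norml; apply/andP; split; lra.
Qed.

Lemma entry_le_norm n (x : 'rV[R]_n) i : `|x 0 i| <= `|x|.
Proof.
rewrite [leRHS]/Num.Def.normr /= mx_normrE; apply/bigmax_geP; right => /=.
by exists (0, i).
Qed.

Lemma norm_le_entries n (x : 'rV[R]_n) (K : R) :
  0 <= K -> (forall i, `|x 0 i| <= K) -> `|x| <= K.
Proof.
move=> K0 xK; rewrite [leLHS]/Num.Def.normr /= mx_normrE; apply/bigmax_leP.
by split => // -[i j] _ /=; rewrite (ord1 i).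
Qed.

Lemma geometric_limit_rV n (a : nat -> 'rV[R]_n) (C : R) :
  (forall k, `|a k.+1 - a k| <= C / 2 ^+ k) ->
  exists l, forall k, `|a k - l| <= 2 * C / 2 ^+ k.
Proof.
move=> aC; have /choice[l lP] : forall i, exists l, forall k, `|a k 0 i - l| <= 2 * C / 2 ^+ k.
  move=> i; apply: geometric_limit => k; apply: le_trans (aC k).
  by have := entry_le_norm (a k.+1 - a k) i; rewrite !mxE.
exists (\row_i l i) => k; apply: norm_le_entries => [|i]; last by rewrite !mxE lP.
by have := le_trans (normr_ge0 _) (aC k); rewrite -mulrA; lra.
Qed.

Lemma norm_dotp_le n (x u : 'rV[R]_n) : `|dotp x u| <= (\sum_i `|u 0 i|) * `|x|.
Proof.
rewrite mulr_suml; apply: le_trans (ler_norm_sum _ _ _) _; apply: ler_sum => i _.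
by rewrite normrM mulrC ler_wpM2l// entry_le_norm.
Qed.

Lemma dotp_continuous n (u : 'rV[R]_n) : continuous (fun x : 'rV[R]_n => dotp x u).
Proof.
apply: (@lipschitz_continuous _ R^o _ (\sum_i `|u 0 i|)) => x y.
by rewrite -dotpBl norm_dotp_le.
Qed.

Lemma closed_dotp_ge n (u : 'rV[R]_n) c : closed [set x | c <= dotp x u].
Proof.
by have /continuous_closedP h := @dotp_continuous n u; exact: (h _ (@closed_ge _ c)).
Qed.

Lemma closed_dotp_le n (u : 'rV[R]_n) c : closed [set x | dotp x u <= c].
Proof.
by have /continuous_closedP h := @dotp_continuous n u; exact: (h _ (@closed_le _ c)).
Qed.

Lemma norm_mulmx_le m n (M : 'M[R]_(m, n)) (x : 'rV[R]_m) :
  `|x *m M| <= (\sum_i \sum_j `|M i j|) * `|x|.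
Proof.
apply: norm_le_entries => [|j].
  by rewrite mulr_ge0//; apply: sumr_ge0 => i _; apply: sumr_ge0.
rewrite mxE mulr_suml; apply: le_trans (ler_norm_sum _ _ _) _; apply: ler_sum => i _.
rewrite normrM mulrC; apply: ler_pM => //; last exact: entry_le_norm.
by rewrite (bigD1 j)//= lerDl sumr_ge0.
Qed.

Lemma mulmxr_continuous m n (M : 'M[R]_(m, n)) : continuous (fun x : 'rV[R]_m => x *m M).
Proof.
apply: (@lipschitz_continuous _ _ _ (\sum_i \sum_j `|M i j|)) => x y.
by rewrite -mulmxBl norm_mulmx_le.
Qed.

Lemma row_mx_continuous (V : normedModType R) m n (A : set V)
    (f : V -> 'rV[R]_m) (g : V -> 'rV[R]_n) :
  {within A, continuous f} -> {within A, continuous g} ->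
  {within A, continuous (fun z => row_mx (f z) (g z))}.
Proof.
move=> /within_epsP cf /within_epsP cg; apply/within_epsP => x Ax e e0.
have [d1 d10 h1] := cf x Ax _ (divr_gt0 e0 (ltr0Sn _ 1)).
have [d2 d20 h2] := cg x Ax _ (divr_gt0 e0 (ltr0Sn _ 1)).
exists (Num.min d1 d2); first by rewrite lt_min d10.
move=> y Ay; rewrite lt_min => /andP[xy1 xy2].
apply: (@le_lt_trans _ _ (e / 2)); last by lra.
apply: norm_le_entries => [|i]; first by lra.
rewrite opp_row_mx add_row_mx mxE; case: fintype.split => j;
  apply: le_trans (entry_le_norm _ _) _; apply: ltW; [exact: h1|exact: h2].
Qed.

Lemma comp_within_continuous (U V W : normedModType R) (A : set U) (B : set V)
    (f : U -> V) (g : V -> W) :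
  {within A, continuous f} -> (forall x, A x -> B (f x)) ->
  {within B, continuous g} -> {within A, continuous (fun x => g (f x))}.
Proof.
move=> /within_epsP cf AB /within_epsP cg; apply/within_epsP => x Ax e e0.
have [d d0 h] := cg _ (AB x Ax) e e0; have [d' d'0 h'] := cf x Ax d d0.
by exists d' => // y Ay xy; apply: h; [exact: AB|exact: h'].
Qed.

Lemma lsubmx_continuous m n :
  continuous (fun z : 'rV[R]_(m + n) => lsubmx z).
Proof.
apply: (@lipschitz_continuous _ _ _ 1) => x y.
rewrite -raddfB mul1r; apply: norm_le_entries => // i; rewrite mxE.
exact: entry_le_norm.
Qed.

Lemma rsubmx_continuous m n :
  continuous (fun z : 'rV[R]_(m + n) => rsubmx z).
Proof.
apply: (@lipschitz_continuous _ _ _ 1) => x y.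
rewrite -raddfB mul1r; apply: norm_le_entries => // i; rewrite mxE.
exact: entry_le_norm.
Qed.

End Continuity.

(** * Polytopes of laminar families *)

Section LaminarPolytopes.
Import mathcomp.boot.fintype mathcomp.boot.finset.
Variables (R : realType) (n : nat).
Implicit Types (N I J : {set 'I_n}) (B F S : {set {set 'I_n}}) (x y z d v : 'rV[R]_n).

Lemma leads_total I J : I != set0 -> leads I J \/ leads J I.
Proof.
case/set0Pn => i0 i0I; have i0U : i0 \in I :|: J by rewrite inE i0I.
case: (arg_minnP (fun i : 'I_n => i : nat) i0U) => i iIJ imin.
have /orP[iI|iJ] : (i \in I) || (i \in J) by have := iIJ; rewrite -in_setU.
  by left; exists i => // j jU; apply: imin; change (j \in I :|: J); rewrite inE.
by right; exists i => // j jU; apply: imin; change (j \in I :|: J); rewrite inE orbC.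
Qed.

(** Take the coordinates [2 ^- i]: each exceeds every sum of distinct later ones. *)
Lemma exists_principal m : exists v : 'rV[R]_m, principal v.
Proof.
exists (\row_i 2 ^- i) => I J I0 J0 IJ _ [i iI imin].
apply: (@lt_le_trans _ _ (2 ^- i)).
  have h (K : {set 'I_m}) k : (forall j, j \in K -> (k < j)%N) ->
      \sum_(j in K) (2 ^- j : R) < 2 ^- k.
    move: {2}(#|K|) (leqnn #|K|) => c; elim: c K k => [|c IH] K k.
      by rewrite leqn0 cards_eq0 => /eqP -> _; rewrite big_set0 invr_gt0 exprn_gt0.
    move=> Kc Kk; have [->|[j0 j0K]] := set_0Vmem K.
      by rewrite big_set0 invr_gt0 exprn_gt0.
    case: (arg_minnP (fun j : 'I_m => j : nat) j0K) => j jK jmin.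
    rewrite (big_setD1 j)//=.
    have lt1 : \sum_(i in K :\ j) (2 ^- i : R) < 2 ^- j.
      apply: IH; first by move: Kc; rewrite (cardsD1 j) [j \in K]jK.
      move=> i'; rewrite !inE => /andP[ij iK].
      by rewrite ltn_neqAle jmin// andbT eq_sym.
    apply: lt_le_trans (_ : 2 ^- j + 2 ^- j <= _); first by rewrite ltrD2l.
    have -> : 2 ^- j + 2 ^- j = 2 ^- j.-1 :> R.
      have := Kk j jK; case: (j : nat) => // q _.
      by rewrite /= exprS invfM; lra.
    by rewrite lef_pV2 ?posrE ?exprn_gt0// ler_eXn2l ?ltr1n//; have := Kk j jK; lia.
  under eq_bigr do rewrite mxE; apply: h => j jJ.
  rewrite ltn_neqAle imin ?jJ ?orbT// andbT.
  apply/negP => /eqP/val_inj ij; have := in_set0 i; rewrite -IJ inE iI.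
  by rewrite ij jJ.
rewrite (bigD1 i)//= mxE lerDl; apply: sumr_ge0 => j _.
by rewrite mxE invr_ge0 exprn_ge0.
Qed.

Definition lpoly B (c : {set 'I_n} -> R) : set 'rV[R]_n :=
  [set x | setsum [set: 'I_n]%SET x = c [set: 'I_n]%SET /\
           forall N, N \in B -> c N <= setsum N x].

Definition tight B (c : {set 'I_n} -> R) x : {set {set 'I_n}} :=
  [set N in B | setsum N x == c N]%SET.

Record laminar_polytope B c : Prop := LaminarPolytope {
  lp_top : [set: 'I_n]%SET \in B;
  lp_laminar : forall x, lpoly B c x -> laminar (tight B c x);
  lp_polytope : polytope (lpoly B c) }.

Definition good_pair B c x y : Prop :=
  [/\ lpoly B c x, lpoly B c y & good R (tight B c x) (tight B c y)].

Definition ind N : 'cV[R]_n := \col_e (e \in N)%:R.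

Lemma setsum_ind N x : setsum N x = dotp x (ind N)^T.
Proof.
rewrite /setsum big_mkcond; apply: eq_bigr => e _; rewrite !mxE.
by case: ifP; rewrite ?mulr1 ?mulr0.
Qed.

Definition perp F : 'M[R]_n := (\bigcap_(N in F) kermx (ind N))%MS.

Lemma sub_perpP F d : reflect (forall N, N \in F -> setsum N d = 0) (d <= perp F)%MS.
Proof.
have E N : (d <= kermx (ind N))%MS = (setsum N d == 0).
  rewrite setsum_ind dotpE trmxK; apply/sub_kermxP/eqP => [->|dN]; first by rewrite mxE.
  by apply/matrixP => i j; rewrite !ord1 dN mxE.
apply: (iffP sub_bigcapmxP) => h N FN; first by apply/eqP; rewrite -E h.
by rewrite E h.
Qed.

(** For a point of the polytope, the dimension of the smallest face that contains it. *)
Definition prank B c x : nat := \rank (perp (tight B c x)).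

Lemma prank_le B c x : (prank B c x <= n)%N.
Proof. exact: rank_leq_row. Qed.

Section OnePolytope.
Variables (B : {set {set 'I_n}}) (c : {set 'I_n} -> R).
Hypothesis LP : laminar_polytope B c.
Local Notation P := (lpoly B c).
Local Notation T := (tight B c).

Lemma tightP N x : reflect (N \in B /\ setsum N x = c N) (N \in T x).
Proof. by rewrite inE; apply: (iffP andP) => -[? /eqP]. Qed.

Lemma top_tight x : P x -> [set: 'I_n]%SET \in T x.
Proof. by move=> [h _]; rewrite inE (lp_top LP) h eqxx. Qed.

Lemma compact_lpoly : compact P.
Proof.
apply: bounded_closed_compact.
  have [A /finite_seqP[s ->] ->] := lp_polytope LP.
  exists (\sum_(a <- s) `|a|); split; first exact: num_real.
  move=> M ltM _ [m [a [p [a0 a1 sp ->]]]]; apply: le_trans (ltW ltM).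
  apply: le_trans (ler_norm_sum _ _ _) _; rewrite -[leRHS]mul1r -a1 mulr_suml.
  apply: ler_sum => i _; rewrite normrZ ger0_norm// ler_wpM2l//.
  by rewrite (big_rem (p i)) ?lerDl ?sumr_ge0//; exact: sp.
have -> : P = [set x | setsum [set: 'I_n]%SET x <= c [set: 'I_n]%SET]%classic `&`
    \bigcap_(N in [set N | N \in B]%classic) [set x | c N <= setsum N x]%classic.
  apply/seteqP; split => [x [h1 h2]|x [/= h1 h2]]; first by split => //=; rewrite h1.
  by split => // ; apply/eqP; rewrite eq_le h1 h2//= (lp_top LP).
apply: closedI.
  have -> : [set x | setsum [set: 'I_n]%SET x <= c [set: 'I_n]%SET]%classic =
      [set x | dotp x (ind [set: 'I_n]%SET)^T <= c [set: 'I_n]%SET]%classic.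
    by apply/seteqP; split => x /=; rewrite setsum_ind.
  exact: closed_dotp_le.
apply: closed_bigI => N _.
have -> : [set x | c N <= setsum N x]%classic = [set x | c N <= dotp x (ind N)^T]%classic.
  by apply/seteqP; split => x /=; rewrite setsum_ind.
exact: closed_dotp_ge.
Qed.

Lemma lpoly_bounded : exists2 K, 0 <= K & forall x, P x -> `|x| <= K.
Proof.
have [M [_ hM]] := compact_bounded compact_lpoly.
exists (`|M| + 1); first by rewrite addr_ge0.
by move=> x Px; apply: hM => //; rewrite (le_lt_trans (ler_norm M))// ltrDl.
Qed.

(** An inequality that is not tight leaves room for a small step; with K the sum of the ratios of
    speed to room, [1 / (1 + K)] suits all inequalities at once. *)
Lemma lpoly_step x d : P x -> setsum [set: 'I_n]%SET d = 0 ->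
  (forall N, N \in T x -> 0 <= setsum N d) ->
  exists2 e0, 0 < e0 & forall e, 0 < e -> e <= e0 -> P (x + e *: d).
Proof.
move=> [xT xB] dT dN.
pose K := \sum_(N in B) `|setsum N d| / (setsum N x - c N).
have t0 N : N \in B -> 0 <= `|setsum N d| / (setsum N x - c N).
  by move=> NB; rewrite divr_ge0// subr_ge0 xB.
have K0 : 0 <= K by apply: sumr_ge0.
exists (1 + K)^-1; first by rewrite invr_gt0; lra.
move=> e e0 ele; split; first by rewrite setsumD setsumZ dT mulr0 addr0.
move=> N NB; rewrite setsumD setsumZ.
have := xB N NB; rewrite le_eqVlt => /orP[/eqP xN|xN].
  by rewrite xN lerDl mulr_ge0 ?(ltW e0)//; apply: dN; rewrite inE NB xN eqxx.
have sl : 0 < setsum N x - c N by rewrite subr_gt0.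
suff : e * `|setsum N d| <= setsum N x - c N.
  by have := ler_wpM2l (ltW e0) (ler_norm (- setsum N d)); rewrite normrN; lra.
have le1 : e * (1 + K) <= 1 by rewrite -ler_pdivlMr ?mul1r//; lra.
have leK : `|setsum N d| / (setsum N x - c N) <= K.
  by rewrite /K (big_setD1 N)//= lerDl sumr_ge0// => M; rewrite inE => /andP[_ /t0].
rewrite -[leRHS]mul1r -ler_pdivrMr// -mulrA.
by apply: le_trans le1; rewrite ler_wpM2l ?(ltW e0)//; lra.
Qed.

Lemma reflected_sym z x : reflected P z x -> reflected P z (2 *: z - x).
Proof. by move=> [Px [y Py yE]]; split; [rewrite -yE opprB addrCA subrr addr0|exists x]. Qed.

Lemma reflectedP z x : reflected P z x <-> P x /\ P (2 *: z - x).
Proof.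
split => [h|[Px Py]]; first by split; [case: h|case: (reflected_sym h)].
by split => //; exists (2 *: z - x) => //; rewrite opprB addrCA subrr addr0.
Qed.

Lemma compact_reflected z : compact (reflected P z).
Proof.
apply: compact_closedI; first exact: compact_lpoly.
apply: compact_closed; first exact: norm_hausdorff.
apply: continuous_compact; last exact: compact_lpoly.
apply: continuous_subspaceT; apply: (@lipschitz_continuous _ _ _ _ 1) => x y.
by rewrite opprB addrC addrA subrK mul1r distrC.
Qed.

Section Principal.
Variable v : 'rV[R]_n.
Hypothesis pv : principal v.

Lemma signvec_dotp_gt0 I J : balanced I J -> leads I J -> 0 < dotp (signvec R I J) v.
Proof.
by move=> [I0 J0 IJ0 cIJ] lIJ; rewrite dotp_signvec subr_gt0; apply: pv.
Qed.

Lemma dotp_signvecC I J : dotp (signvec R J I) v = - dotp (signvec R I J) v.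
Proof. by rewrite !dotp_signvec opprB. Qed.

Lemma balancedC I J : balanced I J -> balanced J I.
Proof. by move=> [I0 J0 IJ0 cIJ]; split => //; rewrite setIC. Qed.

Lemma balanced_top I J : balanced I J -> setsum [set: 'I_n]%SET (signvec R I J) = 0.
Proof. by move=> [_ _ _ cIJ]; rewrite setsum_signvec !setIT cIJ subrr. Qed.

(** If the least index lay in J, a small step of x along [signvec R I J], with the opposite step of
    its reflection, would stay in the polytope and lower the product with v. *)
Lemma minimizer_good z x : reflected P z x ->
  (forall y, reflected P z y -> dotp x v <= dotp y v) ->
  good R (T x) (T (2 *: z - x)).
Proof.
move=> /reflectedP[Px Py] xmin I J bIJ [fA fB]; set y := _ - x in Py fB.
have [//|lJI] := leads_total J (let: And4 I0 _ _ _ := bIJ in I0).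
have vc := signvec_dotp_gt0 (balancedC bIJ) lJI.
set d := signvec R I J in fA fB; rewrite dotp_signvecC -/d in vc.
have dT := balanced_top bIJ; rewrite -/d in dT.
have [e1 e10 h1] := lpoly_step Px dT fA.
have [||e2 e20 h2] := @lpoly_step y (- d) Py.
- by rewrite setsumN dT oppr0.
- by move=> N /fB; rewrite setsumN oppr_ge0.
pose e := Num.min e1 e2.
have e0 : 0 < e by rewrite lt_min e10.
have : dotp x v <= dotp (x + e *: d) v.
  apply/xmin/reflectedP; split; first by apply: h1 => //; rewrite ge_min lexx.
  rewrite opprD addrA -/y -scalerN; apply: h2 => //.
  by rewrite ge_min lexx orbT.
rewrite dotpDl dotpZl lerDl pmulr_rge0//; lra.
Qed.

(** Both y and its reflection lie in the polytope, so y - x is feasible for the tight families of x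
    and of the reflection of x. *)
Lemma good_lt z x y : reflected P z x -> good R (T x) (T (2 *: z - x)) ->
  reflected P z y -> y != x -> dotp x v < dotp y v.
Proof.
move=> /reflectedP[Px Px'] g /reflectedP[Py Py'] yx.
rewrite -subr_gt0 -dotpBl.
apply: (good_dotp_gt0 pv (lp_laminar LP Px) (lp_laminar LP Px')) => //.
- exact: top_tight.
- exact: top_tight.
- split => N /tightP[NB NE]; first by rewrite setsumB NE subr_ge0; apply: Py.2.
  have := Py'.2 _ NB; rewrite -NE !setsumB; lra.
- by rewrite subr_eq0.
Qed.

Lemma bot_ptE z x : reflected P z x -> good R (T x) (T (2 *: z - x)) ->
  bot_pt v (reflected P z) = x.
Proof.
move=> rx g; rewrite /bot_pt; apply: xget_unique.
  split => // y ry; have [->//|yx] := eqVneq y x.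
  exact/ltW/(good_lt rx).
move=> y [ry ymin]; apply/eqP; apply: contraT => yx.
by have := good_lt rx g ry yx; rewrite ltNge ymin.
Qed.

Lemma top_ptE z x : reflected P z x -> good R (T x) (T (2 *: z - x)) ->
  top_pt v (reflected P z) = 2 *: z - x.
Proof.
move=> rx g; rewrite /top_pt.
have opp w : dotp (2 *: z - w) v = 2 * dotp z v - dotp w v.
  by rewrite dotpBl dotpZl.
apply: xget_unique.
  split => [|y ry]; first exact: reflected_sym.
  rewrite opp; have [yx|yx] := eqVneq (2 *: z - y) x.
    by have := opp y; rewrite yx; lra.
  by have := good_lt rx g (reflected_sym ry) yx; rewrite opp; lra.
move=> y [ry ymax]; apply/eqP; apply: contraT => yx.
have yx' : 2 *: z - y != x.
  apply: contraNneq yx => <-; by rewrite opprB addrCA subrr addr0.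
have := good_lt rx g (reflected_sym ry) yx'; have := ymax _ (reflected_sym rx).
by rewrite !opp; lra.
Qed.

Lemma good_pair_bot x y : good_pair B c x y ->
  bot_pt v (reflected P (2^-1 *: (x + y))) = x /\
  top_pt v (reflected P (2^-1 *: (x + y))) = y.
Proof.
move=> [Px Py g]; set z := 2^-1 *: _.
have yE : 2 *: z - x = y by rewrite /z scalerA mulfV ?pnatr_eq0// scale1r addrC addKr.
have rx : reflected P z x by apply/reflectedP; rewrite yE.
by split; [apply: bot_ptE|rewrite -[RHS]yE; apply: top_ptE]; rewrite ?yE.
Qed.

(** Compactness provides a minimizer, which is good. Reflection in z reverses the order of the
    values of the functional, so the reflected minimizer is the maximizer. *)
Lemma bot_top_good_pair z : P z ->
  good_pair B c (bot_pt v (reflected P z)) (top_pt v (reflected P z)) /\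
  2^-1 *: (bot_pt v (reflected P z) + top_pt v (reflected P z)) = z.
Proof.
move=> Pz; have zz : reflected P z z.
  by apply/reflectedP; split => //; rewrite scaler_nat mulr2n addrK.
have ne : (reflected P z !=set0)%classic by exists z.
have cd : {within reflected P z, continuous (fun x => dotp x v)}.
  by apply: continuous_subspaceT; exact: dotp_continuous.
have [x /classical_sets.set_mem rx xmin] := compact_EVT_min ne (@compact_reflected z) cd.
have g : good R (T x) (T (2 *: z - x)).
  by apply: minimizer_good => // y ry; apply: xmin; apply: classical_sets.mem_set.
have [Px Py] := (reflectedP _ _).1 rx.
rewrite (bot_ptE rx g) (top_ptE rx g); split; first by split.
by rewrite addrCA subrr addr0 scalerA mulVf ?pnatr_eq0// scale1r.
Qed.

Lemma tight_midpoint x y : P x -> P y -> T (2^-1 *: (x + y)) = T x :&: T y.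
Proof.
move=> Px Py; apply/setP => N; rewrite !inE; case: (boolP (N \in B)) => //= NB.
rewrite setsumZ setsumD; have h1 := Px.2 _ NB; have h2 := Py.2 _ NB.
apply/eqP/andP => [h|[/eqP -> /eqP ->]]; last by lra.
by split; apply/eqP; lra.
Qed.

Lemma perp_sub F F' : F \subset F' -> (perp F' <= perp F)%MS.
Proof.
move=> /subsetP sF; apply/rV_subP => d /sub_perpP h; apply/sub_perpP => N /sF.
exact: h.
Qed.

(** A common direction and its opposite would both be feasible, hence both have a positive product
    with v. *)
Lemma good_pair_perp x y : good_pair B c x y -> (perp (T x) :&: perp (T y) = 0)%MS.
Proof.
move=> [Px Py g]; apply/eqP; rewrite -submx0; apply/rV_subP => d.
rewrite sub_capmx => /andP[/sub_perpP dx /sub_perpP dy]; rewrite submx0.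
apply: contraT => d0.
have pos (w : 'rV[R]_n) : w != 0 -> (forall N, N \in T x -> setsum N w = 0) ->
    (forall N, N \in T y -> setsum N w = 0) -> 0 < dotp w v.
  move=> w0 wx wy; apply: (good_dotp_gt0 pv (lp_laminar LP Px) (lp_laminar LP Py)) => //.
  - exact: top_tight.
  - exact: top_tight.
  - by split => N NT; [rewrite wx|rewrite wy].
have h1 := pos d d0 dx dy.
have : 0 < dotp (- d) v.
  by apply: pos => [|N NT|N NT]; rewrite ?oppr_eq0// setsumN; [rewrite dx ?oppr0|rewrite dy ?oppr0].
by rewrite dotpNl oppr_gt0 => /(lt_trans h1); rewrite ltxx.
Qed.

(** The tight family of z is the intersection of those of bot and top. So the direction space of z
    contains both of theirs, and these meet trivially. *)
Lemma prank_bot_top z : P z ->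
  (prank B c (bot_pt v (reflected P z)) + prank B c (top_pt v (reflected P z))
   <= prank B c z)%N.
Proof.
move=> /bot_top_good_pair[]; set x := bot_pt _ _; set y := top_pt _ _ => g <-.
have [Px Py _] := g; rewrite /prank -mxrank_disjoint_sum; last exact: good_pair_perp.
apply: mxrankS; rewrite tight_midpoint// addsmx_sub.
by rewrite !perp_sub ?subsetIl ?subsetIr.
Qed.

Lemma tight_bot_top z : P z -> T z = T (bot_pt v (reflected P z)) :&: T (top_pt v (reflected P z)).
Proof.
move=> /bot_top_good_pair[[Px Py _]].
by move=> zE; rewrite -[in LHS]zE tight_midpoint.
Qed.

End Principal.

Lemma prank0_eq x y : prank B c x = 0%N -> T x \subset T y -> y = x.
Proof.
move=> /eqP; rewrite mxrank_eq0 => /eqP p0 /subsetP sT.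
apply/eqP; rewrite -subr_eq0 -submx0 -p0; apply/sub_perpP => N NT.
have /tightP[_ hx] := NT; have /tightP[_ hy] := sT _ NT.
by rewrite setsumB hx hy subrr.
Qed.

End OnePolytope.
End LaminarPolytopes.

(** * Continuous interpolation at finitely many points *)

Section Interpolation.
Variable R : realType.

Lemma norm_sub_continuous (V : normedModType R) (q : V) : continuous (fun z : V => `|z - q|).
Proof.
apply: (@lipschitz_continuous _ V R^o _ 1) => x y; rewrite mul1r.
apply: le_trans (ler_dist_dist _ _) _.
by rewrite opprB addrA subrK.
Qed.

Lemma separating_function (V : normedModType R) (s : seq V) (p : V) : p \notin s ->
  exists phi : V -> R, [/\ continuous phi, phi p = 1 & forall q, q \in s -> phi q = 0].
Proof.
elim: s => [|q s IH]; first by exists (fun=> 1); split => // x; exact: cvg_cst.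
rewrite inE negb_or => /andP[pq /IH[phi [cphi phip phis]]].
exists (fun z => phi z * (`|z - q| / `|p - q|)); split.
- move=> z; apply: (@continuousM _ _ phi (fun z => `|z - q| / `|p - q|)); first exact: cphi.
  apply: (@continuousM _ _ (fun z => `|z - q|) (fun=> `|p - q|^-1)).
    exact: norm_sub_continuous.
  exact: cvg_cst.
- by rewrite phip mul1r divff// normr_eq0 subr_eq0.
- move=> r; rewrite inE => /orP[/eqP ->|/phis ->]; last by rewrite mul0r.
  by rewrite subrr normr0 mul0r mulr0.
Qed.

(** Newton's scheme: the value at a new point is corrected by a function that vanishes at the
    earlier points. This supplies the continuous map from which the transition maps are iterated. *)
Lemma interpolation (V W : normedModType R) (s : seq V) (g : V -> W) :
  exists2 f : V -> W, continuous f & forall p, p \in s -> f p = g p.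
Proof.
elim: s => [|p s [f cf fs]]; first by exists (fun=> 0) => // x; exact: cvg_cst.
have [ps|/separating_function[phi [cphi phip phis]]] := boolP (p \in s).
  by exists f => // q; rewrite inE => /orP[/eqP ->|]; apply: fs.
exists (fun z => f z + phi z *: (g p - f p)).
  move=> z; apply: (@continuousD _ _ _ f (fun z => phi z *: (g p - f p))); first exact: cf.
  by apply: continuousZr_tmp; exact: cphi.
move=> q; rewrite inE => /orP[/eqP ->|qs].
  by rewrite phip scale1r addrC subrK.
by rewrite phis// scale0r addr0 fs.
Qed.

Lemma geometric_le0 (a C : R) : (forall k, a <= C / 2 ^+ k) -> a <= 0.
Proof.
move=> aC; rewrite leNgt; apply/negP => a0.
have C0 : 0 <= `|C| / a by rewrite divr_ge0// ltW.
have := aC (Num.bound (`|C| / a)); apply/negP; rewrite -ltNge.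
rewrite ltr_pdivrMr ?exprn_gt0//; apply: le_lt_trans (ler_norm C) _.
rewrite mulrC -ltr_pdivrMr//.
by apply: lt_trans (archi_boundP C0) _; rewrite -natrX ltr_nat ltn_expl.
Qed.

End Interpolation.

(** * Faces of a laminar polytope *)

Section LaminarFaces.
Variable R : realType.

Definition lface n (B : {set {set 'I_n}}) (c : {set 'I_n} -> R) (S : {set {set 'I_n}}) :
    set 'rV[R]_n :=
  [set x | lpoly B c x /\ S \subset tight B c x].

(** The value 0 outside [B] lets the constraints be indexed by the finite type of all sets, as
    [face_tight] requires. *)
Definition slack n (B : {set {set 'I_n}}) (c : {set 'I_n} -> R) (N : {set 'I_n}) (x : 'rV[R]_n) : R :=
  if N \in B then setsum N x - c N else 0.

Lemma slack_affine n (B : {set {set 'I_n}}) (c : {set 'I_n} -> R) N x y t :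
  slack B c N (t *: x + (1 - t) *: y) = t * slack B c N x + (1 - t) * slack B c N y.
Proof.
by rewrite /slack; case: ifP => _; rewrite ?setsumD ?setsumZ; lra.
Qed.

Lemma lpoly_slack n (B : {set {set 'I_n}}) (c : {set 'I_n} -> R) :
  lpoly B c = [set x | setsum finset.setT x = c finset.setT] `&`
              [set x | forall N, 0 <= slack B c N x].
Proof.
apply/seteqP; split => x [h1 h2]; split => // N.
  by rewrite /slack; case: ifPn => // NB; rewrite subr_ge0 h2.
by move=> NB; have := h2 N; rewrite /slack NB subr_ge0.
Qed.

(** The inequalities of S add up to one that supports the polytope, with equality only if each of
    them is an equality. If S is not contained in B, the set is the empty face. *)
Lemma lface_face n (B : {set {set 'I_n}}) (c : {set 'I_n} -> R) S :
  face (lpoly B c) (lface B c S).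
Proof.
have [/fintype.subsetP SB|nSB] := boolP (S \subset B); last first.
  suff -> : lface B c S = set0 by exact: face_set0.
  apply/seteqP; split => // x [_ /fintype.subset_trans h]; case/negP: nSB; apply: h.
  by apply/fintype.subsetP => N; rewrite inE => /andP[].
exists (- \sum_(N in S) (ind R N)^T), (- \sum_(N in S) c N).
have uE x : dotp x (- \sum_(N in S) (ind R N)^T) = - \sum_(N in S) setsum N x.
  rewrite dotpC dotpNl; congr (- _).
  transitivity (\sum_(N in S) dotp (ind R N)^T x).
    apply: (big_morph (fun y => dotp y x)) => [y z|]; [exact: dotpDl|exact: dotp0l].
  by apply: eq_bigr => N _; rewrite dotpC setsum_ind.
split=> [x [_ xB]|].
  by rewrite uE lerN2; apply: ler_sum => N /SB; exact: xB.
apply/seteqP; split=> [x [Px /fintype.subsetP Sx]|x [Px /=]]; rewrite /= ?uE.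
  split => //; congr (- _); apply: eq_bigr => N /Sx.
  by rewrite inE => /andP[_ /eqP].
move=> /oppr_inj sE; split => //; apply/fintype.subsetP => N NS.
rewrite inE SB//=; have : \sum_(M in S) (setsum M x - c M) = 0.
  by rewrite sumrB sE subrr.
move=> /eqP; rewrite psumr_eq0 => [|M MS]; last by rewrite subr_ge0; apply: Px.2; exact: SB.
by move=> /allP/(_ N (mem_index_enum N))/implyP/(_ NS); rewrite subr_eq0.
Qed.

Lemma slack_lface n (B : {set {set 'I_n}}) (c : {set 'I_n} -> R) (S : {set {set 'I_n}}) x :
  lpoly B c x ->
  (forall N, N \in S -> slack B c N x = 0) <-> lface B c (S :&: B)%SET x.
Proof.
move=> Px; split=> [h|[_ /fintype.subsetP h] N NS].
  split => //; apply/fintype.subsetP => N; rewrite !inE => /andP[NS NB].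
  by have := h N NS; rewrite /slack NB => /eqP; rewrite subr_eq0.
rewrite /slack; case: ifP => // NB; have := h N; rewrite !inE NS NB.
by move=> /(_ isT)/eqP ->; rewrite subrr.
Qed.

Lemma lpoly_face n (B : {set {set 'I_n}}) (c : {set 'I_n} -> R) F :
  face (lpoly B c) F -> F !=set0 -> exists S, F = lface B c S.
Proof.
pose E : set 'rV[R]_n := [set x | setsum finset.setT x = c finset.setT].
have Eaff x y t : E x -> E y -> E (t *: x + (1 - t) *: y).
  by move=> /= xE yE; rewrite /E /= setsumD !setsumZ xE yE -mulrDl addrC subrK mul1r.
move=> fF F0.
have [S ->] := face_tight (@slack_affine _ B c) Eaff (lpoly_slack B c) fF F0.
exists (S :&: B)%SET; apply/seteqP; split => x; first by move=> [Px /slack_lface]; apply.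
by move=> h; have [Px _] := h; split => //; apply/slack_lface.
Qed.

End LaminarFaces.

(** * The diagonal as a morphism of polytopes *)

Section DiagonalArrow.
Variables (R : realType) (n : nat) (B : {set {set 'I_n}}) (c : {set 'I_n} -> R).
Hypothesis LP : laminar_polytope B c.
Local Notation P := (lpoly B c).

Definition diagonal_image : set 'rV[R]_(n + n) :=
  [set w | good_pair B c (lsubmx w) (rsubmx w)].

Definition diagonal_faces : set (set 'rV[R]_(n + n)) :=
  [set F | face (prod_set P P) F /\ F `<=` diagonal_image].

Lemma compact_prod_lpoly : compact (prod_set P P).
Proof.
have [K K0 PK] := lpoly_bounded LP.
apply: bounded_closed_compact.
  exists K; split; first exact: num_real.
  move=> M /ltW KM w [/PK wl /PK wr]; apply: le_trans KM.
  apply: norm_le_entries => // i; rewrite -[w]hsubmxK mxE.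
  by case: fintype.split => j; apply: le_trans (entry_le_norm _ _) _.
have cP : closed P by apply: compact_closed (compact_lpoly LP); exact: norm_hausdorff.
have -> : prod_set P P = (@lsubmx R 1 n n) @^-1` P `&` (@rsubmx R 1 n n) @^-1` P by [].
by apply: closedI; apply: (continuous_closedP _).1 => //;
  [exact: lsubmx_continuous|exact: rsubmx_continuous].
Qed.

Lemma diagonal_faces_complex : polytopal_complex diagonal_faces.
Proof.
apply: (@face_complex _ _ (prod_set P P)); first by apply: prod_set_polytope; exact: lp_polytope LP.
  by move=> F [].
move=> F G [fF Fi] fG; split; last exact: subset_trans (face_sub fG) Fi.
by apply: face_trans fF fG; apply: prod_set_polytope; exact: lp_polytope LP.
Qed.

(** Through a good pair passes the product of the smallest faces of its two points. On that product
    the tight families can only grow, and [good] survives their growth. *)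
Lemma diagonal_faces_support : complex_support diagonal_faces = diagonal_image.
Proof.
apply/seteqP; split=> [w [F [_ +] Fw]|w wi]; first exact.
have [Px Py g] := wi.
exists (prod_set (lface B c (tight B c (lsubmx w))) (lface B c (tight B c (rsubmx w)))).
  split; first by apply: prod_set_face; exact: lface_face.
  move=> z [[Pl sl] [Pr sr]]; split => //; exact: good_sub sl sr g.
by split; split.
Qed.

Lemma compact_diagonal_image : compact diagonal_image.
Proof.
rewrite -diagonal_faces_support.
apply: (@subclosed_compact _ _ (prod_set P P)); last first.
- by move=> w [F [fF _]]; exact: (face_sub fF).
- exact: compact_prod_lpoly.
apply: closed_bigcup; first exact: pc_finite diagonal_faces_complex.
move=> F [[u [a [ua ->]]] _].
have -> : prod_set P P `&` [set x | dotp x u = a] = prod_set P P `&` [set x | a <= dotp x u].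
  apply/seteqP; split => x [Px /= h]; split => //=; first by rewrite h.
  by apply/eqP; rewrite eq_le h ua.
apply: closedI; last exact: closed_dotp_ge.
by apply: compact_closed compact_prod_lpoly; exact: norm_hausdorff.
Qed.

Definition midpoint_mx : 'M[R]_(n + n, n) := 2^-1 *: col_mx 1%:M 1%:M.

Lemma mul_midpoint_mx (w : 'rV[R]_(n + n)) :
  w *m midpoint_mx = 2^-1 *: (lsubmx w + rsubmx w).
Proof. by rewrite -{1}[w]hsubmxK -scalemxAr mul_row_col !mulmx1. Qed.

Lemma diagonal_good v z : principal v -> P z -> diagonal_image (Defs.diagonal v P z) /\
  Defs.diagonal v P z *m midpoint_mx = z.
Proof.
move=> pv Pz; have [g zE] := bot_top_good_pair LP pv Pz.
by split; rewrite /diagonal_image /= ?mul_midpoint_mx row_mxKl row_mxKr.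
Qed.

Lemma good_diagonal v w : principal v -> diagonal_image w ->
  P (w *m midpoint_mx) /\ Defs.diagonal v P (w *m midpoint_mx) = w.
Proof.
move=> pv wi; rewrite mul_midpoint_mx; split; last first.
  by have [h1 h2] := good_pair_bot LP pv wi; rewrite /Defs.diagonal h1 h2 hsubmxK.
have [[Plt Pl] [Prt Pr] _] := wi; split; first by rewrite setsumZ setsumD Plt Prt; lra.
by move=> N NB; rewrite setsumZ setsumD; have := Pl N NB; have := Pr N NB; lra.
Qed.

Lemma diagonal_continuous v : principal v -> {within P, continuous (Defs.diagonal v P)}.
Proof.
move=> pv.
have PE : P = (fun w => w *m midpoint_mx) @` diagonal_image.
  apply/seteqP; split => [z Pz|_ [w wi <-]]; last by have [] := good_diagonal pv wi.
  by have [h1 h2] := diagonal_good pv Pz; exists (Defs.diagonal v P z).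
suff : {within (fun w => w *m midpoint_mx) @` diagonal_image, continuous (Defs.diagonal v P)}.
  by rewrite -PE.
apply: compact_inverse; first exact: compact_diagonal_image.
  by apply: continuous_subspaceT; exact: mulmxr_continuous.
by move=> w wi; have [] := good_diagonal pv wi.
Qed.

Lemma diagonal_poly_arrow v : principal v -> poly_arrow P (prod_set P P) (Defs.diagonal v P).
Proof.
move=> pv; exists diagonal_faces; split.
- exact: diagonal_faces_complex.
- by move=> F [].
- exists (fun w => w *m midpoint_mx); rewrite diagonal_faces_support; split.
  + exact: diagonal_continuous.
  + by apply: continuous_subspaceT; exact: mulmxr_continuous.
  + by move=> x; exact: diagonal_good.
  + by move=> w; exact: good_diagonal.
apply: (subdivision_linear (M := midpoint_mx)); first exact: diagonal_faces_complex.
  by move=> y Py; rewrite diagonal_faces_support; exact: diagonal_good.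
by move=> x; rewrite diagonal_faces_support; exact: good_diagonal.
Qed.

Lemma bot_continuous v : principal v -> {within P, continuous (fun z => bot_pt v (reflected P z))}.
Proof.
move=> pv; have h := comp_within_continuous (diagonal_continuous pv) (fun _ _ => I)
  (continuous_subspaceT (A := setT) (@lsubmx_continuous R n n)).
by have -> : (fun z => bot_pt v (reflected P z)) = (fun z => lsubmx (Defs.diagonal v P z))
  by apply/funext => z; rewrite row_mxKl.
Qed.

Lemma top_continuous v : principal v -> {within P, continuous (fun z => top_pt v (reflected P z))}.
Proof.
move=> pv; have h := comp_within_continuous (diagonal_continuous pv) (fun _ _ => I)
  (continuous_subspaceT (A := setT) (@rsubmx_continuous R n n)).
by have -> : (fun z => top_pt v (reflected P z)) = (fun z => rsubmx (Defs.diagonal v P z))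
  by apply/funext => z; rewrite row_mxKr.
Qed.

End DiagonalArrow.

(** * Transition maps *)

Section Transitions.
Variables (R : realType) (n : nat) (B : {set {set 'I_n}}).
Implicit Types (c : {set 'I_n} -> R) (x z v : 'rV[R]_n).

(** The field [trans_tight], by which each face goes into the face with the same tight sets, has no
    counterpart in [is_transition]; for [tr] it is obtained by comparison with a map constructed
    here. *)
Record transition c c' (f : 'rV[R]_n -> 'rV[R]_n) : Prop := Transition {
  trans_cont : {within lpoly B c, continuous f};
  trans_fun : forall z, lpoly B c z -> lpoly B c' (f z);
  trans_tight : forall z, lpoly B c z -> tight B c z \subset tight B c' (f z);
  trans_diag : forall v z, principal v -> lpoly B c z ->
    Defs.diagonal v (lpoly B c') (f z) =
    row_mx (f (bot_pt v (reflected (lpoly B c) z)))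
           (f (top_pt v (reflected (lpoly B c) z))) }.

(** A point of rank 0 is determined by its tight family. *)
Lemma finite_prank0 c : laminar_polytope B c ->
  finite_set [set x | lpoly B c x /\ prank B c x = 0%N].
Proof.
move=> LP; pose h F := xget (0 : 'rV[R]_n)
  [set x | (lpoly B c x /\ prank B c x = 0%N) /\ tight B c x = F].
apply: (@sub_finite_set _ _ [set h F | F in setT]); last first.
  exact/finite_image/finite_finset.
move=> x Vx; exists (tight B c x) => //; rewrite /h.
apply: xget_unique => // y [[Py y0] yx].
by apply: (prank0_eq Vx.2); rewrite yx.
Qed.

Lemma half_addrr (V : lmodType R) (x : V) : 2^-1 *: (x + x) = x.
Proof.
by rewrite scalerDr -scalerDl (_ : 2^-1 + 2^-1 = 1 :> R) ?scale1r//; lra.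
Qed.

Section Existence.
Variables c c' : {set 'I_n} -> R.
Hypotheses (LP : laminar_polytope B c) (LP' : laminar_polytope B c').
Variable g : 'rV[R]_n -> 'rV[R]_n.
Hypothesis gP : forall x, lpoly B c x -> prank B c x = 0%N ->
  lpoly B c' (g x) /\ tight B c x \subset tight B c' (g x).
Local Notation P := (lpoly B c).
Local Notation P' := (lpoly B c').

(* f is the limit of the iterates of T f z = (f (bot z) + f (top z)) / 2; as
   rk (bot z) + rk (top z) <= rk z, T halves the distance weighted by 1 / rk. *)
Lemma transition_exists : exists f, transition c c' f /\
  forall x, P x -> prank B c x = 0%N -> f x = g x.
Proof.
have [v0 pv0] := exists_principal R n.
pose b z := bot_pt v0 (reflected P z); pose t z := top_pt v0 (reflected P z).
have bt z : P z -> good_pair B c (b z) (t z) /\ 2^-1 *: (b z + t z) = z.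
  exact: bot_top_good_pair.
have Pb z : P z -> P (b z) by move=> /bt[[]].
have Pt z : P z -> P (t z) by move=> /bt[[]].
have Tz z : P z -> tight B c z = (tight B c (b z) :&: tight B c (t z))%SET.
  exact: tight_bot_top.
have Tb z : P z -> tight B c z \subset tight B c (b z).
  by move=> /Tz ->; exact: finset.subsetIl.
have Tt z : P z -> tight B c z \subset tight B c (t z).
  by move=> /Tz ->; exact: finset.subsetIr.
have b0 z : P z -> prank B c z = 0%N -> b z = z.
  by move=> Pz z0; apply: (prank0_eq z0); apply: Tb.
have t0 z : P z -> prank B c z = 0%N -> t z = z.
  by move=> Pz z0; apply: (prank0_eq z0); apply: Tt.
have rkbt z : P z -> (prank B c (b z) + prank B c (t z) <= prank B c z)%N.
  exact: prank_bot_top.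
have /finite_seqP[s sE] := finite_prank0 LP.
have sP x : x \in s <-> P x /\ prank B c x = 0%N.
  by rewrite -[is_true (x \in s)]/([set` s] x) -sE.
have [f0 cf0 f0g] := interpolation s g.
(* Every iterate keeps the values of [g] at the points of rank 0, because these are their own bot
   and top. *)
pose u := fix u k := if k is k'.+1 then fun z => 2^-1 *: (u k' (b z) + u k' (t z)) else f0.
have ug k x : x \in s -> u k x = g x.
  move=> xs; elim: k => [|k IH]; first exact: f0g.
  have [Px x0] := (sP x).1 xs; by rewrite /= b0// t0// IH half_addrr.
have cu k : {within P, continuous (u k)}.
  elim: k => [|k IH]; first exact: continuous_subspaceT.
  have cb := comp_within_continuous (bot_continuous LP pv0) Pb IH.
  have ct := comp_within_continuous (top_continuous LP pv0) Pt IH.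
  have cm := continuous_subspaceT (A := setT) (@mulmxr_continuous R _ _ (midpoint_mx R n)).
  have := comp_within_continuous (row_mx_continuous cb ct) (fun _ _ => I) cm.
  have -> // : (fun z => row_mx (u k (bot_pt v0 (reflected P z)))
      (u k (top_pt v0 (reflected P z))) *m midpoint_mx R n) = u k.+1.
  by apply/funext => z; rewrite mul_midpoint_mx row_mxKl row_mxKr.
have [M M0 f0M] : exists2 M, 0 <= M & forall z, P z -> `|f0 z| <= M.
  have cfP := continuous_compact (cu 0%N) (compact_lpoly LP).
  have [M [_ hM]] := compact_bounded cfP.
  exists (`|M| + 1); first by rewrite addr_ge0.
  move=> z Pz; apply: hM; last by exists z.
  by rewrite (le_lt_trans (ler_norm M))// ltrDl.
(* Consecutive differences contract as well: they are at most [2 * M] at positive rank and vanish at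
   rank 0. *)
have ustep k z : P z -> `|u k.+1 z - u k z| <= 2 * M * (prank B c z)%:R / 2 ^+ k.
  elim: k z => [|k IH] z Pz.
    rewrite expr0 divr1; have [z0|z_gt0] := posnP (prank B c z).
      have zs : z \in s by apply/sP.
      by rewrite z0 mulr0 /= b0// t0// half_addrr subrr normr0.
    apply: (@le_trans _ _ (2 * M)); last by rewrite ler_peMr ?mulr_ge0// ler1n.
    apply: le_trans (ler_normB _ _) _; rewrite /= normrZ ger0_norm ?invr_ge0//.
    have := ler_normD (f0 (b z)) (f0 (t z)).
    by have := f0M _ Pz; have := f0M _ (Pb _ Pz); have := f0M _ (Pt _ Pz); lra.
  have -> : u k.+2 z - u k.+1 z =
      2^-1 *: ((u k.+1 (b z) - u k (b z)) + (u k.+1 (t z) - u k (t z))).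
    by rewrite -[in RHS]addrACA -opprD scalerBr.
  rewrite normrZ ger0_norm ?invr_ge0//.
  have := ler_normD (u k.+1 (b z) - u k (b z)) (u k.+1 (t z) - u k (t z)).
  have := IH _ (Pb _ Pz); have := IH _ (Pt _ Pz).
  have : 2 * M * (prank B c (b z))%:R / 2 ^+ k + 2 * M * (prank B c (t z))%:R / 2 ^+ k
      <= 2 * M * (prank B c z)%:R / 2 ^+ k.
    rewrite -mulrDl -mulrDr -natrD ler_pM2r ?invr_gt0 ?exprn_gt0//.
    by rewrite ler_wpM2l ?mulr_ge0// ler_nat rkbt.
  have -> : 2 * M * (prank B c z)%:R / 2 ^+ k.+1 = 2 * M * (prank B c z)%:R / 2 ^+ k / 2.
    by rewrite exprS invfM; set y := (2 ^+ k)^-1; lra.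
  by lra.
(* [prank] is at most [n], and [geometric_limit_rV] doubles the constant [2 * M * n]. *)
pose C := 2 * (2 * M * n%:R).
have /choice[f fP] : forall z, exists l, P z -> forall k, `|u k z - l| <= C / 2 ^+ k.
  move=> z; have [Pz|nPz] := pselect (P z); last by exists 0.
  have [|l hl] := @geometric_limit_rV R n (fun k => u k z) (2 * M * n%:R).
    move=> k; apply: le_trans (ustep k z Pz) _.
    by rewrite ler_pM2r ?invr_gt0 ?exprn_gt0// ler_wpM2l ?mulr_ge0// ler_nat prank_le.
  by exists l.
have fg x : P x -> prank B c x = 0%N -> f x = g x.
  move=> Px x0; apply/eqP; rewrite -subr_eq0 -normr_le0; apply: (@geometric_le0 _ _ C) => k.
  by rewrite distrC; have := fP x Px k; rewrite ug//; apply/sP.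
have fmid z : P z -> f z = 2^-1 *: (f (b z) + f (t z)).
  move=> Pz; apply/eqP; rewrite -subr_eq0 -normr_le0.
  apply: (@geometric_le0 _ _ (2 * C)) => k.
  have h1 := fP z Pz k.+1; have h2 := fP _ (Pb _ Pz) k; have h3 := fP _ (Pt _ Pz) k.
  apply: le_trans (ler_distD (u k.+1 z) _ _) _; rewrite (distrC (f z)).
  have : `|u k.+1 z - 2^-1 *: (f (b z) + f (t z))| <= C / 2 ^+ k.
    rewrite /= -scalerBr opprD addrACA normrZ ger0_norm ?invr_ge0//.
    have := ler_normD (u k (b z) - f (b z)) (u k (t z) - f (t z)); lra.
  have : C / 2 ^+ k.+1 = C / 2 ^+ k / 2 by rewrite exprS invfM; set y := (2 ^+ k)^-1; lra.
  have : 0 <= C / 2 ^+ k by rewrite divr_ge0 ?mulr_ge0 ?exprn_ge0.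
  by lra.
have fbnd : forall z, P z -> `|f z| <= M + C.
  move=> z Pz; have := fP z Pz 0%N; rewrite expr0 divr1 /= => h.
  have := f0M z Pz; have := ler_distD (f0 z) (f z) 0; rewrite !subr0 distrC; lra.
(* The midpoint law propagates linear inequalities from the vertices. *)
have lin (S : 'rV[R]_n -> Prop) N a e :
    (forall z, S z -> P z /\ S (b z) /\ S (t z)) ->
    (forall z, S z -> prank B c z = 0%N -> e * setsum N (g z) <= a) ->
    forall z, S z -> e * setsum N (f z) <= a.
  move=> Sbt Sg z Sz; rewrite -subr_le0.
  pose K := `|e| * ((\sum_i `|(ind R N)^T 0 i|) * (M + C)) + `|a|.
  apply: (@halving_principle R _ S (prank B c) b t (fun z => e * setsum N (f z) - a) K _ _ _ _ _ z Sz).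
  - by move=> x /Sbt[].
  - by move=> x /Sbt[/rkbt].
  - move=> x /Sbt[Px _]; rewrite /K; apply: lerD; last by rewrite -normrN ler_norm.
    apply: le_trans (ler_norm _) _; rewrite normrM ler_wpM2l// setsum_ind.
    by apply: le_trans (norm_dotp_le _ _) _; rewrite ler_wpM2l ?sumr_ge0// fbnd.
  - by move=> x Sx x0; have [Px _] := Sbt x Sx; rewrite fg// subr_le0 Sg.
  - by move=> x /Sbt[Px _]; rewrite fmid// setsumZ setsumD; lra.
have P'f z : P z -> P' (f z).
  have SP x : P x -> P x /\ P (b x) /\ P (t x) by move=> Px; split => //; split; [exact: Pb|exact: Pt].
  move=> Pz; split.
    apply/eqP; rewrite eq_le; apply/andP; split.
      rewrite -[leLHS]mul1r; apply: (lin P _ _ 1 SP) => // x Px x0.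
      by rewrite mul1r (gP Px x0).1.1.
    rewrite -lerN2 -[leLHS]mulN1r; apply: (lin P _ _ (-1) SP) => // x Px x0.
    by rewrite mulN1r (gP Px x0).1.1.
  move=> N NB; rewrite -lerN2 -[leLHS]mulN1r; apply: (lin P _ _ (-1) SP) => // x Px x0.
  by rewrite mulN1r lerN2; apply: (gP Px x0).1.2.
have tf z : P z -> tight B c z \subset tight B c' (f z).
  move=> Pz; apply/fintype.subsetP => N NT.
  have NB : N \in B by move: NT; rewrite inE => /andP[].
  rewrite inE NB eq_le (P'f z Pz).2// andbT.
  have SP x : P x /\ N \in tight B c x ->
      P x /\ (P (b x) /\ N \in tight B c (b x)) /\ (P (t x) /\ N \in tight B c (t x)).
    move=> [Px Nx]; split => //; split; split; [exact: Pb|exact: (fintype.subsetP (Tb _ Px))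
      |exact: Pt|exact: (fintype.subsetP (Tt _ Px))].
  rewrite -[leLHS]mul1r; apply: (lin _ _ _ 1 SP) => // x [Px Nx] x0.
  rewrite mul1r; have [_ /fintype.subsetP/(_ N Nx)] := gP Px x0.
  by rewrite inE => /andP[_ /eqP ->].
exists f; split => //; split => //.
  exact: (@uniform_limit R _ _ P u f C cu (fun k x Px => fP x Px k)).
move=> v z pv Pz.
have [gv zE] := bot_top_good_pair LP pv Pz.
have [g0 zE0] := bt z Pz.
have [bE tE] := good_pair_bot LP pv g0; rewrite -/(b z) -/(t z) zE0 in bE tE.
rewrite bE tE fmid//.
have [Pbz Ptz gz] := g0.
(* Tight families grow under f, so the image of a good pair is good. It is then the pair of bot and
   top of its midpoint for every principal v, although f was built with [v0]. *)
have g' : good_pair B c' (f (b z)) (f (t z)).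
  by split; [exact: P'f|exact: P'f|exact: good_sub (tf _ Pbz) (tf _ Ptz) gz].
by have [h1 h2] := good_pair_bot LP' pv g'; rewrite /Defs.diagonal h1 h2.
Qed.

End Existence.

Lemma trans_mid c c' f v z : laminar_polytope B c -> laminar_polytope B c' ->
  transition c c' f -> principal v -> lpoly B c z ->
  f z = 2^-1 *: (f (bot_pt v (reflected (lpoly B c) z)) + f (top_pt v (reflected (lpoly B c) z))).
Proof.
move=> LP LP' tf pv Pz.
have [_ {1}<-] := bot_top_good_pair LP' pv (trans_fun tf Pz).
by have /eq_row_mx[-> ->] := trans_diag tf pv Pz.
Qed.

End Transitions.

(** * Planar trees and nests *)

Section Trees.
Variable T : Type.
Implicit Types (t s : tree T) (ts : seq (tree T)).

Fixpoint Forall_trees (P : tree T -> Prop) ts : Prop :=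
  if ts is s :: ts' then P s /\ Forall_trees P ts' else True.

Lemma tree_nested_ind (P : tree T -> Prop) :
  P Leaf -> (forall x ts, Forall_trees P ts -> P (Node x ts)) -> forall t, P t.
Proof.
move=> PL PN; fix IH 1 => -[|x ts]; first exact: PL.
apply: PN; elim: ts => [|s ts IHts] //=.
Qed.

(** Each vertex other than the root is the upper end of exactly one edge, and is met together with
    it. Hence, counting from 0, edge number e of a planar tree ends at vertex e + 1. *)
Lemma edges_snd t : [seq e.2 | e <- edges t] = behead (labels t).
Proof.
elim/tree_nested_ind: t => //= x ts; elim: ts => //= s ts IH [hs /IH hts].
by rewrite !map_cat hts; case: s hs => //= y us ->.
Qed.

End Trees.

Lemma sorted_edges (t : tree nat) e : sorted ltn (labels t) -> e \in edges t -> (e.1 < e.2)%N.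
Proof.
elim/tree_nested_ind: t => //= x ts IHts.
elim: ts IHts => //= s ts IH [hs hts]; rewrite cat_path => /andP[ps pts].
rewrite !mem_cat => /orP[/orP[]|].
- case: s {hs pts} ps => [|y us] //= /andP[xy _].
  by rewrite mem_seq1 => /eqP ->.
- by apply: hs; apply: path_sorted ps.
- apply: (IH hts); move: pts; case: (flatten _) => //= y r /andP[xy ->]; rewrite andbT.
  have [eqx|neq] := eqVneq (last x (labels s)) x; first by rewrite -eqx.
  apply: ltn_trans xy; have : last x (labels s) \in labels s.
    by case: (labels s) neq => //=; rewrite ?eqxx// => z r' _; exact: mem_last.
  by have /allP := order_path_min ltn_trans ps; apply.
Qed.

Section PlanarTrees.
Variable t : tree nat.
Hypothesis pt : planar_tree t.

Lemma planar_labels : labels t = iota 0 (nv t).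
Proof. by case/and3P: pt => _ /eqP. Qed.

Lemma planar_nv : nv t = (ne t).+1.
Proof.
rewrite /ne -(size_map snd) edges_snd size_behead -/(nv t) prednK//.
by case/and3P: pt.
Qed.

Lemma planar_edge_snd (e : 'I_(ne t)) : (edge e).2 = e.+1.
Proof.
rewrite /edge -(nth_map _ 0%N) ?ltn_ord// edges_snd nth_behead planar_labels nth_iota//.
by rewrite planar_nv ltnS.
Qed.

Lemma planar_edge_fst (e : 'I_(ne t)) : ((edge e).1 <= e)%N.
Proof.
rewrite -ltnS -planar_edge_snd; apply: (@sorted_edges t); last exact: mem_nth.
by rewrite planar_labels; exact: iota_ltn_sorted.
Qed.

End PlanarTrees.

(** * Nests as rooted edge sets *)

Section Nests.
Import mathcomp.boot.fintype mathcomp.boot.finset.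
Variable t : tree nat.
Hypothesis pt : planar_tree t.
Local Notation n := (ne t).
Implicit Types (e f g : 'I_n) (N M K C : {set 'I_n}) (r q u : nat).

Definition par e : nat := (edge e).1.

Lemma edgeE e : edge e = (par e, e.+1).
Proof. by rewrite /par -(planar_edge_snd pt e); case: (edge e). Qed.

Lemma par_le e : (par e <= e)%N.
Proof. exact: planar_edge_fst. Qed.

Definition step N u : nat := if [pick e in N | e.+1 == u] is Some e then par e else u.

(* The upper end of the maximal path of edges of N going up from u. *)
Definition anc N u : nat := iter (nv t) (step N) u.

Lemma step_in N e : e \in N -> step N e.+1 = par e.
Proof.
move=> eN; rewrite /step; case: pickP => [f /andP[_]|/(_ e)]; last by rewrite eN eqxx.
by rewrite eqSS => /eqP/val_inj ->.
Qed.

Lemma step_out N u : (forall e, e \in N -> e.+1 != u) -> step N u = u.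
Proof.
move=> h; rewrite /step; case: pickP => // e /andP[eN]; by rewrite (negbTE (h e eN)).
Qed.

Variant step_spec N u : nat -> Type :=
  | StepIn e of e \in N & u = e.+1 : step_spec N u (par e)
  | StepOut of (forall e, e \in N -> e.+1 != u) : step_spec N u u.

Lemma stepP N u : step_spec N u (step N u).
Proof.
rewrite /step; case: pickP => [e /andP[eN /eqP <-]|h]; first exact: StepIn eN _.
by apply: StepOut => e eN; have := h e; rewrite /= eN /= => ->.
Qed.

Lemma iter_step_fix N k u : (u <= k)%N -> step N (iter k (step N) u) = iter k (step N) u.
Proof.
elim: k u => [|k IH] u.
  by rewrite leqn0 => /eqP ->; case: stepP.
move=> uk; rewrite !iterSr; case: (stepP N u) uk => [e eN ->|out] uk.
  by apply: IH; exact: leq_trans (par_le e) _.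
have su := step_out out.
have -> j : iter j (step N) u = u by elim: j => //= j ->.
by [].
Qed.

Lemma anc_step N u : anc N (step N u) = anc N u.
Proof.
have [le|gt] := leqP u (nv t); first by rewrite /anc -iterSr /= iter_step_fix.
rewrite step_out// => e _; apply: contraTneq gt => <-; rewrite -leqNgt.
by rewrite (planar_nv pt) ltnS ltnW.
Qed.

Lemma anc_in N e : e \in N -> anc N e.+1 = anc N (par e).
Proof. by move=> eN; rewrite -(step_in eN) anc_step. Qed.

Lemma anc_out N u : (forall e, e \in N -> e.+1 != u) -> anc N u = u.
Proof.
by move=> /step_out su; rewrite /anc; elim: (nv t) => //= j ->.
Qed.

Lemma anc_ind N (Q : nat -> nat -> Prop) :
  (forall u, (forall e, e \in N -> e.+1 != u) -> Q u u) ->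
  (forall e r, e \in N -> Q (par e) r -> Q e.+1 r) ->
  forall u, Q u (anc N u).
Proof.
move=> Q0 QS; elim/ltn_ind => u IH; case: (stepP N u) => [e eN uE|out]; last first.
  by rewrite anc_out//; exact: Q0.
by rewrite uE anc_in//; apply: QS => //; apply: IH; rewrite uE ltnS par_le.
Qed.

Lemma anc_le N u : (anc N u <= u)%N.
Proof.
apply: (anc_ind (N := N) (Q := fun u r => (r <= u)%N)) => // e r _ h.
exact: leq_trans h (leqW (par_le e)).
Qed.

Lemma lt_nv_edge e : (e.+1 < nv t)%N.
Proof. by rewrite (planar_nv pt) ltnS. Qed.

Lemma lt_nv_par e : (par e < nv t)%N.
Proof. exact: leq_ltn_trans (leqW (par_le e)) (lt_nv_edge e). Qed.

Lemma joined_sym N : symmetric (joined N).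
Proof. by move=> u v; apply: eq_existsb => e; rewrite orbC. Qed.

Lemma joinedP N (u v : 'I_(nv t)) : reflect (exists2 e, e \in N &
   (val u = par e /\ val v = e.+1) \/ (val v = par e /\ val u = e.+1)) (joined N u v).
Proof.
apply: (iffP existsP) => [[e /andP[eN]]|[e eN h]].
  by rewrite edgeE !xpair_eqE => /orP[]/andP[/eqP h1 /eqP h2]; exists e => //; [left|right].
by exists e; rewrite eN edgeE !xpair_eqE; case: h => -[-> ->]; rewrite !eqxx ?orbT.
Qed.

Lemma connect_anc N (u v : 'I_(nv t)) : val v = anc N u -> connect (joined N) u v.
Proof.
have [k uk] := ubnP (val u); elim: k => // k IH in u v uk *.
case: (stepP N u) => [e eN uE|out]; last first.
  by rewrite anc_out// => /val_inj ->; exact: connect0.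
rewrite uE anc_in// => vE; apply: connect_trans (IH (Ordinal (lt_nv_par e)) v _ vE).
  by apply/connect1/joinedP; exists e => //; right.
by move: uk; rewrite [val u]uE /= !ltnS; apply: leq_ltn_trans; rewrite par_le.
Qed.

(** Following edges of N towards the root stays inside a component, and each component has a single
    lowest vertex, the [anc] of all its vertices. *)
Lemma joined_connectE N (u v : 'I_(nv t)) : connect (joined N) u v = (anc N u == anc N v).
Proof.
apply/idP/eqP => [/connectP[p]|uv].
  elim: p u => [|w p IH] u /=; first by move=> _ ->.
  move=> /andP[/joinedP[e eN ueq] pw vE]; rewrite -(IH w pw vE).
  by case: ueq => -[-> ->]; rewrite anc_in.
have lr : (anc N u < nv t)%N by apply: leq_ltn_trans (anc_le N u) (ltn_ord u).
apply: (@connect_trans _ _ (Ordinal lr)); first exact: connect_anc.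
rewrite (sym_connect_sym (@joined_sym N)); exact: connect_anc.
Qed.

(* N is the edge set of a subtree with root r; the empty set is rooted everywhere. *)
Definition rooted r N : bool :=
  [forall e in N, (par e == r) || [exists f in N, par e == f.+1]].

Lemma rootedP r N : reflect (forall e, e \in N ->
  par e = r \/ exists2 f, f \in N & par e = f.+1) (rooted r N).
Proof.
apply: (iffP forall_inP) => h e eN.
  by case/orP: (h e eN) => [/eqP|/exists_inP[f fN /eqP]]; [left|right; exists f].
case: (h e eN) => [->|[f fN ->]]; first by rewrite eqxx.
by apply/orP; right; apply/exists_inP; exists f.
Qed.

Lemma rooted_le r N e : rooted r N -> e \in N -> (r <= par e)%N.
Proof.
move=> /rootedP rN; have [k ek] := ubnP (val e); elim: k => // k IH in e ek * => eN.
case: (rN e eN) => [->//|[f fN pf]].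
have fe : (f < e)%N by rewrite -ltnS -pf ltnS par_le.
have := IH f (leq_trans fe ek) fN; rewrite pf => h.
exact: leq_trans h (leq_trans (par_le f) (leqnSn f)).
Qed.

Lemma rooted_lt r N e : rooted r N -> e \in N -> (r <= e)%N.
Proof. by move=> rN eN; apply: leq_trans (rooted_le rN eN) (par_le e). Qed.

Lemma rooted_notin r N e : rooted r N -> e \in N -> e.+1 != r.
Proof. by move=> rN eN; rewrite gtn_eqF// ltnS (rooted_lt rN eN). Qed.

(** The vertex set of the subtree with root r and edge set N; unlike [touches] it contains r even
    when N is empty. *)
Definition span r N u : bool := (u == r) || [exists e in N, e.+1 == u].

Lemma spanP r N u : reflect (u = r \/ exists2 e, e \in N & u = e.+1) (span r N u).
Proof.
apply: (iffP orP) => -[].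
- by move=> /eqP; left.
- by move=> /exists_inP[e eN /eqP <-]; right; exists e.
- by move=> ->; left.
- by move=> [e eN ->]; right; apply/exists_inP; exists e.
Qed.

Lemma span_par r N e : rooted r N -> e \in N -> span r N (par e).
Proof. by move=> /rootedP rN eN; apply/spanP; exact: rN. Qed.

Lemma anc_span r N u : rooted r N -> span r N u -> anc N u = r.
Proof.
move=> rN; elim/ltn_ind: u => u IH /spanP[->|[e eN uE]].
  by apply: anc_out => e; exact: rooted_notin.
by rewrite uE anc_in//; apply: IH (span_par rN eN); rewrite uE ltnS par_le.
Qed.

Lemma rooted_root r N : rooted r N -> N != set0 -> exists2 e, e \in N & par e = r.
Proof.
move=> rN /set0Pn[e0 e0N].
case: (arg_minnP (fun e : 'I_n => e : nat) e0N) => e eN emin.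
exists e => //; case: (rootedP _ _ rN e eN) => // -[f fN pf].
have := emin f fN; rewrite leqNgt => /negP[].
by rewrite -ltnS -pf ltnS par_le.
Qed.

Lemma touchesP r N u : rooted r N -> N != set0 -> touches N u = span r N u.
Proof.
move=> rN N0; apply/existsP/idP => [[e /andP[eN]]|/spanP[->|[e eN ->]]].
- rewrite /incident edgeE /= => /orP[]/eqP->; first exact: span_par.
  by apply/spanP; right; exists e.
- have [e eN <-] := rooted_root rN N0; exists e.
  by rewrite eN /incident edgeE eqxx.
by exists e; rewrite eN /incident edgeE eqxx orbT.
Qed.

(** In a connected edge set all vertices have the same [anc], which is the root. Conversely, every
    vertex of a rooted set descends to the root along its edges. *)
Lemma nestP N : reflect (N != set0 /\ exists r, rooted r N) (nest N).
Proof.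
apply: (iffP andP) => -[N0 h]; split => //.
  have [e0 e0N] := set0Pn _ N0; exists (anc N (par e0)).
  have ancE e : e \in N -> anc N (par e) = anc N (par e0).
    move=> eN; have := forallP h (Ordinal (lt_nv_par e)) => /forallP/(_ (Ordinal (lt_nv_par e0))).
    move=> /implyP h1; have /h1/implyP h2 : touches N (Ordinal (lt_nv_par e)).
      by apply/existsP; exists e; rewrite eN /incident edgeE eqxx.
    have /h2 : touches N (Ordinal (lt_nv_par e0)).
      by apply/existsP; exists e0; rewrite e0N /incident edgeE eqxx.
    by rewrite joined_connectE => /eqP.
  apply/rootedP => e eN; case: (stepP N (par e)) => [f fN pf|out].
    by right; exists f.
  by left; rewrite -(ancE e eN) anc_out.
have [r rN] := h; apply/forallP => u; apply/forallP => v.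
apply/implyP; rewrite (touchesP _ rN)// => su; apply/implyP; rewrite (touchesP _ rN)// => sv.
by rewrite joined_connectE !(anc_span rN).
Qed.

Lemma rooted_inj r q N : rooted r N -> rooted q N -> N != set0 -> r = q.
Proof.
move=> rN qN /set0Pn[e eN].
by rewrite -(anc_span rN (span_par rN eN)) (anc_span qN (span_par qN eN)).
Qed.

Lemma rooted_top : rooted 0 [set: 'I_n].
Proof.
apply/rootedP => e _; case pe: (par e) => [|k]; [by left|right].
have kn : (k < n)%N by apply: leq_ltn_trans (ltn_ord e); rewrite -ltnS -pe ltnW// ltnS par_le.
by exists (Ordinal kn).
Qed.

Lemma rooted1 e : rooted (par e) [set e].
Proof. by apply/rootedP => f; rewrite inE => /eqP ->; left. Qed.

Lemma rooted0 r : rooted r set0.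
Proof. by apply/rootedP => f; rewrite inE. Qed.

(* The overlap of two subtrees is a subtree rooted at the upper root r', and so
   is their union, rooted at the lower root r. *)
Lemma rooted_overlap r N r' M u : rooted r N -> rooted r' M -> (r <= r')%N ->
  span r N u -> span r' M u ->
  [/\ span r N r', rooted r (N :|: M) & rooted r' (N :&: M)].
Proof.
move=> rN rM rr'.
have notM e : e \in M -> e.+1 != r.
  by move=> eM; rewrite gtn_eqF// ltnS (leq_trans rr' (rooted_lt rM eM)).
have sr' : span r N u -> span r' M u -> span r N r'.
  elim/ltn_ind: u => u IH su; case/spanP => [<-//|[e eM uE]].
  case/spanP: su => [ur|[f fN uE']]; first by have := notM e eM; rewrite -uE ur eqxx.
  have ef : e = f by apply: val_inj; move: uE; rewrite uE' => -[].
  rewrite -ef in fN.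
  by apply: (IH (par e)); rewrite ?uE ?ltnS ?par_le//; exact: span_par.
move=> /sr' h /h sN; split => //.
  apply/rootedP => e; rewrite inE => /orP[eN|eM].
    case: (rootedP _ _ rN e eN) => [|[f fN pf]]; [by left|right].
    by exists f; rewrite // inE fN.
  case: (rootedP _ _ rM e eM) => [pr|[f fM pf]]; last by right; exists f; rewrite // inE fM orbT.
  case/spanP: sN => [r'r|[f fN r'f]]; first by left; rewrite pr.
  by right; exists f; rewrite ?inE ?fN// pr.
apply/rootedP => e; rewrite inE => /andP[eN eM].
case: (rootedP _ _ rM e eM) => [|[f fM pf]]; [by left|right].
case: (rootedP _ _ rN e eN) => [pr|[g gN pg]].
  by have := notM f fM; rewrite -pf pr eqxx.
have fg : f = g by apply: val_inj; move: pf; rewrite pg => -[].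
by exists f; rewrite // inE fM fg gN.
Qed.

(** If the root of C is not that of N, the edge of N below it is outside C and adjacent to it.
    Otherwise the least edge of N outside C starts at a vertex of C. *)
Lemma nest_neighbour N C : nest N -> nest C -> C \proper N ->
  exists e f, [/\ e \in N, e \notin C, f \in C & adjacent e f].
Proof.
move=> /nestP[N0 [r rN]] /nestP[C0 [q qC]] /properP[/subsetP sCN [e1 e1N e1C]].
have [f fC pf] := rooted_root qC C0.
have [qr|qr] := eqVneq q r; last first.
  case: (rootedP _ _ rN f (sCN f fC)) => [pr|[e eN pe]]; first by rewrite -pf pr eqxx in qr.
  exists e, f; split => //.
    by apply/negP => eC; have := rooted_notin qC eC; rewrite -pe pf eqxx.
  by rewrite /adjacent /incident !edgeE /= pe eqxx !orbT.
have e1D : e1 \in N :\: C by rewrite inE e1C e1N.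
case: (arg_minnP (fun e : 'I_n => e : nat) e1D) => e eD emin.
have /andP[eC eN] : (e \notin C) && (e \in N) by have : e \in N :\: C := eD; rewrite inE.
case: (rootedP _ _ rN e eN) => [pr|[g gN pg]].
  by exists e, f; split => //; rewrite /adjacent /incident !edgeE /= pf qr pr eqxx.
exists e, g; split => //; last by rewrite /adjacent /incident !edgeE /= pg eqxx !orbT.
apply: contraT => gC; have : g \in N :\: C by rewrite inE gC gN.
move=> /emin; rewrite leqNgt => /negP[].
by rewrite -ltnS -pg ltnS par_le.
Qed.

End Nests.

(** * Weights of nests, tight nests and nestings *)

Section NestFunction.
Import mathcomp.boot.fintype mathcomp.boot.finset.
Variables (R : realType) (t : tree nat).
Hypothesis pt : planar_tree t.
Local Notation n := (ne t).
Implicit Types (e f g : 'I_n) (N M K C : {set 'I_n}) (r q u : nat) (x : 'rV[R]_n).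

Definition nroot N : nat := if [pick e in N] is Some e then anc N (par e) else 0%N.

Lemma nrootE r N : rooted r N -> N != set0 -> nroot N = r.
Proof.
move=> rN /set0Pn[e0 e0N]; rewrite /nroot; case: pickP => [e eN|/(_ e0)]; last by rewrite e0N.
exact: anc_span rN (span_par rN eN).
Qed.

(* The full edge set is added for the corolla, whose empty edge set is not a nest. *)
Definition nests : {set {set 'I_n}} := [set N | nest N || (N == setT)].

Lemma nests_rooted N : N \in nests -> exists r, rooted r N.
Proof.
rewrite inE => /orP[/(nestP pt)[_]//|/eqP ->]; exists 0%N; exact: rooted_top.
Qed.

Lemma nests_nest N : N \in nests -> N != set0 -> nest N.
Proof.
rewrite inE => /orP[//|/eqP ->] N0; apply/(nestP pt); split => //.
by exists 0%N; exact: rooted_top.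
Qed.

Lemma nest_nests N : nest N -> N \in nests.
Proof. by rewrite inE => ->. Qed.

Lemma sum_setU (F : 'I_n -> R) N M :
  \sum_(e in N :|: M) F e = \sum_(e in N) F e + \sum_(e in M :\: N) F e.
Proof. by rewrite (big_setID N) /= setUK setDUl setDv set0U. Qed.

Lemma sum_setI (F : 'I_n -> R) M N :
  \sum_(e in M) F e = \sum_(e in N :&: M) F e + \sum_(e in M :\: N) F e.
Proof. by rewrite (big_setID N) /= setIC. Qed.

Section Weights.
Variable w : nat -> R.
Hypothesis w_gt0 : forall u, 0 < w u.

Definition subtree_weight r N : R := w r + \sum_(e in N) w e.+1.

(* The sum of w u * w v over the pairs of distinct vertices u, v of the subtree. *)
Definition pair_weight r N : R :=
  (subtree_weight r N ^+ 2 - (w r ^+ 2 + \sum_(e in N) w e.+1 ^+ 2)) / 2.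

Definition nest_weight N : R := pair_weight (nroot N) N.

Lemma pair_weight0 r : pair_weight r set0 = 0.
Proof. by rewrite /pair_weight /subtree_weight !big_set0 !addr0 subrr mul0r. Qed.

Lemma nest_weightE r N : rooted r N -> nest_weight N = pair_weight r N.
Proof.
move=> rN; have [->|N0] := eqVneq N set0; first by rewrite /nest_weight !pair_weight0.
by rewrite /nest_weight (nrootE rN N0).
Qed.

Lemma sum_gt0 N : N != set0 -> 0 < \sum_(e in N) w e.+1.
Proof.
move=> /set0Pn[e eN]; rewrite (big_setD1 e)//= ltr_wpDr// sumr_ge0// => f _.
exact: ltW.
Qed.

(** Strict supermodularity: the union gains the pairs made of a vertex of N only and a vertex of M
    only. The difference is D times the weight of the vertices of N outside the overlap, and both
    factors are positive. *)
Lemma pair_weight_overlap r N r' M u : rooted r N -> rooted r' M -> (r <= r')%N ->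
  span r N u -> span r' M u -> ~~ (N \subset M) -> ~~ (M \subset N) ->
  pair_weight r N + pair_weight r' M <
  pair_weight r (N :|: M) + pair_weight r' (N :&: M).
Proof.
move=> rN rM rr' sN sM nNM nMN.
have [sr' _ _] := rooted_overlap pt rN rM rr' sN sM.
rewrite /pair_weight /subtree_weight !sum_setU (sum_setI _ M N) (sum_setI (fun e => w e.+1 ^+ 2) M N).
set D := \sum_(e in M :\: N) w e.+1; set I := \sum_(e in N :&: M) w e.+1.
set A := \sum_(e in N) w e.+1.
have D0 : 0 < D by apply: sum_gt0; rewrite setD_eq0.
suff : w r' + I < w r + A.
  rewrite -subr_gt0 => h; have := mulr_gt0 D0 h; set A2 := \sum_(e in N) _; lra.
rewrite /A (sum_setI _ N M) setIC -/I; have E0 : 0 < \sum_(e in N :\: M) w e.+1.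
  by apply: sum_gt0; rewrite setD_eq0.
case/spanP: sr' => [->|[g gN r'E]]; first by lra.
have gM : g \notin M by apply/negP => /(rooted_notin pt rM); rewrite r'E eqxx.
have : w r' <= \sum_(e in N :\: M) w e.+1.
  rewrite (big_setD1 g) ?inE ?gM ?gN//= -r'E lerDl sumr_ge0// => f _; exact: ltW.
have := w_gt0 r; lra.
Qed.

Local Notation P := (lpoly nests nest_weight).
Local Notation T := (tight nests nest_weight).

(** Otherwise x(N) + x(M) = x(N u M) + x(N n M) would be at least c(N u M) + c(N n M), which exceeds
    c(N) + c(M). A common vertex suffices for this, so adjacent disjoint nests are excluded along
    with crossing ones. *)
Lemma tight_no_overlap x N M r r' u : P x -> N \in T x -> M \in T x ->
  ~~ (N \subset M) -> ~~ (M \subset N) -> rooted r N -> rooted r' M ->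
  span r N u -> span r' M u -> False.
Proof.
wlog rr' : N M r r' / (r <= r')%N.
  move=> h Px NT MT nNM nMN rN rM sN sM; have [rr'|r'r] := leqP r r'.
    exact: (h N M r r').
  by apply: (h M N r' r) => //; exact: ltnW.
move=> Px NT MT nNM nMN rN rM sN sM.
have [_ rU rI] := rooted_overlap pt rN rM rr' sN sM.
have := pair_weight_overlap rN rM rr' sN sM nNM nMN.
move: NT MT => /tightP[NB] NE /tightP[MB] ME.
rewrite -(nest_weightE rN) -(nest_weightE rM) -(nest_weightE rU) -(nest_weightE rI).
rewrite -NE -ME; apply/negP; rewrite -leNgt.
have sumUI : setsum N x + setsum M x = setsum (N :|: M) x + setsum (N :&: M) x.
  by rewrite /setsum sum_setU [X in _ + X = _](sum_setI _ M N) [X in _ + X = _]addrC addrA.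
rewrite sumUI; apply: lerD.
  apply: Px.2; apply: nest_nests; apply/(nestP pt); split; last by exists r.
  by apply: contraNneq nNM => /eqP; rewrite setU_eq0 => /andP[/eqP -> _]; exact: sub0set.
(* Subtrees may share a vertex without sharing an edge; the second terms are then both 0. *)
have [->|I0] := eqVneq (N :&: M) set0.
  by rewrite /nest_weight pair_weight0 /setsum big_set0.
by apply: Px.2; apply: nest_nests; apply/(nestP pt); split => //; exists r'.
Qed.

Lemma tight_laminar x : P x -> laminar (T x).
Proof.
move=> Px N M NT MT; have [sNM|nNM] := boolP (N \subset M); first exact: Or31.
have [sMN|nMN] := boolP (M \subset N); first exact: Or32.
apply: Or33; rewrite disjoints_subset; apply/subsetP => e eN; rewrite inE; apply/negP => eM.
have /nests_rooted[r rN] := (tightP _ _ _ _ NT).1.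
have /nests_rooted[r' rM] := (tightP _ _ _ _ MT).1.
apply: (@tight_no_overlap x N M r r' e.+1) => //.
  by apply/spanP; right; exists e.
by apply/spanP; right; exists e.
Qed.

(** The empty set belongs to [nests] only for a corolla, where it is the full edge set, and it is
    not a nest. *)
Definition tight_nests x : {set {set 'I_n}} := T x :\ set0.

Lemma adjacent_span r N r' M e f : rooted r N -> rooted r' M -> e \in N -> f \in M ->
  adjacent e f -> exists2 u, span r N u & span r' M u.
Proof.
move=> rN rM eN fM; rewrite /adjacent /incident !(edgeE pt) /=.
have s1 := span_par rN eN; have s2 := span_par rM fM.
have s1' : span r N e.+1 by apply/spanP; right; exists e.
have s2' : span r' M f.+1 by apply/spanP; right; exists f.
by move=> /orP[]/orP[]/eqP uE; [exists (par e)|exists (par e)|exists e.+1|exists e.+1];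
  rewrite // uE.
Qed.

Lemma nesting_tight x : P x -> nesting (tight_nests x).
Proof.
move=> Px; apply/and3P; split.
- apply/forall_inP => N; rewrite !inE => /and3P[N0 NB _].
  by apply: nests_nest => //; rewrite inE.
- apply/implyP => n0; rewrite !inE eqxx orbT Px.1 eqxx !andbT.
  by apply/set0Pn; exists (Ordinal n0); rewrite inE.
apply/forall_inP => N; rewrite in_setD1 => /andP[N0 NT].
apply/forall_inP => M; rewrite in_setD1 => /andP[M0 MT].
apply/implyP => NM; apply/or3P.
have [sNM|nNM] := boolP (N \subset M); first by apply: Or31; rewrite properEneq NM.
have [sMN|nMN] := boolP (M \subset N); first by apply: Or32; rewrite properEneq eq_sym NM.
have /nests_rooted[r rN] := (tightP _ _ _ _ NT).1.
have /nests_rooted[r' rM] := (tightP _ _ _ _ MT).1.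
have no u : span r N u -> span r' M u -> False by apply: (@tight_no_overlap x N M r r' u).
apply: Or33; apply/andP; split.
  apply/eqP/setP => e; rewrite !inE; apply/negP => /andP[eN eM].
  by apply: (no e.+1); apply/spanP; right; exists e.
apply/forall_inP => e eN; apply/forall_inP => f fM; apply/negP => adj.
by have [u] := adjacent_span rN rM eN fM adj; exact: no.
Qed.

End Weights.

Section Nestings.
Variable NN : {set {set 'I_n}}.
Hypothesis nNN : nesting NN.

Lemma nesting_nest N : N \in NN -> nest N.
Proof. by case/and3P: nNN => /forall_inP h _ _; exact: h. Qed.

Lemma nesting_compatible N M : N \in NN -> M \in NN -> N != M -> compatible N M.
Proof. by case/and3P: nNN => _ _ /forall_inP h NN' MN'; move/forall_inP: (h N NN') => /(_ M MN')/implyP. Qed.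

Lemma nesting_top e : [set: 'I_n] \in NN.
Proof.
by case/and3P: nNN => _ /implyP h _; apply: h; exact: leq_ltn_trans (leq0n e) (ltn_ord e).
Qed.

Lemma min_nestP e : [/\ min_nest NN e \in NN, e \in min_nest NN e &
  forall M, M \in NN -> e \in M -> min_nest NN e \subset M].
Proof.
rewrite /min_nest.
pose Q N := (N \in NN) && (e \in N).
have QT : Q setT by rewrite /Q (nesting_top e) inE.
case: (arg_minnP (fun N : {set 'I_n} => #|N|) QT) => N /andP[NNN eN] Nmin; split => // M MN eM.
have [->//|NM] := eqVneq N M.
case/or3P: (nesting_compatible NNN MN NM) => [/proper_sub//|/proper_card|].
  by have := Nmin M; rewrite /Q MN eM => /(_ isT); rewrite leqNgt => /negbTE ->.
by move=> /andP[/eqP dis _]; have := in_set0 e; rewrite -dis inE eN eM.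
Qed.

(* If C is the largest minimal nest of an edge of K, an edge of K next to C but
   outside it would have a minimal nest incompatible with C. *)
Lemma nest_full K : nest K -> (forall f, f \in K -> min_nest NN f \subset K) ->
  exists2 f, f \in K & min_nest NN f = K.
Proof.
move=> nK fK; have [K0 _] := nestP pt _ nK; have [f0 f0K] := set0Pn _ K0.
case: (arg_maxnP (fun f => #|min_nest NN f|) f0K) => f fK' fmax.
have {}fK' : f \in K := fK'.
exists f => //; apply/eqP; apply: contraT => neq.
have [CN fC Cmin] := min_nestP f.
have pCK : min_nest NN f \proper K by rewrite properEneq neq fK.
have [e [g [eK eC gC adj]]] := nest_neighbour pt nK (nesting_nest CN) pCK.
have [C'N eC' C'min] := min_nestP e.
have CC' : min_nest NN f != min_nest NN e by apply: contraNneq eC => ->.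
case/or3P: (nesting_compatible CN C'N CC') => [/proper_card|/proper_sub/subsetP/(_ e eC')|].
- by have := fmax e eK; rewrite /= leqNgt => /negbTE ->.
- by rewrite (negbTE eC).
move=> /andP[_ /forall_inP/(_ g gC)/forall_inP/(_ e eC')].
have -> // : adjacent g e.
move: adj; rewrite /adjacent /incident => /orP[]/orP[]/eqP ->; rewrite eqxx ?orbT//.
Qed.

Lemma nesting_min N : N \in NN -> exists2 f, f \in N & min_nest NN f = N.
Proof.
move=> NNN; apply: nest_full; first exact: nesting_nest.
by move=> f fN; have [_ _] := min_nestP f; apply.
Qed.

(** Since [min_nest] maps the edges onto the nesting, a nesting has at most [ne t] nests, and
    exactly that many when [min_nest] is injective: this is the form in which maximality is used. *)
Lemma nesting_image : NN = [set min_nest NN e | e in [set: 'I_n]].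
Proof.
apply/setP => N; apply/idP/imsetP => [/nesting_min[f _ <-]|[e _ ->]]; first by exists f.
by have [] := min_nestP e.
Qed.

Lemma card_nesting : (#|NN| <= n)%N.
Proof. by rewrite nesting_image (leq_trans (leq_imset_card _ _))// cardsT card_ord. Qed.

End Nestings.

Lemma min_nest_inj (NN : {set {set 'I_n}}) : maximal_nesting NN -> injective (min_nest NN).
Proof.
move=> /andP[nNN /eqP cNN] e f.
have : {in [set: 'I_n] &, injective (min_nest NN)}.
  by apply/imset_injP; rewrite -(nesting_image nNN) cNN cardsT card_ord.
by apply; rewrite inE.
Qed.

Lemma maximal_nestingP (NN : {set {set 'I_n}}) : nesting NN -> injective (min_nest NN) -> maximal_nesting NN.
Proof.
move=> nNN inj; rewrite /maximal_nesting nNN /=.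
apply/eqP; transitivity #|[set min_nest NN e | e in [set: 'I_n]]|.
  by rewrite -nesting_image.
by rewrite card_imset// cardsT card_ord.
Qed.

Section Split.
Variables (r : nat) (N : {set 'I_n}) (e : 'I_n).
Hypotheses (rN : rooted r N) (eN : e \in N).

(** Cutting at e leaves two subtrees, possibly without edges; an edge belongs to the upper one when
    its upper end descends to e + 1 in [N :\ e]. *)
Definition upper_part : {set 'I_n} := [set f in N | (f != e) && (anc (N :\ e) f.+1 == e.+1)].
Definition lower_part : {set 'I_n} := [set f in N | (f != e) && (anc (N :\ e) f.+1 != e.+1)].

Lemma er_neq : r != e.+1.
Proof. by rewrite eq_sym (rooted_notin pt rN eN). Qed.

Lemma anc_cut_top : anc (N :\ e) e.+1 = e.+1.
Proof. by apply: anc_out => f; rewrite !inE eqSS => /andP[]. Qed.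

Lemma anc_cut_root : anc (N :\ e) r = r.
Proof.
by apply: anc_out => f /setD1P[_ fN]; exact: rooted_notin rN fN.
Qed.

Lemma anc_cut u : span r N u -> anc (N :\ e) u = r \/ anc (N :\ e) u = e.+1.
Proof.
elim/ltn_ind: u => u IH /spanP[->|[f fN uE]]; first by left; exact: anc_cut_root.
have [fe|fe] := eqVneq f e; first by right; rewrite uE fe anc_cut_top.
rewrite uE (anc_in pt); last by rewrite !inE fe.
by apply: IH (span_par rN fN); rewrite uE ltnS par_le.
Qed.

Lemma anc_cut_par : anc (N :\ e) (par e) = r.
Proof.
have [//|h] := anc_cut (span_par rN eN).
by have := anc_le pt (N :\ e) (par e); rewrite h ltnNge par_le.
Qed.

Lemma rooted_upper : rooted e.+1 upper_part.
Proof.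
apply/rootedP => f; rewrite inE => /and3P[fN fe /eqP].
rewrite (anc_in pt) ?inE ?fe// => fanc.
case: (rootedP _ _ rN f fN) => [pr|[g gN pg]].
  by have := er_neq; rewrite -fanc pr anc_cut_root eqxx.
have [ge|ge] := eqVneq g e; first by left; rewrite pg ge.
by right; exists g; rewrite // inE gN ge -pg fanc eqxx.
Qed.

Lemma rooted_lower : rooted r lower_part.
Proof.
apply/rootedP => f; rewrite inE => /and3P[fN fe].
rewrite (anc_in pt) ?inE ?fe// => fanc.
case: (rootedP _ _ rN f fN) => [pr|[g gN pg]]; first by left.
right; exists g => //; rewrite inE gN -pg fanc andbT.
by apply: contraNneq fanc => ge; rewrite pg ge anc_cut_top.
Qed.

Lemma big_split_part (F : 'I_n -> R) : \sum_(f in N) F f =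
  F e + (\sum_(f in upper_part) F f + \sum_(f in lower_part) F f).
Proof.
rewrite (big_setD1 e)//=; congr (_ + _).
rewrite (bigID (fun f => anc (N :\ e) f.+1 == e.+1)) /=; congr (_ + _);
by apply: eq_bigl => f; rewrite !inE andbCA andbA.
Qed.

Lemma span_upper u : (anc (N :\ e) u == e.+1) = span e.+1 upper_part u.
Proof.
apply/eqP/spanP => [|[->|[f + ->]]]; last 2 first.
- exact: anc_cut_top.
- by rewrite inE => /and3P[_ _ /eqP].
case: (stepP (N :\ e) u) => [f + uE|out]; last by rewrite anc_out//; left.
rewrite !inE => /andP[fe fN]; rewrite uE => h; right; exists f => //.
by rewrite inE fN fe h eqxx.
Qed.

Lemma span_lower u : (anc (N :\ e) u == r) = span r lower_part u.
Proof.
apply/eqP/spanP => [|[->|[f + ->]]]; last 2 first.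
- exact: anc_cut_root.
- rewrite inE => /and3P[fN fe h]; have [//|h'] : anc (N :\ e) f.+1 = r \/ anc (N :\ e) f.+1 = e.+1.
    by apply: anc_cut; apply/spanP; right; exists f.
  by rewrite h' eqxx in h.
case: (stepP (N :\ e) u) => [f + uE|out]; last by rewrite anc_out//; left.
rewrite !inE => /andP[fe fN]; rewrite uE => h; right; exists f => //.
by rewrite inE fN fe h er_neq.
Qed.

Lemma side_upper (u : 'I_(nv t)) : (u \in side N e e.+1) = span e.+1 upper_part u.
Proof.
rewrite -span_upper inE; apply/existsP/eqP => [[v /andP[/eqP vE]]|uE].
  by rewrite (joined_connectE pt) vE anc_cut_top => /eqP <-.
exists (Ordinal (lt_nv_edge pt e)); rewrite eqxx (joined_connectE pt) /=.
by rewrite anc_cut_top uE.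
Qed.

Lemma side_lower (u : 'I_(nv t)) : (u \in side N e (par e)) = span r lower_part u.
Proof.
rewrite -span_lower inE; apply/existsP/eqP => [[v /andP[/eqP vE]]|uE].
  by rewrite (joined_connectE pt) vE anc_cut_par => /eqP <-.
exists (Ordinal (lt_nv_par pt e)); rewrite eqxx (joined_connectE pt) /=.
by rewrite anc_cut_par uE.
Qed.

End Split.

Lemma rooted_anc_const q C N f g : rooted q C -> C \subset N -> f \in C -> g \in C ->
  anc N f.+1 = anc N g.+1.
Proof.
move=> qC /subsetP CN fC gC; suff h h' : h' \in C -> anc N h'.+1 = anc N q by rewrite !h.
have [k hk] := ubnP (val h'); elim: k => // k IH in h' hk * => hC.
rewrite (anc_in pt) ?CN//; case: (rootedP _ _ qC h' hC) => [->//|[h2 h2C p2]].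
have lt : (h2 < h')%N by rewrite -ltnS -p2 ltnS par_le.
by rewrite p2; apply: IH => //; exact: leq_trans lt hk.
Qed.

End NestFunction.

(** * Operahedra *)

Section VertexCoordinates.
Import mathcomp.boot.fintype mathcomp.boot.finset.
Variables (R : realType) (t : tree nat).
Hypothesis pt : planar_tree t.
Local Notation n := (ne t).
Implicit Types (e f g : 'I_n) (N M K C : {set 'I_n}) (r q u : nat) (x : 'rV[R]_n).

Variable w : 'I_(nv t) -> nat.
Hypothesis w_gt0 : forall v, (0 < w v)%N.

(** The default 1 keeps the weight positive at numbers that are not vertices. *)
Definition real_weight u : R := if insub u is Some v then (w v)%:R else 1.
Local Notation wR := real_weight.

Lemma real_weight_gt0 u : 0 < wR u.
Proof. by rewrite /wR; case: insubP => // v _ _; rewrite ltr0n. Qed.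

Lemma real_weightE (u : 'I_(nv t)) : wR u = (w u)%:R.
Proof. by rewrite /wR valK. Qed.

Lemma sum_span r N : rooted r N -> (r < nv t)%N ->
  ((\sum_(u : 'I_(nv t) | span r N u) w u)%N)%:R = subtree_weight wR r N.
Proof.
move=> rN rt; rewrite natr_sum (bigD1 (Ordinal rt)) /=; last by apply/spanP; left.
rewrite /subtree_weight -(real_weightE (Ordinal rt)); congr (_ + _).
rewrite (eq_bigl (mem [set Ordinal (lt_nv_edge pt e) | e in N])).
  rewrite big_imset /=; last by move=> e f _ _ [] /val_inj.
  by apply: eq_bigr => e _; rewrite -real_weightE.
move=> u; apply/andP/imsetP => [[/spanP[ur|[e eN ue]] neq]|[e eN ->]].
- by case/negP: neq; apply/eqP/val_inj.
- by exists e => //; apply: val_inj.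
split; first by apply/spanP; right; exists e.
by rewrite -val_eqE /=; exact: rooted_notin rN eN.
Qed.

(** A pair of vertices lies above the cut, below it, or is separated by it. The separated pairs
    contribute the product that is the e-th coordinate of a vertex of the operahedron. *)
Lemma pair_weight_split r N e : rooted r N -> e \in N ->
  pair_weight wR r N = pair_weight wR e.+1 (upper_part N e) +
    pair_weight wR r (lower_part N e) +
    subtree_weight wR e.+1 (upper_part N e) * subtree_weight wR r (lower_part N e).
Proof.
move=> rN eN; rewrite /pair_weight /subtree_weight !(big_split_part eN).
set A := \sum_(f in upper_part N e) wR f.+1; set B := \sum_(f in lower_part N e) wR f.+1.
set A2 := \sum_(f in upper_part N e) _; set B2 := \sum_(f in lower_part N e) _.
lra.
Qed.

Section MaximalNesting.
Variable NN : {set {set 'I_n}}.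
Hypothesis mNN : maximal_nesting NN.
Local Notation nNN := (andP mNN).1.
Local Notation M := (vertexM R NN w).

Lemma vertexME r e : rooted r (min_nest NN e) ->
  M 0 e = subtree_weight wR e.+1 (upper_part (min_nest NN e) e) *
          subtree_weight wR r (lower_part (min_nest NN e) e).
Proof.
move=> rN; have [_ eN _] := min_nestP nNN e.
have rt : (r < nv t)%N by apply: leq_ltn_trans (rooted_le pt rN eN) (lt_nv_par pt e).
rewrite -(sum_span (rooted_upper pt rN eN) (lt_nv_edge pt e)).
rewrite -(sum_span (rooted_lower pt e rN) rt) -natrM mxE !(edgeE pt) /=.
by congr ((_ * _)%:R); apply: eq_bigl => u; [exact: side_upper|exact: side_lower].
Qed.

(** The minimal nest of an edge of K avoids e, by injectivity of [min_nest], so it stays on one side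
    of the cut and [nest_full] applies. The boolean b selects the side. *)
Lemma part_in r e b K :
  K = [set f in min_nest NN e | (f != e) && ((anc (min_nest NN e :\ e) f.+1 == e.+1) == b)] ->
  rooted r K -> K = set0 \/ K \in NN.
Proof.
move=> KE rK; have [NNN eN Nmin] := min_nestP nNN e.
have [->|K0] := eqVneq K set0; [by left|right].
have sK f : f \in K -> [/\ f \in min_nest NN e, f != e &
    (anc (min_nest NN e :\ e) f.+1 == e.+1) = b].
  by rewrite KE inE => /and3P[? ? /eqP].
have nK : nest K by apply/(nestP pt); split => //; exists r.
have Kmin f : f \in K -> min_nest NN f \subset K.
  move=> fK; have [fN fe fanc] := sK f fK.
  have [CN fC Cmin] := min_nestP nNN f.
  have sCN : min_nest NN f \subset min_nest NN e by apply: Cmin.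
  have eC : e \notin min_nest NN f.
    apply/negP => /(Nmin _ CN) h; have /(min_nest_inj pt mNN) fe' : min_nest NN f = min_nest NN e.
      by apply/eqP; rewrite eqEsubset sCN.
    by rewrite fe' eqxx in fe.
  apply/subsetP => g gC; have [_ [q qC]] := nestP pt _ (nesting_nest nNN CN).
  have sCe : min_nest NN f \subset min_nest NN e :\ e.
    by apply/subsetP => h hC; rewrite !inE (subsetP sCN)// andbT; apply: contraNneq eC => <-.
  have := subsetP sCe g gC; rewrite !inE => /andP[ge gN].
  by rewrite KE inE gN ge -(rooted_anc_const pt qC sCe fC gC) fanc eqxx.
by have [f fK <-] := nest_full pt nNN nK Kmin; have [] := min_nestP nNN f.
Qed.

(** Induction on the size of N, cut at the edge e of which it is the minimal nest. A subtree K
    avoiding e lies in one of the two parts. One containing e is cut by e into [K1] and [K2], and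
    the pairs that e separates in K weigh at most the coordinate at e, with equality for K = N. *)
Lemma vertexM_sums k N r : (#|N| <= k)%N -> N = set0 \/ N \in NN -> rooted r N ->
  (forall q K, rooted q K -> K \subset N -> pair_weight wR q K <= setsum K M) /\
  pair_weight wR r N = setsum N M.
Proof.
have empty q : pair_weight wR q set0 = setsum set0 M.
  by rewrite pair_weight0 /setsum big_set0.
elim: k N r => [|k IH] N r.
  rewrite leqn0 cards_eq0 => /eqP -> _ _; split => // q K _.
  by rewrite subset0 => /eqP ->; rewrite empty.
move=> Nk [->|NNN] rN.
  by split => // q K _; rewrite subset0 => /eqP ->; rewrite empty.
have [e eN NE] := nesting_min pt nNN NNN.
have rN' : rooted r (min_nest NN e) by rewrite NE.
have cU : (#|upper_part N e| <= k)%N.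
  rewrite -ltnS; apply: leq_trans Nk; apply: proper_card; apply/properP; split.
    by apply/subsetP => f; rewrite inE => /andP[].
  by exists e; rewrite // inE eqxx andbF.
have cL : (#|lower_part N e| <= k)%N.
  rewrite -ltnS; apply: leq_trans Nk; apply: proper_card; apply/properP; split.
    by apply/subsetP => f; rewrite inE => /andP[].
  by exists e; rewrite // inE eqxx andbF.
have [|U1 U2] := IH _ e.+1 cU _ (rooted_upper pt rN eN).
  by apply: (part_in (e := e) (b := true)) (rooted_upper pt rN eN); rewrite NE; apply/setP => f; rewrite !inE eqb_id.
have [|L1 L2] := IH _ r cL _ (rooted_lower pt e rN).
  by apply: (part_in (e := e) (b := false)) (rooted_lower pt e rN); rewrite NE; apply/setP => f; rewrite !inE eqbF_neg.
have ME : M 0 e = subtree_weight wR e.+1 (upper_part N e) * subtree_weight wR r (lower_part N e).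
  by rewrite (vertexME rN') NE.
split; last first.
  by rewrite (pair_weight_split rN eN) U2 L2 /setsum (big_split_part eN) ME; lra.
move=> q K qK sKN; have [->|K0] := eqVneq K set0; first by rewrite empty.
have [eK|eK] := boolP (e \in K); last first.
  have sKe : K \subset N :\ e.
    by apply/subsetP => h hK; rewrite !inE (subsetP sKN)// andbT; apply: contraNneq eK => <-.
  have [f0 f0K] := set0Pn _ K0.
  have [h|h] := eqVneq (anc (N :\ e) f0.+1) e.+1.
    apply: U1 => //; apply/subsetP => f fK; rewrite inE (subsetP sKN)//=.
    rewrite (rooted_anc_const pt qK sKe fK f0K) h eqxx andbT.
    by apply: contraNneq eK => <-.
  apply: L1 => //; apply/subsetP => f fK; rewrite inE (subsetP sKN)//=.
  rewrite (rooted_anc_const pt qK sKe fK f0K) h andbT.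
  by apply: contraNneq eK => <-.
have qe : (q <= e)%N by apply: rooted_lt qK eK.
pose K1 := K :&: upper_part N e; pose K2 := K :&: lower_part N e.
have rK1 : rooted e.+1 K1.
  apply/rootedP => f; rewrite inE => /andP[fK fU].
  case: (rootedP _ _ (rooted_upper pt rN eN) f fU) => [|[g gU pg]]; [by left|right].
  exists g => //; rewrite inE gU andbT.
  case: (rootedP _ _ qK f fK) => [pq|[h hK ph]]; last first.
    by suff -> : g = h by []; apply: val_inj; move: pg; rewrite ph => -[].
  have := rooted_lt pt (rooted_upper pt rN eN) gU.
  by move: qe; rewrite -pq pg => h1 h2; have := ltn_trans h1 h2; rewrite ltnn.
have rK2 : rooted q K2.
  apply/rootedP => f; rewrite inE => /andP[fK fL].
  case: (rootedP _ _ qK f fK) => [|[g gK pg]]; [by left|right].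
  exists g => //; rewrite inE gK /=.
  have gN := subsetP sKN g gK; move: fL; rewrite inE => /and3P[fN fe].
  rewrite (anc_in pt) ?inE ?fe// pg => ganc; rewrite gN ganc andbT.
  by apply: contraNneq ganc => ->; rewrite anc_cut_top.
have sumK (F : 'I_n -> R) : \sum_(f in K) F f = F e + (\sum_(f in K1) F f + \sum_(f in K2) F f).
  rewrite (big_setD1 e)//=; congr (_ + _).
  rewrite (bigID (fun f => anc (N :\ e) f.+1 == e.+1)) /=; congr (_ + _);
  apply: eq_bigl => f; rewrite !inE; have [fK|_] := boolP (f \in K); rewrite ?andbF//;
  by rewrite (subsetP sKN f fK) andbT.
have -> : pair_weight wR q K = pair_weight wR e.+1 K1 + pair_weight wR q K2 +
    subtree_weight wR e.+1 K1 * subtree_weight wR q K2.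
  rewrite /pair_weight /subtree_weight !sumK.
  set A := \sum_(f in K1) wR f.+1; set B := \sum_(f in K2) wR f.+1.
  set A2 := \sum_(f in K1) _; set B2 := \sum_(f in K2) _; lra.
have sub_sum (A A' : {set 'I_n}) : A \subset A' ->
    \sum_(f in A) wR f.+1 <= \sum_(f in A') wR f.+1.
  move=> sA; rewrite (sum_setI _ A' A) (setIidPl sA) lerDl sumr_ge0// => f _.
  exact/ltW/real_weight_gt0.
have w1 : subtree_weight wR e.+1 K1 <= subtree_weight wR e.+1 (upper_part N e).
  by rewrite /subtree_weight lerD2l sub_sum// subsetIr.
have w2 : subtree_weight wR q K2 <= subtree_weight wR r (lower_part N e).
  (* If the root q of K is not r, it is still a vertex of the lower part: the upper end of an edge g
     that does not belong to [K2]. *)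
  have [<-|qr] := eqVneq q r; first by rewrite /subtree_weight lerD2l sub_sum// subsetIr.
  have [f fK pf] := rooted_root pt qK K0.
  have := span_par rN (subsetP sKN f fK); rewrite pf => /spanP[/eqP|[g gN qg]].
    by rewrite (negbTE qr).
  have gL : g \in lower_part N e.
    rewrite inE gN /=; apply/andP; split; first by apply: contraTneq qe => <-; rewrite qg ltnn.
    by rewrite ltn_eqF// (leq_ltn_trans (anc_le pt _ _))// -qg ltnS.
  have gK2 : g \notin K2 by apply/negP => /(rooted_notin pt rK2); rewrite qg eqxx.
  rewrite /subtree_weight qg -(big_setU1 g)//=.
  apply: le_trans (sub_sum _ (lower_part N e) _) _.
    by apply/subsetP => h /setU1P[->//|/setIP[]].
  by rewrite lerDr; exact/ltW/real_weight_gt0.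
have h1 := U1 _ _ rK1 (subsetIr _ _); have h2 := L1 _ _ rK2 (subsetIr _ _).
have pos p (A : {set 'I_n}) : 0 <= subtree_weight wR p A.
  by rewrite addr_ge0 ?sumr_ge0// => *; exact/ltW/real_weight_gt0.
have := ler_pM (pos _ _) (pos _ _) w1 w2; rewrite -ME.
rewrite /setsum sumK -/(setsum K1 M) -/(setsum K2 M); lra.
Qed.

End MaximalNesting.
End VertexCoordinates.

(** * The operahedron as a laminar polytope *)

Section Operahedra.
Import mathcomp.boot.fintype mathcomp.boot.finset.
Variables (R : realType) (t : tree nat).
Hypothesis pt : planar_tree t.
Local Notation n := (ne t).
Implicit Types (e f g : 'I_n) (N M K C : {set 'I_n}) (NN : {set {set 'I_n}}) (x : 'rV[R]_n).

(** Parents have smaller numbers, so the initial segments of the edge numbering are subtrees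
    containing the root; they form a chain of [ne t] nests. *)
Lemma exists_maximal_nesting : exists NN, maximal_nesting (t := t) NN.
Proof.
pose I (i : 'I_n) := [set e : 'I_n | (e <= i)%N].
have Iinj : injective I.
  have le i j : I i = I j -> (i <= j)%N.
    by move=> ij; have : i \in I i by [rewrite inE]; rewrite ij inE.
  by move=> i j ij; apply/val_inj/eqP; rewrite eqn_leq !le.
exists [set I i | i : 'I_n]; rewrite /maximal_nesting card_imset// card_ord eqxx andbT.
apply/and3P; split.
- apply/forall_inP => N /imsetP[i _ ->]; apply/(nestP pt); split.
    by apply/set0Pn; exists i; rewrite inE.
  exists 0%N; apply/rootedP => e; rewrite inE => ei; case pe: (par e) => [|k]; [by left|right].
  have ke : (k < e)%N by rewrite -pe par_le.
  by exists (Ordinal (ltn_trans ke (ltn_ord e))); rewrite // inE /= (leq_trans (ltnW ke)).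
- apply/implyP => n0; have mn : (n.-1 < n)%N by rewrite prednK.
  apply/imsetP; exists (Ordinal mn) => //; apply/setP => e; rewrite !inE /=.
  by rewrite -ltnS prednK// ltn_ord.
apply/forall_inP => N /imsetP[i _ ->]; apply/forall_inP => M /imsetP[j _ ->].
have sub (a b : 'I_n) : (a <= b)%N -> I a \subset I b.
  by move=> ab; apply/subsetP => e; rewrite !inE => /leq_trans; apply.
apply/implyP => neq; apply/or3P; case/orP: (leq_total i j) => /sub s.
  by apply: Or31; rewrite properEneq neq.
by apply: Or32; rewrite properEneq eq_sym neq.
Qed.

Lemma card_set1I e N : #|[set e] :&: N| = (e \in N) :> nat.
Proof.
case: (boolP (e \in N)) => eN; first by rewrite (setIidPl _) ?cards1// sub1set.
by apply/eqP; rewrite cards_eq0 setI_eq0 disjoints1.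
Qed.

Lemma dotpNr x (u : 'rV[R]_n) : dotp x (- u) = - dotp x u.
Proof. by rewrite dotpC dotpNl dotpC. Qed.

Section OneWeight.
Variable w : 'I_(nv t) -> nat.
Hypothesis w_gt0 : forall v, (0 < w v)%N.
Local Notation wR := (real_weight R w).
Local Notation c := (nest_weight wR).
Local Notation P := (lpoly (nests t) c).
Local Notation T := (tight (nests t) c).
Let wR_gt0 : forall u, 0 < wR u := real_weight_gt0 R w_gt0.

Lemma nests_top : [set: 'I_n] \in nests t.
Proof. by rewrite inE eqxx orbT. Qed.

Lemma top_cases NN : nesting NN -> [set: 'I_n] = set0 \/ [set: 'I_n] \in NN.
Proof.
move=> nNN; have [->|/set0Pn[e _]] := eqVneq [set: 'I_n] set0; [by left|right].
exact: nesting_top nNN e.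
Qed.

Lemma vertexM_lpoly NN : maximal_nesting NN ->
  P (vertexM R NN w) /\ NN \subset T (vertexM R NN w).
Proof.
move=> mNN; have nNN := (andP mNN).1.
have tE N : N = set0 \/ N \in NN -> c N = setsum N (vertexM R NN w).
  move=> NNN; have [r rN] : exists r, rooted r N.
    by case: NNN => [->|/(nesting_nest nNN)/(nestP pt)[_]//]; exists 0%N; exact: rooted0.
  by rewrite (nest_weightE _ _ rN)//; have [_] := vertexM_sums R pt w_gt0 mNN (leqnn _) NNN rN.
have PM : P (vertexM R NN w).
  split; first by rewrite tE//; exact: top_cases.
  move=> N /(nests_rooted pt)[r rN]; rewrite (nest_weightE _ _ rN)//.
  have [h _] := vertexM_sums R pt w_gt0 mNN (leqnn _) (top_cases nNN) (rooted_top pt).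
  by apply: h => //; exact: subsetT.
split => //; apply/subsetP => N NNN; rewrite inE nest_nests ?(nesting_nest nNN)//=.
by rewrite tE//; right.
Qed.

Lemma tight_nests_sub x : P x -> (#|tight_nests wR x| <= n)%N.
Proof. by move=> Px; apply: (card_nesting pt); exact: nesting_tight. Qed.

(** The nonempty tight sets form a nesting, which has at most [ne t] members, and [NN] already
    provides that many. *)
Lemma tight_vertexM NN : maximal_nesting NN -> tight_nests wR (vertexM R NN w) = NN.
Proof.
move=> mNN; have [PM /subsetP sT] := vertexM_lpoly mNN.
have nNN := (andP mNN).1.
apply/esym/eqP; rewrite eqEcard (eqP (andP mNN).2) tight_nests_sub// andbT.
apply/subsetP => N NNN; rewrite !inE -?[N \in T _]inE.
have [N0 _] := nestP pt _ (nesting_nest nNN NNN).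
by have := sT N NNN; rewrite !inE N0 => /andP[-> ->].
Qed.

(** The minimal nest of e consists of e and of the two parts cut off by e, each empty or in [NN]. So
    a direction of sum zero over all nests of [NN] vanishes at e. *)
Lemma prank_vertexM NN : maximal_nesting NN -> prank (nests t) c (vertexM R NN w) = 0%N.
Proof.
move=> mNN; have [PM /subsetP sT] := vertexM_lpoly mNN; have nNN := (andP mNN).1.
apply/eqP; rewrite mxrank_eq0 -submx0; apply/rV_subP => d /sub_perpP dT.
rewrite submx0; apply/eqP/rowP => e; rewrite mxE.
have d0 N : N = set0 \/ N \in NN -> setsum N d = 0.
  by case=> [->|/sT/dT//]; rewrite /setsum big_set0.
have [NNN eN _] := min_nestP nNN e.
have [_ [r rN]] := nestP pt _ (nesting_nest nNN NNN).
have U : upper_part (min_nest NN e) e = set0 \/ upper_part (min_nest NN e) e \in NN.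
  apply: (part_in pt mNN (e := e) (b := true)) (rooted_upper pt rN eN).
  by apply/setP => f; rewrite !inE eqb_id.
have L : lower_part (min_nest NN e) e = set0 \/ lower_part (min_nest NN e) e \in NN.
  apply: (part_in pt mNN (e := e) (b := false)) (rooted_lower pt e rN).
  by apply/setP => f; rewrite !inE eqbF_neg.
have := d0 _ (or_intror NNN); rewrite /setsum (big_split_part eN).
by rewrite -/(setsum _ d) -/(setsum _ d) (d0 _ U) (d0 _ L) !addr0.
Qed.

(** If two edges e and f have the same minimal tight nest, the tight nests do not separate them, and
    1_e - 1_f is a direction along which these nests stay tight. *)
Lemma maximal_or_direction x : P x -> maximal_nesting (tight_nests wR x) \/
  exists e f, e != f /\ forall N, N \in T x -> (e \in N) = (f \in N).
Proof.
move=> Px; have nNN := nesting_tight pt wR_gt0 Px.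
have [/injectiveP inj|/injectivePn[e [f ef mef]]] := boolP (injectiveb (min_nest (tight_nests wR x))).
  by left; apply: maximal_nestingP.
right; exists e, f; split => // N NT; have [->|N0] := eqVneq N set0; first by rewrite !inE.
have NNN : N \in tight_nests wR x by rewrite in_setD1 N0.
have [_ ee emin] := min_nestP nNN e; have [_ ff fmin] := min_nestP nNN f.
apply/idP/idP => [/(emin _ NNN)|/(fmin _ NNN)] /subsetP h; apply: h.
  by rewrite mef.
by rewrite -mef.
Qed.

Lemma vertexM_eq x NN : maximal_nesting NN -> tight_nests wR x = NN -> x = vertexM R NN w.
Proof.
move=> mNN xNN; apply: (prank0_eq (prank_vertexM mNN)); apply/subsetP => N NT.
have [N0|N0] := eqVneq N set0.
  by move: NT; rewrite N0 !inE => /andP[-> /=]; rewrite /setsum !big_set0.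
by have : N \in NN by [rewrite -(tight_vertexM mNN) in_setD1 N0]; rewrite -xNN in_setD1 => /andP[].
Qed.

Lemma prank0_maximal x : P x -> prank (nests t) c x = 0%N ->
  maximal_nesting (tight_nests wR x) /\ x = vertexM R (tight_nests wR x) w.
Proof.
move=> Px x0; have [mT|[e [f [ef efN]]]] := maximal_or_direction Px.
  by split => //; exact: vertexM_eq.
pose d := signvec R [set e] [set f].
have : (d <= perp R (T x))%MS.
  apply/sub_perpP => N /efN h; rewrite setsum_signvec.
  by rewrite !card_set1I h subrr.
move/eqP: x0; rewrite mxrank_eq0 => /eqP ->; rewrite submx0 => /eqP/rowP/(_ e).
by rewrite !mxE !inE eqxx (negbTE ef) subr0 => /eqP; rewrite oner_eq0.
Qed.

(** One moves along d until a further inequality becomes tight; [N0] guarantees that this happens,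
    and the least ratio tells when. *)
Lemma lpoly_more_tight x d N0 : P x -> (forall N, N \in T x -> setsum N d = 0) ->
  N0 \in nests t -> setsum N0 d < 0 ->
  exists l, [/\ 0 < l, P (x + l *: d) & T x \proper T (x + l *: d)].
Proof.
move=> Px dT N0B dN0.
pose Q N := (N \in nests t) && (setsum N d < 0).
have QN0 : Q N0 by rewrite /Q N0B.
pose ratio N := (setsum N x - c N) / - setsum N d.
case: (@Order.TotalTheory.arg_minP _ _ _ N0 Q ratio QN0) => N /andP[NB dN] Nmin.
have sl : 0 < setsum N x - c N.
  rewrite lt_neqAle subr_ge0 Px.2// andbT eq_sym subr_eq0; apply/negP => h.
  by move: dN; rewrite dT ?ltxx// inE NB.
have l0 : 0 < ratio N by rewrite divr_gt0// oppr_gt0.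
exists (ratio N).
have Pl : P (x + ratio N *: d).
  split.
    by rewrite setsumD setsumZ dT ?mulr0 ?addr0 ?Px.1// inE nests_top Px.1 eqxx.
  move=> M MB; rewrite setsumD setsumZ; have := Px.2 _ MB.
  have [dM|dM] := ltP (setsum M d) 0; last by have := mulr_ge0 (ltW l0) dM; lra.
  have QM : Q M by rewrite /Q MB.
  have := Nmin M QM; rewrite {2}/ratio ler_pdivlMr ?oppr_gt0// mulrN; lra.
split => //; apply/properP; split.
  by apply/subsetP => M MT; move: (MT); rewrite !inE setsumD setsumZ dT// mulr0 addr0.
exists N; last by rewrite inE NB /= -subr_eq0 gt_eqF.
have dn : setsum N d != 0 by rewrite lt_eqF.
rewrite inE NB /= setsumD setsumZ /ratio invrN mulrN mulNr -mulrA mulVf//.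
by rewrite mulr1 opprB addrCA subrr addr0.
Qed.

Lemma direction_tight x e f : P x -> e != f ->
  (forall N, N \in T x -> (e \in N) = (f \in N)) ->
  exists l, [/\ 0 < l, P (x + l *: signvec R [set e] [set f])
               & T x \proper T (x + l *: signvec R [set e] [set f])].
Proof.
move=> Px ef efN; apply: (lpoly_more_tight (N0 := [set f])) => //.
- move=> N /efN h; rewrite setsum_signvec.
  by rewrite !card_set1I h subrr.
- apply: nest_nests; apply/(nestP pt); split; first by apply/set0Pn; exists f; rewrite inE.
  by exists (par f); exact: rooted1.
by rewrite setsum1 !mxE !inE eqxx eq_sym (negbTE ef) sub0r oppr_lt0.
Qed.

(** Induction on the number of nests that are not tight. A point whose tight nests do not form a
    maximal nesting lies between two points, on the line in direction 1_e - 1_f, with more tight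
    nests. *)
Lemma lpoly_sub_hull x : P x -> hull [set vertexM R NN w | NN in [set NN | maximal_nesting NN]]%classic x.
Proof.
move: {2}(#|nests t| - #|T x|)%N (leqnn (#|nests t| - #|T x|)) => k.
elim: k x => [|k IH] x xk Px; have [mT|[e [f [ef efN]]]] := maximal_or_direction Px.
- by apply: sub_hull; exists (tight_nests wR x) => //; apply/esym/vertexM_eq.
(* All nests are tight already, so a step cannot make another one tight. *)
- exfalso; have [l [_ _ /proper_card]] := direction_tight Px ef efN.
  rewrite ltnNge; apply/negP; rewrite negbK; apply: leq_trans (_ : (#|nests t| <= _)%N).
    by apply/subset_leq_card/subsetP => N; rewrite inE => /andP[].
  by rewrite -subn_eq0 -leqn0.
- by apply: sub_hull; exists (tight_nests wR x) => //; apply/esym/vertexM_eq.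
have meas y : T x \proper T y -> (#|nests t| - #|T y| <= k)%N.
  move=> /proper_card lt; have : (#|T y| <= #|nests t|)%N.
    by apply/subset_leq_card/subsetP => N; rewrite inE => /andP[].
  by move: xk lt; lia.
have [l [l0 Pl Tl]] := direction_tight Px ef efN.
have fe : f != e by rewrite eq_sym.
have [m [m0 Pm Tm]] := direction_tight Px fe (fun N NT => esym (efN N NT)).
(* The point x is at distances l and m, in units of d, from the two ends, hence the coefficient
   [m / (l + m)] of the first end. *)
have := hull_convex (IH _ (meas _ Tl) Pl) (IH _ (meas _ Tm) Pm) (t := m / (l + m)).
have lm : 0 < l + m by rewrite addr_gt0.
have -> : signvec R [set f] [set e] = - signvec R [set e] [set f].
  by apply/rowP => i; rewrite !mxE opprB.
have -> : m / (l + m) *: (x + l *: signvec R [set e] [set f]) +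
    (1 - m / (l + m)) *: (x + m *: - signvec R [set e] [set f]) = x.
  set d := signvec _ _ _; apply/rowP => i; rewrite !mxE.
  have -> : 1 - m / (l + m) = l / (l + m).
    by field; rewrite gt_eqF.
  by field; rewrite gt_eqF.
by apply; rewrite divr_ge0 ?(ltW m0) ?(ltW lm)//= ler_pdivrMr// mul1r lerDr ltW.
Qed.

Lemma operahedronE : operahedron w = P.
Proof.
apply/seteqP; split => [x hx|]; last exact: lpoly_sub_hull.
split.
  rewrite setsum_ind; apply: hull_dotp_eq hx => _ [NN mNN <-].
  by rewrite -setsum_ind; have [[]] := vertexM_lpoly mNN.
move=> N NB; rewrite setsum_ind -lerN2 -[leLHS]dotpNr.
apply: hull_dotp_le hx => _ [NN mNN <-].
by rewrite dotpNr lerN2 -setsum_ind; apply: (vertexM_lpoly mNN).1.2.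
Qed.

Lemma operahedron_laminar : laminar_polytope (nests t) c.
Proof.
split; [exact: nests_top|by move=> x; apply: tight_laminar|].
rewrite -operahedronE; exists [set vertexM R NN w | NN in [set NN | maximal_nesting NN]]%classic => //.
exact/finite_image/finite_finset.
Qed.

End OneWeight.

Lemma std_gt0 (v : 'I_(nv t)) : (0 < std t v)%N. Proof. by []. Qed.

Section TwoWeights.
Variables w w' : 'I_(nv t) -> nat.
Hypotheses (w_gt0 : forall v, (0 < w v)%N) (w'_gt0 : forall v, (0 < w' v)%N).

Record weight_transition (f : 'rV[R]_n -> 'rV[R]_n) : Prop := WeightTransition {
  wt_transition : transition (nests t) (nest_weight (real_weight R w)) (nest_weight (real_weight R w')) f;
  wt_vertex : forall NN, maximal_nesting NN -> f (vertexM R NN w) = vertexM R NN w' }.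

(** The initial data send the vertex of a nesting to the vertex of the same nesting for the other
    weight; both are tight for the same nests. *)
Lemma weight_transition_exists : exists f : 'rV[R]_n -> 'rV[R]_n, weight_transition f.
Proof.
have [x Px x0|f [tf fg]] := transition_exists (operahedron_laminar w_gt0) (operahedron_laminar w'_gt0)
   (g := fun x => vertexM R (tight_nests (real_weight R w) x) w').
  have [mT xE] := prank0_maximal w_gt0 Px x0.
  have [PM /subsetP sT] := vertexM_lpoly w'_gt0 mT; split => //.
  apply/subsetP => N NT; have [N0|N0] := eqVneq N set0; last first.
    by apply: sT; rewrite in_setD1 N0.
  by move: NT; rewrite N0 !inE => /andP[-> /=]; rewrite /setsum !big_set0 /nest_weight !pair_weight0.
exists f; split => // NN mNN; have [PM _] := vertexM_lpoly w_gt0 mNN.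
by rewrite (fg _ PM (prank_vertexM w_gt0 mNN)) (tight_vertexM w_gt0 mNN).
Qed.

End TwoWeights.
End Operahedra.

(** * Uniqueness of transition maps *)

Section TransitionMaps.
Variable R : realType.

(** The halving principle applied to the norm of f - g. The type [X] is arbitrary because pairs of
    points will be used as well. *)
Lemma midpoint_unique m (X : Type) (S : X -> Prop) (rk : X -> nat) (b t : X -> X)
    (f g : X -> 'rV[R]_m) (K : R) :
  (forall x, S x -> S (b x) /\ S (t x)) ->
  (forall x, S x -> (rk (b x) + rk (t x) <= rk x)%N) ->
  (forall x, S x -> `|f x| <= K /\ `|g x| <= K) ->
  (forall x, S x -> rk x = 0%N -> f x = g x) ->
  (forall x, S x -> f x = 2^-1 *: (f (b x) + f (t x))) ->
  (forall x, S x -> g x = 2^-1 *: (g (b x) + g (t x))) ->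
  forall x, S x -> f x = g x.
Proof.
move=> Sbt rkbt bnd fg0 fmid gmid x Sx.
apply/eqP; rewrite -subr_eq0 -normr_le0.
apply: (@halving_principle R X S rk b t (fun x => `|f x - g x|) (K + K)) => //.
- by move=> y /bnd[h1 h2]; apply: le_trans (ler_normB _ _) _; exact: lerD.
- by move=> y Sy y0; rewrite fg0// subrr normr0.
move=> y Sy; rewrite fmid// [X in _ - X]gmid// -scalerBr opprD addrACA normrZ ger0_norm ?invr_ge0//.
by rewrite mulrC ler_pM2r ?invr_gt0// ler_normD.
Qed.

Variable t : tree nat.
Hypothesis pt : planar_tree t.
Local Notation n := (ne t).
Local Notation c w := (nest_weight (real_weight R w)).
Local Notation P w := (lpoly (nests t) (c w)).
Local Notation pos w := (forall v, (0 < w v)%N).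

Lemma weight_transition_unique w w' f g : pos w -> pos w' ->
  weight_transition w w' f -> weight_transition w w' g ->
  forall x, P w x -> f x = g x.
Proof.
move=> w0 w'0 [tf vf] [tg vg].
have LP := operahedron_laminar R pt w0; have LP' := operahedron_laminar R pt w'0.
have [v pv] := exists_principal R n; have [K K0 PK] := lpoly_bounded LP'.
apply: (@midpoint_unique _ _ _ (prank (nests t) (c w))
  (fun z => bot_pt v (reflected (P w) z)) (fun z => top_pt v (reflected (P w) z)) _ _ K).
- by move=> x /(bot_top_good_pair LP pv)[[]].
- by move=> x; exact: prank_bot_top.
- by move=> x Px; split; apply/PK; [exact: trans_fun tf _ Px|exact: trans_fun tg _ Px].
- by move=> x Px /(prank0_maximal pt w0 Px)[mT ->]; rewrite vf ?vg.
- by move=> x; exact: trans_mid LP LP' tf pv.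
- by move=> x; exact: trans_mid LP LP' tg pv.
Qed.

Lemma weight_transition_id w : pos w -> weight_transition (R := R) (t := t) w w id.
Proof.
by move=> w0; split => //; split => //; apply: continuous_subspaceT => ? ?.
Qed.

Lemma weight_transition_comp w1 w2 w3 f g :
  weight_transition (R := R) (t := t) w1 w2 f -> weight_transition w2 w3 g ->
  weight_transition w1 w3 (fun z => g (f z)).
Proof.
move=> [tf vf] [tg vg]; split => [|NN mNN]; last by rewrite vf// vg.
split.
- exact: comp_within_continuous (trans_cont tf) (trans_fun tf) (trans_cont tg).
- by move=> z /(trans_fun tf); exact: trans_fun.
- move=> z Pz; apply: fintype.subset_trans (trans_tight tf Pz) _.
  exact: trans_tight (trans_fun tf Pz).
move=> v z pv Pz; rewrite (trans_diag tg pv (trans_fun tf Pz)).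
by have /eq_row_mx[-> ->] := trans_diag tf pv Pz.
Qed.

Lemma weight_transition_inv w w' f g : pos w -> pos w' ->
  weight_transition w w' f -> weight_transition w' w g ->
  forall x, P w x -> g (f x) = x.
Proof.
move=> w0 w'0 wf wg x Px.
by apply: (weight_transition_unique w0 w0 (weight_transition_comp wf wg) (weight_transition_id w0)).
Qed.

Lemma lodayE : loday t = P (std t).
Proof. by rewrite /loday operahedronE. Qed.

(** The constructed map shows that [xget] has something to choose from. The choice agrees with it by
    uniqueness, from which the compatibility with tight sets is inherited. *)
Lemma trP w : pos w -> weight_transition (std t) w (tr (R := R) w).
Proof.
move=> w0; have s0 := @std_gt0 t.
have LP := operahedron_laminar R pt s0; have LP' := operahedron_laminar R pt w0.
have [f [tf vf]] := weight_transition_exists R pt s0 w0.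
have isf : is_transition w f.
  split; rewrite ?lodayE ?operahedronE//.
  - exact: trans_cont tf.
  - exact: trans_fun tf.
  - by move=> v pv z Pz; apply: (trans_diag tf).
have [] : is_transition w (tr (R := R) w) by apply: (xgetPex _ (P := [set f | is_transition w f])); exists f.
rewrite lodayE (operahedronE R pt w0) => tc tm tv td.
have eqf : forall x, P (std t) x -> tr (R := R) w x = f x.
  have [v pv] := exists_principal R n; have [K K0 PK] := lpoly_bounded LP'.
  apply: (@midpoint_unique _ _ _ (prank (nests t) (c (std t)))
    (fun z => bot_pt v (reflected (P (std t)) z)) (fun z => top_pt v (reflected (P (std t)) z)) _ _ K).
  - by move=> x /(bot_top_good_pair LP pv)[[]].
  - by move=> x; exact: prank_bot_top.
  - by move=> x Px; split; apply/PK; [exact: tm|exact: trans_fun tf _ Px].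
  - by move=> x Px /(prank0_maximal pt s0 Px)[mT ->]; rewrite vf ?tv.
  - move=> x Px; have [_ {1}<-] := bot_top_good_pair LP' pv (tm _ Px).
    by have /eq_row_mx[-> ->] := td v pv x Px.
  - by move=> x; exact: trans_mid LP LP' tf pv.
by split => //; split => // [z Pz|v z pv Pz]; [rewrite eqf//; exact: (trans_tight tf)|exact: td].
Qed.

Lemma tr_std x : P (std t) x -> tr (std t) x = x.
Proof.
move=> Px; have s0 := @std_gt0 t.
exact: (weight_transition_unique s0 s0 (trP s0) (weight_transition_id s0)).
Qed.

(** Neither the transition nor its inverse can remove a tight set. *)
Lemma weight_transition_tight w w' f : pos w -> pos w' -> weight_transition w w' f ->
  forall x, P w x -> tight (nests t) (c w') (f x) = tight (nests t) (c w) x.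
Proof.
move=> w0 w'0 wf x Px; have [g wg] := weight_transition_exists R pt w'0 w0.
apply/eqP; rewrite finset.eqEsubset (trans_tight (wt_transition wf) Px) andbT.
have := trans_tight (wt_transition wg) (trans_fun (wt_transition wf) Px).
by rewrite (weight_transition_inv w0 w'0 wf wg).
Qed.

End TransitionMaps.

(** * Substitution of trees *)

Section TreeOperations.

Section GraftForest.
Variable T : Type.

(** The anonymous inner fixpoint of [graft] under a name; [graft_node] holds by conversion. *)
Fixpoint graft_forest (us ts : seq (tree T)) : seq (tree T) :=
  if us is u :: us' then
    graft u (take (leaves u) ts) :: graft_forest us' (drop (leaves u) ts)
  else [::].

End GraftForest.

Lemma graft_node (T : Type) (x : T) us ts : graft (Node x us) ts = Node x (graft_forest us ts).
Proof. by []. Qed.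

Lemma size_graft_forest (T : Type) (us ts : seq (tree T)) : size (graft_forest us ts) = size us.
Proof. by elim: us ts => //= u us IH ts; rewrite IH. Qed.

Section Maps.
Variables (T T' : Type) (f : T -> T').

Lemma labels_tmap t : labels (tmap f t) = map f (labels t).
Proof.
elim/tree_nested_ind: t => //= x ts IHts; congr (_ :: _).
by elim: ts IHts => //= s ts IH [-> /IH ->]; rewrite map_cat.
Qed.

Lemma arities_tmap t : arities (tmap f t) = arities t.
Proof.
elim/tree_nested_ind: t => //= x ts IHts; rewrite size_map; congr (_ :: _).
by elim: ts IHts => //= s ts IH [-> /IH ->].
Qed.

Lemma leaves_tmap t : leaves (tmap f t) = leaves t.
Proof.
elim/tree_nested_ind: t => //= x ts IHts.
by elim: ts IHts => //= s ts IH [-> /IH ->].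
Qed.

Lemma edges_tmap t : edges (tmap f t) = [seq (f e.1, f e.2) | e <- edges t].
Proof.
elim/tree_nested_ind: t => //= x ts IHts.
by elim: ts IHts => //= s ts IH [-> /IH ->]; rewrite !map_cat; case: s.
Qed.

Lemma graft_tmap t ts : graft (tmap f t) (map (tmap f) ts) = tmap f (graft t ts).
Proof.
elim/tree_nested_ind: t ts => [|x us IHus] ts; first by case: ts.
rewrite /= -/(graft_forest _ _) -/(graft_forest us ts); congr (Node _ _).
elim: us IHus ts => //= u us IH [hu /IH{}IH] ts.
by rewrite leaves_tmap -map_take -map_drop hu IH.
Qed.

End Maps.

Lemma tmap_comp (T T' T'' : Type) (f : T' -> T'') (g : T -> T') t :
  tmap f (tmap g t) = tmap (fun x => f (g x)) t.
Proof.
elim/tree_nested_ind: t => //= x ts IHts; congr (Node _ _).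
by elim: ts IHts => //= s ts IH [-> /IH ->].
Qed.

Lemma eq_in_tmap (T : eqType) (T' : Type) (f g : T -> T') t :
  {in labels t, f =1 g} -> tmap f t = tmap g t.
Proof.
elim/tree_nested_ind: t => //= x ts IHts fg; congr (Node _ _).
  by apply: fg; rewrite mem_head.
have {}fg : {in flatten [seq labels s | s <- ts], f =1 g}.
  by move=> y yt; apply: fg; rewrite inE yt orbT.
elim: ts IHts fg => //= s ts IH [hs hts] fg; rewrite hs ?IH// => y yt;
by apply: fg; rewrite mem_cat yt ?orbT.
Qed.

Lemma tmap_id (T : Type) (t : tree T) : tmap id t = t.
Proof.
elim/tree_nested_ind: t => //= x ts IHts; congr (Node _ _).
by elim: ts IHts => //= s ts IH [-> /IH ->].
Qed.

(** Keeping each arity with its label allows the vertices of a substitution to be counted without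
    following their order. *)
Fixpoint label_arities (T : Type) (t : tree T) : seq (T * nat) :=
  if t is Node x ts then (x, size ts) :: flatten [seq label_arities s | s <- ts] else [::].

Section Generic.
Variable T : Type.
Implicit Types (t s r u : tree T) (ts us : seq (tree T)) (a b : pred T).

Lemma labels_label_arities t : labels t = map fst (label_arities t).
Proof.
elim/tree_nested_ind: t => //= x ts IHts; congr (_ :: _).
by elim: ts IHts => //= s ts IH [-> /IH ->]; rewrite map_cat.
Qed.

Lemma arities_label_arities t : arities t = map snd (label_arities t).
Proof.
elim/tree_nested_ind: t => //= x ts IHts; congr (_ :: _).
by elim: ts IHts => //= s ts IH [-> /IH ->]; rewrite map_cat.
Qed.

Lemma size_labels_arities t : size (labels t) = size (arities t).
Proof. by rewrite labels_label_arities arities_label_arities !size_map. Qed.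

Lemma leaves_graft t ts : size ts = leaves t -> leaves (graft t ts) = sumn [seq leaves s | s <- ts].
Proof.
elim/tree_nested_ind: t ts => [|x us IHus] ts.
  by case: ts => [|s []]//= _; rewrite addn0.
rewrite graft_node /=; elim: us IHus ts => [_ [|]|u us IH [hu /IH{}IH] ts]//= szts.
have lu : (leaves u <= size ts)%N by rewrite szts leq_addr.
rewrite hu ?size_takel// IH; last by rewrite size_drop szts addKn.
by rewrite -sumn_cat -map_cat cat_take_drop.
Qed.

Lemma graft_forest_cat us1 us2 ts : graft_forest (us1 ++ us2) ts =
  graft_forest us1 (take (sumn [seq leaves u | u <- us1]) ts) ++
  graft_forest us2 (drop (sumn [seq leaves u | u <- us1]) ts).
Proof.
elim: us1 ts => [|u us IH] ts /=; first by rewrite drop0.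
rewrite IH take_takel ?leq_addr// drop_drop addnC.
by rewrite take_drop addnC.
Qed.

Lemma graft_graft r us ts : size us = leaves r ->
  size ts = sumn [seq leaves u | u <- us] ->
  graft (graft r us) ts = graft r (graft_forest us ts).
Proof.
elim/tree_nested_ind: r us ts => [|x vs IHvs] us ts.
  by case: us => [|u []]//= _; rewrite addn0 => <-; rewrite take_size.
rewrite !graft_node /= => szus szts; congr (Node _ _).
elim: vs IHvs us ts szus szts => [_ [|]|v vs IH [hv /IH{}IH] us ts]//= szus szts.
have lv : (leaves v <= size us)%N by rewrite szus leq_addr.
have sz1 : size (take (leaves v) us) = leaves v by rewrite size_takel.
have szts' := szts; rewrite -(cat_take_drop (leaves v) us) map_cat sumn_cat in szts'.
have -> : graft_forest us ts = graft_forest (take (leaves v) us ++ drop (leaves v) us) ts.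
  by rewrite cat_take_drop.
rewrite graft_forest_cat take_cat drop_cat size_graft_forest sz1 ltnn subnn take0 drop0 cats0.
rewrite leaves_graft// hv// ?size_takel ?szts' ?leq_addr//.
by rewrite IH// ?size_drop ?szus ?szts' ?addKn.
Qed.

Lemma count_label_arities_graft (p : pred (T * nat)) t ts : size ts = leaves t ->
  count p (label_arities (graft t ts)) =
  (count p (label_arities t) + sumn [seq count p (label_arities s) | s <- ts])%N.
Proof.
elim/tree_nested_ind: t ts => [|x us IHus] ts.
  by case: ts => [|s []]//= _; rewrite addn0.
rewrite graft_node /= size_graft_forest -addnA => szts; congr (_ + _)%N.
elim: us IHus ts szts => [_ [|]|u us IH [hu /IH{}IH] ts]//= szts.
have lu : (leaves u <= size ts)%N by rewrite szts leq_addr.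
rewrite !count_cat hu ?size_takel// IH; last by rewrite size_drop szts addKn.
by rewrite addnACA -sumn_cat -map_cat cat_take_drop.
Qed.

Definition substitutable a s t : bool :=
  all (fun p => a p.1 ==> (p.2 == leaves s)) (label_arities t).

Lemma substitutable_forest a s x ts : substitutable a s (Node x ts) ->
  (a x -> size ts = leaves s) /\ all (substitutable a s) ts.
Proof.
move=> /andP[/implyP h]; move=> ok; split; first by move=> /h/eqP.
have {}ok : all (fun p => a p.1 ==> (p.2 == leaves s)) (flatten (map (@label_arities T) ts)) := ok.
by elim: ts ok {h} => //= u us IH; rewrite all_cat => /andP[ou /IH ->]; rewrite andbT.
Qed.

Lemma leaves_subst a s t : substitutable a s t -> leaves (subst a s t) = leaves t.
Proof.
elim/tree_nested_ind: t => //= x ts IHts /substitutable_forest[ax ok].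
have E : [seq leaves u | u <- [seq subst a s u | u <- ts]] = [seq leaves u | u <- ts].
  by elim: ts IHts ok {ax} => //= u us IH [hu /IH{}IH] /andP[/hu -> /IH ->].
case: ifP => [/ax szts|_] /=; last by rewrite E.
by rewrite leaves_graft ?E// size_map.
Qed.

Lemma map_subst_forest a s ts : all (substitutable a s) ts ->
  [seq leaves u | u <- [seq subst a s u | u <- ts]] = [seq leaves u | u <- ts].
Proof. by elim: ts => //= u us IH /andP[/leaves_subst -> /IH ->]. Qed.

Lemma subst_id a s t : ~~ has a (labels t) -> subst a s t = t.
Proof.
elim/tree_nested_ind: t => //= x ts IHts; rewrite negb_or => /andP[/negbTE -> h].
congr (Node _ _); elim: ts IHts h => //= u us IH [hu /IH{}IH].
by rewrite has_cat negb_or => /andP[/hu -> /IH ->].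
Qed.

(** The vertices that are kept, and one copy of s for each replaced vertex. *)
Lemma count_label_arities_subst (p : pred (T * nat)) a s t : substitutable a s t ->
  count p (label_arities (subst a s t)) =
  (count (fun y => p y && ~~ a y.1) (label_arities t) +
   count a (labels t) * count p (label_arities s))%N.
Proof.
elim/tree_nested_ind: t => //= x ts IHts /substitutable_forest[ax ok].
have E : sumn [seq count p (label_arities u) | u <- [seq subst a s u | u <- ts]] =
  (count (fun y => p y && ~~ a y.1) (flatten [seq label_arities u | u <- ts]) +
   count a (flatten [seq labels u | u <- ts]) * count p (label_arities s))%N.
  elim: ts IHts ok {ax} => //= u us IH [hu /IH{}IH] /andP[/hu -> /IH ->].
  by rewrite !count_cat mulnDl addnACA.
case: ifP => [/ax szts|_] /=; last first.
  by rewrite size_map andbT add0n -addnA -E count_flatten -[in LHS]map_comp.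
by rewrite count_label_arities_graft ?size_map// E andbF add0n mulnDl mul1n addnCA.
Qed.

Lemma subst_graft b r s ts : size ts = leaves s -> substitutable b r s ->
  subst b r (graft s ts) = graft (subst b r s) [seq subst b r u | u <- ts].
Proof.
elim/tree_nested_ind: s ts => [|x us IHus] ts; first by case: ts => [|u []].
move=> szts /substitutable_forest[bx ok].
have E : [seq subst b r u | u <- graft_forest us ts] =
    graft_forest [seq subst b r u | u <- us] [seq subst b r u | u <- ts].
  move: szts => /=; elim: us IHus ts ok {bx} => [|u us IH] //= [hu /IH{}IH] ts /andP[oku okus] szts.
  have lu : (leaves u <= size ts)%N by rewrite szts leq_addr.
  by rewrite hu ?size_takel// leaves_subst// -map_take -map_drop IH// size_drop szts addKn.
rewrite graft_node /= E; case: ifP => [/bx szus|_] //.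
by rewrite graft_graft ?size_map// map_subst_forest.
Qed.

Lemma subst_subst_seq a b s r t : ~~ has b (labels t) -> substitutable a s t ->
  substitutable b r s -> subst b r (subst a s t) = subst a (subst b r s) t.
Proof.
move=> + + okr; elim/tree_nested_ind: t => //= x ts IHts.
rewrite negb_or => /andP[/negbTE bx nb] /substitutable_forest[ax ok].
have E : [seq subst b r u | u <- [seq subst a s u | u <- ts]] = [seq subst a (subst b r s) u | u <- ts].
  elim: ts IHts nb ok {ax} => //= u us IH [hu /IH{}IH].
  by rewrite has_cat negb_or => /andP[/hu{}hu /IH{}IH] /andP[/hu -> /IH ->].
case: ifP => [/ax szts|_] /=; last by rewrite bx E.
by rewrite subst_graft ?size_map// E.
Qed.

Lemma substitutable_id b r s : ~~ has b (labels s) -> substitutable b r s.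
Proof.
rewrite labels_label_arities /substitutable; elim: (label_arities s) => //= p l IH.
by rewrite negb_or => /andP[/negbTE -> /IH ->].
Qed.

Lemma subst_subst_par a b s r t : (forall x, a x -> ~~ b x) ->
  ~~ has b (labels s) -> ~~ has a (labels r) ->
  substitutable a s t -> substitutable b r t ->
  subst b r (subst a s t) = subst a s (subst b r t).
Proof.
move=> ab bs ar; elim/tree_nested_ind: t => //= x ts IHts.
move=> /substitutable_forest[ax oka] /substitutable_forest[bx okb].
have E : [seq subst b r u | u <- [seq subst a s u | u <- ts]] =
         [seq subst a s u | u <- [seq subst b r u | u <- ts]].
  elim: ts IHts oka okb {ax bx} => //= u us IH [hu /IH{}IH].
  by move=> /andP[/hu{}hu /IH{}IH] /andP[/hu -> /IH ->].
case: (boolP (a x)) => [aax|nax]; case: (boolP (b x)) => [bbx|nbx].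
- by have := ab x aax; rewrite bbx.
- rewrite /= aax subst_graft ?size_map ?ax//; last exact: substitutable_id.
  by rewrite E subst_id.
- rewrite /= bbx subst_graft ?size_map ?bx//; last exact: substitutable_id.
  by rewrite E [subst a s r]subst_id.
by rewrite /= (negbTE nbx) (negbTE nax) E.
Qed.

Lemma graft_corolla (y : T) m ts : size ts = m -> graft (Node y (nseq m Leaf)) ts = Node y ts.
Proof.
move=> szts; rewrite graft_node; congr (Node _ _).
by elim: m ts szts => [[]|m IH [|u ts]]//= [/IH]; rewrite drop0 => ->.
Qed.

Lemma graft_leaves t : graft t (nseq (leaves t) Leaf) = t.
Proof.
elim/tree_nested_ind: t => //= x us IHus; rewrite -/(graft_forest us _); congr (Node _ _).
elim: us IHus => //= u us IH [hu /IH{}IH].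
by rewrite nseqD take_size_cat ?size_nseq// drop_size_cat ?size_nseq// hu IH.
Qed.

End Generic.

Lemma subst_tmap (T T' : eqType) (f : T -> T') (a : pred T) (a' : pred T') s t :
  {in labels t, forall x, a' (f x) = a x} ->
  subst a' (tmap f s) (tmap f t) = tmap f (subst a s t).
Proof.
elim/tree_nested_ind: t => //= x ts IHts aa'; rewrite aa' ?mem_head//.
have {}aa' : {in flatten [seq labels s | s <- ts], forall y, a' (f y) = a y}.
  by move=> y yt; apply: aa'; rewrite inE yt orbT.
have E : [seq subst a' (tmap f s) u | u <- [seq tmap f u | u <- ts]] =
         [seq tmap f u | u <- [seq subst a s u | u <- ts]].
  elim: ts IHts aa' => //= u us IH [hu hus] aa'; rewrite hu ?IH// => y yt;
  by apply: aa'; rewrite mem_cat yt ?orbT.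
by rewrite E; case: ifP => //= _; rewrite graft_tmap.
Qed.

End TreeOperations.

(** * The order of the vertices in a substitution *)

Section SubstitutionOrder.
Variable T : Type.
Implicit Types (t s r u : tree T) (ts us : seq (tree T)) (a p q : pred T).

Local Notation filter := seq.filter.
Local Notation all_labels ts := (flatten [seq labels u | u <- ts]).

Lemma filter_labels_graft_inner q s ts : ~~ has q (all_labels ts) ->
  filter q (labels (graft s ts)) = filter q (labels s).
Proof.
elim/tree_nested_ind: s ts => [|x us IHus] ts.
  case: ts => //= r ts; rewrite has_cat negb_or => /andP[nq _].
  by apply: size0nil; apply/eqP; rewrite size_filter eqn0Ngt -has_count.
rewrite graft_node /= => nq.
suff -> : filter q (all_labels (graft_forest us ts)) = filter q (all_labels us) by [].
elim: us IHus ts nq => //= u us IH [hu /IH{}IH] ts nq.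
have /andP[n1 n2] : ~~ has q (all_labels (take (leaves u) ts)) &&
    ~~ has q (all_labels (drop (leaves u) ts)).
  by rewrite -negb_or -has_cat -flatten_cat -map_cat cat_take_drop.
by rewrite !filter_cat hu// IH.
Qed.

Lemma filter_labels_graft_outer p us ts :
  size ts = sumn [seq leaves u | u <- us] -> ~~ has p (all_labels us) ->
  filter p (all_labels (graft_forest us ts)) = filter p (all_labels ts).
Proof.
have H s : forall ts, size ts = leaves s -> ~~ has p (labels s) ->
    filter p (labels (graft s ts)) = filter p (all_labels ts).
  elim/tree_nested_ind: s => [|x vs IHvs] {us}ts.
    by case: ts => [|r []]//= _; rewrite cats0.
  rewrite graft_node /= => szts; rewrite negb_or => /andP[/negbTE ->].
  elim: vs IHvs ts szts => [_ [|]|u us IH [hu /IH{}IH] ts]//= szts.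
  have lu : (leaves u <= size ts)%N by rewrite szts leq_addr.
  rewrite has_cat negb_or => /andP[/hu{}hu /IH{}IH].
  rewrite filter_cat hu ?size_takel// IH; last by rewrite size_drop szts addKn.
  by rewrite -filter_cat -flatten_cat -map_cat cat_take_drop.
elim: us ts => [[]|u us IH ts]//= szts.
have lu : (leaves u <= size ts)%N by rewrite szts leq_addr.
rewrite has_cat negb_or => /andP[nu /IH{}IH].
rewrite filter_cat H ?size_takel// IH; last by rewrite size_drop szts addKn.
by rewrite -filter_cat -flatten_cat -map_cat cat_take_drop.
Qed.

(** The vertices of the inserted tree are met in their own order, though vertices of t may come in
    between. *)
Lemma filter_labels_subst_inner q a s t :
  (count a (labels t) <= 1)%N -> ~~ has q (labels t) ->
  filter q (labels (subst a s t)) = if has a (labels t) then filter q (labels s) else [::].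
Proof.
elim/tree_nested_ind: t => //= x ts IHts; rewrite negb_or => ca /andP[/negbTE qx nq].
case: ifP ca => [ax|_]; last first.
  rewrite add0n /= qx => ca.
  elim: ts IHts ca nq => //= u us IH [hu /IH{}IH]; rewrite count_cat !has_cat negb_or.
  move=> ca /andP[/hu{}hu /IH{}IH].
  rewrite filter_cat hu; last exact: leq_trans (leq_addr _ _) ca.
  rewrite IH; last exact: leq_trans (leq_addl _ _) ca.
  case: ifP => //= au; case: ifP => //= aus; last by rewrite cats0.
  by rewrite !has_count in au aus; have := leq_trans (leq_add au aus) ca.
rewrite ltnS leqn0 => ca; rewrite filter_labels_graft_inner//.
have {ca} na : ~~ has a (all_labels ts) by rewrite has_count -leqNgt leqn0.
elim: ts {IHts} nq na => //= u us IH; rewrite !has_cat !negb_or.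
by move=> /andP[nq /IH{}IH] /andP[na /IH{}IH]; rewrite subst_id// nq.
Qed.

(** Grafting keeps the subtrees of a replaced vertex in order, and the root of s is met where that
    vertex was. So, of each copy of s only the root being retained, the order is that of t. *)
Lemma filter_labels_subst_outer p a s y us t : s = Node y us ->
  substitutable a s t -> p y -> ~~ has p (behead (labels s)) ->
  all (fun x => a x || p x) (labels t) ->
  filter p (labels (subst a s t)) = [seq if a x then y else x | x <- labels t].
Proof.
move=> sE + py nps; elim/tree_nested_ind: t => //= x ts IHts.
move=> hs; have {hs}[ax ok] := substitutable_forest hs.
move=> /andP[apx alls].
have E : filter p (all_labels [seq subst a s u | u <- ts]) =
    [seq if a x then y else x | x <- all_labels ts].
  elim: ts IHts ok alls {ax} => //= u vs IH [hu /IH{}IH] /andP[/hu{}hu /IH{}IH].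
  by rewrite all_cat => /andP[/hu{}hu /IH{}IH]; rewrite filter_cat hu IH map_cat.
case: ifP apx => [aax _|_ /= ->]; last by rewrite E.
have szts : size [seq subst a s u | u <- ts] = sumn [seq leaves u | u <- us].
  by rewrite size_map ax// sE.
by rewrite {1}sE graft_node /= py (filter_labels_graft_outer szts) ?E// -[flatten _]/(behead (labels (Node y us))) -sE.
Qed.

End SubstitutionOrder.

(** * The edges of a substitution *)

Section SubstitutionEdges.
Variable T : eqType.
Implicit Types (t s r u : tree T) (ts us : seq (tree T)) (a : pred T) (e : T * T).

Definition root_is (z : T) r : bool := if r is Node x _ then x == z else false.

Lemma edges_graft s ts e : e \in edges (graft s ts) ->
  [|| e \in edges s, has (fun r => e \in edges r) ts
    | (e.1 \in labels s) && has (root_is e.2) ts].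
Proof.
elim/tree_nested_ind: s ts => [|x us IHus] ts.
  by case: ts => //= r ts ->.
rewrite graft_node /= inE.
elim: us IHus ts => //= u us IH [hu /IH{}IH] ts; rewrite !mem_cat => /orP[/orP[]|].
- case: u {hu} => [|y vs]; last by rewrite graft_node /= => ->.
  case: ts => //= r ts; case: r => //= y vs; rewrite mem_seq1 => /eqP -> /=.
  by rewrite !eqxx /= !orbT.
- move=> /hu /or3P[->|h|/andP[-> h]]; rewrite ?orbT//.
    by rewrite -(cat_take_drop (leaves u) ts) has_cat h /= !orbT.
  by rewrite -(cat_take_drop (leaves u) ts) [has (root_is _) _]has_cat h /= !orbT.
move=> /IH /or3P[->|h|/andP[h1 h]]; rewrite ?orbT//.
  by rewrite -(cat_take_drop (leaves u) ts) has_cat h /= !orbT.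
rewrite -(cat_take_drop (leaves u) ts) [has (root_is _) _]has_cat h orbT andbT.
by case/orP: h1 => ->; rewrite ?orbT.
Qed.

Lemma root_is_subst a s y us t z : s = Node y us -> root_is z (subst a s t) ->
  exists2 x, root_is x t & z = if a x then y else x.
Proof.
move=> ->; case: t => //= x ts; case: ifP => [ax|nax] /= /eqP <-; exists x => //; by rewrite ?ax ?nax.
Qed.

(** A tree grafted on s hangs from the vertex bearing the leaf, so a replaced lower end becomes some
    vertex of s, left open here; a replaced upper end becomes the root y. *)
Lemma edges_subst a s y us t e : s = Node y us -> e \in edges (subst a s t) ->
  e \in edges s \/ exists e', [/\ e' \in edges t,
     if a e'.1 then e.1 \in labels s else e.1 == e'.1
   & e.2 = if a e'.2 then y else e'.2].
Proof.
move=> sE; elim/tree_nested_ind: t => //= x ts IHts.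
pose src : bool := if a x then e.1 \in labels s else e.1 == x.
have E : e \in flatten [seq edges u | u <- [seq subst a s u | u <- ts]] \/
    src /\ has (root_is e.2) [seq subst a s u | u <- ts] ->
  e \in edges s \/ exists e', [/\ e' \in edges (Node x ts),
     if a e'.1 then e.1 \in labels s else e.1 == e'.1
   & e.2 = if a e'.2 then y else e'.2].
  rewrite /=; elim: ts IHts => [_ [|[]]|u vs IH [hu /IH{}IH]] //=.
  have weak : e \in edges s \/ (exists e', [/\ e' \in flatten
       [seq (if s is Node y _ then [:: (x, y)] else [::]) ++ edges s | s <- vs],
     if a e'.1 then e.1 \in labels s else e.1 == e'.1
   & e.2 = if a e'.2 then y else e'.2]) -> e \in edges s \/
   exists e', [/\ e' \in ((if u is Node y _ then [:: (x, y)] else [::]) ++ edges u) ++ flatten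
       [seq (if s is Node y _ then [:: (x, y)] else [::]) ++ edges s | s <- vs],
     if a e'.1 then e.1 \in labels s else e.1 == e'.1
   & e.2 = if a e'.2 then y else e'.2].
    by case=> [->|[e' [h1 h2 h3]]]; [left|right; exists e'; rewrite mem_cat h1 orbT].
  rewrite mem_cat => -[/orP[/hu[->|[e' [h1 h2 h3]]]|h]|[sr /orP[]]].
  - by left.
  - by right; exists e'; rewrite !mem_cat h1 orbT.
  - by apply: weak; apply: IH; left.
  - move=> /(root_is_subst sE)[z]; case: u {hu weak} => //= z' us' /eqP <- ez.
    by right; exists (x, z'); rewrite mem_head.
  - by move=> h; apply: weak; apply: IH; right.
case: ifP @src E => ax src E.
  move=> /edges_graft /or3P[->|h|/andP[h1 h2]]; [by left| |by apply: E; right].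
  apply: E; left; elim: [seq _ | _ <- _] h => //= r vs IH; rewrite mem_cat => /orP[->//|/IH ->].
  by rewrite orbT.
move=> eE; apply: E; move: eE => /=; elim: (map (subst a s) ts) => //= u vs IH.
rewrite !mem_cat => /orP[/orP[]|/IH[h|[h1 h2]]].
- by case: u => //= z us'; rewrite mem_seq1 /src => /eqP ->; right; rewrite /= !eqxx.
- by move=> ->; left.
- by left; rewrite h orbT.
- by right; rewrite h2 orbT.
Qed.

End SubstitutionEdges.

Lemma label_arities_tmap (T T' : Type) (f : T -> T') (r : tree T) :
  label_arities (tmap f r) = [seq (f p.1, p.2) | p <- label_arities r].
Proof.
elim/tree_nested_ind: r => //= x ts IHts; rewrite size_map; congr (_ :: _).
by elim: ts IHts => //= u ts IH [-> /IH ->]; rewrite map_cat.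
Qed.

Lemma planar_root (r : tree nat) : planar_tree r -> exists us, r = Node 0%N us.
Proof. by case: r => [|x us] /and3P[]//= _ /eqP[-> _] _; exists us. Qed.

Lemma uniq_count_mem (T : eqType) (l : seq T) : (forall x, (count_mem x l <= 1)%N) -> uniq l.
Proof.
move=> h; apply: count_mem_uniq => x; move: (h x); rewrite -has_pred1 has_count.
by case: (count_mem x l) => [|[]].
Qed.

Lemma map_index_uniq (T : eqType) (l : seq T) : uniq l -> [seq index x l | x <- l] = iota 0 (size l).
Proof.
case: l => // x0 l ul; apply: (@eq_from_nth _ 0%N); rewrite size_map ?size_iota// => i il.
by rewrite (nth_map x0)// index_uniq// nth_iota.
Qed.

Lemma index_filter_lt (T : eqType) (p : pred T) (x0 : T) (l : seq T) i j : uniq l ->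
  (i < j < size (seq.filter p l))%N ->
  (index (nth x0 (seq.filter p l) i) l < index (nth x0 (seq.filter p l) j) l)%N.
Proof.
move=> ul /andP[ij jl]; have il := ltn_trans ij jl.
have : sorted ltn [seq index x l | x <- seq.filter p l].
  apply: (subseq_sorted ltn_trans (map_subseq _ (filter_subseq p l))).
  by rewrite map_index_uniq// iota_ltn_sorted.
move=> /(sorted_ltn_nth ltn_trans 0%N)/(_ i j).
by rewrite !inE size_map !(nth_map x0)//; apply.
Qed.

Lemma planar_edge_index (r : tree nat) (f : 'I_(ne r)) : planar_tree r ->
  index (par f, f.+1) (edges r) = f.
Proof.
move=> pr; rewrite -(edgeE pr f) index_uniq//.
by apply: (@map_uniq _ _ snd); rewrite edges_snd (planar_labels pr) -drop1 drop_uniq// iota_uniq.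
Qed.

(** * Numbering the vertices and edges of a substituted tree *)

Section SubstitutionInterface.
Local Notation filter := seq.filter.
Variables (t s : tree nat) (a : nat).
Hypothesis pt : planar_tree t.
Hypothesis ps : planar_tree s.
Hypothesis ha : (a < nv t)%N.
Hypothesis hs : nth 0%N (arities t) a = leaves s.
Local Notation q := (subst_tree t a s).
Local Notation lab := (subst_lab t a s).
Local Notation L := (labels lab).
Local Notation pos := (new_vertex t a s).

Lemma label_arities_planar p : p \in label_arities t ->
  (p.1 < nv t)%N /\ p.2 = nth 0%N (arities t) p.1.
Proof.
move=> /(nthP (0%N, 0%N))[i szi <-]; rewrite arities_label_arities.
have E : (nth (0%N, 0%N) (label_arities t) i).1 = i.
  rewrite -(nth_map _ 0%N)// -labels_label_arities (planar_labels pt) nth_iota//.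
  by rewrite /nv labels_label_arities size_map.
by rewrite E (nth_map (0%N, 0%N))// /nv labels_label_arities size_map.
Qed.

Lemma subst_lab_substitutable : substitutable (pred1 (inl a)) (tmap inr s) (tmap inl t).
Proof.
apply/allP => p; rewrite label_arities_tmap => /mapP[p' /label_arities_planar[_ p2] ->] /=.
by apply/implyP => /eqP[p1]; rewrite leaves_tmap p2 p1 hs.
Qed.

Lemma mem_labels_planar v : (v \in labels t) = (v < nv t)%N.
Proof. by rewrite (planar_labels pt) mem_iota. Qed.

Lemma count_subst_lab : count (pred1 (inl a : (nat + nat)%type)) (labels (tmap inl t)) = 1%N.
Proof.
rewrite labels_tmap count_map (eq_count (a2 := pred1 a))//.
by rewrite count_uniq_mem ?mem_labels_planar ?ha// (planar_labels pt) iota_uniq.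
Qed.

Lemma arities_subst_lab_count (p : pred nat) :
  count p (arities q) = (count (fun y => p y.2 && (y.1 != a)) (label_arities t) + count p (arities s))%N.
Proof.
rewrite arities_tmap arities_label_arities count_map.
rewrite (count_label_arities_subst _ subst_lab_substitutable) count_subst_lab mul1n.
by rewrite !label_arities_tmap !count_map arities_label_arities count_map.
Qed.

Lemma count_labels_subst_lab (p : pred (nat + nat)) :
  count p L = (count (fun v => p (inl v) && (v != a)) (labels t) +
               count (fun v => p (inr v)) (labels s))%N.
Proof.
rewrite labels_label_arities count_map.
rewrite (count_label_arities_subst _ subst_lab_substitutable) count_subst_lab mul1n.
by rewrite !label_arities_tmap !count_map !labels_label_arities !count_map.
Qed.

(* kt i and ks i are the numbers, in the substituted tree, of the vertices i of t
   and i of s; the vertex a of t stands for the root of s. *)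
Definition emb (i : nat) : nat + nat := if i == a then inr 0%N else inl i.
Definition kt (i : nat) : nat := pos (emb i).
Definition ks (i : nat) : nat := pos (inr i).

Lemma subst_lab_uniq : uniq L.
Proof.
apply: uniq_count_mem => x; rewrite count_labels_subst_lab.
case: x => v.
  rewrite [X in (_ + X)%N](eq_count (a2 := pred0))// count_pred0 addn0.
  apply: leq_trans (_ : count_mem v (labels t) <= 1)%N.
    by apply: sub_count => u /= /andP[].
  by rewrite count_uniq_mem ?leq_b1// (planar_labels pt) iota_uniq.
rewrite [X in (X + _)%N](eq_count (a2 := pred0))// count_pred0 add0n.
rewrite (eq_count (a2 := pred1 v))// count_uniq_mem ?leq_b1//.
by rewrite (planar_labels ps) iota_uniq.
Qed.

Lemma mem_subst_lab x : (x \in L) =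
  match x with inl v => (v < nv t)%N && (v != a) | inr v => (v < nv s)%N end.
Proof.
rewrite -has_pred1 has_count count_labels_subst_lab addn_gt0 -!has_count.
rewrite (planar_labels pt) (planar_labels ps).
apply/orP/idP => [[/hasP[v]|/hasP[v]]|].
- by rewrite mem_iota /= => vt /andP[/eqP <-]; rewrite vt.
- by rewrite mem_iota /= => vs /eqP <-.
case: x => v; first by move=> /andP[vt va]; left; apply/hasP; exists v; rewrite ?mem_iota//= eqxx.
by move=> vs; right; apply/hasP; exists v; rewrite ?mem_iota//= eqxx.
Qed.

Lemma filter_outer :
  filter (fun x => if x is inr v then v == 0%N else true) L = map emb (iota 0 (nv t)).
Proof.
have [us sE] := planar_root ps.
rewrite (@filter_labels_subst_outer _ _ _ _ (inr 0%N) (map (tmap inr) us))//.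
- rewrite labels_tmap -map_comp (planar_labels pt); apply: eq_map => v /=.
  by rewrite /emb (inj_eq inl_inj).
- by rewrite sE.
- exact: subst_lab_substitutable.
- rewrite labels_tmap (planar_labels ps) planar_nv// -[behead _]/(map _ (iota 1 _)) has_map -all_predC.
  by apply/allP => v; rewrite mem_iota /=; case: v.
by rewrite labels_tmap all_map; apply/allP => v _ /=; rewrite orbT.
Qed.

Lemma filter_inner : filter (fun x => if x is inr v then true else false) L = map inr (iota 0 (nv s)).
Proof.
rewrite filter_labels_subst_inner ?count_subst_lab//; last first.
  by rewrite labels_tmap has_map -all_predC; apply/allP.
rewrite has_count count_subst_lab labels_tmap (planar_labels ps).
by apply/all_filterP; rewrite all_map; apply/allP.
Qed.

Lemma kt_lt i j : (i < j < nv t)%N -> (kt i < kt j)%N.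
Proof.
move=> /andP[ij jt]; have it := ltn_trans ij jt.
have := @index_filter_lt _ (fun x => if x is inr v then v == 0%N else true) (inl 0%N) _ i j subst_lab_uniq.
by rewrite filter_outer size_map size_iota ij jt !(nth_map 0%N) ?size_iota// !nth_iota//; apply.
Qed.

Lemma ks_lt i j : (i < j < nv s)%N -> (ks i < ks j)%N.
Proof.
move=> /andP[ij jt]; have it := ltn_trans ij jt.
have := @index_filter_lt _ (fun x => if x is inr v then true else false) (inl 0%N) _ i j subst_lab_uniq.
by rewrite filter_inner size_map size_iota ij jt !(nth_map 0%N) ?size_iota// !nth_iota//; apply.
Qed.

Lemma kt_at : kt a = ks 0.
Proof. by rewrite /kt /emb eqxx. Qed.

Lemma nv_pos r : planar_tree r -> (0 < nv r)%N.
Proof. by case/and3P. Qed.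

Lemma emb_in i : (i < nv t)%N -> emb i \in L.
Proof.
move=> it; rewrite mem_subst_lab /emb; have [_|ia] := eqVneq i a; first exact: nv_pos.
by rewrite it.
Qed.

Lemma kt0 : kt 0 = 0%N.
Proof.
rewrite /kt; have [ts tE] := planar_root pt; have [us sE] := planar_root ps.
rewrite /new_vertex /subst_lab tE sE /emb /=; rewrite (inj_eq inl_inj) eq_sym.
by case: ifP.
Qed.

Lemma pos_inj x y : x \in L -> pos x = pos y -> x = y.
Proof.
move=> xL xy; have yL : y \in L by rewrite -index_mem -[index _ _]xy index_mem.
by rewrite -(nth_index (inl 0%N) xL) -(nth_index (inl 0%N) yL) -/(pos x) xy.
Qed.

Lemma nv_subst : nv q = size L.
Proof. by rewrite /nv labels_tmap size_map. Qed.

Lemma pos_bound x : x \in L -> (pos x < nv q)%N.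
Proof. by rewrite nv_subst index_mem. Qed.

Lemma size_subst_lab : (size L).+1 = (nv t + nv s)%N.
Proof.
rewrite -(count_predT L) count_labels_subst_lab count_predT -addSn; congr (_ + _)%N.
rewrite [X in X.+1](eq_count (a2 := predC (pred1 a)))// /nv -(count_predC (pred1 a)).
by rewrite count_uniq_mem ?mem_labels_planar ?ha// (planar_labels pt) iota_uniq.
Qed.

Lemma planar_subst : planar_tree q.
Proof.
rewrite /planar_tree nv_subst.
rewrite (leq_ltn_trans (leq0n _) (_ : index (emb a) L < _)%N) ?index_mem ?emb_in//=.
rewrite labels_tmap map_index_uniq ?subst_lab_uniq// eqxx /=.
have h (r : tree nat) : planar_tree r -> count (predC (leq 1)) (arities r) = 0%N.
  by case/and3P => _ _ h; apply/eqP; rewrite eqn0Ngt -has_count has_predC h.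
(* Vertices without inputs are counted: they could only come from t or from s, which have none. *)
rewrite all_count -(eqn_add2r (count (predC (leq 1)) (arities q))) count_predC.
rewrite -[X in X == _]addn0 eqn_add2l eq_sym arities_subst_lab_count h// addn0 -leqn0.
rewrite -[X in (_ <= X)%N](h t)// [in leqRHS]arities_label_arities count_map.
by apply: sub_count => y /= /andP[].
Qed.


Lemma ne_subst : ne q = (ne t + ne s)%N.
Proof.
apply/eqP; rewrite -(eqn_add2r 2) -addSnnS -addSnnS addn0 -planar_nv ?planar_subst//.
rewrite nv_subst size_subst_lab (planar_nv pt) (planar_nv ps).
by apply/eqP; lia.
Qed.

Lemma kt_bound i : (i < nv t)%N -> (kt i < nv q)%N.
Proof. by move=> it; rewrite pos_bound// emb_in. Qed.

Lemma ks_bound i : (i < nv s)%N -> (ks i < nv q)%N.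
Proof. by move=> it; rewrite pos_bound// mem_subst_lab. Qed.

Lemma kt_gt0 (f : 'I_(ne t)) : (0 < kt f.+1)%N.
Proof. by apply: (leq_ltn_trans (leq0n (kt 0))); rewrite kt_lt//= (lt_nv_edge pt). Qed.

Lemma ks_gt0 (f : 'I_(ne s)) : (0 < ks f.+1)%N.
Proof. by apply: (leq_ltn_trans (leq0n (ks 0))); rewrite ks_lt//= (lt_nv_edge ps). Qed.

Lemma jt_subproof (f : 'I_(ne t)) : ((kt f.+1).-1 < ne q)%N.
Proof. by rewrite -ltnS prednK ?kt_gt0// -(planar_nv planar_subst) kt_bound// (lt_nv_edge pt). Qed.

Lemma js_subproof (f : 'I_(ne s)) : ((ks f.+1).-1 < ne q)%N.
Proof. by rewrite -ltnS prednK ?ks_gt0// -(planar_nv planar_subst) ks_bound// (lt_nv_edge ps). Qed.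

(** An edge is named by its upper end: edge f of t goes to the edge below the image of vertex f + 1,
    whose number is one less than that of this image. *)
Definition jt (f : 'I_(ne t)) : 'I_(ne q) := Ordinal (jt_subproof f).
Definition js (f : 'I_(ne s)) : 'I_(ne q) := Ordinal (js_subproof f).

Lemma jt_succ f : (jt f).+1 = kt f.+1.
Proof. by rewrite /= prednK ?kt_gt0. Qed.

Lemma js_succ f : (js f).+1 = ks f.+1.
Proof. by rewrite /= prednK ?ks_gt0. Qed.

Lemma jt_lt (f g : 'I_(ne t)) : (f < g)%N -> (jt f < jt g)%N.
Proof.
by move=> fg; rewrite -ltnS jt_succ -ltnS jt_succ ltnS kt_lt// ltnS fg (lt_nv_edge pt).
Qed.

Lemma js_lt (f g : 'I_(ne s)) : (f < g)%N -> (js f < js g)%N.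
Proof.
by move=> fg; rewrite -ltnS js_succ -ltnS js_succ ltnS ks_lt// ltnS fg (lt_nv_edge ps).
Qed.

Lemma jt_inj : injective jt.
Proof.
by move=> f g fg; apply/val_inj/eqP; case: ltngtP => // /jt_lt; rewrite fg ltnn.
Qed.

Lemma js_inj : injective js.
Proof.
by move=> f g fg; apply/val_inj/eqP; case: ltngtP => // /js_lt; rewrite fg ltnn.
Qed.

Lemma emb_inj i j : emb i = emb j -> i = j.
Proof. by rewrite /emb; do 2!case: eqP => [->|_]; move=> // -[]. Qed.

Local Notation labedge e := (nth (inl 0%N, inl 0%N) (edges lab) e).

Lemma labedge_edge (e : 'I_(ne q)) : edge e = (pos (labedge e).1, pos (labedge e).2).
Proof.
have : (e < size (edges lab))%N by have := ltn_ord e; rewrite {2}/ne edges_tmap size_map.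
by move=> eL; rewrite /edge edges_tmap (nth_map (inl 0%N, inl 0%N)).
Qed.

Lemma labedge_in (e : 'I_(ne q)) : labedge e \in edges lab.
Proof. by apply: mem_nth; have := ltn_ord e; rewrite {2}/ne edges_tmap size_map. Qed.

Lemma labedge_snd (e : 'I_(ne q)) : (labedge e).2 \in L.
Proof.
have : (labedge e).2 \in [seq x.2 | x <- edges lab] by rewrite map_f ?labedge_in.
by rewrite edges_snd; exact: mem_behead.
Qed.

Lemma labedge_cases (e : 'I_(ne q)) :
  (exists f : 'I_(ne s), labedge e = (inr (par f), inr f.+1)) \/
  (exists2 f : 'I_(ne t), (labedge e).2 = emb f.+1 &
     if par f == a then exists2 w, (w < nv s)%N & (labedge e).1 = inr w
     else (labedge e).1 = inl (par f)).
Proof.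
have [us sE] := planar_root ps.
have /edges_subst : labedge e \in edges lab := labedge_in e.
move=> /(_ (inr 0%N) [seq tmap inr u | u <- us]) []; first by rewrite sE.
  rewrite edges_tmap => /mapP[p /(nthP (0%N, 0%N))[i il <-] ->]; left.
  by exists (Ordinal il); rewrite -[nth _ _ _]/(edge (Ordinal il)) (edgeE ps).
move=> [e' []]; rewrite edges_tmap => /mapP[p /(nthP (0%N, 0%N))[i il <-] ->].
rewrite -[nth _ _ _]/(edge (Ordinal il)) (edgeE pt) /= !(inj_eq inl_inj) => h1 h2; right.
exists (Ordinal il) => //; case: ifP h1 => _; last by move/eqP.
rewrite labels_tmap (planar_labels ps) => /mapP[w]; rewrite mem_iota => ws ->; by exists w.
Qed.

Lemma jt_js f g : jt f != js g.
Proof.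
apply/eqP => /(congr1 (fun e : 'I_(ne q) => (e : nat).+1)).
rewrite jt_succ js_succ => /pos_inj; rewrite emb_in ?(lt_nv_edge pt)// => /(_ isT).
by rewrite /emb; case: ifP.
Qed.

Lemma succ_labedge (e : 'I_(ne q)) : e.+1 = pos (labedge e).2.
Proof. by rewrite -(planar_edge_snd planar_subst) labedge_edge. Qed.

Lemma jt_or_js (e : 'I_(ne q)) : (exists f, e = jt f) \/ (exists f, e = js f).
Proof.
have [[f fE]|[f fE _]] := labedge_cases e; [right|left]; exists f; apply: val_inj; apply: succn_inj.
  by rewrite js_succ succ_labedge fE.
by rewrite jt_succ succ_labedge fE.
Qed.

Lemma labedge_js f : labedge (js f) = (inr (par f), inr f.+1).
Proof.
have : (labedge (js f)).2 = inr f.+1.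
  by apply: pos_inj; rewrite ?labedge_snd// -succ_labedge js_succ.
have [[g ->] [/ord_inj ->] //|[g -> _]] := labedge_cases (js f).
by rewrite /emb; case: ifP.
Qed.

Lemma labedge_jt f : (labedge (jt f)).2 = emb f.+1 /\
  if par f == a then exists2 w, (w < nv s)%N & (labedge (jt f)).1 = inr w
  else (labedge (jt f)).1 = inl (par f).
Proof.
have E : (labedge (jt f)).2 = emb f.+1.
  by apply: pos_inj; rewrite ?labedge_snd// -succ_labedge jt_succ.
split=> //; have [[g gE]|[g]] := labedge_cases (jt f).
  by move: E; rewrite gE /emb; case: ifP.
by rewrite E => /emb_inj[/ord_inj ->].
Qed.

Lemma par_js f : par (js f) = ks (par f).
Proof. by rewrite /par labedge_edge labedge_js. Qed.

Lemma par_jt f : par f != a -> par (jt f) = kt (par f).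
Proof.
move=> fa; have [_] := labedge_jt f; rewrite (negbTE fa) /par labedge_edge => -> /=.
by rewrite /kt /emb (negbTE fa).
Qed.

(** The edge is grafted on a leaf of s. Which vertex of s bears that leaf stays open; all that will
    be used is that it lies in s. *)
Lemma par_jt_at f : par f = a -> exists2 w, (w < nv s)%N & par (jt f) = ks w.
Proof.
move=> fa; have [_] := labedge_jt f; rewrite fa eqxx => -[w ws] wE; exists w => //.
by rewrite /par labedge_edge wE.
Qed.

Lemma origin_js f : origin (js f) = inr (val f).
Proof. by rewrite /origin labedge_js planar_edge_index. Qed.

Lemma origin_jt f : origin (jt f) = inl (val f).
Proof.
rewrite /origin; have [] := labedge_jt f; case: (labedge (jt f)) => u v /= -> h.
have pf := par_le pt f; have fE := planar_edge_index f pt.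
case: eqP h => [fa [w _ ->]|fa ->]; rewrite /emb; case: eqP => [fa'|_]; try by rewrite -?fa -?fa' fE.
by move: pf; rewrite fa -fa' ltnn.
Qed.

End SubstitutionInterface.

(** * Nests and faces of a substitution *)

Section SubstitutionNests.
Import mathcomp.boot.fintype mathcomp.boot.finset.
Variables (R : realType) (t s : tree nat) (a : nat).
Hypothesis pt : planar_tree t.
Hypothesis ps : planar_tree s.
Hypothesis ha : (a < nv t)%N.
Hypothesis hs : nth 0%N (arities t) a = leaves s.
Local Notation q := (subst_tree t a s).
Local Notation pq := (planar_subst pt ps ha hs).
Local Notation jt := (jt pt ps ha hs).
Local Notation js := (js pt ps ha hs).
Local Notation kt := (kt t s a).
Local Notation ks := (ks t s a).
Implicit Types (N M : {set 'I_(ne q)}).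

Definition outer N : {set 'I_(ne t)} := [set f | jt f \in N].
Definition inner N : {set 'I_(ne s)} := [set f | js f \in N].

Lemma outer_inner N : N = (jt @: outer N) :|: (js @: inner N).
Proof.
apply/setP => e; rewrite inE; apply/idP/orP => [eN|[]/imsetP[f]]; last 2 first.
- by rewrite inE => fN ->.
- by rewrite inE => fN ->.
have [[f ef]|[f ef]] := jt_or_js pt ps ha hs e; [left|right]; rewrite ef.
  by rewrite imset_f// inE -ef.
by rewrite imset_f// inE -ef.
Qed.

Lemma disjoint_jt_js (A : {set 'I_(ne t)}) (B : {set 'I_(ne s)}) : fintype.disjoint (mem (jt @: A)) (mem (js @: B)).
Proof.
apply/pred0P => e; apply/negbTE/negP => /andP[/imsetP[f _ ->] /imsetP[g _] /eqP].
by rewrite (negbTE (jt_js pt ps ha hs f g)).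
Qed.

Lemma sum_jt_js (F : 'I_(ne q) -> R) (A : {set 'I_(ne t)}) (B : {set 'I_(ne s)}) :
  \sum_(e in (jt @: A) :|: (js @: B)) F e = \sum_(f in A) F (jt f) + \sum_(f in B) F (js f).
Proof.
rewrite (eq_bigl [predU jt @: A & js @: B]); last by move=> e; rewrite inE.
rewrite bigU ?disjoint_jt_js//= !big_imset//.
- by move=> f g _ _; exact: js_inj.
- by move=> f g _ _; exact: jt_inj.
Qed.

Lemma sum_outer_inner (F : 'I_(ne q) -> R) N :
  \sum_(e in N) F e = \sum_(f in outer N) F (jt f) + \sum_(f in inner N) F (js f).
Proof. by rewrite {1}(outer_inner N) sum_jt_js. Qed.

Lemma outerE (A : {set 'I_(ne t)}) (B : {set 'I_(ne s)}) : outer ((jt @: A) :|: (js @: B)) = A.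
Proof.
apply/setP => f; rewrite !inE (mem_imset _ _ (@jt_inj _ _ _ pt ps ha hs)).
by case: imsetP => [[g _ /eqP]|]; rewrite ?(negbTE (jt_js pt ps ha hs f g))// orbF.
Qed.

Lemma innerE (A : {set 'I_(ne t)}) (B : {set 'I_(ne s)}) : inner ((jt @: A) :|: (js @: B)) = B.
Proof.
apply/setP => f; rewrite !inE (mem_imset _ _ (@js_inj _ _ _ pt ps ha hs)) orbC.
by case: imsetP => [[g _ /esym/eqP]|]; rewrite ?(negbTE (jt_js pt ps ha hs g f))// orbF.
Qed.

Lemma edges_inlE (A : {set 'I_(ne t)}) : edges_inl a s A = jt @: A.
Proof.
apply/setP => e; rewrite inE; apply/exists_inP/imsetP => -[f fA]; last first.
  by move=> ->; exists f => //; rewrite origin_jt.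
move=> /eqP oe; exists f => //; have [[g eg]|[g eg]] := jt_or_js pt ps ha hs e.
  by move: oe; rewrite eg origin_jt => -[/ord_inj ->].
by move: oe; rewrite eg origin_js.
Qed.

Lemma edges_inrE (A : {set 'I_(ne s)}) : edges_inr t a A = js @: A.
Proof.
apply/setP => e; rewrite inE; apply/exists_inP/imsetP => -[f fA]; last first.
  by move=> ->; exists f => //; rewrite origin_js.
move=> /eqP oe; exists f => //; have [[g eg]|[g eg]] := jt_or_js pt ps ha hs e.
  by move: oe; rewrite eg origin_jt.
by move: oe; rewrite eg origin_js => -[/ord_inj ->].
Qed.

Lemma ks_kt v u : (v < nv s)%N -> (u < nv t)%N -> ks v = kt u -> v = 0%N /\ u = a.
Proof.
move=> vs ut; rewrite /ks /kt => /pos_inj; rewrite (mem_subst_lab pt ps ha hs) vs => /(_ isT).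
by rewrite /emb; case: eqP => // -> [->].
Qed.

Lemma ks_inj v u : (v < nv s)%N -> ks v = ks u -> v = u.
Proof. by move=> vs /pos_inj; rewrite (mem_subst_lab pt ps ha hs) vs => /(_ isT)[]. Qed.

Lemma kt_inj v u : (v < nv t)%N -> kt v = kt u -> v = u.
Proof.
by move=> vt /pos_inj h; apply: (@emb_inj a); apply: h; exact: (emb_in pt ps ha hs).
Qed.

Lemma rooted_js r (M : {set 'I_(ne s)}) : rooted r M -> rooted (ks r) (js @: M).
Proof.
move=> /rootedP rM; apply/rootedP => _ /imsetP[f fM ->].
rewrite par_js; case: (rM f fM) => [->|[g gM ->]]; first by left.
by right; exists (js g); rewrite ?imset_f// js_succ.
Qed.

(** The form that a nest of t takes in a substituted nesting: all of E(s) is added when the nest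
    touches a. *)
Definition lift_nest (A : {set 'I_(ne t)}) : {set 'I_(ne q)} :=
  (jt @: A) :|: (js @: (if touches A a then setT else set0)).

Lemma rooted_lift_nest u (A : {set 'I_(ne t)}) : rooted u A -> A != set0 ->
  rooted (kt u) (lift_nest A).
Proof.
move=> rA A0; have /rootedP h := rA; apply/rootedP => e.
rewrite inE => /orP[]/imsetP[f fA ->]; last first.
  rewrite par_js; move: fA; case: ifP => [tA _|]; last by rewrite inE.
  have [pf0|pf0] := eqVneq (par f) 0%N.
    move: tA; rewrite (touchesP pt a rA A0) => /spanP[<-|[g gA ga]].
      by left; rewrite pf0 kt_at.
    right; exists (jt g); first by rewrite inE imset_f.
    by rewrite jt_succ -ga kt_at pf0.
  have /rootedP/(_ f (in_setT f))[/eqP|[g _ ->]] := rooted_top ps; first by rewrite (negbTE pf0).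
  by right; exists (js g); rewrite ?js_succ// /lift_nest tA inE orbC imset_f.
have [fa|fa] := eqVneq (par f) a; last first.
  rewrite par_jt//; case: (h f fA) => [->|[g gA ->]]; first by left.
  by right; exists (jt g); rewrite ?jt_succ// inE imset_f.
have tA : touches A a by apply/existsP; exists f; rewrite fA /incident (edgeE pt) fa eqxx.
have [w ws ->] := par_jt_at pt ps ha hs fa; rewrite /lift_nest tA.
case: w ws => [|w] ws.
  case: (h f fA) => [<-|[g gA pg]]; first by left; rewrite fa kt_at.
  by right; exists (jt g); rewrite ?jt_succ -?pg ?fa ?kt_at// inE imset_f.
have ws' : (w < ne s)%N by move: ws; rewrite (planar_nv ps).
by right; exists (js (Ordinal ws')); rewrite ?js_succ// inE [X in _ || X]imset_f ?orbT.
Qed.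

Section Weights.
Variable w : 'I_(nv q) -> nat.
Hypothesis w_gt0 : forall v, (0 < w v)%N.

Definition extended_weight u : nat := if insub u is Some v then w v else 1%N.

Definition inner_weight (v : 'I_(nv s)) : nat := extended_weight (ks v).

(** Contracting s to the vertex a gives a the total weight of s. For the standard weight this is the
    weight [nv s] at a, as in the partial composition. *)
Definition outer_weight (v : 'I_(nv t)) : nat :=
  if val v == a then (\sum_u inner_weight u)%N else extended_weight (kt v).

Lemma extended_weight_gt0 u : (0 < extended_weight u)%N.
Proof. by rewrite /extended_weight; case: insubP. Qed.

Lemma inner_weight_gt0 v : (0 < inner_weight v)%N.
Proof. exact: extended_weight_gt0. Qed.

Lemma outer_weight_gt0 v : (0 < outer_weight v)%N.
Proof.
rewrite /outer_weight; case: ifP => _; last exact: extended_weight_gt0.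
by rewrite (bigD1 (Ordinal (nv_pos ps)))//= ltn_addr// inner_weight_gt0.
Qed.

Local Notation W := (real_weight R w).
Local Notation Ws := (real_weight R inner_weight).
Local Notation Wt := (real_weight R outer_weight).
Local Notation c := (nest_weight W).
Local Notation cs := (nest_weight Ws).
Local Notation ct := (nest_weight Wt).

Lemma real_weight_extended u : W u = (extended_weight u)%:R.
Proof. by rewrite /real_weight /extended_weight; case: insubP. Qed.

Lemma inner_weightE v : (v < nv s)%N -> Ws v = W (ks v).
Proof. by move=> vs; rewrite -[v]/(val (Ordinal vs)) real_weightE real_weight_extended. Qed.

Lemma outer_weightE v : (v < nv t)%N -> v != a -> Wt v = W (kt v).
Proof.
move=> vt va; rewrite -[v]/(val (Ordinal vt)) real_weightE real_weight_extended.
by rewrite /outer_weight /= (negbTE va).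
Qed.

Lemma outer_weight_at : Wt a = (\sum_u inner_weight u)%N%:R.
Proof. by rewrite -[a in LHS]/(val (Ordinal ha)) real_weightE /outer_weight eqxx. Qed.

Lemma inner_subtree_le v (B : {set 'I_(ne s)}) : (v < nv s)%N -> rooted v B ->
  subtree_weight Ws v B <= Wt a.
Proof.
move=> vs rB; rewrite -(sum_span R ps inner_weight rB vs) outer_weight_at ler_nat.
by rewrite [leqRHS](bigID (fun u : 'I_(nv s) => span v B u)) leq_addr.
Qed.

Lemma inner_subtree_full : subtree_weight Ws 0 [set: 'I_(ne s)] = Wt a.
Proof.
rewrite -(sum_span R ps inner_weight (rooted_top ps) (nv_pos ps)) outer_weight_at.
congr (_%:R); apply: eq_bigl => -[u us]; apply/spanP => /=.
case: u us => [|u] us; first by left.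
have us' : (u < ne s)%N by move: us; rewrite (planar_nv ps).
by right; exists (Ordinal us'); rewrite ?inE.
Qed.

Lemma nest_root_cases r N : rooted r N -> N != set0 ->
  (exists2 v, (v < nv s)%N & r = ks v) \/ (exists u, [/\ (u < nv t)%N, u != a & r = kt u]).
Proof.
move=> rN /(rooted_root pq rN)[e eN <-]; have [[f ->]|[f ->]] := jt_or_js pt ps ha hs e.
  have [fa|fa] := eqVneq (par f) a.
    by left; have [v vs ->] := par_jt_at pt ps ha hs fa; exists v.
  by right; exists (par f); rewrite (lt_nv_par pt) par_jt.
by left; exists (par f); rewrite ?(lt_nv_par ps) ?par_js.
Qed.

Lemma ks_succ v (e : 'I_(ne q)) : (v < nv s)%N -> ks v = e.+1 ->
  (exists2 g, e = js g & v = g.+1) \/ (exists g, [/\ e = jt g, v = 0%N & g.+1 = a]).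
Proof.
move=> vs; have [[f ->]|[f ->]] := jt_or_js pt ps ha hs e.
  by rewrite jt_succ => /(ks_kt vs (lt_nv_edge pt f))[-> fa]; right; exists f.
by rewrite js_succ => /(ks_inj vs) ->; left; exists f.
Qed.

Lemma kt_succ u (e : 'I_(ne q)) : (u < nv t)%N -> u != a -> kt u = e.+1 -> exists2 g, e = jt g & u = g.+1.
Proof.
move=> ut ua; have [[f ->]|[f ->]] := jt_or_js pt ps ha hs e.
  by rewrite jt_succ => /(kt_inj ut) ->; exists f.
rewrite js_succ => /esym/(ks_kt (lt_nv_edge ps f) ut)[_ /eqP]; by rewrite (negbTE ua).
Qed.

(* If the subtree of N meets s, X is the weight of its other vertices and m that of
   its part in s: the nest outer N counts all of s at the vertex a. *)
Definition nest_defect N : Prop := exists X m : R,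
  [/\ 0 <= X, m <= Wt a, ct (outer N) + cs (inner N) = c N + X * (Wt a - m),
      exists u, rooted u (outer N) & exists v, rooted v (inner N)] /\
  [/\ inner N = setT -> X * (Wt a - m) = 0, outer N = set0 -> X = 0
    & ~~ touches (outer N) a -> X = 0].

Lemma inner_sum (B : {set 'I_(ne s)}) (F : R -> R) :
  \sum_(f in B) F (W (js f).+1) = \sum_(f in B) F (Ws f.+1).
Proof. by apply: eq_bigr => f _; rewrite js_succ inner_weightE ?(lt_nv_edge ps). Qed.

Lemma outer_sum (A : {set 'I_(ne t)}) (F : R -> R) : (forall f, f \in A -> f.+1 != a) ->
  \sum_(f in A) F (W (jt f).+1) = \sum_(f in A) F (Wt f.+1).
Proof.
by move=> Aa; apply: eq_bigr => f fA; rewrite jt_succ outer_weightE ?(lt_nv_edge pt)// Aa.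
Qed.

(** All edges of N coming from t lie above s. X is the weight of their upper ends and m that of the
    part of s in N, so replacing this part by all of s adds [X * (Wt a - m)] to the pairs. *)
Lemma nest_defect_inner_root v N : (v < nv s)%N -> rooted (ks v) N -> nest_defect N.
Proof.
move=> vs rN; have /rootedP h := rN.
have na f : f \in outer N -> f.+1 != a.
  rewrite inE => fN; apply/eqP => fa; have := rooted_lt pq rN fN.
  rewrite -ltnS jt_succ fa kt_at ltnNge; case: v vs {rN h} => [|v] vs; first by rewrite leqnn.
  by rewrite ltnW// ks_lt.
have ri : rooted v (inner N).
  apply/rootedP => f; rewrite inE => /h; rewrite par_js => -[/ks_inj|[e eN /ks_succ]].
    by rewrite (lt_nv_par ps) => /(_ isT); left.
  rewrite (lt_nv_par ps) => /(_ isT)[[g ge ->]|[g [ge _ ga]]].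
    by right; exists g; rewrite // inE -ge.
  by have := na g; rewrite inE -ge eN ga eqxx => /(_ isT).
have ro : rooted a (outer N).
  apply/rootedP => f; rewrite inE => /h; have [fa|fa] := eqVneq (par f) a; first by left.
  rewrite par_jt// => -[/esym/(ks_kt vs (lt_nv_par pt f))[_ /eqP]|[e eN /kt_succ]].
    by rewrite (negbTE fa).
  by rewrite (lt_nv_par pt) fa => /(_ isT isT)[g ge ->]; right; exists g; rewrite // inE -ge.
exists (\sum_(f in outer N) Wt f.+1), (subtree_weight Ws v (inner N)); split; split.
- by apply: sumr_ge0 => f _; rewrite ltW// real_weight_gt0//; exact: outer_weight_gt0.
- exact: inner_subtree_le.
- rewrite (nest_weightE pq W rN) (nest_weightE ps Ws ri) (nest_weightE pt Wt ro).
  rewrite /pair_weight /subtree_weight !sum_outer_inner.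
  rewrite (inner_sum _ id) (inner_sum _ (fun x => x ^+ 2)).
  rewrite (outer_sum id na) (outer_sum (fun x => x ^+ 2) na) inner_weightE//.
  by field.
- by exists a.
- by exists v.
- move=> iT; rewrite iT; have -> : v = 0%N.
    have [T0|T0] := eqVneq [set: 'I_(ne s)] set0; last first.
      by apply: (rooted_inj ps _ (rooted_top ps) T0); rewrite -iT.
    apply/eqP; rewrite -leqn0 -ltnS; move: vs; rewrite (planar_nv ps).
    by have := cardsT 'I_(ne s); rewrite T0 cards0 card_ord => <-.
  by rewrite inner_subtree_full subrr mulr0.
- by move=> ->; rewrite big_set0.
- case: (set_0Vmem (outer N)) => [->|[f fN]]; first by rewrite big_set0.
  rewrite (touchesP pt a ro) ?(introT (spanP _ _ _))//; first by left.
  by apply/set0Pn; exists f.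
Qed.

(** A subtree whose root is outside s can only enter s through its root, by the edge below a; so
    inner N is rooted at 0, or empty. *)
Lemma nest_defect_outer_root u N : (u < nv t)%N -> u != a -> rooted (kt u) N -> N != set0 ->
  nest_defect N.
Proof.
move=> ut ua rN N0; have /rootedP h := rN.
have below f : f \in inner N -> exists2 g, g \in outer N & g.+1 = a.
  have [k] := ubnP (val f); elim: k => // k IH in f * => fk; rewrite inE => /h; rewrite par_js.
  case=> [/(ks_kt (lt_nv_par ps f) ut)[_ /eqP]|[e eN /ks_succ]]; first by rewrite (negbTE ua).
  rewrite (lt_nv_par ps) => /(_ isT)[[g ge pf]|[g [ge _ ga]]].
    apply: (IH g); last by rewrite inE -ge.
    by rewrite ltnS in fk; apply: leq_trans fk; rewrite -[leqLHS]/(g.+1) -pf; exact: par_le.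
  by exists g; rewrite // inE -ge.
have ri : rooted 0 (inner N).
  apply/rootedP => f; rewrite inE => /h; rewrite par_js.
  case=> [/(ks_kt (lt_nv_par ps f) ut)[_ /eqP]|[e eN /ks_succ]]; first by rewrite (negbTE ua).
  rewrite (lt_nv_par ps) => /(_ isT)[[g ge pf]|[g [ge -> ga]]]; last by left.
  by right; exists g; rewrite // inE -ge.
have ro : rooted u (outer N).
  apply/rootedP => f; rewrite inE => /h; have [fa|fa] := eqVneq (par f) a; last first.
    rewrite par_jt// => -[/(kt_inj (lt_nv_par pt f)) ->|[e eN /kt_succ]]; first by left.
    by rewrite (lt_nv_par pt) fa => /(_ isT isT)[g ge ->]; right; exists g; rewrite // inE -ge.
  have [w' ws ->] := par_jt_at pt ps ha hs fa.
  case=> [/(ks_kt ws ut)[_ /eqP]|[e eN /(ks_succ ws)]]; first by rewrite (negbTE ua).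
  rewrite fa => -[[g ge _]|[g [ge _ ga]]]; last by right; exists g; rewrite // inE -ge.
  have [|g' g'N g'a] := below g; first by rewrite inE -ge.
  by right; exists g'.
have wa_ge0 : 0 <= Wt a by rewrite ltW// real_weight_gt0//; exact: outer_weight_gt0.
(* [f0] is the edge below a. If N contains it, N reaches the root of s, even when inner N is empty;
   otherwise N does not meet s and X = m = 0. *)
case: (pickP (fun f => (f \in outer N) && (f.+1 == a))) => [f0 /andP[f0N /eqP f0a]|none].
  have na f : f \in outer N :\ f0 -> f.+1 != a.
    by rewrite in_setD1 => /andP[ff0 _]; rewrite -f0a eqSS.
  exists (Wt u + \sum_(f in outer N :\ f0) Wt f.+1), (subtree_weight Ws 0 (inner N)); split; split.
  - apply: addr_ge0; first by rewrite ltW// real_weight_gt0//; exact: outer_weight_gt0.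
    by apply: sumr_ge0 => f _; rewrite ltW// real_weight_gt0//; exact: outer_weight_gt0.
  - by apply: inner_subtree_le; rewrite ?nv_pos.
  - rewrite (nest_weightE pq W rN) (nest_weightE ps Ws ri) (nest_weightE pt Wt ro).
    rewrite /pair_weight /subtree_weight !sum_outer_inner.
    rewrite (inner_sum _ id) (inner_sum _ (fun x => x ^+ 2)) !(big_setD1 f0 f0N) /=.
    rewrite (outer_sum id na) (outer_sum (fun x => x ^+ 2) na) inner_weightE ?nv_pos//.
    have kf : (kt f0.+1).-1.+1 = ks 0 by rewrite prednK ?(kt_gt0 pt ps ha hs)// f0a kt_at.
    rewrite kf f0a outer_weightE//.
    by field.
  - by exists u.
  - by exists 0%N.
  - by move=> ->; rewrite inner_subtree_full subrr mulr0.
  - by move=> o0; rewrite o0 inE in f0N.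
  - rewrite (touchesP pt a ro) ?(introT (spanP _ _ _))//; first by right; exists f0.
    by apply/set0Pn; exists f0.
have i0 : inner N = set0.
  by apply/setP => f; rewrite in_set0; apply/negP => /below[g gN ga]; have := none g; rewrite gN ga eqxx.
have na f : f \in outer N -> f.+1 != a by move=> fN; have := none f; rewrite fN /= => ->.
exists 0, 0; split; split => //; try by rewrite mul0r.
- rewrite i0 (nest_weightE pq W rN) (nest_weightE ps Ws (rooted0 s 0)) (nest_weightE pt Wt ro).
  rewrite pair_weight0 /pair_weight /subtree_weight !sum_outer_inner i0 !big_set0.
  rewrite (outer_sum id na) (outer_sum (fun x => x ^+ 2) na) outer_weightE//.
  by field.
- by exists u.
- by exists 0%N.
Qed.

Lemma nest_defectP r N : rooted r N -> N != set0 -> nest_defect N.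
Proof.
move=> rN N0; have [[v vs rv]|[u [ut ua ru]]] := nest_root_cases rN N0.
  by apply: nest_defect_inner_root vs _; rewrite -rv.
by apply: nest_defect_outer_root ut ua _ N0; rewrite -ru.
Qed.

End Weights.
End SubstitutionNests.

(** * The face that is the image of Theta *)

Section ThetaFace.
Import mathcomp.boot.fintype mathcomp.boot.finset.
Variables (R : realType) (t s : tree nat) (a : nat).
Hypothesis pt : planar_tree t.
Hypothesis ps : planar_tree s.
Hypothesis ha : (a < nv t)%N.
Hypothesis hs : nth 0%N (arities t) a = leaves s.
Local Notation q := (subst_tree t a s).
Local Notation pq := (planar_subst pt ps ha hs).
Local Notation jt := (jt pt ps ha hs).
Local Notation js := (js pt ps ha hs).
Local Notation outer := (outer pt ps ha hs).
Local Notation inner := (inner pt ps ha hs).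
Local Notation lift_nest := (lift_nest pt ps ha hs).
Implicit Types (N M : {set 'I_(ne q)}) (x : 'rV[R]_(ne t)) (y : 'rV[R]_(ne s)).

Lemma setsum0 n (z : 'rV[R]_n) : setsum set0 z = 0.
Proof. by rewrite /setsum big_set0. Qed.

Lemma coordE n (z : 'rV[R]_n) (i : 'I_n) : Defs.coord z (val i) = z 0 i.
Proof. by rewrite /Defs.coord valK. Qed.

Lemma theta_jt x y f : theta a x y 0 (jt f) = x 0 f.
Proof. by rewrite mxE origin_jt coordE. Qed.

Lemma theta_js x y f : theta a x y 0 (js f) = y 0 f.
Proof. by rewrite mxE origin_js coordE. Qed.

Lemma theta_eq x y (z : 'rV[R]_(ne q)) : (forall f, z 0 (jt f) = x 0 f) -> (forall f, z 0 (js f) = y 0 f) ->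
  z = theta a x y.
Proof.
move=> zt zs; apply/rowP => e; have [[f ->]|[f ->]] := jt_or_js pt ps ha hs e.
  by rewrite zt theta_jt.
by rewrite zs theta_js.
Qed.

Lemma setsum_theta N x y : setsum N (theta a x y) = setsum (outer N) x + setsum (inner N) y.
Proof.
rewrite /setsum (sum_outer_inner pt ps ha hs).
by congr (_ + _); apply: eq_bigr => f _; rewrite ?theta_jt ?theta_js.
Qed.

Lemma outer_lift A : outer (lift_nest A) = A.
Proof. exact: outerE. Qed.

Lemma inner_lift A : inner (lift_nest A) = if touches A a then setT else set0.
Proof. exact: innerE. Qed.

Lemma inner_js (A : {set 'I_(ne s)}) : inner (js @: A) = A.
Proof. by have := innerE pt ps ha hs set0 A; rewrite imset0 set0U. Qed.

Lemma outer_js (A : {set 'I_(ne s)}) : outer (js @: A) = set0.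
Proof. by have := outerE pt ps ha hs set0 A; rewrite imset0 set0U. Qed.

Lemma outerT : outer setT = setT.
Proof. by apply/setP => f; rewrite !inE. Qed.

Lemma innerT : inner setT = setT.
Proof. by apply/setP => f; rewrite !inE. Qed.

Lemma lift_inj : injective lift_nest.
Proof. by move=> A A' E; rewrite -(outer_lift A) E outer_lift. Qed.

Lemma nest_lift A : nest A -> nest (lift_nest A).
Proof.
move=> /(nestP pt)[A0 [u uA]]; apply/(nestP pq); split; last by exists (kt t s a u); exact: rooted_lift_nest.
by case/set0Pn: A0 => f fA; apply/set0Pn; exists (jt f); rewrite inE imset_f.
Qed.

Lemma nest_js (A : {set 'I_(ne s)}) : nest A -> nest (js @: A).
Proof.
move=> /(nestP ps)[A0 [u uA]]; apply/(nestP pq); split; last by exists (ks t s a u); exact: rooted_js.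
by case/set0Pn: A0 => f fA; apply/set0Pn; exists (js f); rewrite imset_f.
Qed.

Local Notation Tq := [set: 'I_(ne q)].
Local Notation Ts := [set: 'I_(ne s)].
Local Notation Tt := [set: 'I_(ne t)].

Section Weights.
Variable w : 'I_(nv q) -> nat.
Hypothesis w_gt0 : forall v, (0 < w v)%N.
Local Notation ws := (inner_weight w).
Local Notation wt := (outer_weight w).
Let ws_gt0 := inner_weight_gt0 w_gt0.
Let wt_gt0 := outer_weight_gt0 ps w_gt0.
Local Notation W := (real_weight R w).
Local Notation Ws := (real_weight R ws).
Local Notation Wt := (real_weight R wt).
Local Notation c := (nest_weight W).
Local Notation cs := (nest_weight Ws).
Local Notation ct := (nest_weight Wt).
Local Notation P := (lpoly (nests q) c).
Local Notation Ps := (lpoly (nests s) cs).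
Local Notation Pt := (lpoly (nests t) ct).

Lemma nest_weight_set0 (r : tree nat) (v : nat -> R) : planar_tree r ->
  nest_weight v (set0 : {set 'I_(ne r)}) = 0.
Proof. by move=> pr; rewrite (nest_weightE pr v (rooted0 r 0)) pair_weight0. Qed.

Lemma nest_weight_lift A : nest A ->
  c (lift_nest A) = ct A + if touches A a then cs Ts else 0.
Proof.
move=> /[dup] nA /(nestP pt)[A0 [u uA]].
have lA0 : lift_nest A != set0 by have /(nestP pq)[] := nest_lift nA.
have [X [m [[_ _ E _ _] [iT _ tA]]]] := nest_defectP R pt ps ha hs w_gt0 (rooted_lift_nest pt ps ha hs uA A0) lA0.
move: E iT tA; rewrite outer_lift inner_lift; case: (touches A a) => E iT tA.
  by rewrite E iT ?addr0.
by move: E; rewrite tA// mul0r (nest_weight_set0 _ ps) !addr0.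
Qed.

Lemma nest_weight_js (A : {set 'I_(ne s)}) : nest A -> c (js @: A) = cs A.
Proof.
move=> /[dup] nA /(nestP ps)[A0 [u uA]].
have lA0 : js @: A != set0 by have /(nestP pq)[] := nest_js nA.
have [X [m [[_ _ E _ _] [_ o0 _]]]] := nest_defectP R pt ps ha hs w_gt0 (rooted_js pt ps ha hs uA) lA0.
by move: E; rewrite (o0 (outer_js A)) outer_js inner_js (nest_weight_set0 _ pt) mul0r addr0 add0r => ->.
Qed.

Lemma nest_weight_top : c Tq = ct Tt + cs Ts.
Proof.
have [T0|T0] := eqVneq [set: 'I_(ne q)] set0.
  have := outerT; have := innerT; rewrite T0.
  have -> : outer set0 = set0 by apply/setP => f; rewrite !inE.
  have -> : inner set0 = set0 by apply/setP => f; rewrite !inE.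
  by move=> <- <-; rewrite (nest_weight_set0 _ pq) (nest_weight_set0 _ pt) (nest_weight_set0 _ ps) addr0.
have [X [m [[_ _ E _ _] [iT _ _]]]] := nest_defectP R pt ps ha hs w_gt0 (rooted_top pq) T0.
by move: E iT; rewrite outerT innerT => -> ->//; rewrite addr0.
Qed.

Lemma rooted_bound (r : tree nat) (v : nat -> R) u (A : {set 'I_(ne r)}) (z : 'rV[R]_(ne r)) : planar_tree r ->
  lpoly (nests r) (nest_weight v) z -> rooted u A -> nest_weight v A <= setsum A z.
Proof.
move=> pr [_ Pz] uA; have [->|A0] := eqVneq A set0; first by rewrite nest_weight_set0// setsum0.
by apply/Pz/nest_nests/(nestP pr); split=> //; exists u.
Qed.

(** The bounds for outer N and inner N add up to [c N] plus a defect, which is nonnegative. *)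
Lemma theta_lpoly x y : Pt x -> Ps y -> P (theta a x y).
Proof.
move=> Px Py; split.
  by rewrite setsum_theta outerT innerT nest_weight_top Px.1 Py.1.
move=> N NB; have [->|N0] := eqVneq N set0.
  by rewrite (nest_weight_set0 _ pq) setsum0.
have [r rN] := nests_rooted pq NB; rewrite setsum_theta.
have [X [m [[X0 mw E [u uA] [v vB]] _]]] := nest_defectP R pt ps ha hs w_gt0 rN N0.
apply: le_trans (lerD (rooted_bound pt Px uA) (rooted_bound ps Py vB)).
by rewrite E lerDl mulr_ge0// subr_ge0.
Qed.

Lemma tight_nest (r : tree nat) (v : nat -> R) A (z : 'rV[R]_(ne r)) :
  planar_tree r -> A \in tight_nests (t := r) v z ->
  [/\ nest A, A \in nests r & setsum A z = nest_weight v A].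
Proof.
move=> pr; rewrite /tight_nests in_setD1 => /andP[A0 /tightP[AB Az]]; split => //.
exact: (nests_nest pr AB A0).
Qed.

Lemma tight_nestI (r : tree nat) (v : nat -> R) A (z : 'rV[R]_(ne r)) : planar_tree r -> nest A ->
  setsum A z = nest_weight v A -> A \in tight_nests (t := r) v z.
Proof.
move=> pr nA Az; rewrite 3!inE Az eqxx andbT; have /(nestP pr)[-> _] := nA.
by rewrite (nest_nests nA).
Qed.

Lemma tight_lift x y A : Pt x -> Ps y -> A \in tight_nests Wt x ->
  lift_nest A \in tight_nests W (theta a x y).
Proof.
move=> Px Py /(tight_nest pt)[nA AB Ax]; apply: (tight_nestI pq); first exact: nest_lift.
rewrite setsum_theta outer_lift inner_lift nest_weight_lift// Ax; case: ifP => _.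
  by rewrite Py.1.
by rewrite setsum0.
Qed.

Lemma tight_js x y (A : {set 'I_(ne s)}) : Pt x -> Ps y -> A \in tight_nests Ws y ->
  js @: A \in tight_nests W (theta a x y).
Proof.
move=> Px Py /(tight_nest ps)[nA AB Ay]; apply: (tight_nestI pq); first exact: nest_js.
by rewrite setsum_theta outer_js inner_js nest_weight_js// Ay setsum0 add0r.
Qed.

Lemma js_top x y : Ps y -> setsum (js @: Ts) (theta a x y) = cs Ts.
Proof. by move=> Py; rewrite setsum_theta outer_js inner_js setsum0 add0r Py.1. Qed.

(** The inequality of [lift_nest A], minus the equality for E(s) if A touches a, is the inequality
    of A; nests of s keep theirs. So the image of Theta is the face where E(s) is tight. *)
Lemma theta_surj (z : 'rV[R]_(ne q)) : P z -> setsum (js @: Ts) z = cs Ts ->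
  exists x y, [/\ Pt x, Ps y & z = theta a x y].
Proof.
move=> Pz zs.
pose x : 'rV[R]_(ne t) := \row_f z 0 (jt f); pose y : 'rV[R]_(ne s) := \row_f z 0 (js f).
have zE : z = theta a x y by apply: theta_eq => f; rewrite mxE.
have ys : setsum setT y = cs Ts.
  by rewrite -zs zE setsum_theta outer_js inner_js setsum0 add0r.
exists x, y; split => //; split => //.
- apply: (addIr (cs Ts)); rewrite -nest_weight_top -Pz.1 [in RHS]zE setsum_theta.
  by rewrite outerT innerT ys.
- move=> A AB; have [->|A0] := eqVneq A set0; first by rewrite (nest_weight_set0 _ pt) setsum0.
  have nA := nests_nest pt AB A0; have := Pz.2 _ (nest_nests (nest_lift nA)).
  rewrite {1}zE setsum_theta outer_lift inner_lift nest_weight_lift//; case: ifP => _.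
    by rewrite ys lerD2r.
  by rewrite setsum0 !addr0.
move=> A AB; have [->|A0] := eqVneq A set0; first by rewrite (nest_weight_set0 _ ps) setsum0.
have nA := nests_nest ps AB A0; have := Pz.2 _ (nest_nests (nest_js nA)).
by rewrite {1}zE setsum_theta outer_js inner_js nest_weight_js// setsum0 add0r.
Qed.

Lemma subst_nestingE (NN' : {set {set 'I_(ne t)}}) (NN'' : {set {set 'I_(ne s)}}) :
  subst_nesting a NN' NN'' = [set js @: A | A : {set 'I_(ne s)} in NN''] :|: [set lift_nest A | A in NN'].
Proof.
congr (_ :|: _); apply: eq_imset => A; first exact: edges_inrE.
rewrite /lift_nest !(edges_inlE pt ps ha hs) (edges_inrE pt ps ha hs); case: ifP => // _.
by rewrite imset0 setU0.
Qed.

Lemma card_subst_nesting (NN' : {set {set 'I_(ne t)}}) (NN'' : {set {set 'I_(ne s)}}) :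
  nesting NN' -> #|subst_nesting a NN' NN''| = (#|NN'| + #|NN''|)%N.
Proof.
move=> nNN'; rewrite subst_nestingE cardsU (_ : _ :&: _ = set0) ?cards0 ?subn0.
  rewrite card_imset ?card_imset; first by rewrite addnC.
    exact: lift_inj.
  by move=> A A' E; rewrite -(inner_js A) E inner_js.
apply/setP => N; rewrite !inE; apply/negbTE/negP => /andP[/imsetP[A _ ->] /imsetP[B BN E]].
have /(nestP pt)[B0 _] := nesting_nest nNN' BN.
by move: B0; rewrite -(outer_lift B) -E outer_js eqxx.
Qed.

(** The substituted nesting consists of tight nests of the image point, and it already has the
    maximal number [ne t + ne s] of them. *)
Lemma theta_vertexM (NN' : {set {set 'I_(ne t)}}) (NN'' : {set {set 'I_(ne s)}}) :
  maximal_nesting NN' -> maximal_nesting NN'' ->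
  maximal_nesting (subst_nesting a NN' NN'') /\
  theta a (vertexM R NN' wt) (vertexM R NN'' ws) = vertexM R (subst_nesting a NN' NN'') w.
Proof.
move=> m' m''; have /andP[n' /eqP c'] := m'; have /andP[n'' /eqP c''] := m''.
have [Px _] := vertexM_lpoly R pt wt_gt0 m'; have [Py _] := vertexM_lpoly R ps ws_gt0 m''.
set z := theta _ _ _; have Pz : P z := theta_lpoly Px Py.
have nz := nesting_tight pq (real_weight_gt0 R w_gt0) Pz.
have E : subst_nesting a NN' NN'' = tight_nests W z.
  apply/eqP; rewrite eqEcard (card_subst_nesting _ n') c' c'' -(ne_subst pt ps ha hs) (card_nesting pq nz) andbT.
  rewrite subst_nestingE subUset; apply/andP; split; apply/subsetP => _ /imsetP[A AN ->].
    by apply: tight_js => //; rewrite (tight_vertexM R ps).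
  by apply: tight_lift => //; rewrite (tight_vertexM R pt).
have mz : maximal_nesting (tight_nests W z).
  by rewrite /maximal_nesting nz -E card_subst_nesting// c' c'' -(ne_subst pt ps ha hs) eqxx.
rewrite E; split => //; exact: (vertexM_eq pq w_gt0 mz erefl).
Qed.

End Weights.
End ThetaFace.

(** * Theta and the bot-top diagonals *)

Section ThetaDiagonal.
Import mathcomp.boot.fintype mathcomp.boot.finset.
Variables (R : realType) (t s : tree nat) (a : nat).
Hypothesis pt : planar_tree t.
Hypothesis ps : planar_tree s.
Hypothesis ha : (a < nv t)%N.
Hypothesis hs : nth 0%N (arities t) a = leaves s.
Local Notation q := (subst_tree t a s).
Local Notation pq := (planar_subst pt ps ha hs).
Local Notation jt := (jt pt ps ha hs).
Local Notation js := (js pt ps ha hs).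
Local Notation outer := (outer pt ps ha hs).
Local Notation inner := (inner pt ps ha hs).
Local Notation lift := (lift_nest pt ps ha hs).
Implicit Types (x : 'rV[R]_(ne t)) (y : 'rV[R]_(ne s)).

Local Notation c w := (nest_weight (real_weight R w)).
Local Notation P r w := (lpoly (nests r) (c w)).

Lemma signvec_theta I J :
  signvec R I J = theta a (signvec R (outer I) (outer J)) (signvec R (inner I) (inner J)).
Proof. by apply: theta_eq => f; rewrite !mxE !inE. Qed.

Lemma leads_monotone m n (j : 'I_m -> 'I_n) (I J : {set 'I_n}) i (e : 'I_n) :
  (forall f g : 'I_m, (f < g)%N -> (j f < j g)%N) ->
  (forall k, (k \in I) || (k \in J) -> (e <= k)%N) ->
  e = j i -> (e \in I) || (e \in J) ->
  leads [set f | j f \in I] [set f | j f \in J] -> e \in I.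
Proof.
move=> jlt emin ei eIJ [i0 i0I i0min].
rewrite inE in i0I; have : (i0 <= i)%N by apply: i0min; rewrite !inE -ei.
rewrite leq_eqVlt => /orP[/eqP/val_inj ii|/jlt]; first by rewrite ei -ii.
by rewrite -ei ltnNge emin// i0I.
Qed.

Lemma theta_linear k x y x' y' :
  k *: (theta a x y + theta a x' y') = theta a (k *: (x + x')) (k *: (y + y')).
Proof. by apply: theta_eq => f; rewrite mxE [in LHS]mxE ?theta_jt ?theta_js !mxE. Qed.

Section Weights.
Variable w : 'I_(nv q) -> nat.
Hypothesis w_gt0 : forall v, (0 < w v)%N.
Local Notation ws := (inner_weight w).
Local Notation wt := (outer_weight w).
Let ws_gt0 := inner_weight_gt0 w_gt0.
Let wt_gt0 := outer_weight_gt0 ps w_gt0.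
Let LP := operahedron_laminar R pq w_gt0.
Let LPs := operahedron_laminar R ps ws_gt0.
Let LPt := operahedron_laminar R pt wt_gt0.

(** E(s) is tight at both image points, so a feasible vector has sum zero over it: I and J are
    equinumerous within each of the two blocks of edges. *)
Lemma card_theta_signvec (I J : {set 'I_(ne q)}) x y x' y' : 
  P t wt x -> P t wt x' -> P s ws y -> P s ws y' ->
  #|I| = #|J| ->
  feasible (tight (nests q) (c w) (theta a x y)) (tight (nests q) (c w) (theta a x' y'))
    (signvec R I J) ->
  setsum setT (signvec R (inner I) (inner J)) = 0 /\
  setsum setT (signvec R (outer I) (outer J)) = 0.
Proof.
move=> Px Px' Py Py' cIJ [fA fB].
have ss : setsum setT (signvec R (inner I) (inner J)) = 0.
  have [T0|T0] := eqVneq [set: 'I_(ne s)] set0; first by rewrite T0 setsum0.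
  have nT : nest [set: 'I_(ne s)] by apply/(nestP ps); split => //; exists 0%N; exact: rooted_top.
  have tT z : P s ws z -> [set: 'I_(ne s)] \in tight_nests (real_weight R ws) z.
    by move=> Pz; apply: tight_nestI => //; exact: Pz.1.
  have E : setsum (js @: setT) (signvec R I J) = setsum setT (signvec R (inner I) (inner J)).
    by rewrite signvec_theta setsum_theta outer_js inner_js setsum0 add0r.
  apply/eqP; rewrite -E eq_le; apply/andP; split.
    by apply: fB; have /setD1P[] := tight_js pt ps ha hs w_gt0 Px' Py' (tT _ Py').
  by apply: fA; have /setD1P[] := tight_js pt ps ha hs w_gt0 Px Py (tT _ Py).
split => //; apply: (addIr (setsum setT (signvec R (inner I) (inner J)))).
rewrite -{1}(outerT pt ps ha hs) -{1}(innerT pt ps ha hs) -setsum_theta -signvec_theta ss addr0.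
by rewrite setsum_signvec !setIT cIJ subrr.
Qed.

Lemma good_part n (A B : {set {set 'I_n}}) (I J : {set 'I_n}) : good R A B ->
  I :&: J = set0 -> setsum setT (signvec R I J) = 0 -> I :|: J != set0 ->
  feasible A B (signvec R I J) -> leads I J.
Proof.
move=> gAB IJ0; rewrite setsum_signvec !setIT => /eqP; rewrite subr_eq0 eqr_nat => /eqP cIJ IJ fe.
apply: gAB => //; split => //.
  by apply: contraNneq IJ => I0; move: cIJ; rewrite I0 cards0 => /esym/cards0_eq ->; rewrite setU0.
by apply: contraNneq IJ => J0; move: cIJ; rewrite J0 cards0 => /cards0_eq ->; rewrite setU0.
Qed.

(** The two blocks of 1_I - 1_J are feasible for the two good pairs. The least index of I and J lies
    in one block, where it is again least since [jt] and [js] are increasing; goodness there puts it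
    in I. *)
Lemma good_pair_theta x y x' y' :
  good_pair (nests t) (c wt) x x' -> good_pair (nests s) (c ws) y y' ->
  good_pair (nests q) (c w) (theta a x y) (theta a x' y').
Proof.
move=> [Px Px' gt] [Py Py' gs]; split; try exact: theta_lpoly.
move=> I J [I0 J0 IJ0 cIJ] fe; have [ss st] := card_theta_signvec Px Px' Py Py' cIJ fe.
have feS : feasible (tight (nests s) (c ws) y) (tight (nests s) (c ws) y')
    (signvec R (inner I) (inner J)).
  split=> A /[dup] AT /tightP[AB _]; have [->|A0] := eqVneq A set0; rewrite ?setsum0//.
    have /setD1P[_ /fe.1] := tight_js pt ps ha hs w_gt0 Px Py (introT setD1P (conj A0 AT)).
    by rewrite signvec_theta setsum_theta outer_js inner_js setsum0 add0r.
  have /setD1P[_ /fe.2] := tight_js pt ps ha hs w_gt0 Px' Py' (introT setD1P (conj A0 AT)).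
  by rewrite signvec_theta setsum_theta outer_js inner_js setsum0 add0r.
have feT : feasible (tight (nests t) (c wt) x) (tight (nests t) (c wt) x')
    (signvec R (outer I) (outer J)).
  have E A : setsum (lift A) (signvec R I J) = setsum A (signvec R (outer I) (outer J)).
    rewrite signvec_theta setsum_theta outer_lift inner_lift.
    by case: ifP; rewrite ?ss ?setsum0 addr0.
  split=> A /[dup] AT /tightP[AB _]; have [->|A0] := eqVneq A set0; rewrite ?setsum0//.
    by have /setD1P[_ /fe.1] := tight_lift pt ps ha hs w_gt0 Px Py (introT setD1P (conj A0 AT)); rewrite E.
  by have /setD1P[_ /fe.2] := tight_lift pt ps ha hs w_gt0 Px' Py' (introT setD1P (conj A0 AT)); rewrite E.
have dI (X : {set 'I_(ne q)}) : X != set0 -> exists2 e, e \in X & forall k, k \in X -> (e <= k)%N.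
  move=> /set0Pn[e0 e0X]; case: (arg_minnP (fun e : 'I_(ne q) => e : nat) e0X) => e eX emin.
  by exists e.
have [|e eIJ emin] := dI (I :|: J); first by rewrite setU_eq0 negb_and I0.
rewrite inE in eIJ; have {}emin k : (k \in I) || (k \in J) -> (e <= k)%N by move=> h; apply: emin; rewrite inE.
exists e => //; have [[f ef]|[f ef]] := jt_or_js pt ps ha hs e.
  apply: (leads_monotone (@jt_lt _ _ _ pt ps ha hs) emin ef eIJ).
  apply: good_part gt _ st _ feT; first by apply/setP => g; rewrite !inE; have /setP/(_ (jt g)) := IJ0; rewrite !inE.
  by apply/set0Pn; exists f; rewrite !inE -ef.
apply: (leads_monotone (@js_lt _ _ _ pt ps ha hs) emin ef eIJ).
apply: good_part gs _ ss _ feS; first by apply/setP => g; rewrite !inE; have /setP/(_ (js g)) := IJ0; rewrite !inE.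
by apply/set0Pn; exists f; rewrite !inE -ef.
Qed.

Lemma bot_top_theta v vt vs x y : principal v -> principal vt -> principal vs ->
  P t wt x -> P s ws y ->
  bot_pt v (reflected (P q w) (theta a x y)) =
    theta a (bot_pt vt (reflected (P t wt) x)) (bot_pt vs (reflected (P s ws) y)) /\
  top_pt v (reflected (P q w) (theta a x y)) =
    theta a (top_pt vt (reflected (P t wt) x)) (top_pt vs (reflected (P s ws) y)).
Proof.
move=> pv pvt pvs Px Py.
have [gx mx] := bot_top_good_pair LPt pvt Px; have [gy my] := bot_top_good_pair LPs pvs Py.
by have := good_pair_bot LP pv (good_pair_theta gx gy); rewrite theta_linear mx my.
Qed.

End Weights.

(* Both sides are compatible with the bot-top diagonals and agree on vertices. *)
Lemma transition_theta w w' f ft fs : (forall v, (0 < w v)%N) -> (forall v, (0 < w' v)%N) ->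
  weight_transition w w' f ->
  weight_transition (outer_weight w) (outer_weight w') ft ->
  weight_transition (inner_weight w) (inner_weight w') fs ->
  forall x y, P t (outer_weight w) x -> P s (inner_weight w) y ->
  f (theta a x y) = theta a (ft x) (fs y).
Proof.
move=> w0 w'0 [tf vf] [tft vft] [tfs vfs] x y Px Py.
have ws0 := inner_weight_gt0 w0; have wt0 := outer_weight_gt0 ps w0.
have ws0' := inner_weight_gt0 w'0; have wt0' := outer_weight_gt0 ps w'0.
have LP := operahedron_laminar R pq w0; have LP' := operahedron_laminar R pq w'0.
have LPs := operahedron_laminar R ps ws0; have LPs' := operahedron_laminar R ps ws0'.
have LPt := operahedron_laminar R pt wt0; have LPt' := operahedron_laminar R pt wt0'.
have [v pv] := exists_principal R (ne q); have [vt pvt] := exists_principal R (ne t).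
have [vs pvs] := exists_principal R (ne s); have [K K0 PK] := lpoly_bounded LP'.
(* Uniqueness is applied to pairs of points, ranked by the sum of the two ranks; a pair has rank 0
   only when both points are vertices. *)
apply: (@midpoint_unique R _ _
  (fun z : 'rV[R]_(ne t) * 'rV[R]_(ne s) => P t (outer_weight w) z.1 /\ P s (inner_weight w) z.2)
  (fun z => (prank (nests t) (c (outer_weight w)) z.1 + prank (nests s) (c (inner_weight w)) z.2)%N)
  (fun z => (bot_pt vt (reflected (P t (outer_weight w)) z.1), bot_pt vs (reflected (P s (inner_weight w)) z.2)))
  (fun z => (top_pt vt (reflected (P t (outer_weight w)) z.1), top_pt vs (reflected (P s (inner_weight w)) z.2)))
  (fun z => f (theta a z.1 z.2)) (fun z => theta a (ft z.1) (fs z.2)) K _ _ _ _ _ _ (x, y)) => //=.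
- move=> z [/(bot_top_good_pair LPt pvt)[[Pbt Ptt _] _] /(bot_top_good_pair LPs pvs)[[Pbs Pts _] _]].
  by [].
- move=> z [zt zs]; rewrite addnACA leq_add//; [exact: prank_bot_top zt|exact: prank_bot_top zs].
- move=> z [zt zs]; split; apply/PK.
    exact: (trans_fun tf (theta_lpoly pt ps ha hs w0 zt zs)).
  exact: (theta_lpoly pt ps ha hs w'0 (trans_fun tft zt) (trans_fun tfs zs)).
- move=> z [zt zs] /eqP; rewrite addn_eq0 => /andP[/eqP rt /eqP rs].
  have [mt ->] := prank0_maximal pt wt0 zt rt; have [ms ->] := prank0_maximal ps ws0 zs rs.
  have [mq ->] := theta_vertexM R pt ps ha hs w0 mt ms.
  have [_] := theta_vertexM R pt ps ha hs w'0 mt ms.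
  by rewrite vf// vft// vfs// => ->.
- move=> z [zt zs]; rewrite (trans_mid LP LP' tf pv (theta_lpoly pt ps ha hs w0 zt zs)).
  by have [-> ->] := bot_top_theta w0 pv pvt pvs zt zs.
move=> z [zt zs]; rewrite [in LHS](trans_mid LPt LPt' tft pvt zt) [in LHS](trans_mid LPs LPs' tfs pvs zs).
by rewrite theta_linear.
Qed.

End ThetaDiagonal.

(** * Operadic trees *)

Section FaceEmbeddings.
Variable R : realType.

Lemma linear_mx m n (f : 'rV[R]_m -> 'rV[R]_n) :
  (forall k x y, f (k *: x + y) = k *: f x + f y) -> exists M, forall x, f x = x *m M.
Proof.
move=> lf.
have fD x y : f (x + y) = f x + f y by have := lf 1 x y; rewrite !scale1r.
have f0 : f 0 = 0 by have := lf (-1) 0 0; rewrite scaler0 addr0 scaleN1r addNr.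
have fZ k x : f (k *: x) = k *: f x by have := lf k x 0; rewrite f0 !addr0.
exists (\matrix_i f (delta_mx 0 i)) => x.
rewrite mulmx_sum_row [in LHS](row_sum_delta x).
rewrite (big_morph f fD f0); apply: eq_bigr => i _.
by rewrite fZ rowK.
Qed.

(** A functional on a product is a sum of two, and it is maximal at a pair exactly when both terms
    are; a point of the face supplies the two maxima. *)
Lemma prod_face m n (P : set 'rV[R]_m) (Q : set 'rV[R]_n) F :
  face (prod_set P Q) F -> F !=set0 ->
  exists F1 F2, [/\ face P F1, face Q F2 & F = prod_set F1 F2].
Proof.
move=> [u [c [h FE]]] [z0]; rewrite FE => -[[Pz0 Qz0] /= z0c].
have dE (z : 'rV[R]_(m + n)) : dotp z u = dotp (lsubmx z) (lsubmx u) + dotp (rsubmx z) (rsubmx u).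
  by rewrite -{1}[z]hsubmxK -{1}[u]hsubmxK dotp_row_mx.
have hc x y : P x -> Q y -> dotp x (lsubmx u) + dotp y (rsubmx u) <= c.
  by move=> Px Qy; have := h (row_mx x y); rewrite dE row_mxKl row_mxKr; apply; split; rewrite ?row_mxKl ?row_mxKr.
rewrite dE in z0c.
exists (P `&` [set x | dotp x (lsubmx u) = dotp (lsubmx z0) (lsubmx u)]).
exists (Q `&` [set y | dotp y (rsubmx u) = dotp (rsubmx z0) (rsubmx u)]); split.
- exists (lsubmx u), (dotp (lsubmx z0) (lsubmx u)); split => // x Px.
  by have := hc _ _ Px Qz0; rewrite -z0c lerD2r.
- exists (rsubmx u), (dotp (rsubmx z0) (rsubmx u)); split => // y Qy.
  by have := hc _ _ Pz0 Qy; rewrite -z0c lerD2l.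
apply/seteqP; split => z /=.
  move=> [[Pz Qz]]; rewrite dE => zc; have := hc _ _ Pz Qz0; have := hc _ _ Pz0 Qz.
  by move=> h1 h2; split; split => //=; lra.
by move=> [[Pz /= z1] [Qz /= z2]]; split; [split|rewrite /= dE z1 z2].
Qed.

(** A special kind of morphism that matches faces with faces instead of subdividing the source. The
    structure maps are of this kind, and composites and products of such maps are easy to handle. *)
Record face_embedding m n (P : set 'rV[R]_m) (Q : set 'rV[R]_n) (f : 'rV[R]_m -> 'rV[R]_n) : Prop :=
  FaceEmbedding {
  fe_cont : {within P, continuous f};
  fe_inv : exists2 g : 'rV[R]_n -> 'rV[R]_m, {within f @` P, continuous g} &
    forall x, P x -> g (f x) = x;
  fe_face : forall F, face P F -> face Q (f @` F);
  fe_cell : forall F, face Q F -> F `<=` f @` P -> face P (P `&` f @^-1` F) }.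

Lemma face_embedding_arrow m n (P : set 'rV[R]_m) (Q : set 'rV[R]_n) f :
  polytope P -> polytope Q -> face_embedding P Q f -> poly_arrow P Q f.
Proof.
move=> pP pQ [fc [g gc gf] ff fcell].
(* The complex consists of the faces of Q inside the image; their inverse images are the faces of
   P. *)
have [D DE] : exists D, D = [set F | face Q F /\ F `<=` f @` P] by eexists.
have fP : f @` P `<=` Q := face_sub (ff _ (face_refl P)).
have DfP : D (f @` P) by rewrite DE; split => //; exact: ff (face_refl P).
have sD : complex_support D = f @` P.
  apply/seteqP; split => [y [F]|y Py]; last by exists (f @` P).
  by rewrite DE => -[_ FP] /FP.
have cell G : face P G -> P `&` f @^-1` (f @` G) = G.
  move=> /face_sub GP; apply/seteqP; split => [x [Px [x' Gx' fx]]|x Gx].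
    by rewrite -(gf _ Px) -fx (gf _ (GP _ Gx')).
  by split; [exact: GP|exists x].
exists D; split.
- apply: (face_complex pQ) => [F|F G]; rewrite DE; first by case.
  by move=> [QF FP] FG; split; [exact: face_trans QF FG|move=> x /(face_sub FG)/FP].
- by move=> F; rewrite DE => -[].
- exists g; rewrite sD; split => //.
    by move=> x Px; split; [exists x|exact: gf].
  by move=> y [x Px <-]; rewrite gf.
split.
  apply: (face_complex pP) => [_ [F + <-]|_ G [F + <-]]; rewrite DE => -[QF FP].
    exact: fcell.
  move=> FG; have PG := face_trans pP (fcell _ QF FP) FG.
  exists (f @` G); last exact: cell.
  by split; [exact: ff|move=> _ [x /(face_sub PG) Px <-]; exists x].
apply/seteqP; split => [x [_ [F _ <-]] []//|x Px].
by exists (P `&` f @^-1` (f @` P)); [exists (f @` P)|split => //; exists x].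
Qed.

Lemma face_embedding_comp l m n (P : set 'rV[R]_l) (Q : set 'rV[R]_m) (S : set 'rV[R]_n) f g :
  face_embedding P Q f -> face_embedding Q S g -> face_embedding P S (fun x => g (f x)).
Proof.
move=> [fc [f' f'c f'f] ff fcell] [gc [g' g'c g'g] gf gcell].
have fP : f @` P `<=` Q := face_sub (ff _ (face_refl P)).
have fPQ x : P x -> Q (f x) by move=> Px; apply: fP; exists x.
have im F : (fun x => g (f x)) @` F = g @` (f @` F) by rewrite -image_comp.
split.
- exact: comp_within_continuous fc fPQ gc.
- exists (fun y => f' (g' y)) => [|x Px]; last by rewrite g'g ?f'f//; exact: fPQ.
  apply: (@comp_within_continuous _ _ _ _ _ (f @` P)) f'c => [|_ [x Px <-]].
    apply: continuous_subspaceW g'c => _ [x Px <-]; by exists (f x) => //; exact: fPQ.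
  by exists x => //; rewrite g'g//; exact: fPQ.
- by move=> F /ff/gf; rewrite im.
move=> F SF FP.
have FQ : F `<=` g @` Q by move=> _ /FP[x Px <-]; exists (f x) => //; exact: fPQ.
have -> : P `&` (fun x => g (f x)) @^-1` F = P `&` f @^-1` (Q `&` g @^-1` F).
  by apply/seteqP; split=> x [Px]; [move=> Fx; split; [|split; [exact: fPQ|]]|case].
apply: fcell; first exact: gcell.
move=> y [Qy /= /FP[x Px gfx]]; exists x => //.
by rewrite -(g'g _ Qy) -gfx g'g//; exact: fPQ.
Qed.

Lemma prod_set_image m n m' n' (P : set 'rV[R]_m) (P' : set 'rV[R]_m')
   (f : 'rV[R]_m -> 'rV[R]_n) (f' : 'rV[R]_m' -> 'rV[R]_n') :
  (fun z => row_mx (f (lsubmx z)) (f' (rsubmx z))) @` prod_set P P' = prod_set (f @` P) (f' @` P').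
Proof.
apply/seteqP; split => [_ [z [Pz P'z] <-]|z [[x Px xE] [y Py yE]]].
  by split; rewrite ?row_mxKl ?row_mxKr; [exists (lsubmx z)|exists (rsubmx z)].
exists (row_mx x y); first by split; rewrite ?row_mxKl ?row_mxKr.
by rewrite row_mxKl row_mxKr xE yE hsubmxK.
Qed.

Lemma prod_map_continuous m n m' n' (P : set 'rV[R]_m) (P' : set 'rV[R]_m')
   (f : 'rV[R]_m -> 'rV[R]_n) (f' : 'rV[R]_m' -> 'rV[R]_n') :
  {within P, continuous f} -> {within P', continuous f'} ->
  {within prod_set P P', continuous (fun z => row_mx (f (lsubmx z)) (f' (rsubmx z)))}.
Proof.
move=> fc f'c; apply: row_mx_continuous.
  apply: comp_within_continuous fc => [|z []//].
  by apply: continuous_subspaceT => z; exact: lsubmx_continuous.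
apply: comp_within_continuous f'c => [|z []//].
by apply: continuous_subspaceT => z; exact: rsubmx_continuous.
Qed.

Lemma face_embedding_prod m n m' n' (P : set 'rV[R]_m) (Q : set 'rV[R]_n)
    (P' : set 'rV[R]_m') (Q' : set 'rV[R]_n') f f' :
  face_embedding P Q f -> face_embedding P' Q' f' ->
  face_embedding (prod_set P P') (prod_set Q Q')
    (fun z => row_mx (f (lsubmx z)) (f' (rsubmx z))).
Proof.
move=> [fc [g gc gf] ff fcell] [f'c [g' g'c g'f] f'f f'cell]; split.
- exact: prod_map_continuous.
- exists (fun z => row_mx (g (lsubmx z)) (g' (rsubmx z))); rewrite ?prod_set_image.
    exact: prod_map_continuous.
  by move=> z [Pz P'z]; rewrite row_mxKl row_mxKr gf// g'f// hsubmxK.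
- move=> F PF; have [->|/set0P F0] := eqVneq F set0; first by rewrite image_set0; exact: face_set0.
  have [F1 [F2 [PF1 PF2 ->]]] := prod_face PF F0; rewrite prod_set_image.
  by apply: prod_set_face; [exact: ff|exact: f'f].
move=> F QF; have [->|/set0P F0] := eqVneq F set0.
  by rewrite preimage_set0 setI0 => _; exact: face_set0.
have [F1 [F2 [QF1 QF2 FE]]] := prod_face QF F0; rewrite prod_set_image FE => FP.
have [z0] := F0; rewrite FE => -[F1z F2z].
have -> : prod_set P P' `&` (fun z => row_mx (f (lsubmx z)) (f' (rsubmx z))) @^-1` prod_set F1 F2 =
   prod_set (P `&` f @^-1` F1) (P' `&` f' @^-1` F2).
  apply/seteqP; split => z; rewrite /prod_set /= ?row_mxKl ?row_mxKr; by move=> [[h1 h2] [h3 h4]].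
apply: prod_set_face.
  apply: fcell => // x F1x; have := FP (row_mx x (rsubmx z0)).
  by rewrite /prod_set /= row_mxKl row_mxKr; case.
apply: f'cell => // y F2y; have := FP (row_mx (lsubmx z0) y).
by rewrite /prod_set /= row_mxKl row_mxKr; case.
Qed.

Lemma face_embedding_linear m n (P : set 'rV[R]_m) (Q : set 'rV[R]_n) f g :
  (forall k x y, f (k *: x + y) = k *: f x + f y) ->
  (forall k x y, g (k *: x + y) = k *: g x + g y) ->
  (forall x, g (f x) = x) -> polytope P -> polytope Q -> face Q (f @` P) ->
  face_embedding P Q f.
Proof.
move=> /linear_mx[M fM] /linear_mx[N gN] gf pP pQ fP.
have fE : f = fun x => x *m M by apply/funext.
have gE : g = fun x => x *m N by apply/funext.
split.
- by rewrite fE; apply: continuous_subspaceT => x; exact: mulmxr_continuous.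
- exists g => // ; rewrite gE; apply: continuous_subspaceT => x; exact: mulmxr_continuous.
- move=> F PF; apply: (face_trans pQ fP); rewrite fE; apply: face_linear => //.
  by move=> x y _ _ xy; rewrite -(gf x) -(gf y) !fM xy.
move=> F [u [c [uc ->]]] _; exists (u *m M^T), c; split.
  move=> x Px; rewrite -dotp_mulmx -fM; apply/uc/(face_sub fP); by exists x.
apply/seteqP; split => x /= [Px]; first by move=> [_ /=]; rewrite fM dotp_mulmx.
by rewrite -dotp_mulmx -fM => xc; split => //; split => //; apply: (face_sub fP); exists x.
Qed.

Lemma face_embedding_id n (P : set 'rV[R]_n) : face_embedding P P id.
Proof.
split.
- by apply: continuous_subspaceT => x; exact: cvg_id.
- by exists id => //; apply: continuous_subspaceT => x; exact: cvg_id.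
- by move=> F; rewrite image_id.
by move=> F PF FP; rewrite setIidr//; exact: face_sub.
Qed.

(** Nonempty faces are given by tight sets, which transitions preserve. *)
Lemma face_embedding_transition t w w' f : planar_tree t ->
  (forall v, (0 < w v)%N) -> (forall v, (0 < w' v)%N) ->
  weight_transition (R := R) (t := t) w w' f ->
  face_embedding (operahedron (R := R) w) (operahedron w') f.
Proof.
move=> pt w0 w'0 wf; rewrite !operahedronE//.
have [g wg] := weight_transition_exists R pt w'0 w0.
have gf := weight_transition_inv pt w0 w'0 wf wg.
have fg := weight_transition_inv pt w'0 w0 wg wf.
have Pf := trans_fun (wt_transition wf); have Pg := trans_fun (wt_transition wg).
have im S : f @` lface (nests t) (nest_weight (real_weight R w)) S =
    lface (nests t) (nest_weight (real_weight R w')) S.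
  apply/seteqP; split => [_ [x [Px Sx] <-]|y [Py Sy]].
    by split; [exact: Pf|rewrite (weight_transition_tight pt w0 w'0 wf)].
  exists (g y); last exact: fg.
  by split; [exact: Pg|rewrite (weight_transition_tight pt w'0 w0 wg)].
have imT : f @` lpoly (nests t) (nest_weight (real_weight R w)) =
    lpoly (nests t) (nest_weight (real_weight R w')).
  by apply/seteqP; split => [_ [x Px <-]|y Py]; [exact: Pf|exists (g y); [exact: Pg|exact: fg]].
split.
- exact: trans_cont (wt_transition wf).
- by exists g => //; rewrite imT; exact: trans_cont (wt_transition wg).
- move=> F PF; have [->|/set0P F0] := eqVneq F set0; first by rewrite image_set0; exact: face_set0.
  by have [S ->] := lpoly_face PF F0; rewrite im; exact: lface_face.
move=> F PF _; have [->|/set0P F0] := eqVneq F set0.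
  by rewrite preimage_set0 setI0; exact: face_set0.
have [S ->] := lpoly_face PF F0.
suff -> : lpoly (nests t) (nest_weight (real_weight R w)) `&`
    f @^-1` lface (nests t) (nest_weight (real_weight R w')) S =
    lface (nests t) (nest_weight (real_weight R w)) S by exact: lface_face.
apply/seteqP; split => x /= [Px]; first by case=> _; rewrite (weight_transition_tight pt w0 w'0 wf).
by move=> Sx; split => //; split; [exact: Pf|rewrite (weight_transition_tight pt w0 w'0 wf)].
Qed.

End FaceEmbeddings.

(** * Sequences, splicing and permutations *)

Section Sequences.
Variable T : Type.
Implicit Types (s u : seq T) (k l : seq nat) (i j : nat).

Lemma onth_size s i x : onth s i = Some x -> (i < size s)%N.
Proof. by move=> e; rewrite -onthTE e. Qed.

Lemma map_splice (T' : Type) (f : T -> T') i s u :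
  map f (splice i s u) = splice i (map f s) (map f u).
Proof. by rewrite /splice !map_cat map_take map_drop. Qed.

Lemma size_splice i s u : (i < size s)%N -> size (splice i s u) = (size s + size u).-1.
Proof.
by move=> h; rewrite /splice !size_cat size_drop size_takel ?(ltnW h)//; lia.
Qed.

Lemma nth_splice (x0 : T) i s u j : (i < size s)%N -> nth x0 (splice i s u) j =
  if (j < i)%N then nth x0 s j else if (j < i + size u)%N then nth x0 u (j - i)
  else nth x0 s (j - size u).+1.
Proof.
move=> h; rewrite /splice nth_cat size_takel ?(ltnW h)//; case: ltnP => ji; first by rewrite nth_take.
rewrite nth_cat -(ltn_add2l i) subnKC//; case: ltnP => // uj.
by rewrite nth_drop; congr nth; lia.
Qed.

Lemma precomposeE (x0 : T) s k : all (fun v => v < size s)%N k ->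
  precompose s k = [seq nth x0 s v | v <- k].
Proof.
elim: k => //= v k IH /andP[vs /IH <-].
by rewrite -odflt_onth; move: vs; rewrite -onthTE; case: onth.
Qed.

Lemma map_precompose (T' : Type) (f : T -> T') s k :
  map f (precompose s k) = precompose (map f s) k.
Proof. by elim: k => //= v k IH; rewrite onth_map; case: onth => //= x; rewrite IH. Qed.

Lemma is_perm_bound n k : is_perm n k -> all (fun v => v < n)%N k.
Proof. by move=> pk; rewrite (perm_all _ pk); apply/allP => v; rewrite mem_iota. Qed.

Lemma is_perm_size n k : is_perm n k -> size k = n.
Proof. by move=> /perm_size; rewrite size_iota. Qed.

Lemma is_perm_uniq n k : is_perm n k -> uniq k.
Proof. by move=> /perm_uniq ->; exact: iota_uniq. Qed.

Lemma size_precompose s k : is_perm (size s) k -> size (precompose s k) = size s.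
Proof.
case: s => [|x0 s] pk; first by move: (is_perm_size pk) => /= /size0nil ->.
by rewrite (precomposeE x0 (is_perm_bound pk)) size_map (is_perm_size pk).
Qed.

Lemma nth_precompose (x0 : T) s k i : is_perm (size s) k -> (i < size s)%N ->
  nth x0 (precompose s k) i = nth x0 s (nth 0%N k i).
Proof.
move=> pk h; rewrite (precomposeE x0 (is_perm_bound pk)) (nth_map 0%N)//.
by rewrite (is_perm_size pk).
Qed.

Lemma precompose1 s : precompose s (iota 0 (size s)) = s.
Proof.
case: s => // x0 s; rewrite (precomposeE x0).
  by rewrite -/(mkseq _ _) mkseq_nth.
by apply/allP => v; rewrite mem_iota.
Qed.

End Sequences.

Lemma perm_precompose (T : eqType) (s : seq T) k : is_perm (size s) k -> perm_eq (precompose s k) s.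
Proof.
case: s => [|x0 s] pk; first by move: (is_perm_size pk) => /= /size0nil ->.
rewrite (precomposeE x0 (is_perm_bound pk)).
by rewrite -{2}[x0 :: s](mkseq_nth x0) /mkseq perm_map.
Qed.

Lemma is_perm_precompose n k l : is_perm n k -> is_perm n l -> is_perm n (precompose k l).
Proof.
move=> pk pl; have sk := is_perm_size pk; apply: perm_trans pk; apply: perm_precompose.
by rewrite sk.
Qed.

Lemma precomposeA (T : Type) (s : seq T) k l : is_perm (size s) k -> is_perm (size s) l ->
  precompose (precompose s k) l = precompose s (precompose k l).
Proof.
case: s => [|x0 s] pk pl; first by move: (is_perm_size pl) (is_perm_size pk) => /= /size0nil -> /size0nil ->.
have szk := is_perm_size pk.
rewrite (precomposeE x0 (_ : all (fun v => v < size (precompose (x0 :: s) k))%N l)); last first.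
  by rewrite size_precompose//; exact: is_perm_bound.
rewrite (precomposeE x0 (is_perm_bound (is_perm_precompose pk pl))).
rewrite (precomposeE 0%N (_ : all (fun v => v < size k)%N l)); last by rewrite szk; exact: is_perm_bound.
rewrite -map_comp; apply/eq_in_map => v /(allP (is_perm_bound pl)) vs /=.
by rewrite nth_precompose.
Qed.

Lemma perm_splice (T : eqType) (s u : seq T) i x0 : (i < size s)%N ->
  perm_eq (nth x0 s i :: splice i s u) (s ++ u).
Proof.
move=> h; have E : s = take i s ++ nth x0 s i :: drop i.+1 s by rewrite -drop_nth// cat_take_drop.
rewrite /splice [X in perm_eq _ (X ++ _)]E -[nth x0 s i :: drop _ _]cat1s -!catA.
by rewrite perm_sym perm_catCA /= perm_cons perm_cat2l perm_catC.
Qed.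

(** * Composites of operadic trees and their types *)

Section Composition.
Variables (c c' : seq posn) (d d' : posn) (i : nat) (x y : optree).
Hypotheses (ox : is_optree x) (tx : of_type c d x).
Hypotheses (oy : is_optree y) (ty : of_type c' d' y).
Hypothesis ci : onth c i = Some d'.
Local Notation a := (nth 0%N x.2 i).

Lemma of_type_size : size x.2 = size c.
Proof. by case: tx => /(congr1 size); rewrite !size_map. Qed.

Lemma comp_planar_l : planar_tree x.1. Proof. by case/andP: ox. Qed.
Lemma comp_planar_r : planar_tree y.1. Proof. by case/andP: oy. Qed.

Lemma comp_index : (i < size x.2)%N.
Proof. by rewrite of_type_size; exact: onth_size ci. Qed.

Lemma comp_vertex : (a < nv x.1)%N.
Proof.
have /andP[_ px] := ox; have : a \in x.2 by rewrite mem_nth ?comp_index.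
by rewrite (perm_mem px) mem_iota.
Qed.

Lemma comp_arity : nth 0%N (arities x.1) a = leaves y.1.
Proof.
case: ty => _ ->; case: tx => /(congr1 (fun s => nth 0%N s i)) E _.
rewrite (nth_map 0%N) ?comp_index// in E; rewrite E (nth_map d') ?(onth_size ci)//.
by rewrite (@onth_nth _ d' _ _ _ ci).
Qed.

End Composition.

Section LabelledArity.
Variable T : eqType.

Lemma nth_label_arities (r : tree T) x n : uniq (labels r) -> (x, n) \in label_arities r ->
  nth 0%N (arities r) (index x (labels r)) = n.
Proof.
move=> ur /(nthP (x, n))[k kr E].
have lk : nth x (labels r) k = x by rewrite labels_label_arities (nth_map (x, n))// E.
have ik : index x (labels r) = k.
  by rewrite -{1}lk index_uniq// labels_label_arities size_map.
by rewrite ik arities_label_arities (nth_map (x, n))// E.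
Qed.

Lemma label_arities_nth (r : tree T) x : x \in labels r ->
  (x, nth 0%N (arities r) (index x (labels r))) \in label_arities r.
Proof.
rewrite labels_label_arities arities_label_arities => xr.
set k := index _ _; have kr : (k < size (label_arities r))%N by rewrite -(size_map fst) index_mem.
rewrite (nth_map (x, 0%N))//; have {1}-> : x = (nth (x, 0%N) (label_arities r) k).1.
  by rewrite -(nth_map _ x)// nth_index.
by rewrite -surjective_pairing mem_nth.
Qed.

End LabelledArity.

Section SubstArity.
Variables (t s : tree nat) (a : nat).
Hypothesis pt : planar_tree t.
Hypothesis ps : planar_tree s.
Hypothesis ha : (a < nv t)%N.
Hypothesis hs : nth 0%N (arities t) a = leaves s.

Lemma arities_subst_tree : arities (subst_tree t a s) = arities (subst_lab t a s).
Proof. exact: arities_tmap. Qed.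

Lemma index_planar (r : tree nat) v : planar_tree r -> (v < nv r)%N -> index v (labels r) = v.
Proof.
move=> pr vr; rewrite (planar_labels pr).
by rewrite -[v in index v](@nth_iota 0%N 0%N (nv r))// index_uniq ?iota_uniq ?size_iota.
Qed.

Lemma arity_inr v : (v < nv s)%N ->
  nth 0%N (arities (subst_tree t a s)) (new_vertex t a s (inr v)) = nth 0%N (arities s) v.
Proof.
move=> vs; rewrite arities_subst_tree; apply: nth_label_arities.
  exact: (subst_lab_uniq pt ps ha hs).
rewrite -has_pred1 has_count (count_label_arities_subst _ (subst_lab_substitutable pt hs)).
rewrite addn_gt0 count_subst_lab// mul1n orbC -has_count; apply/orP; left.
apply/hasP; exists (inr v, nth 0%N (arities s) v) => /=; last by rewrite eqxx.
rewrite label_arities_tmap; apply/mapP; exists (v, nth 0%N (arities s) v) => //.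
by rewrite -{2}(index_planar ps vs) label_arities_nth// mem_labels_planar.
Qed.

Lemma arity_inl v : (v < nv t)%N -> v != a ->
  nth 0%N (arities (subst_tree t a s)) (new_vertex t a s (inl v)) = nth 0%N (arities t) v.
Proof.
move=> vt va; rewrite arities_subst_tree; apply: nth_label_arities.
  exact: (subst_lab_uniq pt ps ha hs).
rewrite -has_pred1 has_count (count_label_arities_subst _ (subst_lab_substitutable pt hs)).
rewrite addn_gt0 -has_count; apply/orP; left.
apply/hasP; exists (inl v, nth 0%N (arities t) v) => /=; last by rewrite eqxx (inj_eq inl_inj).
rewrite label_arities_tmap; apply/mapP; exists (v, nth 0%N (arities t) v) => //.
by rewrite -{2}(index_planar pt vt) label_arities_nth// mem_labels_planar.
Qed.

Lemma leaves_subst_tree : leaves (subst_tree t a s) = leaves t.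
Proof. by rewrite leaves_tmap leaves_subst ?leaves_tmap//; exact: subst_lab_substitutable. Qed.

End SubstArity.

Section CompositionType.
Variables (c c' : seq posn) (d d' : posn) (i : nat) (x y : optree).
Hypotheses (ox : is_optree x) (tx : of_type c d x).
Hypotheses (oy : is_optree y) (ty : of_type c' d' y).
Hypothesis ci : onth c i = Some d'.
Local Notation a := (nth 0%N x.2 i).

Lemma splice_in (T : eqType) (s : seq T) j x0 : uniq s -> (j < size s)%N ->
  forall v, v \in take j s ++ drop j.+1 s -> v \in s /\ v != nth x0 s j.
Proof.
move=> us js v vv; have E : s = take j s ++ nth x0 s j :: drop j.+1 s.
  by rewrite -drop_nth// cat_take_drop.
have : uniq (take j s ++ nth x0 s j :: drop j.+1 s) by rewrite -E.
rewrite cat_uniq /= => /and3P[_ + /andP[nd _]]; rewrite negb_or => /andP[nt _].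
move: vv; rewrite mem_cat => /orP[vt|vd]; rewrite {1}E mem_cat inE ?vt ?vd ?orbT; split => //.
  by apply: contraNneq nt => <-.
by apply: contraNneq nd => <-.
Qed.

Lemma optree_comp_perm : is_perm (nv (subst_tree x.1 a y.1)) (optree_comp i x y).2.
Proof.
have pt := comp_planar_l ox; have ps := comp_planar_r oy.
have ha := comp_vertex ox tx ci; have hs := comp_arity tx ty ci.
have ix := comp_index tx ci; have /andP[_ px] := ox; have /andP[_ py] := oy.
rewrite /is_perm -(planar_labels (planar_subst pt ps ha hs)) labels_tmap.
(* The composite numbering with vertices still named by their origin; it is a rearrangement of the
   labels of [subst_lab]. *)
pose S := splice i (map inl x.2) (map inr y.2) : seq (nat + nat).
have -> : (optree_comp i x y).2 = map (new_vertex x.1 a y.1) S.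
  by rewrite map_splice -!map_comp.
apply: perm_map; apply: uniq_perm.
- have : uniq (nth (inl 0%N) (map inl x.2) i :: S).
    rewrite (perm_uniq (perm_splice _ _ _)) ?size_map// cat_uniq !map_inj_uniq; try exact: inl_inj; try exact: inr_inj.
    rewrite (is_perm_uniq px) (is_perm_uniq py) /= andbT.
    by apply/hasPn => _ /mapP[v _ ->]; apply/mapP => -[].
  by move=> /andP[].
- exact: (subst_lab_uniq pt ps ha hs).
move=> v; rewrite (mem_subst_lab pt ps ha hs).
have <- : (v \in S) && (v != inl a) = match v with inl u => (u < nv x.1)%N && (u != a) | inr u => (u < nv y.1)%N end.
  have : (v \in nth (inl 0%N) (map inl x.2) i :: S) = (v \in map inl x.2 ++ map inr y.2).
    by rewrite (perm_mem (perm_splice _ _ _)) ?size_map.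
  rewrite (nth_map 0%N)// in_cons => E.
  have E2 : (v \in S) && (v != inl a) = (v \in map inl x.2 ++ map inr y.2) && (v != inl a).
    by rewrite -E; case: eqP; rewrite ?andbF ?andbT.
  rewrite E2 mem_cat; case: v {E E2} => u.
    rewrite (mem_map inl_inj) (inj_eq inl_inj) (perm_mem px) mem_iota /=.
    by rewrite [X in _ || X](_ : _ = false) ?orbF//; apply/mapP => -[].
  rewrite (mem_map inr_inj) (perm_mem py) mem_iota /= andbT.
  by rewrite [X in X || _](_ : _ = false)//; apply/mapP => -[].
have : uniq (nth (inl 0%N) (map inl x.2) i :: S).
  rewrite (perm_uniq (perm_splice _ _ _)) ?size_map// cat_uniq !map_inj_uniq; try exact: inl_inj; try exact: inr_inj.
  rewrite (is_perm_uniq px) (is_perm_uniq py) /= andbT.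
  by apply/hasPn => _ /mapP[u _ ->]; apply/mapP => -[].
rewrite (nth_map 0%N)// => /andP[na _]; case: eqP => [->|]; last by rewrite andbT.
by rewrite (negbTE na).
Qed.

Lemma optree_comp_is : is_optree (optree_comp i x y).
Proof.
apply/andP; split; last exact: optree_comp_perm.
exact: (planar_subst (comp_planar_l ox) (comp_planar_r oy) (comp_vertex ox tx ci) (comp_arity tx ty ci)).
Qed.

Lemma optree_comp_type : of_type (splice i c c') d (optree_comp i x y).
Proof.
have pt := comp_planar_l ox; have ps := comp_planar_r oy.
have ha := comp_vertex ox tx ci; have hs := comp_arity tx ty ci.
have ix := comp_index tx ci; have /andP[_ px] := ox; have /andP[_ py] := oy.
split; last by rewrite leaves_subst_tree//; case: tx.
rewrite [RHS]map_splice; case: tx => <- _; case: ty => <- _.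
rewrite /optree_comp [in LHS]/= [in LHS]map_splice -!map_comp.
have ina v : v \in take i x.2 ++ drop i.+1 x.2 ->
  nth 0%N (arities (subst_tree x.1 a y.1)) (new_vertex x.1 a y.1 (inl v)) = nth 0%N (arities x.1) v.
  move=> /(splice_in 0%N (is_perm_uniq px) ix)[vx va]; apply: arity_inl => //.
  by move: vx; rewrite (perm_mem px) mem_iota.
rewrite /splice -!map_take -!map_drop; congr (_ ++ (_ ++ _)); apply/eq_in_map => v vv /=.
- by rewrite ina// mem_cat vv.
- by rewrite arity_inr//; move: vv; rewrite (perm_mem py) mem_iota.
- by rewrite ina// mem_cat vv orbT.
Qed.

End CompositionType.

Lemma optree_act_is c d kappa x : is_optree x -> of_type c d x -> is_perm (size c) kappa ->
  is_optree (optree_act kappa x) /\ of_type (precompose c kappa) d (optree_act kappa x).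
Proof.
move=> ox tx pk; have /andP[px qx] := ox; have [h1 h2] := tx.
rewrite -(of_type_size tx) in pk.
split; last by split => //; rewrite /= !map_precompose h1.
rewrite /is_optree /= px; apply: perm_trans qx; exact: perm_precompose.
Qed.

Lemma arities_corolla n : arities (corolla n) = [:: n].
Proof. by rewrite /= size_nseq; congr (_ :: _); elim: n. Qed.

Lemma labels_corolla n : labels (corolla n) = [:: 0%N].
Proof. by rewrite /=; congr (_ :: _); elim: n. Qed.

Lemma leaves_corolla n : leaves (corolla n) = n.
Proof. by rewrite /= map_nseq sumn_nseq mul1n. Qed.

Lemma planar_corolla n : (0 < n)%N -> planar_tree (corolla n).
Proof. by move=> n0; rewrite /planar_tree /nv labels_corolla arities_corolla /= n0. Qed.

Lemma optree_unit_is n : is_optree (optree_unit n) /\ of_type [:: n] n (optree_unit n).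
Proof.
split; first by rewrite /is_optree planar_corolla /nv ?labels_corolla//; exact: valP.
by split; rewrite /optree_unit ?leaves_corolla// arities_corolla.
Qed.

(** * Finitely many operadic trees of a given type *)

Section Finiteness.

(** Leaves carry no label, so a bound on the arities accompanies the bounds on the labels. *)
Lemma finite_trees K m h :
  finite_set [set t : tree nat | [/\ (size (labels t) <= h)%N, all (fun v => v < K)%N (labels t)
                                   & all (fun v => v <= m)%N (arities t)]].
Proof.
elim: h => [|h IH].
  apply: (sub_finite_set (B := [set Leaf])); last exact: finite_set1.
  by move=> [|x ts] [].
pose A := [set t : tree nat | [/\ (size (labels t) <= h)%N, all (fun v => v < K)%N (labels t)
                                   & all (fun v => v <= m)%N (arities t)]].
have fin j : finite_set [set ts : seq (tree nat) | (size ts <= j)%N /\ Forall_trees A ts].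
  elim: j => [|j IHj].
    apply: (sub_finite_set (B := [set [::]])); last exact: finite_set1.
    by move=> [|x ts] [].
  apply: (sub_finite_set (B := [set [::]] `|`
      [set x :: y | x in A & y in [set ts | (size ts <= j)%N /\ Forall_trees A ts]])); last first.
    rewrite finite_setU; split; [exact: finite_set1|exact: finite_image2].
  by move=> [|t ts] [szt At]; [left|right; exists t; [case: At|exists ts; [case: At|]]].
apply: (sub_finite_set (B := [set Leaf] `|` [set Node x y | x in [set` iota 0 K] &
    y in [set ts | (size ts <= m)%N /\ Forall_trees A ts]])); last first.
  by rewrite finite_setU; split; [exact: finite_set1|apply: finite_image2 => //; exact: finite_seq].
move=> [|x ts]; first by left.
move=> [/= szt /andP[xK allK] /andP[szm allm]]; right; exists x; first by rewrite /= mem_iota.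
exists ts => //; split => //; rewrite ltnS in szt; elim: ts szt allK allm {szm} => //= t ts IHts.
rewrite size_cat !all_cat => szt /andP[tK tsK] /andP[tm tsm]; split.
  by split => //; apply: leq_trans szt; rewrite leq_addr.
by apply: IHts => //; apply: leq_trans szt; rewrite leq_addl.
Qed.

Lemma finite_comps (c : seq posn) (d : posn) : finite_set [set x : optree | is_optree x /\ of_type c d x].
Proof.
pose m := (\max_(n <- c) val n)%N; pose k := size c.
apply: (sub_finite_set _ (finite_setX (finite_trees k m k) (finite_seq (permutations (iota 0 k))))).
move=> [t s] [/andP[/= pt ps] tx]; have := of_type_size tx => /= szs.
have nvt : nv t = k by rewrite -(is_perm_size ps) szs.
split; last by rewrite /= mem_permutations -nvt.
rewrite /=; split.
- by rewrite -/(nv t) nvt.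
- by rewrite (planar_labels pt) nvt; apply/allP => v; rewrite mem_iota.
apply/(all_nthP 0%N) => v; rewrite -size_labels_arities -/(nv t) => vt.
have vs : v \in s by rewrite (perm_mem ps) mem_iota.
have : nth 0%N (arities t) v \in [seq val n | n <- c] by case: tx => <- _; exact: (map_f (nth 0%N (arities t))).
by move=> /mapP[n nc ->]; rewrite /m; exact: (@leq_bigmax_seq _ c xpredT (fun n : posn => val n)).
Qed.

End Finiteness.

(** * Iterated substitutions *)

Section SpliceLaws.
Variable T : Type.
Implicit Types (s u r : seq T) (i j : nat) (k l : seq nat).

Lemma splice_seqA i j s u r : (i < size s)%N -> (j < size u)%N ->
  splice (i + j) (splice i s u) r = splice i s (splice j u r).
Proof.
move=> si uj; have ti : size (take i s) = i by rewrite size_takel// ltnW.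
rewrite /splice take_cat drop_cat ti.
have -> : (i + j < i)%N = false by lia.
have -> : ((i + j).+1 < i)%N = false by lia.
have -> : (i + j - i = j)%N by lia.
have -> : ((i + j).+1 - i = j.+1)%N by lia.
rewrite take_cat uj drop_cat -!catA; case: ltnP => // uj'.
have -> : drop j.+1 u = [::] by apply: drop_oversize.
have -> : (j.+1 - size u = 0)%N by lia.
by rewrite drop0.
Qed.

Lemma splice_parA i j s u r : (i < j < size s)%N ->
  splice (j + size u).-1 (splice i s u) r = splice i (splice j s r) u.
Proof.
move=> /andP[ij sj]; have si := ltn_trans ij sj.
have ti : size (take i s) = i by rewrite size_takel// ltnW.
have tj : size (take j s) = j by rewrite size_takel// ltnW.
rewrite /splice take_cat drop_cat ti.
have -> : ((j + size u).-1 < i)%N = false by lia.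
have -> : ((j + size u).-1.+1 < i)%N = false by lia.
rewrite take_cat drop_cat.
have -> : ((j + size u).-1 - i < size u)%N = false by lia.
have -> : ((j + size u).-1.+1 - i < size u)%N = false by lia.
rewrite [in RHS]take_cat [in RHS]drop_cat tj ij.
have E : take ((j + size u).-1 - i - size u) (drop i.+1 s) = drop i.+1 (take j s).
  by rewrite take_drop; congr (drop _ (take _ _)); lia.
have E' : drop ((j + size u).-1.+1 - i - size u) (drop i.+1 s) = drop j.+1 s.
  by rewrite drop_drop; congr drop; lia.
rewrite E E' take_takel ?(ltnW ij)// -!catA; case: ltnP => // ij'.
have ji : j = i.+1 by lia.
by rewrite ji subnn drop0 drop_oversize// size_takel// -ji ltnW.
Qed.

Lemma eq_splice (T' : eqType) (f g : T' -> T) i (s : seq T') u :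
  {in take i s ++ drop i.+1 s, f =1 g} -> splice i (map f s) u = splice i (map g s) u.
Proof.
move=> fg; rewrite /splice -!map_take -!map_drop; congr (_ ++ (_ ++ _));
by apply/eq_in_map => v vs; apply: fg; rewrite mem_cat vs ?orbT.
Qed.

Lemma precompose_block i s u k l : is_perm (size s) k -> is_perm (size u) l -> (i < size s)%N ->
  precompose (splice (nth 0%N k i) s u) (block_perm k i l) =
  splice i (precompose s k) (precompose u l).
Proof.
case: s => // x0 s' pk pl si; set s := x0 :: s' in pk si *; set a := nth 0%N k i.
have ik : (i < size k)%N by rewrite (is_perm_size pk).
have as_ : (a < size s)%N by apply: (allP (is_perm_bound pk)); exact: mem_nth.
have szl := is_perm_size pl.
have szS := size_splice u as_.
have E (X : seq nat) (f : nat -> nat) (r : seq T) (us : seq T) :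
    all (fun v => (f v < size r)%N) X -> (forall v, v \in X -> nth x0 r (f v) = nth x0 us v) ->
    precompose r (map f X) = map (nth x0 us) X.
  move=> rX rn; rewrite (precomposeE x0); last by rewrite all_map.
  by rewrite -map_comp; apply/eq_in_map => w /rn.
have sub v : v \in take i k ++ drop i.+1 k -> (v < size s)%N /\ v != a.
  move=> /(splice_in 0%N (is_perm_uniq pk) ik)[vk va]; split => //.
  exact: (allP (is_perm_bound pk)).
have fs v : v \in take i k ++ drop i.+1 k ->
   ((if (v < a)%N then v else (v + size l).-1)%N < size (splice a s u))%N /\
   nth x0 (splice a s u) (if (v < a)%N then v else (v + size l).-1)%N = nth x0 s v.
  move=> /sub[vs va]; rewrite szS szl nth_splice//; move: va; rewrite neq_ltn => /orP[va|av].
    by rewrite va va; split => //; apply: leq_trans va _; move: as_; clear; move: (size s) (a : nat); lia.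
  have -> : (v < a)%N = false by rewrite ltnNge (ltnW av).
  have -> : ((v + size u).-1 < a)%N = false by move: av; clear; move: (a : nat) (v : nat); lia.
  have -> : ((v + size u).-1 < a + size u)%N = false by move: av; clear; move: (a : nat) (v : nat); lia.
  split; first by move: av vs; clear; move: (size s) (a : nat) (v : nat); lia.
  by congr nth; move: av; clear; move: (a : nat) (v : nat); lia.
rewrite /block_perm -/a /splice -!map_take -!map_drop -/(splice a s u).
rewrite [LHS]/precompose !pmap_cat -!/(precompose _ _).
rewrite (precomposeE x0 (is_perm_bound pk)) -!map_take -!map_drop; congr (_ ++ (_ ++ _)).
- apply: E => //; first by apply/allP => v vt; apply: (fs v _).1; rewrite mem_cat vt.
  by move=> v vt; apply: (fs v _).2; rewrite mem_cat vt.
- rewrite (precomposeE x0 (is_perm_bound pl)).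
  apply: E => //.
    apply/allP => v /(allP (is_perm_bound pl)); rewrite szS; move: as_; clear.
    by move: (size s) (size u) (a : nat) (v : nat); lia.
  move=> v /(allP (is_perm_bound pl)) vu; rewrite nth_splice//.
  by rewrite ltnNge leq_addr /= ltn_add2l vu addKn.
- apply: E => //; first by apply/allP => v vt; apply: (fs v _).1; rewrite mem_cat vt orbT.
  by move=> v vt; apply: (fs v _).2; rewrite mem_cat vt orbT.
Qed.

End SpliceLaws.

(** * Independence of the names of vertices *)

Section Relabelling.
Variables (T T' : eqType).

Lemma index_map_in (f : T -> T') (l : seq T) x : {in l &, injective f} -> x \in l ->
  index (f x) (map f l) = index x l.
Proof.
elim: l => //= y l IH inj; rewrite inE => xl.
have -> : (f y == f x) = (y == x).
  apply/eqP/eqP => [fxy|->//]; apply: inj => //; rewrite inE ?eqxx//.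
case: eqP => // yx; rewrite IH//.
  by move=> v w vl wl; apply: inj; rewrite inE ?vl ?wl orbT.
by case/orP: xl => // /eqP xy; rewrite xy in yx.
Qed.

(** Numbering vertices by position does not see their names, as long as these are distinct. Iterated
    substitutions can thus be compared on a single tree with structured names. *)
Lemma tmap_index_relabel (f : T -> T') (t : tree T) : {in labels t &, injective f} ->
  tmap (index^~ (labels (tmap f t))) (tmap f t) = tmap (index^~ (labels t)) t.
Proof.
move=> inj; rewrite tmap_comp; apply: eq_in_tmap => x xt.
by rewrite labels_tmap index_map_in.
Qed.

End Relabelling.

Lemma tmap_index_planar (t : tree nat) : planar_tree t -> tmap (index^~ (labels t)) t = t.
Proof.
move=> pt; rewrite -[RHS]tmap_id; apply: eq_in_tmap => v.
by rewrite mem_labels_planar// => /(index_planar pt).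
Qed.

Section NestedSubstitutionTrees.
Variables (R : realType).

(** The coordinate of the edge below vertex u. At the root it is meaningless, since the predecessor
    of 0 is 0; hence the side conditions that exclude the root. *)
Definition vcoord n (z : 'rV[R]_n) (u : nat) : R := Defs.coord z u.-1.

(** The edge below the root of s is the edge of t below a. *)
Definition label_coord m n (x : 'rV[R]_m) (a : nat) (y : 'rV[R]_n) (l : nat + nat) : R :=
  match l with
  | inl u => vcoord x u
  | inr 0 => vcoord x a
  | inr v => vcoord y v
  end.

Lemma vcoord_theta (t s : tree nat) a (x : 'rV[R]_(ne t)) (y : 'rV[R]_(ne s)) l :
  planar_tree t -> planar_tree s -> (a < nv t)%N -> nth 0%N (arities t) a = leaves s ->
  l \in labels (subst_lab t a s) -> new_vertex t a s l != 0%N ->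
  vcoord (theta a x y) (new_vertex t a s l) = label_coord x a y l.
Proof.
move=> pt ps ha hs; rewrite (mem_subst_lab pt ps ha hs).
have outer u : (u < nv t)%N -> kt t s a u != 0%N -> vcoord (theta a x y) (kt t s a u) = vcoord x u.
  case: u => [|u] ut; first by rewrite (kt0 a pt ps).
  have ut' : (u < ne t)%N by move: ut; rewrite (planar_nv pt).
  move=> _; rewrite /vcoord -[u.+1]/((Ordinal ut').+1) -(jt_succ pt ps ha hs).
  by rewrite !coordE theta_jt -coordE.
case: l => [u /andP[ut ua]|[|v] vs]; rewrite /label_coord.
- have -> : new_vertex t a s (inl u) = kt t s a u by rewrite /kt /emb (negbTE ua).
  exact: outer.
- by rewrite -[new_vertex _ _ _ _]/(ks t s a 0) -kt_at; exact: outer.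
have vs' : (v < ne s)%N by move: vs; rewrite (planar_nv ps).
move=> _; rewrite /vcoord -[new_vertex _ _ _ _]/(ks t s a (Ordinal vs').+1) -(js_succ pt ps ha hs).
by rewrite !coordE theta_js -coordE.
Qed.

Lemma eq_coord n n' (z : 'rV[R]_n) (z' : 'rV[R]_n') : n = n' ->
  (forall k, (k < n)%N -> vcoord z k.+1 = vcoord z' k.+1) -> forall k, Defs.coord z k = Defs.coord z' k.
Proof.
move=> nn' h k; subst n'; have [/h//|nk] := ltnP k n.
by rewrite /Defs.coord insubN// -leqNgt.
Qed.

Section Left.
Variables (t s r : tree nat) (a : nat) (beta : nat + nat).
Hypothesis pt : planar_tree t.
Hypothesis ps : planar_tree s.
Hypothesis pr : planar_tree r.
Hypothesis ha : (a < nv t)%N.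
Hypothesis hs : nth 0%N (arities t) a = leaves s.
Local Notation q := (subst_tree t a s).
Local Notation lab := (subst_lab t a s).
Local Notation pos := (new_vertex t a s).
Hypothesis bL : beta \in labels lab.
Local Notation b := (pos beta).
Hypothesis hr : nth 0%N (arities q) b = leaves r.

(** Vertices are named [inl (inl u)], [inl (inr v)] or [inr w] according to whether they come from
    t, s or r. The vertex beta lies in s for the sequential axiom and in t for the parallel one. *)
Definition double_subst : tree ((nat + nat) + nat) :=
  subst (pred1 (inl beta)) (tmap inr r) (tmap inl lab).
Local Notation X := double_subst.

Definition double_label (l : (nat + nat) + nat) : nat + nat :=
  match l with inl x => inl (pos x) | inr w => inr w end.

Lemma double_hb : (b < nv q)%N.
Proof. exact: (pos_bound bL). Qed.

Lemma double_substitutable : substitutable (pred1 (inl beta)) (tmap inr r) (tmap inl lab).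
Proof.
apply/allP => p; rewrite label_arities_tmap => /mapP[[y n] yl ->] /=.
apply/implyP => /eqP[yb]; rewrite leaves_tmap -hr arities_subst_tree yb in yl *.
by rewrite (nth_label_arities (subst_lab_uniq pt ps ha hs) yl).
Qed.

Lemma mem_double l : (l \in labels X) =
  match l with inl x => (x \in labels lab) && (x != beta) | inr w => (w < nv r)%N end.
Proof.
have cb : count (pred1 (inl beta)) (labels (tmap inl lab : tree ((nat + nat) + nat))) = 1%N.
  rewrite labels_tmap count_map (eq_count (a2 := pred1 beta))//.
  by rewrite count_uniq_mem ?bL// (subst_lab_uniq pt ps ha hs).
rewrite -has_pred1 has_count labels_label_arities count_map.
rewrite (count_label_arities_subst _ double_substitutable) cb mul1n addn_gt0.
rewrite !label_arities_tmap !count_map -!has_count.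
apply/orP/idP => [[/hasP[[y n] yl /= /andP[/eqP <- yb]]|/hasP[[y n] yl /= /eqP <-]]|].
- move: yb; rewrite (inj_eq inl_inj) => ->; rewrite andbT labels_label_arities.
  by apply/mapP; exists (y, n).
- by rewrite -mem_labels_planar// labels_label_arities; apply/mapP; exists (y, n).
case: l => [x /andP[xl xb]|w wr]; [left|right].
  apply/hasP; exists (x, nth 0%N (arities lab) (index x (labels lab))); first exact: label_arities_nth.
  by rewrite /= eqxx (inj_eq inl_inj).
apply/hasP; exists (w, nth 0%N (arities r) (index w (labels r))) => /=; last by rewrite eqxx.
by apply: label_arities_nth; rewrite mem_labels_planar.
Qed.

Lemma double_label_inj : {in labels X &, injective double_label}.
Proof.
move=> [x|w] [x'|w'] //; rewrite !mem_double /=; last by move=> _ _ [->].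
by move=> /andP[xl _] _ [/(pos_inj xl) ->].
Qed.

Lemma double_subst_lab : subst_lab q b r = tmap double_label X.
Proof.
rewrite /subst_lab /double_subst -(subst_tmap (a' := pred1 (inl b))).
  by rewrite /subst_tree !tmap_comp.
move=> l; rewrite labels_tmap => /mapP[x xl ->] /=.
rewrite !(inj_eq inl_inj); apply/eqP/eqP => [/(pos_inj xl)//|->//].
Qed.

Lemma double_subst_tree : subst_tree q b r = tmap (index^~ (labels X)) X.
Proof.
by rewrite /subst_tree /new_vertex double_subst_lab tmap_index_relabel//; exact: double_label_inj.
Qed.

Lemma double_vertex l : l \in labels X -> new_vertex q b r (double_label l) = index l (labels X).
Proof.
by move=> lX; rewrite /new_vertex double_subst_lab labels_tmap index_map_in//; exact: double_label_inj.
Qed.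

Lemma double_uniq : uniq (labels X).
Proof.
apply: (@map_uniq _ _ double_label); rewrite -labels_tmap -double_subst_lab.
exact: (subst_lab_uniq (planar_subst pt ps ha hs) pr double_hb hr).
Qed.

Lemma ne_double : (ne (subst_tree q b r)).+1 = size (labels X).
Proof.
have pq := planar_subst pt ps ha hs.
rewrite -(planar_nv (planar_subst pq pr double_hb hr)).
by rewrite double_subst_tree /nv labels_tmap size_map.
Qed.

Lemma double_coord (x : 'rV[R]_(ne t)) (y : 'rV[R]_(ne s)) (z : 'rV[R]_(ne r)) l :
  l \in labels X -> index l (labels X) != 0%N ->
  vcoord (theta b (theta a x y) z) (index l (labels X)) =
  match l with
  | inl l' => label_coord x a y l'
  | inr 0 => label_coord x a y beta
  | inr w => vcoord z w
  end.
Proof.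
move=> lX; rewrite -double_vertex// => l0.
have pq := planar_subst pt ps ha hs.
have lq : double_label l \in labels (subst_lab q b r) by rewrite double_subst_lab labels_tmap map_f.
rewrite vcoord_theta//; last exact: double_hb.
case: l lX l0 lq => [l'|[|w]]; rewrite mem_double //=.
  move=> /andP[lL lb] l0 _; apply: vcoord_theta => //; apply: contraNneq l0 => p0; rewrite p0.
  have := kt0 b pq pr; rewrite /kt /emb; case: eqP => [b0 _|_ -> //].
  by case/eqP: lb; apply: (pos_inj lL); rewrite p0.
move=> _ l0 _; apply: vcoord_theta => //; apply: contraNneq l0 => p0.
by rewrite -[new_vertex _ _ _ _]/(ks q r b 0) -kt_at p0 kt0.
Qed.

End Left.

Section SequentialSubstitution.
Variables (t s r : tree nat) (a b : nat).
Hypothesis pt : planar_tree t.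
Hypothesis ps : planar_tree s.
Hypothesis pr : planar_tree r.
Hypothesis ha : (a < nv t)%N.
Hypothesis hs : nth 0%N (arities t) a = leaves s.
Hypothesis hb : (b < nv s)%N.
Hypothesis hr : nth 0%N (arities s) b = leaves r.
Local Notation q := (subst_tree t a s).
Local Notation b' := (new_vertex t a s (inr b)).
Local Notation s' := (subst_tree s b r).
Local Notation X := (double_subst t s r a (inr b)).

Lemma seq_bL : inr b \in labels (subst_lab t a s).
Proof. by rewrite (mem_subst_lab pt ps ha hs). Qed.

Lemma seq_hr : nth 0%N (arities q) b' = leaves r.
Proof. by rewrite arity_inr. Qed.

Lemma seq_ps' : planar_tree s'.
Proof. exact: (planar_subst ps pr hb hr). Qed.

Lemma seq_hs' : nth 0%N (arities t) a = leaves s'.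
Proof. by rewrite leaves_subst_tree. Qed.

(** The names that the same vertices receive when r is put into s beforehand. *)
Definition right_label (l : (nat + nat) + nat) : nat + nat :=
  match l with
  | inl (inl u) => inl u
  | inl (inr v) => inr (new_vertex s b r (inl v))
  | inr w => inr (new_vertex s b r (inr w))
  end.

Lemma right_label_inj : {in labels X &, injective right_label}.
Proof.
have sub := mem_subst_lab ps pr hb hr.
move=> [[u|v]|w] [[u'|v']|w']; rewrite !(mem_double pt ps pr ha hs seq_bL seq_hr) ?(mem_subst_lab pt ps ha hs) //=.
- by move=> _ _ [->].
- move=> /andP[vs vb] _ [/pos_inj]; rewrite sub vs => h.
  by have /h[->] : true && (v != b) by [].
- move=> /andP[vs vb] _ [/pos_inj]; rewrite sub vs => h.
  by have /h : true && (v != b) by [].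
- by move=> wr _ [/pos_inj]; rewrite sub wr => /(_ isT).
- by move=> wr _ [/pos_inj]; rewrite sub wr => /(_ isT)[->].
Qed.

Lemma right_subst_lab : subst_lab t a s' = tmap right_label X.
Proof.
have -> : X = subst (pred1 (inl (inl a)))
    (tmap (fun l => match l with inl v => inl (inr v) | inr w => inr w end) (subst_lab s b r))
    (tmap (fun u => inl (inl u)) t).
  rewrite /double_subst [subst_lab t a s]/subst_lab.
  rewrite -(@subst_tmap _ _ inl (pred1 (inl a)) (pred1 (inl (inl a)))); last first.
    by move=> l _ /=; rewrite (inj_eq inl_inj).
  rewrite !tmap_comp subst_subst_seq.
  - congr subst; rewrite /subst_lab -(subst_tmap (a' := pred1 (inl (inr b)))) ?tmap_comp//.
    move=> l; rewrite labels_tmap => /mapP[v _ ->] /=.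
    by rewrite !(inj_eq inl_inj) (inj_eq inr_inj).
  - by rewrite labels_tmap has_map -all_predC; apply/allP => v _.
  - apply/allP => p; rewrite label_arities_tmap => /mapP[p' pt' ->] /=.
    have [_ p2] := label_arities_planar pt pt'.
    by apply/implyP => /eqP[p1]; rewrite leaves_tmap p2 p1 hs.
  apply/allP => p; rewrite label_arities_tmap => /mapP[p' pt' ->] /=.
  have [_ p2] := label_arities_planar ps pt'.
  by apply/implyP => /eqP[p1]; rewrite leaves_tmap p2 p1 hr.
rewrite /subst_lab -(subst_tmap (a' := pred1 (inl a))).
  by rewrite /subst_tree !tmap_comp; congr subst; apply: eq_in_tmap => -[].
by move=> l; rewrite labels_tmap => /mapP[v _ ->] /=; rewrite !(inj_eq inl_inj).
Qed.

Lemma right_subst_tree : subst_tree t a s' = tmap (index^~ (labels X)) X.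
Proof.
by rewrite /subst_tree /new_vertex right_subst_lab tmap_index_relabel//; exact: right_label_inj.
Qed.

Lemma right_vertex l : l \in labels X -> new_vertex t a s' (right_label l) = index l (labels X).
Proof.
by move=> lX; rewrite /new_vertex right_subst_lab labels_tmap index_map_in//; exact: right_label_inj.
Qed.

Lemma seq_subst_tree : subst_tree q b' r = subst_tree t a s'.
Proof. by rewrite right_subst_tree (double_subst_tree pt ps pr ha hs seq_bL seq_hr). Qed.

Lemma right_coord (x : 'rV[R]_(ne t)) (y : 'rV[R]_(ne s)) (z : 'rV[R]_(ne r)) l :
  l \in labels X -> index l (labels X) != 0%N ->
  vcoord (theta a x (theta b y z)) (index l (labels X)) =
  match l with
  | inl l' => label_coord x a y l'
  | inr 0 => label_coord x a y (inr b)
  | inr w => vcoord z w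
  end.
Proof.
move=> lX; rewrite -right_vertex// => l0.
have lq : right_label l \in labels (subst_lab t a s') by rewrite right_subst_lab labels_tmap map_f.
rewrite (vcoord_theta _ _ pt seq_ps' ha seq_hs')//.
have k0 : new_vertex s b r (inr 0%N) = kt s r b b by rewrite kt_at.
have kb v : (v < nv s)%N -> (kt s r b v == 0%N) = (v == 0%N).
  case: v => [|v] vs; first by rewrite (kt0 b ps pr).
  have vs' : (v < ne s)%N by move: vs; rewrite (planar_nv ps).
  by have := kt_gt0 ps pr hb hr (Ordinal vs'); rewrite lt0n => /negbTE ->.
have kw w : (w.+1 < nv r)%N -> (ks s r b w.+1 == 0%N) = false.
  move=> wr; have wr' : (w < ne r)%N by move: wr; rewrite (planar_nv pr).
  by have := ks_gt0 ps pr hb hr (Ordinal wr'); rewrite lt0n => /negbTE ->.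
have lc p : label_coord x a (theta b y z) (inr p) = if p == 0%N then vcoord x a else vcoord (theta b y z) p by case: p.
case: l lX l0 lq => [[u|v]|w]; rewrite (mem_double pt ps pr ha hs seq_bL seq_hr) // ?(mem_subst_lab pt ps ha hs).
  move=> /andP[vs vb] _ _; rewrite /right_label lc.
  have vE : new_vertex s b r (inl v) = kt s r b v by rewrite /kt /emb; move: vb; rewrite (inj_eq inr_inj) => /negbTE ->.
  rewrite vE kb//; case: v vs vb vE => [//|v] vs vb vE.
  rewrite /= -vE (vcoord_theta _ _ ps pr hb hr)//; last by rewrite vE kb.
  by rewrite (mem_subst_lab ps pr hb hr) vs; move: vb; rewrite (inj_eq inr_inj).
case: w => [|w] wr _ _; rewrite /right_label lc; last first.
  rewrite -[new_vertex _ _ _ _]/(ks s r b w.+1) kw// (vcoord_theta _ _ ps pr hb hr)//.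
    by rewrite (mem_subst_lab ps pr hb hr).
  by rewrite -[new_vertex _ _ _ _]/(ks s r b w.+1) kw.
rewrite k0 kb//; case: (eqVneq b 0%N) => [->//|b0].
rewrite -k0 (vcoord_theta _ _ ps pr hb hr)//; first by case: b b0.
  by rewrite (mem_subst_lab ps pr hb hr).
by rewrite k0 kb.
Qed.

(** Stated coordinate by coordinate, because the two vectors have types indexed by trees that are
    equal but not convertible. Both coordinates are read off from the name of the upper end of the
    edge. *)
Lemma seq_theta (x : 'rV[R]_(ne t)) (y : 'rV[R]_(ne s)) (z : 'rV[R]_(ne r)) k :
  Defs.coord (theta b' (theta a x y) z) k = Defs.coord (theta a x (theta b y z)) k.
Proof.
have nX := ne_double pt ps pr ha hs seq_bL seq_hr.
apply: eq_coord => [|{}k kq]; first by rewrite seq_subst_tree.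
have kX : (k.+1 < size (labels X))%N by rewrite -nX ltnS.
have uX := double_uniq pt ps pr ha hs seq_bL seq_hr.
rewrite -(index_uniq (inr 0%N) kX uX); have lX := mem_nth (inr 0%N) kX.
by rewrite (double_coord pt ps pr ha hs seq_bL seq_hr)// ?right_coord// index_uniq.
Qed.

End SequentialSubstitution.

Section ParallelSubstitution.
Variables (t s r : tree nat) (a b : nat).
Hypothesis pt : planar_tree t.
Hypothesis ps : planar_tree s.
Hypothesis pr : planar_tree r.
Hypothesis ha : (a < nv t)%N.
Hypothesis hs : nth 0%N (arities t) a = leaves s.
Hypothesis hb : (b < nv t)%N.
Hypothesis hr : nth 0%N (arities t) b = leaves r.
Hypothesis ab : a != b.
Local Notation b' := (new_vertex t a s (inl b)).
Local Notation a' := (new_vertex t b r (inl a)).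
Local Notation X := (double_subst t s r a (inl b)).
Local Notation X' := (double_subst t r s b (inl a)).

Lemma par_bL : inl b \in labels (subst_lab t a s).
Proof. by rewrite (mem_subst_lab pt ps ha hs) hb eq_sym. Qed.

Lemma par_aL : inl a \in labels (subst_lab t b r).
Proof. by rewrite (mem_subst_lab pt pr hb hr) ha. Qed.

Lemma par_hr : nth 0%N (arities (subst_tree t a s)) b' = leaves r.
Proof. by rewrite arity_inl// eq_sym. Qed.

Lemma par_hs : nth 0%N (arities (subst_tree t b r)) a' = leaves s.
Proof. by rewrite arity_inl. Qed.

(** Exchanging s and r in the names turns one order of substitution into the other. *)
Definition swap_label (l : (nat + nat) + nat) : (nat + nat) + nat :=
  match l with
  | inl (inl u) => inl (inl u)
  | inl (inr v) => inr v
  | inr w => inl (inr w)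
  end.

Lemma swap_label_inj : injective swap_label.
Proof. by move=> [[u|v]|w] [[u'|v']|w'] //= [->]. Qed.

Lemma swap_double : X' = tmap swap_label X.
Proof.
have dE (t' s' r' : tree nat) (a0 b0 : nat) : double_subst t' s' r' a0 (inl b0) =
    subst (pred1 (inl (inl b0))) (tmap inr r')
      (subst (pred1 (inl (inl a0))) (tmap (fun v => inl (inr v)) s') (tmap (fun u => inl (inl u)) t')).
  rewrite /double_subst /subst_lab -(subst_tmap (a' := pred1 (inl (inl a0)))) ?tmap_comp//.
rewrite !dE -(subst_tmap (a' := pred1 (inl (inl b)))); last first.
  by move=> l _ /=; rewrite -[inl (inl b) in LHS]/(swap_label (inl (inl b))) (inj_eq swap_label_inj).
rewrite -(subst_tmap (a' := pred1 (inl (inl a)))); last first.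
  by move=> l _ /=; rewrite -[inl (inl a) in LHS]/(swap_label (inl (inl a))) (inj_eq swap_label_inj).
rewrite !tmap_comp; apply: subst_subst_par.
- by move=> l /= /eqP ->; rewrite !(inj_eq inl_inj) eq_sym.
- by rewrite labels_tmap has_map -all_predC; apply/allP => v _.
- by rewrite labels_tmap has_map -all_predC; apply/allP => v _.
- apply/allP => p; rewrite label_arities_tmap => /mapP[p' pt' ->] /=.
  have [_ p2] := label_arities_planar pt pt'.
  by apply/implyP => /eqP[p1]; rewrite leaves_tmap p2 p1 hr.
apply/allP => p; rewrite label_arities_tmap => /mapP[p' pt' ->] /=.
have [_ p2] := label_arities_planar pt pt'.
by apply/implyP => /eqP[p1]; rewrite leaves_tmap p2 p1 hs.
Qed.

Lemma index_swap l : index (swap_label l) (labels X') = index l (labels X).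
Proof. by rewrite swap_double labels_tmap index_map//; exact: swap_label_inj. Qed.

Lemma mem_swap l : (swap_label l \in labels X') = (l \in labels X).
Proof. by rewrite swap_double labels_tmap mem_map//; exact: swap_label_inj. Qed.

Lemma par_subst_tree : subst_tree (subst_tree t a s) b' r = subst_tree (subst_tree t b r) a' s.
Proof.
rewrite (double_subst_tree pt ps pr ha hs par_bL par_hr).
rewrite (double_subst_tree pt pr ps hb hr par_aL par_hs) swap_double tmap_index_relabel//.
by move=> l l' _ _; exact: swap_label_inj.
Qed.

Lemma par_theta (x : 'rV[R]_(ne t)) (y : 'rV[R]_(ne s)) (z : 'rV[R]_(ne r)) k :
  Defs.coord (theta b' (theta a x y) z) k = Defs.coord (theta a' (theta b x z) y) k.
Proof.
have nX := ne_double pt ps pr ha hs par_bL par_hr.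
apply: eq_coord => [|{}k kq]; first by rewrite par_subst_tree.
have kX : (k.+1 < size (labels X))%N by rewrite -nX ltnS.
have uX := double_uniq pt ps pr ha hs par_bL par_hr.
rewrite -(index_uniq (inr 0%N) kX uX); have lX := mem_nth (inr 0%N) kX.
set l := nth _ _ _ in lX *; have l0 : index l (labels X) != 0%N by rewrite index_uniq.
rewrite (double_coord pt ps pr ha hs par_bL par_hr)// -index_swap.
rewrite (double_coord pt pr ps hb hr par_aL par_hs) ?mem_swap ?index_swap//.
by case: l {lX l0} => [[u|[|v]]|[|w]].
Qed.

End ParallelSubstitution.
End NestedSubstitutionTrees.

Lemma splice_parA_eq (T : Type) (f g : nat -> T) i j (s : seq nat) (u r : seq T) :
  (i < j < size s)%N -> uniq s ->
  (forall v, v \in s -> v != nth 0%N s i -> v != nth 0%N s j -> f v = g v) ->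
  splice (j + size u).-1 (splice i (map f s) u) r = splice i (splice j (map g s) r) u.
Proof.
move=> /[dup] ijs /andP[ij js] us fg; have is_ := ltn_trans ij js.
(* f and g agree off entries i and j only. The hybrid h agrees with f off entry j and with g off
   entry i, and each of these entries is replaced in turn. *)
rewrite splice_parA ?size_map//; pose h v := if v == nth 0%N s i then f v else g v.
rewrite (eq_splice (g := h)); last first.
  by move=> v /(splice_in 0%N us js)[vs vj]; rewrite /h; case: eqVneq => // vi; exact: fg.
rewrite -splice_parA ?size_map// (eq_splice (g := g)); last first.
  by move=> v /(splice_in 0%N us is_)[_ /negbTE vi]; rewrite /h vi.
by rewrite splice_parA ?size_map.
Qed.

Section NthSplice.
Variables (T : Type) (x0 : T) (s u : seq T) (i : nat).
Hypothesis si : (i < size s)%N.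

Lemma nth_splice_inner j : (j < size u)%N -> nth x0 (splice i s u) (i + j) = nth x0 u j.
Proof. by move=> ju; rewrite nth_splice// ltnNge leq_addr /= ltn_add2l ju addKn. Qed.

Lemma nth_splice_gt j n : (i < j)%N -> size u = n ->
  nth x0 (splice i s u) (j + n).-1 = nth x0 s j.
Proof.
move=> ij <-; rewrite nth_splice//.
have -> : ((j + size u).-1 < i)%N = false by lia.
have -> : ((j + size u).-1 < i + size u)%N = false by lia.
by congr nth; lia.
Qed.

Lemma nth_splice_lt k : (k < i)%N -> nth x0 (splice i s u) k = nth x0 s k.
Proof. by move=> ki; rewrite nth_splice// ki. Qed.

End NthSplice.

(** * Associativity of the composition of operadic trees *)

Section OptreeLaws.
Variables (c c1 c2 : seq posn) (d d1 d2 : posn) (i j : nat) (x y z : optree).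
Hypotheses (ox : is_optree x) (tx : of_type c d x).
Hypotheses (oy : is_optree y) (ty : of_type c1 d1 y).
Hypotheses (oz : is_optree z) (tz : of_type c2 d2 z).
Hypothesis ci : onth c i = Some d1.

Lemma optree_bound (u : optree) v : is_optree u -> v \in u.2 -> (v < nv u.1)%N.
Proof. by move=> /andP[_ pu]; rewrite (perm_mem pu) mem_iota. Qed.

Lemma optree_uniq (u : optree) : is_optree u -> uniq u.2.
Proof. by move=> /andP[_ /is_perm_uniq]. Qed.

Lemma optree_seqA : onth c1 j = Some d2 ->
  optree_comp (i + j) (optree_comp i x y) z = optree_comp i x (optree_comp j y z).
Proof.
move=> cj; have px := comp_planar_l ox; have py := comp_planar_l oy; have pz := comp_planar_l oz.
have ix := comp_index tx ci; have jy := comp_index ty cj.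
have ha := comp_vertex ox tx ci; have hs := comp_arity tx ty ci.
have hb := comp_vertex oy ty cj; have hr := comp_arity ty tz cj.
rewrite {1}/optree_comp [(optree_comp i x y).2]/= nth_splice_inner ?size_map// (nth_map 0%N)//.
congr pair; first exact: seq_subst_tree.
have bL := seq_bL px py ha hs hb; have br := seq_hr px py ha hs hb hr.
have vE l : l \in labels (double_subst x.1 y.1 z.1 (nth 0%N x.2 i) (inr (nth 0%N y.2 j))) ->
    new_vertex (subst_tree x.1 (nth 0%N x.2 i) y.1) (new_vertex x.1 (nth 0%N x.2 i) y.1 (inr (nth 0%N y.2 j))) z.1
       (double_label x.1 y.1 (nth 0%N x.2 i) l) =
    new_vertex x.1 (nth 0%N x.2 i) (subst_tree y.1 (nth 0%N y.2 j) z.1)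
       (right_label y.1 z.1 (nth 0%N y.2 j) l).
  by move=> lX; rewrite double_vertex// right_vertex.
rewrite /optree_comp [in LHS]/= [in RHS]/= !map_splice -!map_comp splice_seqA ?size_map//.
rewrite (eq_splice (g := new_vertex x.1 (nth 0%N x.2 i) (subst_tree y.1 (nth 0%N y.2 j) z.1) \o inl)); last first.
  move=> v /(splice_in 0%N (optree_uniq ox) ix)[/(optree_bound ox) vx va].
  by apply: (vE (inl (inl v))); rewrite mem_double// (mem_subst_lab px py ha hs) vx va.
congr splice; rewrite (eq_splice (g := new_vertex x.1 (nth 0%N x.2 i) (subst_tree y.1 (nth 0%N y.2 j) z.1) \o inr \o
    new_vertex y.1 (nth 0%N y.2 j) z.1 \o inl)); last first.
  move=> v /(splice_in 0%N (optree_uniq oy) jy)[/(optree_bound oy) vy vb].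
  by apply: (vE (inl (inr v))); rewrite mem_double// (mem_subst_lab px py ha hs) vy (inj_eq inr_inj).
congr splice; apply/eq_in_map => v /(optree_bound oz) vz.
by apply: (vE (inr v)); rewrite mem_double.
Qed.

Lemma optree_parA : onth c j = Some d2 -> (i < j)%N ->
  optree_comp (j + size c1).-1 (optree_comp i x y) z = optree_comp i (optree_comp j x z) y.
Proof.
move=> cj ij; have px := comp_planar_l ox; have py := comp_planar_l oy; have pz := comp_planar_l oz.
have ix := comp_index tx ci; have jx := comp_index tx cj.
have ha := comp_vertex ox tx ci; have hs := comp_arity tx ty ci.
have hb := comp_vertex ox tx cj; have hr := comp_arity tx tz cj.
have ab : nth 0%N x.2 i != nth 0%N x.2 j by rewrite nth_uniq ?optree_uniq// ltn_eqF.
have bL := par_bL px py ha hs hb ab; have br := par_hr px py ha hs hb hr ab.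
have aL := par_aL px pz ha hb hr ab; have as_ := par_hs px pz ha hs hb hr ab.
have vE l : l \in labels (double_subst x.1 y.1 z.1 (nth 0%N x.2 i) (inl (nth 0%N x.2 j))) ->
    new_vertex (subst_tree x.1 (nth 0%N x.2 i) y.1) (new_vertex x.1 (nth 0%N x.2 i) y.1 (inl (nth 0%N x.2 j))) z.1
       (double_label x.1 y.1 (nth 0%N x.2 i) l) =
    new_vertex (subst_tree x.1 (nth 0%N x.2 j) z.1) (new_vertex x.1 (nth 0%N x.2 j) z.1 (inl (nth 0%N x.2 i))) y.1
       (double_label x.1 z.1 (nth 0%N x.2 j) (swap_label l)).
  move=> lX; rewrite double_vertex// double_vertex ?mem_swap//.
  by rewrite index_swap.
have ijx : (i < j < size x.2)%N by rewrite ij.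
rewrite -(of_type_size ty) {1}/optree_comp {1}[in RHS]/optree_comp.
rewrite [(optree_comp i x y).2]/= [(optree_comp j x z).2]/= nth_splice_gt ?size_map//.
rewrite nth_splice_lt ?size_map// !(nth_map 0%N)//.
congr pair; first exact: par_subst_tree.
rewrite /optree_comp [in LHS]/= [in RHS]/= !map_splice -!map_comp.
set F1 := map _ x.2; set F2 := map _ y.2; set F3 := map _ z.2.
set G1 := map _ x.2; set G3 := map _ z.2; set G2 := map _ y.2.
have -> : F3 = G3.
  by apply/eq_in_map => v /(optree_bound oz) vz; apply: (vE (inr v)); rewrite mem_double.
have -> : F2 = G2.
  apply/eq_in_map => v /(optree_bound oy) vy.
  by apply: (vE (inl (inr v))); rewrite mem_double// (mem_subst_lab px py ha hs) vy.
rewrite -[size y.2](size_map _ _ : size G2 = _).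
apply: splice_parA_eq => //; first exact: optree_uniq.
move=> v /(optree_bound ox) vx va vb.
apply: (vE (inl (inl v))); rewrite mem_double// (mem_subst_lab px py ha hs) vx va.
by rewrite (inj_eq inl_inj).
Qed.

End OptreeLaws.

(** * Unit laws *)

Section UnitLaws.
Variable R : realType.

(** A corolla puts a single vertex in place of a vertex, which only renames it. *)
Lemma subst_corolla (T : Type) (p : pred T) y m (t : tree T) : substitutable p (Node y (nseq m Leaf)) t ->
  subst p (Node y (nseq m Leaf)) t = tmap (fun x => if p x then y else x) t.
Proof.
elim/tree_nested_ind: t => //= x ts IHts h; have {h}[ax ok] := substitutable_forest h.
have E : [seq subst p (Node y (nseq m Leaf)) u | u <- ts] = [seq tmap (fun x => if p x then y else x) u | u <- ts].
  by elim: ts IHts ok {ax} => //= u us IH [hu /IH{}IH] /andP[/hu -> /IH ->].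
case: ifP => [/ax szts|_]; last by rewrite E.
rewrite -[LHS]/(graft (Node y (nseq m Leaf)) _) graft_corolla ?size_map; first by rewrite E.
by rewrite szts /= map_nseq sumn_nseq mul1n.
Qed.

Lemma splice_nth (T : Type) (x0 : T) i s : (i < size s)%N -> splice i s [:: nth x0 s i] = s.
Proof. by move=> h; rewrite /splice /= -drop_nth// cat_take_drop. Qed.

Section Right.
Variables (t : tree nat) (a n : nat).
Hypothesis pt : planar_tree t.
Hypothesis ha : (a < nv t)%N.
Hypothesis n0 : (0 < n)%N.
Hypothesis hn : nth 0%N (arities t) a = n.

Lemma unitr_hs : nth 0%N (arities t) a = leaves (corolla n).
Proof. by rewrite leaves_corolla. Qed.

Lemma unitr_subst_lab : subst_lab t a (corolla n) = tmap (emb a) t.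
Proof.
have ok := subst_lab_substitutable pt unitr_hs; move: ok.
have -> : tmap inr (corolla n) = Node (inr 0%N) (nseq n Leaf) :> tree (nat + nat) by rewrite /= map_nseq.
rewrite /subst_lab.
have -> : tmap inr (corolla n) = Node (inr 0%N) (nseq n Leaf) :> tree (nat + nat).
  by rewrite /= map_nseq.
move=> ok; rewrite subst_corolla// tmap_comp; apply: eq_in_tmap => v _ /=.
by rewrite /emb (inj_eq inl_inj).
Qed.

Lemma unitr_subst_tree : subst_tree t a (corolla n) = t.
Proof.
rewrite /subst_tree /new_vertex unitr_subst_lab tmap_index_relabel ?tmap_index_planar//.
by move=> u v _ _; exact: emb_inj.
Qed.

Lemma unitr_vertex v : (v < nv t)%N -> new_vertex t a (corolla n) (emb a v) = v.
Proof.
move=> vt; rewrite /new_vertex unitr_subst_lab labels_tmap index_map ?index_planar//.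
by move=> u u'; exact: emb_inj.
Qed.

Lemma unitr_theta (x : 'rV[R]_(ne t)) (z : 'rV[R]_(ne (corolla n))) k :
  Defs.coord (theta a x z) k = Defs.coord x k.
Proof.
apply: eq_coord => [|{}k]; first by rewrite unitr_subst_tree.
move=> kq; have kt : (k < ne t)%N by rewrite -(congr1 ne unitr_subst_tree).
have kt' : (k.+1 < nv t)%N by rewrite (planar_nv pt).
have pc := planar_corolla n0.
rewrite -{1}(unitr_vertex kt') (vcoord_theta _ _ pt pc ha unitr_hs).
- by rewrite /emb; case: eqP => [<-|_].
- exact: (emb_in pt pc ha unitr_hs).
- by rewrite unitr_vertex.
Qed.

End Right.

Section Left.
Variables (s : tree nat) (n : nat).
Hypothesis ps : planar_tree s.
Hypothesis n0 : (0 < n)%N.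
Hypothesis hn : leaves s = n.

Lemma unitl_subst_lab : subst_lab (corolla n) 0 s = tmap inr s.
Proof.
have -> : subst_lab (corolla n) 0 s = graft (tmap inr s) (nseq n Leaf).
  by rewrite /subst_lab /= !map_nseq.
by have := graft_leaves (tmap inr s : tree (nat + nat)); rewrite leaves_tmap hn.
Qed.

Lemma unitl_subst_tree : subst_tree (corolla n) 0 s = s.
Proof.
rewrite /subst_tree /new_vertex unitl_subst_lab tmap_index_relabel ?tmap_index_planar//.
by move=> u v _ _; exact: inr_inj.
Qed.

Lemma unitl_vertex v : (v < nv s)%N -> new_vertex (corolla n) 0 s (inr v) = v.
Proof.
move=> vs; rewrite /new_vertex unitl_subst_lab labels_tmap index_map ?index_planar//.
exact: inr_inj.
Qed.

Lemma unitl_theta (z : 'rV[R]_(ne (corolla n))) (y : 'rV[R]_(ne s)) k :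
  Defs.coord (theta 0 z y) k = Defs.coord y k.
Proof.
apply: eq_coord => [|{}k]; first by rewrite unitl_subst_tree.
move=> kq; have ks : (k < ne s)%N by rewrite -(congr1 ne unitl_subst_tree).
have ks' : (k.+1 < nv s)%N by rewrite (planar_nv ps).
have pc := planar_corolla n0.
have h0 : (0 < nv (corolla n))%N by rewrite /nv labels_corolla.
have hs : nth 0%N (arities (corolla n)) 0 = leaves s by rewrite arities_corolla.
rewrite -{1}(unitl_vertex ks') (vcoord_theta _ _ pc ps h0 hs)//; last by rewrite unitl_vertex.
by rewrite (mem_subst_lab pc ps h0 hs).
Qed.

End Left.

Lemma optree_unitr c d d' i x : is_optree x -> of_type c d x -> onth c i = Some d' ->
  optree_comp i x (optree_unit d') = x.
Proof.
move=> ox tx ci; have px := comp_planar_l ox; have ix := comp_index tx ci.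
have [ou tu] := optree_unit_is d'.
have ha := comp_vertex ox tx ci; have := comp_arity tx tu ci.
rewrite leaves_corolla => hs; case: x ox tx px ix ha hs {ci ou tu} => t s ox tx px ix ha hs /=.
rewrite /optree_comp /= (unitr_subst_tree px hs); congr pair.
rewrite (eq_splice (g := id)) => [|v /(splice_in 0%N (optree_uniq ox) ix)[/(optree_bound ox) vx va]].
  rewrite map_id -[new_vertex _ _ _ _]/(ks t (corolla (sval d')) (nth 0%N s i) 0).
  by rewrite -kt_at /kt unitr_vertex// splice_nth.
by have := unitr_vertex px hs vx; rewrite /emb (negbTE va).
Qed.

Lemma optree_unitl c d x : is_optree x -> of_type c d x ->
  optree_comp 0 (optree_unit d) x = x.
Proof.
move=> ox tx; have px := comp_planar_l ox; have [_ lx] := tx.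
have d0 : (0 < val d)%N by exact: valP.
case: x ox tx px lx => t s ox tx px lx.
rewrite /optree_comp /= (unitl_subst_tree px lx); congr pair.
rewrite /splice /= cats0 -[RHS]map_id; apply/eq_in_map => v /(optree_bound ox) vs.
exact: unitl_vertex.
Qed.

End UnitLaws.

(** * Weights induced on the factors of a composite *)

Section InducedWeights.
Import mathcomp.boot.fintype mathcomp.boot.finset.
Variables (R : realType) (t s : tree nat) (a : nat).
Hypothesis pt : planar_tree t.
Hypothesis ps : planar_tree s.
Hypothesis ha : (a < nv t)%N.
Hypothesis hs : nth 0%N (arities t) a = leaves s.
Local Notation q := (subst_tree t a s).
Local Notation pq := (planar_subst pt ps ha hs).

Lemma weight_gt0 (r : tree nat) b l : (0 < l)%N -> forall v, (0 < @weight r b l v)%N.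
Proof. by move=> l0 v; rewrite /weight; case: ifP. Qed.

Lemma weight1 (r : tree nat) b : @weight r b 1 = std r.
Proof. by apply/funext => v; rewrite /weight; case: ifP. Qed.

Lemma extended_std u : extended_weight (std q) u = 1%N.
Proof. by rewrite /extended_weight; case: insubP. Qed.

Lemma inner_std : inner_weight (std q) = std s.
Proof. by apply/funext => v; rewrite /inner_weight extended_std. Qed.

Lemma outer_std : outer_weight (std q) = @weight t a (nv s).
Proof.
apply/funext => v; rewrite /outer_weight /weight inner_std extended_std /std.
by rewrite sum1_card card_ord.
Qed.

Lemma extended_weightE b l u : (u < nv q)%N ->
  extended_weight (@weight q b l) u = if u == b then l else 1%N.
Proof. by move=> uq; rewrite /extended_weight insubT. Qed.

Lemma inner_weight_inner b l : (b < nv s)%N ->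
  inner_weight (@weight q (new_vertex t a s (inr b)) l) = @weight s b l.
Proof.
move=> hb; apply/funext => v; rewrite /inner_weight extended_weightE ?ks_bound// /weight.
by congr (if _ then _ else _); apply/eqP/eqP => [/(ks_inj pt ps ha hs (ltn_ord v)) //|->].
Qed.

Lemma sum_weight b l : (b < nv s)%N -> (\sum_u @weight s b l u).+1 = (nv s + l)%N.
Proof.
move=> hb; rewrite (bigD1 (Ordinal hb))//= {1}/weight eqxx.
rewrite (eq_bigr (fun=> 1%N)) => [|v vb]; last by rewrite /weight -[b]/(val (Ordinal hb)) (inj_eq val_inj) (negbTE vb).
rewrite sum1_card -addnS addnC; congr (_ + _)%N.
have := cardC1 (Ordinal hb); rewrite card_ord => E.
rewrite (eq_card (B := predC1 (Ordinal hb)))// E prednK//; exact: nv_pos.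
Qed.

(** One vertex of s has weight l and the others weight 1. When l is the size of a tree put at b, the
    total is the size of the substituted tree. *)
Lemma outer_weight_inner b l : (b < nv s)%N ->
  outer_weight (@weight q (new_vertex t a s (inr b)) l) = @weight t a (nv s + l).-1.
Proof.
move=> hb; apply/funext => v; rewrite /outer_weight [RHS]/weight.
case: eqP => [_|/eqP va]; first by rewrite inner_weight_inner// -(sum_weight l hb).
rewrite extended_weightE ?kt_bound//; case: eqP => // E.
by have [_ va'] := ks_kt pt ps ha hs hb (ltn_ord v) (esym E); move: va; rewrite -[val v]/(nat_of_ord v) va' eqxx.
Qed.

Lemma inner_weight_outer b l : (b < nv t)%N -> b != a ->
  inner_weight (@weight q (new_vertex t a s (inl b)) l) = std s.
Proof.
move=> hb ba; apply/funext => v; rewrite /inner_weight extended_weightE ?ks_bound//.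
have -> : new_vertex t a s (inl b) = kt t s a b by rewrite /kt /emb (negbTE ba).
case: eqP => // E; have [_ /eqP] := ks_kt pt ps ha hs (ltn_ord v) hb E.
by rewrite (negbTE ba).
Qed.

Lemma outer_weight_outer b l : (b < nv t)%N -> b != a ->
  outer_weight (@weight q (new_vertex t a s (inl b)) l) =
  fun v : 'I_(nv t) => if val v == a then nv s else if val v == b then l else 1%N.
Proof.
move=> hb ba; apply/funext => v; rewrite /outer_weight.
case: eqP => [_|/eqP va].
  by rewrite inner_weight_outer// /std sum1_card card_ord.
rewrite extended_weightE ?kt_bound//.
have -> : new_vertex t a s (inl b) = kt t s a b by rewrite /kt /emb (negbTE ba).
by congr (if _ then _ else _); apply/eqP/eqP => [/(kt_inj pt ps ha hs (ltn_ord v)) //|->].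
Qed.

(** On the face, a transition of the whole tree splits into transitions of the factors. The outer
    one, composed with the transition inside the partial composition, starts from the standard
    weight, so uniqueness identifies the composite with [tr]. *)
Lemma tr_theta w x y : (forall v, (0 < w v)%N) -> loday t x -> loday s y ->
  tr (R := R) w (theta a (tr (@weight t a (nv s)) x) y) =
  theta a (tr (outer_weight w) x) (tr (inner_weight w) y).
Proof.
move=> w0; rewrite !lodayE// => Px Py.
have q0 := @std_gt0 q; have t0 := @std_gt0 t; have s0 := @std_gt0 s.
have wt0 := outer_weight_gt0 ps w0; have ws0 := inner_weight_gt0 w0.
have l0 := weight_gt0 (r := t) a (nv_pos ps).
have trl := trP R pt l0.
have [f wf] := weight_transition_exists R pt l0 wt0.
have wf' : weight_transition (outer_weight (std q)) (outer_weight w) f by rewrite outer_std.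
have ws' : weight_transition (inner_weight (std q)) (inner_weight w) (tr (R := R) (inner_weight w)).
  by rewrite inner_std; exact: trP.
rewrite (transition_theta pt ps ha hs q0 w0 (trP R pq w0) wf' ws').
- congr theta; apply: (weight_transition_unique pt t0 wt0 (weight_transition_comp trl wf) (trP R pt wt0)).
  exact: Px.
- by rewrite outer_std; exact: (trans_fun (wt_transition trl) Px).
by rewrite inner_std.
Qed.

Lemma theta_loday x y : loday (R := R) t x -> loday s y ->
  loday q (theta a (tr (@weight t a (nv s)) x) y).
Proof.
rewrite !lodayE ?pq// => Px Py; apply: (theta_lpoly pt ps ha hs (@std_gt0 q)); last by rewrite inner_std.
rewrite outer_std; have l0 := weight_gt0 (r := t) a (nv_pos ps).
exact: (trans_fun (wt_transition (trP R pt l0)) Px).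
Qed.

Lemma two_weightsC n l l' (b b' : nat) : b != b' ->
  (fun v : 'I_n => if val v == b then l else if val v == b' then l' else 1%N) =
  (fun v : 'I_n => if val v == b' then l' else if val v == b then l else 1%N).
Proof. by move=> /negbTE bb'; apply/funext => v; case: eqP => // ->; rewrite bb'. Qed.

End InducedWeights.

(** * The operad laws on points *)

Section OperadLaws.
Variable R : realType.

(** Points without their profile, so that equations between composites need no transport along
    equalities of profiles. *)
Definition iop : Type := {x : optree & 'rV[R]_(ne x.1)}.
Implicit Types p q r : iop.

Definition icomp i p q : iop :=
  existT _ (optree_comp i (tag p) (tag q))
    (theta (nth 0%N (tag p).2 i)
       (tr (@weight (tag p).1 (nth 0%N (tag p).2 i) (nv (tag q).1)) (tagged p)) (tagged q)).

Definition iact kappa p : iop := existT _ (optree_act kappa (tag p)) (tagged p).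

Definition iunit n : iop := existT _ (optree_unit n) (0 : 'rV[R]_(ne (optree_unit n).1)).

Definition iops (c : seq posn) (d : posn) p : Prop :=
  (is_optree (tag p) /\ of_type c d (tag p)) /\ loday (tag p).1 (tagged p).

Lemma iop_eq p p' : tag p = tag p' ->
  (forall k, Defs.coord (tagged p) k = Defs.coord (tagged p') k) -> p = p'.
Proof.
case: p p' => x z [x' z'] /= xx'; subst x' => zz'; congr existT.
by apply/rowP => e; rewrite -!coordE.
Qed.

Lemma icomp_ops c d c' d' i p q : iops c d p -> iops c' d' q -> onth c i = Some d' ->
  iops (splice i c c') d (icomp i p q).
Proof.
move=> [[op tp] Pp] [[oq tq] Pq] ci; split; first split.
- exact: (optree_comp_is op tp oq tq ci).
- exact: (optree_comp_type op tp oq tq ci).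
apply: theta_loday => //; [exact: comp_planar_l op|exact: comp_planar_l oq|exact: comp_vertex op tp ci|].
exact: comp_arity tp tq ci.
Qed.

Lemma icomp_seqA c d c1 d1 c2 d2 i j p q r :
  iops c d p -> iops c1 d1 q -> iops c2 d2 r -> onth c i = Some d1 -> onth c1 j = Some d2 ->
  icomp (i + j) (icomp i p q) r = icomp i p (icomp j q r).
Proof.
move=> [[op tp] Pp] [[oq tq] Pq] [[or tr_] Pr] ci cj.
have pp := comp_planar_l op; have pq := comp_planar_l oq; have pr := comp_planar_l or.
have ha := comp_vertex op tp ci; have hs := comp_arity tp tq ci.
have hb := comp_vertex oq tq cj; have hr := comp_arity tq tr_ cj.
apply: iop_eq => [|k] /=; first exact: (optree_seqA op tp oq tq or tr_ ci cj).
have ix := comp_index tp ci; have jy := comp_index tq cj.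
rewrite nth_splice_inner ?size_map// (nth_map 0%N)//.
rewrite (tr_theta pp pq ha hs) ?outer_weight_inner ?inner_weight_inner//; last first.
  by apply: weight_gt0; exact: nv_pos.
rewrite seq_theta//; congr (Defs.coord (theta _ (tr (@weight _ _ _) _) _) k).
(* The induced weight of the outer vertex is the number of vertices of the inner composite: the
   replaced vertex is counted once too often in the sum of the two sizes. *)
by rewrite -(size_subst_lab pq hb hr) /= nv_subst.
Qed.

(** On both sides p undergoes a single transition, to the weight with the sizes of q and r at the
    two vertices; the remaining transitions go from the standard weight to itself and are
    identities. *)
Lemma icomp_parA c d c1 d1 c2 d2 i j p q r :
  iops c d p -> iops c1 d1 q -> iops c2 d2 r -> onth c i = Some d1 -> onth c j = Some d2 -> (i < j)%N ->
  icomp (j + size c1).-1 (icomp i p q) r = icomp i (icomp j p r) q.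
Proof.
move=> [[op tp] Pp] [[oq tq] Pq] [[or tr_] Pr] ci cj ij.
have pp := comp_planar_l op; have pq := comp_planar_l oq; have pr := comp_planar_l or.
have ix := comp_index tp ci; have jx := comp_index tp cj.
have ha := comp_vertex op tp ci; have hs := comp_arity tp tq ci.
have hb := comp_vertex op tp cj; have hr := comp_arity tp tr_ cj.
have ab : nth 0%N (tag p).2 i != nth 0%N (tag p).2 j by rewrite nth_uniq ?optree_uniq// ltn_eqF.
apply: iop_eq => [|k] /=; first exact: (optree_parA op tp oq tq or tr_ ci cj ij).
rewrite nth_splice_gt ?size_map ?(of_type_size tq)// nth_splice_lt ?size_map// !(nth_map 0%N)//.
rewrite (tr_theta pp pq ha hs) ?outer_weight_outer ?inner_weight_outer// 1?eq_sym//; last first.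
  by apply: weight_gt0; exact: nv_pos.
rewrite (tr_theta pp pr hb hr) ?outer_weight_outer ?inner_weight_outer//; last first.
  by apply: weight_gt0; exact: nv_pos.
have Eq : tr (std (tag q).1) (tagged q) = tagged q by apply: (tr_std pq); rewrite -lodayE.
have Er : tr (std (tag r).1) (tagged r) = tagged r by apply: (tr_std pr); rewrite -lodayE.
rewrite Eq Er (par_theta pp pq pr ha hs hb hr ab).
by rewrite (two_weightsC (nv (tag p).1) (nv (tag q).1) (nv (tag r).1) ab).
Qed.

Lemma icomp_unitr c d d' i p : iops c d p -> onth c i = Some d' -> icomp i p (iunit d') = p.
Proof.
move=> [[op tp] Pp] ci; have pp := comp_planar_l op; have [_ tu] := optree_unit_is d'.
have ha := comp_vertex op tp ci; have := comp_arity tp tu ci; rewrite leaves_corolla => hs.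
apply: iop_eq => [|k] /=; first exact: (optree_unitr op tp ci).
rewrite unitr_theta//; last exact: valP.
by rewrite /nv labels_corolla weight1 tr_std// -lodayE.
Qed.

Lemma icomp_unitl c d p : iops c d p -> icomp 0 (iunit d) p = p.
Proof.
move=> [[op tp] Pp]; have pp := comp_planar_l op; have [_ lp] := tp.
apply: iop_eq => [|k] /=; first exact: (optree_unitl op tp).
by rewrite unitl_theta//; exact: valP.
Qed.

Lemma iact1 c d p : iops c d p -> iact (iota 0 (size c)) p = p.
Proof.
move=> [[op tp] _]; apply: iop_eq => //=.
by rewrite /optree_act -(of_type_size tp) precompose1; case: (tag p).
Qed.

Lemma iactM c d kappa tau p : iops c d p -> is_perm (size c) kappa -> is_perm (size c) tau ->
  iact tau (iact kappa p) = iact (precompose kappa tau) p.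
Proof.
move=> [[op tp] _] pk pt; apply: iop_eq => //=.
by rewrite /optree_act /= precomposeA// (of_type_size tp).
Qed.

Lemma icomp_equiv c d c' d' i kappa tau p q : iops c d p -> iops c' d' q ->
  is_perm (size c) kappa -> is_perm (size c') tau -> onth (precompose c kappa) i = Some d' ->
  icomp i (iact kappa p) (iact tau q) = iact (block_perm kappa i tau) (icomp (nth 0%N kappa i) p q).
Proof.
move=> [[op tp] _] [[oq tq] _] pk pt ci.
have ic : (i < size c)%N by rewrite -(size_precompose pk); exact: onth_size ci.
have aE : nth 0%N (precompose (tag p).2 kappa) i = nth 0%N (tag p).2 (nth 0%N kappa i).
  by rewrite nth_precompose ?(of_type_size tp).
apply: iop_eq => [|k] /=; rewrite /optree_comp /optree_act /= aE//.
congr pair; rewrite precompose_block ?size_map ?(of_type_size tp) ?(of_type_size tq)//.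
by rewrite !map_precompose.
Qed.

End OperadLaws.

(** * The operad of operahedra *)

Section OinfOperad.
Variable R : realType.
Local Notation U := (underlying (Oinf R)).

(* The carrier of [U] does not depend on the profile: it is [iop R] up to conversion. *)
Lemma tot_eq c d c' d' (x : elt U c d) (x' : elt U c' d') :
  c = c' -> d = d' -> (x : iop R) = x' -> tot x = tot x'.
Proof. by move=> cc dd; subst c' d' => /= ->. Qed.

Lemma tot_inv c d c' d' (x : elt U c d) (x' : elt U c' d') :
  tot x = tot x' -> [/\ c = c', d = d' & (x : iop R) = x'].
Proof.
move=> E; split.
- exact: (congr1 (fun s => (tag s).1) E).
- exact: (congr1 (fun s => (tag s).2) E).
exact: (congr1 (fun s => (tagged s : iop R)) E).
Qed.

Lemma ocompE c d c' d' i (p : elt U c d) (q : elt U c' d') : (ocomp U i p q : iop R) = icomp i p q.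
Proof. by rewrite /= /ptmap /pair_pt /= row_mxKl row_mxKr. Qed.

Lemma Oinf_is_operad : is_operad U.
Proof.
split.
- move=> c d c' d' i p q Pp Pq ci.
  have := icomp_ops (p := p) (q := q) Pp Pq ci; by rewrite -ocompE.
- move=> c d kappa p [[op tp] Pp] pk.
  by have [h1 h2] := optree_act_is op tp pk.
- move=> c; have [h1 h2] := optree_unit_is c; split; first by split.
  have n0 : ne (corolla (val c)) = 0%N.
    by apply/eqP; rewrite -eqSS -planar_nv ?planar_corolla ?valP// /nv labels_corolla.
  have [NN mNN] := exists_maximal_nesting (planar_corolla (valP c)).
  have [P0 _] := vertexM_lpoly R (planar_corolla (valP c)) (@std_gt0 _) mNN.
  rewrite /= lodayE; last exact: planar_corolla (valP c).
  suff -> : 0 = vertexM R NN (std (corolla (val c))) by [].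
  by apply/rowP => -[e el]; exfalso; move: el; rewrite n0.
- move=> c d c1 d1 c2 d2 i j p q r Pp Pq Pr ci cj.
  have ic := onth_size ci; have jc := onth_size cj.
  apply: tot_eq => //; first exact: splice_seqA.
  by rewrite !ocompE; apply: icomp_seqA Pp Pq Pr ci cj.
- move=> c d c1 d1 c2 d2 i j p q r Pp Pq Pr ci cj ij.
  have jc := onth_size cj.
  apply: tot_eq => //; first by apply: splice_parA; rewrite ij.
  by rewrite !ocompE; apply: icomp_parA Pp Pq Pr ci cj ij.
- move=> c d d' i p Pp ci; have ic := onth_size ci.
  apply: tot_eq => //; last by rewrite ocompE; apply: icomp_unitr Pp ci.
  by rewrite -(@onth_nth _ d' _ _ _ ci) splice_nth.
- move=> c d p Pp; apply: tot_eq => //; last by rewrite ocompE; apply: icomp_unitl Pp.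
  by rewrite /splice /= cats0.
- move=> c d p Pp; apply: tot_eq => //; first exact: precompose1.
  exact: iact1 Pp.
- move=> c d kappa tau p Pp pk pt; apply: tot_eq => //; first exact: precomposeA.
  exact: iactM Pp pk pt.
move=> c d c' d' i kappa tau p q Pp Pq pk pt ci.
have ic : (i < size c)%N by rewrite -(size_precompose pk); exact: onth_size ci.
apply: tot_eq => //; first by rewrite precompose_block.
transitivity (iact (block_perm kappa i tau) (icomp (nth 0%N kappa i) p q)); last by rewrite -ocompE.
by rewrite ocompE; apply: icomp_equiv Pp Pq pk pt ci.
Qed.

Lemma polytope_loday t : planar_tree t -> polytope (loday (R := R) t).
Proof. by move=> pt; rewrite lodayE//; exact: lp_polytope (operahedron_laminar R pt (@std_gt0 t)). Qed.

Lemma loday_nonempty t : planar_tree t -> loday (R := R) t !=set0.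
Proof.
move=> pt; have [NN mNN] := exists_maximal_nesting pt.
exists (vertexM R NN (std t)); rewrite lodayE//.
by have [] := vertexM_lpoly R pt (@std_gt0 t) mNN.
Qed.

Lemma Oinf_poly_object c d : poly_object (Oinf_obj R c d).
Proof.
split; first exact: finite_comps.
by move=> x [/andP[px _] _]; split; [exact: polytope_loday|exact: loday_nonempty].
Qed.

(** This is the face on which the nest E(s) is tight. *)
Lemma theta_face t s a : planar_tree t -> planar_tree s -> (a < nv t)%N ->
  nth 0%N (arities t) a = leaves s ->
  face (loday (R := R) (subst_tree t a s))
    [set theta a (lsubmx z) (rsubmx z) | z in prod_set (operahedron (@weight t a (nv s))) (loday s)].
Proof.
move=> pt ps ha hs; have pq := planar_subst pt ps ha hs.
rewrite operahedronE//; last by apply: weight_gt0; exact: nv_pos.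
rewrite !lodayE// -(outer_std t s a) -(inner_std t s a).
(* If [s] is a corolla, the image of its edge set is empty and in general not in [nests]; the filter
   then leaves no condition. *)
set S := [set N in nests (subst_tree t a s) | N == js pt ps ha hs @: [set: 'I_(ne s)]]%SET.
suff -> : [set theta a (lsubmx z) (rsubmx z) | z in prod_set
   (lpoly (nests t) (nest_weight (real_weight R (outer_weight (std (subst_tree t a s))))))
   (lpoly (nests s) (nest_weight (real_weight R (inner_weight (std (subst_tree t a s))))))] =
  lface (nests (subst_tree t a s)) (nest_weight (real_weight R (std (subst_tree t a s)))) S.
  exact: lface_face.
have q0 := @std_gt0 (subst_tree t a s).
apply/seteqP; split => [_ [z [Px Py] <-]|z [Pz Sz]].
  split; first exact: theta_lpoly.
  apply/fintype.subsetP => N; rewrite inE => /andP[NB /eqP NE].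
  apply/tightP; rewrite NE; split; first by rewrite -NE.
  rewrite (js_top pt ps ha hs (lsubmx z) Py); have [T0|T0] := eqVneq [set: 'I_(ne s)]%SET finset.set0.
    by rewrite T0 imset0 !nest_weight_set0.
  rewrite nest_weight_js//; apply/(nestP ps); split => //; exists 0%N; exact: rooted_top.
have zs : setsum (js pt ps ha hs @: [set: 'I_(ne s)])%SET z =
    nest_weight (real_weight R (inner_weight (std (subst_tree t a s)))) [set: 'I_(ne s)]%SET.
  have [T0|T0] := eqVneq [set: 'I_(ne s)]%SET finset.set0.
    by rewrite T0 imset0 nest_weight_set0// setsum0.
  have nT : nest [set: 'I_(ne s)]%SET by apply/(nestP ps); split => //; exists 0%N; exact: rooted_top.
  have /(fintype.subsetP Sz)/tightP[_ ->] : (js pt ps ha hs @: [set: 'I_(ne s)])%SET \in S.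
    by rewrite inE eqxx andbT; apply: nest_nests; exact: nest_js.
  by rewrite nest_weight_js.
have [x [y [Px Py ->]]] := theta_surj q0 Pz zs.
by exists (row_mx x y); rewrite ?row_mxKl ?row_mxKr//; split; rewrite ?row_mxKl ?row_mxKr.
Qed.

Lemma theta_linear_row t s a : planar_tree t -> planar_tree s -> (a < nv t)%N ->
  nth 0%N (arities t) a = leaves s -> forall k (z z' : 'rV[R]_(ne t + ne s)),
  theta a (lsubmx (k *: z + z')) (rsubmx (k *: z + z')) =
  k *: theta a (lsubmx z) (rsubmx z) + theta a (lsubmx z') (rsubmx z').
Proof.
move=> pt ps ha hs k z z'; apply/rowP => e.
rewrite [RHS]mxE [X in _ = X + _]mxE.
by have [[f ->]|[f ->]] := jt_or_js pt ps ha hs e; rewrite ?theta_jt ?theta_js !mxE.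
Qed.

Lemma comp_embedding t s a : planar_tree t -> planar_tree s -> (a < nv t)%N ->
  nth 0%N (arities t) a = leaves s ->
  face_embedding (prod_set (loday t) (loday s)) (loday (subst_tree t a s))
    (fun z : 'rV[R]_(ne t + ne s) => theta a (tr (@weight t a (nv s)) (lsubmx z)) (rsubmx z)).
Proof.
move=> pt ps ha hs; have pq := planar_subst pt ps ha hs; have l0 := weight_gt0 (r := t) a (nv_pos ps).
have E1 := face_embedding_prod (face_embedding_transition pt (@std_gt0 t) l0 (trP R pt l0))
   (face_embedding_id (loday (R := R) s)).
pose g (z : 'rV[R]_(ne (subst_tree t a s))) : 'rV[R]_(ne t + ne s) :=
  row_mx (\row_f z 0 (jt pt ps ha hs f)) (\row_f z 0 (js pt ps ha hs f)).
have E2 : face_embedding (prod_set (operahedron (@weight t a (nv s))) (loday s)) (loday (subst_tree t a s))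
    (fun z : 'rV[R]_(ne t + ne s) => theta a (lsubmx z) (rsubmx z)).
  apply: (face_embedding_linear (g := g)) (theta_face pt ps ha hs).
  - exact: theta_linear_row.
  - move=> k z z'; rewrite /g scale_row_mx add_row_mx; congr row_mx; by apply/rowP => f; rewrite !mxE.
  - move=> z; rewrite /g -[RHS]hsubmxK; congr row_mx; apply/rowP => f; rewrite mxE ?theta_jt ?theta_js//.
  - apply: prod_set_polytope; last exact: polytope_loday.
    rewrite operahedronE//; exact: lp_polytope (operahedron_laminar R pt l0).
  - exact: polytope_loday.
have := face_embedding_comp E1 E2.
congr face_embedding; apply/funext => z.
by rewrite row_mxKl row_mxKr.
Qed.

Lemma ne_corolla n : ne (corolla n) = 0%N.
Proof. by rewrite /ne -(size_map snd) edges_snd labels_corolla. Qed.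

Lemma row0_eq n (x y : 'rV[R]_n) : n = 0%N -> x = y.
Proof. by move=> n0; apply/rowP => -[e el]; exfalso; move: el; rewrite n0. Qed.

Lemma unit_embedding n : (0 < n)%N ->
  face_embedding [set: 'rV[R]_0] (loday (corolla n)) (fun=> 0).
Proof.
move=> n0; have pc := planar_corolla n0; have nc := ne_corolla n.
apply: (face_embedding_linear (g := fun=> 0)).
- by move=> k x y; exact: row0_eq.
- by move=> k x y; exact: row0_eq.
- by move=> x; exact: row0_eq.
- exists [set 0]; first exact: finite_set1.
  apply/seteqP; split => // x _; apply: sub_hull; exact: row0_eq.
- exact: polytope_loday.
have -> : [set 0 | _ in [set: 'rV[R]_0]] = loday (R := R) (corolla n); last exact: face_refl.
have [z0 Pz0] := loday_nonempty pc.
apply/seteqP; split => [_ [x _ <-]|x Px]; first by rewrite (row0_eq 0 z0 nc).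
by exists 0 => //; exact: row0_eq.
Qed.

Lemma Oinf_is_poly_operad : is_poly_operad (Oinf R).
Proof.
split.
- exact: Oinf_poly_object.
- move=> c d c' d' i ci [x y] [[ox tx] [oy ty]]; split.
    by split; [exact: (optree_comp_is ox tx oy ty ci)|exact: (optree_comp_type ox tx oy ty ci)].
  have px := comp_planar_l ox; have py := comp_planar_l oy.
  have ha := comp_vertex ox tx ci; have hs := comp_arity tx ty ci.
  apply: face_embedding_arrow.
  + apply: prod_set_polytope; exact: polytope_loday.
  + exact: (polytope_loday (planar_subst px py ha hs)).
  exact: comp_embedding.
- move=> c d kappa pk x [ox tx]; split; first exact: (optree_act_is ox tx pk).
  have px := comp_planar_l ox; apply: face_embedding_arrow; [exact: polytope_loday|exact: polytope_loday|].
  exact: face_embedding_id.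
- move=> c x _; split; first exact: optree_unit_is.
  have e := unit_embedding (valP c); apply: face_embedding_arrow => //.
    exists [set 0]; first exact: finite_set1.
    by apply/seteqP; split => // z _; apply: sub_hull; exact: row0_eq.
  exact: polytope_loday (planar_corolla (valP c)).
exact: Oinf_is_operad.
Qed.

End OinfOperad.

(** * Nested trees *)

Section OnthSplice.
Variable T : Type.
Implicit Types (s u : seq T).

Lemma onth_splice i s u k : (i < size s)%N ->
  onth (splice i s u) k = nth None (splice i (map Some s) (map Some u)) k.
Proof. by move=> si; rewrite onthE map_splice. Qed.

Lemma onth_splice_inner i j s u : (i < size s)%N -> (j < size u)%N ->
  onth (splice i s u) (i + j) = onth u j.
Proof. by move=> si uj; rewrite onth_splice// nth_splice_inner ?size_map// onthE. Qed.

Lemma onth_splice_gt i j s u : (i < j)%N -> (i < size s)%N ->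
  onth (splice i s u) (j + size u).-1 = onth s j.
Proof. by move=> ij si; rewrite onth_splice// nth_splice_gt ?size_map// onthE. Qed.

Lemma onth_splice_lt i k s u : (k < i)%N -> (i < size s)%N -> onth (splice i s u) k = onth s k.
Proof. by move=> ki si; rewrite onth_splice// nth_splice_lt ?size_map// onthE. Qed.

Lemma onth_precompose s kappa i : is_perm (size s) kappa -> (i < size s)%N ->
  onth (precompose s kappa) i = onth s (nth 0%N kappa i).
Proof.
by move=> pk si; rewrite !onthE map_precompose nth_precompose ?size_map.
Qed.

End OnthSplice.

Lemma is_perm_block n m kappa i tau : is_perm n kappa -> is_perm m tau -> (i < n)%N ->
  is_perm (n + m).-1 (block_perm kappa i tau).
Proof.
move=> pk pt ni; set a := nth 0%N kappa i; set f := fun v => if (v < a)%N then v else (v + m).-1.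
have sk := is_perm_size pk; have st := is_perm_size pt.
have an : (a < n)%N by apply: (allP (is_perm_bound pk)); rewrite mem_nth ?sk.
have -> : block_perm kappa i tau = splice i (map f kappa) (map (addn a) tau) by rewrite /block_perm st.
(* For identity permutations the block permutation is the identity; the general one is a
   rearrangement of it. *)
have E : splice a (map f (iota 0 n)) (map (addn a) (iota 0 m)) = iota 0 (n + m).-1.
  have -> : ((n + m).-1 = a + (m + (n - a.+1)))%N by lia.
  rewrite /splice -map_take -map_drop take_iota drop_iota !iotaD add0n.
  have -> : minn a n = a by lia.
  congr (_ ++ (_ ++ _)).
  - rewrite -[RHS]map_id; apply/eq_in_map => v; rewrite mem_iota /f add0n => /= -> //.
  - by rewrite -iotaDl addn0.
  apply: (@eq_from_nth _ 0%N); rewrite size_map ?size_iota// => k kn.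
  rewrite (nth_map 0%N) ?size_iota// !nth_iota// /f add0n.
  by case: ltnP; lia.
rewrite /is_perm -E -(perm_cons (f a)).
have -> : f a = nth (f a) (map f kappa) i by rewrite (nth_map 0%N) ?sk.
apply: perm_trans (perm_splice _ _ _) _; first by rewrite size_map sk.
rewrite (nth_map 0%N) ?sk// -/a.
have {1}-> : f a = nth (f a) (map f (iota 0 n)) a by rewrite (nth_map 0%N) ?size_iota// nth_iota.
rewrite perm_sym; apply: perm_trans (perm_splice _ _ _) _; first by rewrite size_map size_iota.
by apply: perm_cat; apply: perm_map; rewrite perm_sym.
Qed.

(** * Pulling back the operad axioms *)

Section Transfer.
Variables (C I : Type) (O O' : operad C) (f : I -> forall c d, elt O c d -> elt O' c d).
Hypothesis fm : forall k, operad_morphism (f k).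
Hypothesis oO' : is_operad O'.
Hypothesis O_comp : forall c d c' d' i (x : elt O c d) (y : elt O c' d'),
  ops O c d x -> ops O c' d' y -> onth c i = Some d' -> ops O _ _ (ocomp O i x y).
Hypothesis O_act : forall c d kappa (x : elt O c d),
  ops O c d x -> is_perm (size c) kappa -> ops O _ _ (oact O kappa x).
Hypothesis O_unit : forall c, ops O _ _ (ounit O c).
Hypothesis f_inj : forall c d c' d' (x : elt O c d) (x' : elt O c' d'), ops O c d x -> ops O c' d' x' ->
  (forall k, tot (f k x) = tot (f k x')) -> tot x = tot x'.

(** The axioms are equations, and each [f k] carries them to instances valid in [O']; joint
    injectivity brings them back. One map serves for the nested trees, and the two projections for
    the square. *)
Lemma operad_transfer : is_operad O.
Proof.
split=> //.
- move=> c d c1 d1 c2 d2 i j x y z ox oy oz ci cj; have ic := onth_size ci; have jc := onth_size cj.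
  have cij : onth (splice i c c1) (i + j) = Some d2 by rewrite onth_splice_inner.
  have oxy := O_comp ox oy ci; have oyz := O_comp oy oz cj.
  apply: f_inj => [||k]; [exact: O_comp oxy oz cij|exact: O_comp ox oyz ci|].
  have [fo fc _ _] := fm k; rewrite (fc _ _ _ _ _ _ _ oxy oz cij) (fc _ _ _ _ _ _ _ ox oy ci).
  rewrite (fc _ _ _ _ _ _ _ ox oyz ci) (fc _ _ _ _ _ _ _ oy oz cj).
  by apply: (op_seqA oO') => //; exact: fo.
- move=> c d c1 d1 c2 d2 i j x y z ox oy oz ci cj ij; have ic := onth_size ci; have jc := onth_size cj.
  have cij : onth (splice i c c1) (j + size c1).-1 = Some d2 by rewrite onth_splice_gt.
  have cji : onth (splice j c c2) i = Some d1 by rewrite onth_splice_lt.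
  have oxy := O_comp ox oy ci; have oxz := O_comp ox oz cj.
  apply: f_inj => [||k]; [exact: O_comp oxy oz cij|exact: O_comp oxz oy cji|].
  have [fo fc _ _] := fm k; rewrite (fc _ _ _ _ _ _ _ oxy oz cij) (fc _ _ _ _ _ _ _ ox oy ci).
  rewrite (fc _ _ _ _ _ _ _ oxz oy cji) (fc _ _ _ _ _ _ _ ox oz cj).
  by apply: (op_parA oO') => //; exact: fo.
- move=> c d d' i x ox ci; apply: f_inj => [||k] //; first exact: O_comp ox (O_unit d') ci.
  have [fo fc _ fu] := fm k; rewrite (fc _ _ _ _ _ _ _ ox (O_unit d') ci) fu.
  by apply: (op_unitr oO') => //; exact: fo.
- move=> c d x ox; have cd : onth [:: d] 0 = Some d by [].
  apply: f_inj => [||k] //; first exact: O_comp (O_unit d) ox cd.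
  have [fo fc _ fu] := fm k; rewrite (fc _ _ _ _ _ _ _ (O_unit d) ox cd) fu.
  by apply: (op_unitl oO'); exact: fo.
- move=> c d x ox; have pc : is_perm (size c) (iota 0 (size c)) by rewrite /is_perm.
  apply: f_inj => [||k] //; first exact: O_act.
  have [fo _ fa _] := fm k; rewrite fa//.
  by apply: (op_act1 oO'); exact: fo.
- move=> c d kappa tau x ox pk pt.
  have pt' : is_perm (size (precompose c kappa)) tau by rewrite size_precompose.
  have okx := O_act ox pk; have pkt := is_perm_precompose pk pt.
  apply: f_inj => [||k]; [exact: O_act|exact: O_act|].
  have [fo _ fa _] := fm k; rewrite (fa _ _ _ _ okx pt') (fa _ _ _ _ ox pk) (fa _ _ _ _ ox pkt).
  by apply: (op_actM oO') => //; exact: fo.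
move=> c d c' d' i kappa tau x y ox oy pk pt ci.
have ic : (i < size c)%N by rewrite -(size_precompose pk); exact: onth_size ci.
have cki : onth c (nth 0%N kappa i) = Some d' by rewrite -onth_precompose.
have okx := O_act ox pk; have oty := O_act oy pt; have oxy := O_comp ox oy cki.
have pb : is_perm (size (splice (nth 0%N kappa i) c c')) (block_perm kappa i tau).
  by rewrite size_splice; [exact: is_perm_block|exact: onth_size cki].
apply: f_inj => [||k]; [exact: O_comp|exact: O_act|].
have [fo fc fa _] := fm k; rewrite (fc _ _ _ _ _ _ _ okx oty ci) (fa _ _ _ _ ox pk) (fa _ _ _ _ oy pt).
rewrite (fa _ _ _ _ oxy pb) (fc _ _ _ _ _ _ _ ox oy cki).
by apply: (op_equiv oO') => //; exact: fo.
Qed.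

End Transfer.

Section NestedTrees.
Variable R : realType.
Local Notation U := (underlying (Oinf R)).
Local Notation vp c d := (@vertex_point R c d).

Lemma tr_vertexM t w (NN : {set {set 'I_(ne t)}}) : planar_tree t -> (forall v, (0 < w v)%N) ->
  maximal_nesting NN -> tr (R := R) w (vertexM R NN (std t)) = vertexM R NN w.
Proof. by move=> pt w0; exact: (wt_vertex (trP R pt w0)). Qed.

Lemma nested_comp c d c' d' i p q : ops nested_operad c d p -> ops nested_operad c' d' q ->
  onth c i = Some d' ->
  ops nested_operad (splice i c c') d (ocomp nested_operad i p q) /\
  (vp (splice i c c') d (ocomp nested_operad i p q) : iop R) = icomp i (vp c d p) (vp c' d' q).
Proof.
move=> [op tp mp] [oq tq mq] ci; have pp := comp_planar_l op; have pq := comp_planar_l oq.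
have ha := comp_vertex op tp ci; have hs := comp_arity tp tq ci.
have [mS E] := theta_vertexM R pp pq ha hs (@std_gt0 _) mp mq.
split; first by split; [exact: (optree_comp_is op tp oq tq ci)|exact: (optree_comp_type op tp oq tq ci)|].
rewrite /icomp /= tr_vertexM//; last by apply: weight_gt0; exact: nv_pos.
by move: E; rewrite outer_std inner_std => ->.
Qed.

Lemma nested_ops c d p : ops nested_operad c d p -> ops U c d (vp c d p).
Proof.
move=> [op tp mp]; split; first by split.
have pp := comp_planar_l op; rewrite /= lodayE//.
by have [] := vertexM_lpoly R pp (@std_gt0 _) mp.
Qed.

Lemma vertex_point_morphism : operad_morphism (O := nested_operad) (O' := U) (@vertex_point R).
Proof.
split.
- exact: nested_ops.
- move=> c d c' d' i p q Pp Pq ci; have [_ E] := nested_comp Pp Pq ci.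
  by apply: etrans E _; rewrite -ocompE.
- by [].
move=> c; rewrite /vertex_point /=; congr existT.
by apply: row0_eq; exact: ne_corolla.
Qed.

Lemma iop_tagged_inj (x : optree) (z z' : 'rV[R]_(ne x.1)) :
  existT _ x z = existT _ x z' :> iop R -> z = z'.
Proof.
move=> E; apply/rowP => e; have := congr1 (fun s : iop R => Defs.coord (tagged s) (val e)) E.
by rewrite /= !coordE.
Qed.

(** The nesting is recovered as the set of tight nests of the vertex. *)
Lemma vertex_point_inj c d c' d' (p : elt nested_operad c d) (p' : elt nested_operad c' d') :
  ops nested_operad c d p -> ops nested_operad c' d' p' ->
  (vp c d p : iop R) = vp c' d' p' -> (p : nested_tree) = p'.
Proof.
case: p p' => x NN [x' NN'] [/= ox tx mx] [/= ox' tx' mx'] E.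
have xx' : x = x' := congr1 tag E; subst x'; congr existT.
have px := comp_planar_l ox.
have EM : vertexM R NN (std x.1) = vertexM R NN' (std x.1).
  exact: (iop_tagged_inj E).
by rewrite -(tight_vertexM R px (@std_gt0 _) mx) EM tight_vertexM.
Qed.

Lemma nested_is_operad : is_operad nested_operad.
Proof.
apply: (@operad_transfer _ unit _ _ (fun=> @vertex_point R) (fun=> vertex_point_morphism) (Oinf_is_operad R)).
- by move=> c d c' d' i x y ox oy ci; have [] := nested_comp ox oy ci.
- move=> c d kappa p [op tp mp] pk; have [h1 h2] := optree_act_is op tp pk; by split.
- move=> c; have [h1 h2] := optree_unit_is c; split => //.
  have [NN mNN] := exists_maximal_nesting (planar_corolla (valP c)).
  suff NN0 : NN = finset.set0 by rewrite NN0 in mNN.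
  by apply/eqP; rewrite -cards_eq0; move: mNN => /andP[_ /eqP ->]; rewrite ne_corolla.
move=> c d c' d' p p' op op' /(_ tt) E.
have [cc dd Ep] := tot_inv E; have pp := vertex_point_inj op op' Ep.
by subst c' d'; rewrite /= in pp; rewrite pp.
Qed.

(** If the tight nests do not form a maximal nesting, some step moves the point and keeps all of
    them tight, hence stays in every face through the point. *)
Lemma vertex_nesting t z : planar_tree t -> vertex (loday (R := R) t) z ->
  exists2 NN, maximal_nesting NN & z = vertexM R NN (std t).
Proof.
move=> pt; rewrite /vertex lodayE// => vz; have t0 := @std_gt0 t.
have Pz : lpoly (nests t) (nest_weight (real_weight R (std t))) z by apply: (face_sub vz).
have [mz|[e [f [ef h]]]] := maximal_or_direction pt t0 Pz.
  by exists (tight_nests (real_weight R (std t)) z) => //; exact: (vertexM_eq pt t0 mz erefl).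
have [l [l0 Pl Tl]] := direction_tight pt Pz ef h.
have [S SE] := lpoly_face vz (ex_intro _ z erefl).
have [_ Sz] : lface (nests t) (nest_weight (real_weight R (std t))) S z by rewrite -SE.
have : [set z] (z + l *: signvec R [set e]%SET [set f]%SET).
  rewrite SE; split => //; apply: fintype.subset_trans Sz _.
  exact: fintype.proper_sub Tl.
by move=> /= E; move: Tl; rewrite E fintype.properxx.
Qed.

(** The smallest face through a point of rank 0 is that point. *)
Lemma vertexM_vertex t NN : planar_tree t -> maximal_nesting NN ->
  vertex (loday (R := R) t) (vertexM R NN (std t)).
Proof.
move=> pt mNN; rewrite /vertex lodayE//; have t0 := @std_gt0 t.
have [Pz _] := vertexM_lpoly R pt t0 mNN.
suff -> : [set vertexM R NN (std t)] = lface (nests t) (nest_weight (real_weight R (std t)))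
    (tight (nests t) (nest_weight (real_weight R (std t))) (vertexM R NN (std t))) by exact: lface_face.
apply/seteqP; split => [_ ->|y [Py Ty]]; first by split.
by apply: (prank0_eq (prank_vertexM R pt t0 mNN)).
Qed.

Lemma vertex_point_bij c d :
  set_bij (ops nested_operad c d) (vertices (obj (Oinf R) c d)) (vp c d).
Proof.
split.
- move=> p [op tp mp]; split; first by split.
  by apply: vertexM_vertex => //; exact: comp_planar_l op.
- move=> p p' /classical_sets.set_mem op /classical_sets.set_mem op'; exact: vertex_point_inj.
move=> [x z] [/= [ox tx] vz]; have px := comp_planar_l ox.
have [NN mNN zE] := vertex_nesting px vz.
by exists (mknested (x := x) NN) => //; rewrite /vertex_point /= zE.
Qed.

End NestedTrees.

(** * The diagonal *)

Section SquareOperad.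
Variable R : realType.
Local Notation U := (underlying (Oinf R)).
Local Notation SU := (underlying (square_operad (Oinf R))).

Definition half (b : bool) (p : {x : optree & 'rV[R]_(ne x.1 + ne x.1)}) : iop R :=
  existT _ (tag p) (if b then lsubmx (tagged p) else rsubmx (tagged p)).

Definition half_elt (b : bool) c d (p : elt SU c d) : elt U c d := half b p.

Lemma half_comp b c d c' d' i (p : elt SU c d) (q : elt SU c' d') :
  half_elt b (ocomp SU i p q) = ocomp U i (half_elt b p) (half_elt b q).
Proof.
rewrite /half_elt /half /= /ptmap /pair_pt /=; congr existT.
by case: b; rewrite !row_mxKl !row_mxKr ?row_mxKl ?row_mxKr.
Qed.

Lemma square_opsP c d (p : elt SU c d) : ops SU c d p <-> forall b, ops U c d (half_elt b p).
Proof.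
split=> [[cp [Pl Pr]] []|h]; [by split|by split|].
by split; [case: (h true)|split; [case: (h true)|case: (h false)]].
Qed.

Lemma half_morphism b : operad_morphism (half_elt b).
Proof.
split.
- by move=> c d p /square_opsP.
- by move=> *; exact: half_comp.
- by move=> c d kappa p _ _; rewrite /half_elt /half /= /ptmap /=; congr existT; case: b; rewrite ?row_mxKl ?row_mxKr.
- by move=> c; rewrite /half_elt /half /= /ptmap /=; congr existT; case: b; rewrite ?row_mxKl ?row_mxKr.
Qed.

Lemma half_inj (p p' : {x : optree & 'rV[R]_(ne x.1 + ne x.1)}) :
  (forall b, half b p = half b p') -> p = p'.
Proof.
case: p p' => x z [x' z'] h; have xx' : x = x' := congr1 tag (h true); subst x'.
congr existT; rewrite -[z]hsubmxK -[z']hsubmxK.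
by rewrite (iop_tagged_inj (h true)) (iop_tagged_inj (h false)).
Qed.

Lemma square_is_operad : is_operad SU.
Proof.
have oU := Oinf_is_operad R.
apply: (operad_transfer half_morphism oU).
- move=> c d c' d' i x y /square_opsP ox /square_opsP oy ci; apply/square_opsP => b.
  by rewrite half_comp; exact: (op_comp oU).
- move=> c d kappa x /[dup] ox /square_opsP ox' pk; apply/square_opsP => b.
  by rewrite (om_act (half_morphism b) ox pk); exact: (op_act oU).
- move=> c; apply/square_opsP => b.
  by rewrite (om_unit (half_morphism b)); exact: (op_unit oU).
move=> c d c' d' p p' _ _ h.
have [cc dd _] := tot_inv (h true); subst c' d'; congr (tot _).
by apply: half_inj => b; have [] := tot_inv (h b).
Qed.

Definition shuffle m n m' n' (z : 'rV[R]_((m + n) + (m' + n'))) : 'rV[R]_((m + m') + (n + n')) :=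
  row_mx (row_mx (lsubmx (lsubmx z)) (lsubmx (rsubmx z)))
         (row_mx (rsubmx (lsubmx z)) (rsubmx (rsubmx z))).

Lemma shuffleK m n m' n' (z : 'rV[R]_((m + n) + (m' + n'))) : shuffle (shuffle z) = z.
Proof. by rewrite /shuffle !(row_mxKl, row_mxKr) !hsubmxK. Qed.

Lemma shuffle_linear m n m' n' k (x y : 'rV[R]_((m + n) + (m' + n'))) :
  shuffle (k *: x + y) = k *: shuffle x + shuffle y.
Proof.
rewrite /shuffle !scale_row_mx !add_row_mx.
by congr (row_mx (row_mx _ _) (row_mx _ _)); apply/rowP => e; rewrite !mxE.
Qed.

(** The composition of the square is this exchange of the middle factors followed by two copies of
    the composition. *)
Lemma shuffle_embedding m n (P : set 'rV[R]_m) (Q : set 'rV[R]_n) : polytope P -> polytope Q ->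
  face_embedding (prod_set (prod_set P P) (prod_set Q Q)) (prod_set (prod_set P Q) (prod_set P Q)) (@shuffle m m n n).
Proof.
move=> pP pQ; have pPP := prod_set_polytope pP pP; have pQQ := prod_set_polytope pQ pQ.
have pPQ := prod_set_polytope pP pQ.
apply: (face_embedding_linear (g := @shuffle m n m n)).
- exact: shuffle_linear.
- exact: shuffle_linear.
- exact: shuffleK.
- exact: prod_set_polytope.
- exact: prod_set_polytope.
suff -> : (@shuffle m m n n) @` prod_set (prod_set P P) (prod_set Q Q) = prod_set (prod_set P Q) (prod_set P Q).
  exact: face_refl.
apply/seteqP; split => [_ [z [[Pl Pr] [Ql Qr]] <-]|z [[Pl Ql] [Pr Qr]]].
  by rewrite /shuffle; split; split; rewrite ?row_mxKl ?row_mxKr ?row_mxKl ?row_mxKr.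
exists (shuffle z); last exact: shuffleK.
by rewrite /shuffle; split; split; rewrite ?row_mxKl ?row_mxKr ?row_mxKl ?row_mxKr.
Qed.

Lemma square_is_poly_operad : is_poly_operad (square_operad (Oinf R)).
Proof.
have [obj_ comp_ act_ unit_ _] := Oinf_is_poly_operad R.
split.
- move=> c d; have [fin pol] := obj_ c d; split => // x /pol[pP [z Pz]]; split; first exact: prod_set_polytope.
  by exists (row_mx z z); split; rewrite ?row_mxKl ?row_mxKr.
- move=> c d c' d' i ci [x y] /[dup] oxy [[ox tx] [oy ty]]; split; first exact: (comp_ _ _ _ _ _ ci _ oxy).1.
  have px := comp_planar_l ox; have py := comp_planar_l oy.
  have ha := comp_vertex ox tx ci; have hs := comp_arity tx ty ci.
  have e := comp_embedding R px py ha hs.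
  have pq := polytope_loday R (planar_subst px py ha hs).
  apply: face_embedding_arrow.
  + by apply: prod_set_polytope; apply: prod_set_polytope; exact: polytope_loday.
  + exact: prod_set_polytope.
  have := face_embedding_comp (shuffle_embedding (polytope_loday R px) (polytope_loday R py)) (face_embedding_prod e e).
  rewrite /=; congr face_embedding; apply/funext => z.
  by rewrite /shuffle /= /pair_pt !(row_mxKl, row_mxKr).
- move=> c d kappa pk x /[dup] ocx [ox tx]; split; first exact: (act_ _ _ _ pk _ ocx).1.
  have pP := polytope_loday R (comp_planar_l ox).
  apply: face_embedding_arrow; [exact: prod_set_polytope|exact: prod_set_polytope|].
  exact: face_embedding_prod (face_embedding_id _) (face_embedding_id _).
- move=> c x ox; split; first exact: (unit_ c x ox).1.
  have pc := polytope_loday R (planar_corolla (valP c)).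
  have pt0 : polytope [set: 'rV[R]_0].
    exists [set 0]; first exact: finite_set1.
    by apply/seteqP; split => // z _; apply: sub_hull; exact: row0_eq.
  apply: face_embedding_arrow => //; first exact: prod_set_polytope.
  have nc : (ne (corolla (val c)) + ne (corolla (val c)) = 0)%N by rewrite ne_corolla.
  apply: (face_embedding_linear (g := fun=> 0)) => //.
  + by move=> k z z'; exact: row0_eq.
  + by move=> k z z'; exact: row0_eq.
  + by move=> z; exact: row0_eq.
  + exact: prod_set_polytope.
  have -> : [set row_mx 0 0 | _ in [set: 'rV[R]_0]] =
      prod_set (loday (R := R) (corolla (val c))) (loday (corolla (val c))); last exact: face_refl.
  have [z0 Pz0] := loday_nonempty R (planar_corolla (valP c)).
  have z00 := row0_eq 0 z0 (ne_corolla (val c)).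
  apply/seteqP; split => [_ [z _ <-]|z Pz].
    by split; rewrite ?row_mxKl ?row_mxKr z00.
  by exists 0 => //; exact: row0_eq.
exact: square_is_operad.
Qed.

Section Diagonal.
Variable v : forall x : optree, 'rV[R]_(ne x.1).
Hypothesis pv : forall x, is_optree x -> principal (v x).

Lemma bot_top_comp t s a (vt : 'rV[R]_(ne t)) vs vq x y : planar_tree t -> planar_tree s -> (a < nv t)%N ->
  nth 0%N (arities t) a = leaves s -> principal vt -> principal vs -> principal vq ->
  loday t x -> loday s y ->
  let z := theta a (tr (@weight t a (nv s)) x) y in
  bot_pt vq (reflected (loday (subst_tree t a s)) z) =
    theta a (tr (@weight t a (nv s)) (bot_pt vt (reflected (loday t) x))) (bot_pt vs (reflected (loday s) y)) /\
  top_pt vq (reflected (loday (subst_tree t a s)) z) =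
    theta a (tr (@weight t a (nv s)) (top_pt vt (reflected (loday t) x))) (top_pt vs (reflected (loday s) y)).
Proof.
move=> pt ps ha hs pvt pvs pvq; have pq := planar_subst pt ps ha hs; rewrite !lodayE// => Px Py.
have l0 := weight_gt0 (r := t) a (nv_pos ps); have wt := wt_transition (trP R pt l0).
have := bot_top_theta pt ps ha hs (@std_gt0 _) pvq pvt pvs (x := tr (@weight t a (nv s)) x) (y := y).
rewrite !outer_std !inner_std => /(_ (trans_fun wt Px) Py) [/= -> ->].
by have /eq_row_mx[-> ->] := trans_diag wt pvt Px.
Qed.

(** Bot and top form a good pair with midpoint x, and a good pair is the pair of bot and top of its
    midpoint for every principal vector. *)
Lemma bot_top_independent t (u u' x : 'rV[R]_(ne t)) : planar_tree t -> principal u -> principal u' ->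
  loday t x -> Defs.diagonal u (loday t) x = Defs.diagonal u' (loday t) x.
Proof.
move=> pt pu pu'; rewrite lodayE// => Px; have LP := operahedron_laminar R pt (@std_gt0 t).
have [g E] := bot_top_good_pair LP pu' Px.
by have [b b'] := good_pair_bot LP pu g; rewrite /Defs.diagonal -[in LHS]E b b'.
Qed.

Lemma diagonal_morphism : poly_operad_morphism (Oinf_diagonal v).
Proof.
split.
  move=> c d x [ox tx]; split; first by split.
  have px := comp_planar_l ox; have LP := operahedron_laminar R px (@std_gt0 x.1).
  have := diagonal_poly_arrow LP (pv ox); rewrite /= /square_poly /=.
  by rewrite lodayE.
split.
- move=> c d [x z] [[/= ox tx] Pz]; split; first by split.
  have px := comp_planar_l ox; have LP := operahedron_laminar R px (@std_gt0 x.1).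
  move: Pz; rewrite /= lodayE// => Pz.
  by have [[] ] := diagonal_good LP (pv ox) Pz.
- move=> c d c' d' i [x z] [y z'] [[ox tx] Pz] [[oy ty] Pz'] ci; rewrite /= in ox tx Pz oy ty Pz'.
  have px := comp_planar_l ox; have py := comp_planar_l oy.
  have ha := comp_vertex ox tx ci; have hs := comp_arity tx ty ci.
  have oq := optree_comp_is ox tx oy ty ci.
  have [bE tE] := bot_top_comp px py ha hs (pv ox) (pv oy) (pv oq) Pz Pz'.
  rewrite /= /ptmap /pair_pt /=; congr existT.
  by rewrite /Defs.diagonal !(row_mxKl, row_mxKr) bE tE.
(* v may take different values at (t, sigma) and at its image under kappa, so equivariance rests on
   the independence of the orientation vector. *)
- move=> c d kappa [x z] [[ox tx] Pz] pk; rewrite /= in ox tx Pz.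
  rewrite /= /ptmap /=; congr existT; rewrite hsubmxK.
  have [oq _] := optree_act_is ox tx pk.
  exact: (bot_top_independent (comp_planar_l ox) (pv oq) (pv ox) Pz).
move=> c; rewrite /= /ptmap /=; congr existT.
have nc : (ne (corolla (val c)) + ne (corolla (val c)) = 0)%N by rewrite ne_corolla.
exact: row0_eq.
Qed.

End Diagonal.
End SquareOperad.

Theorem theorem4p18 (R : realType) :
  is_poly_operad (Oinf R) /\
  [/\ is_operad nested_operad,
      forall c d, set_bij (ops nested_operad c d) (vertices (obj (Oinf R) c d))
                          (@vertex_point R c d)
    & operad_morphism (@vertex_point R)] /\
  (forall v : (forall x : optree, 'rV[R]_(ne x.1)),
     (forall x : optree, is_optree x -> principal (v x)) ->
     is_poly_operad (square_operad (Oinf R)) /\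
     poly_operad_morphism (Oinf_diagonal v)).
Proof.
split; first exact: Oinf_is_poly_operad; split.
  split; [exact: (nested_is_operad R)|exact: vertex_point_bij|exact: vertex_point_morphism].
by move=> v pv; split; [exact: square_is_poly_operad|exact: diagonal_morphism].
Qed.
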